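(* Let $\phi\in[0,2\pi)$ and let $A_\phi$ and $P_\phi$ be the self-adjoint operators in $L^2((0,2\pi))$ given by $$A_\phi f=-f'',\quad f\in\operatorname{dom}(A_\phi)=\big\{g\in H^2((0,2\pi))\,\big|\,g(0)=e^{i\phi}g(2\pi),\ g'(0)=e^{i\phi}g'(2\pi)\big\},$$ $$P_\phi f=if',\quad f\in\operatorname{dom}(P_\phi)=\big\{g\in H^1((0,2\pi))\,\big|\,g(0)=e^{i\phi}g(2\pi)\big\}.$$ Then the following assertions hold: $(i)$ If $s\in(0,1/2)$, then $\operatorname{dom}\big(A_\phi^{s/2}\big)=\operatorname{dom}\big(|P_\phi|^s\big)=H^s((0,2\pi))$. $(ii)$ If $s=1/2$, then $$\operatorname{dom}\big(A_\phi^{1/4}\big)=\operatorname{dom}\big(|P_\phi|^{1/2}\big)=\bigg\{f\in H^{1/2}((0,2\pi))\,\bigg|\,\int_0^{2\pi}\frac{dt}{t^2}\int_0^t dx\,\big|e^{i\phi}f(x+2\pi-t)-f(x)\big|^2<\infty\bigg\}.$$ $(iii)$ If $s\in(1/2,1)$, then $$\operatorname{dom}\big(A_\phi^{s/2}\big)=\operatorname{dom}\big(|P_\phi|^s\big)=\big\{f\in H^s((0,2\pi))\,\big|\,f(0)=e^{i\phi}f(2\pi)\big\}.$$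
   Context: One has $A_\phi=P_\phi^2\geq0$; fractional powers are defined by the spectral theorem. $H^s(\mathbb R)$ is the usual ($L^2$-based) fractional Sobolev space, and $H^s((0,2\pi))=\{f\in L^2((0,2\pi))\mid\text{there exists }g\in H^s(\mathbb R)\text{ with }g|_{(0,2\pi)}=f\}$. For $s>1/2$ elements of $H^s((0,2\pi))$ are identified with their continuous representatives on $[0,2\pi]$, so that boundary values make sense. *)

(* Defs.v *)
From HB Require Import structures.
From mathcomp Require Import all_boot all_order all_algebra.
From mathcomp Require Import complex.
From mathcomp Require Import all_classical all_reals all_analysis.

Set Implicit Arguments.
Unset Strict Implicit.
Unset Printing Implicit Defensive.

Import Order.TTheory GRing.Theory Num.Theory.
Import numFieldNormedType.Exports.

Local Open Scope classical_set_scope.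
Local Open Scope ring_scope.
Local Open Scope complex_scope.

(* Elements of L^2(Omega), with Omega a subset of the line, are represented by
   functions R -> R[i] of which only the values on Omega matter; equality in
   L^2(Omega) is equality almost everywhere on Omega. *)

Section L2.
Context {R : realType}.
Local Notation mu := (@lebesgue_measure R).
Implicit Types (Omega : set R) (f g : R -> R[i]).

Definition abs2 (z : R[i]) : R := complex.Re z ^+ 2 + complex.Im z ^+ 2.

Definition expi (t : R) : R[i] := cos t +i* sin t.

Definition sqnorm Omega f : \bar R := (\int[mu]_(x in Omega) (abs2 (f x))%:E)%E.

Definition L2 Omega : set (R -> R[i]) :=
  [set f | [/\ measurable_fun Omega (fun x => complex.Re (f x)),
               measurable_fun Omega (fun x => complex.Im (f x)) &
               (sqnorm Omega f < +oo)%E]].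

Definition cintegral Omega f : R[i] :=
  (\int[mu]_(x in Omega) complex.Re (f x)) +i*
  (\int[mu]_(x in Omega) complex.Im (f x)).

Definition inner Omega f g : R[i] := cintegral Omega (fun x => f x * (g x)^*).

End L2.

Section Sobolev.
Context {R : realType}.
Local Notation mu := (@lebesgue_measure R).
Implicit Types (Omega : set R) (f g : R -> R[i]) (s : R).

(* Test functions are C^1 with compact support, as in Brezis, Functional
   Analysis, Sobolev Spaces and Partial Differential Equations, Chapter 8. *)
Definition test_function Omega (psi : R -> R) : Prop :=
  [/\ forall x, derivable psi x 1,
      continuous (derive1 psi) &
      exists K : set R, [/\ compact K, K `<=` Omega &
        forall x, ~ K x -> psi x = 0]].

Definition clocally_integrable Omega f : Prop :=
  locally_integrable Omega (fun x => complex.Re (f x)) /\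
  locally_integrable Omega (fun x => complex.Im (f x)).

Definition is_weak_derivative Omega f g : Prop :=
  [/\ clocally_integrable Omega f, clocally_integrable Omega g &
      forall psi, test_function Omega psi ->
        cintegral Omega (fun x => f x * (derive1 psi x)%:C) =
        - cintegral Omega (fun x => g x * (psi x)%:C)].

(* The weak derivative, unique up to equality almost everywhere on Omega. *)
Definition wderiv Omega f : R -> R[i] :=
  xget (cst 0) [set g | is_weak_derivative Omega f g].

(* Square of the Gagliardo (Slobodeckij) seminorm on the line. At x = y the
   numerator vanishes and the quotient is 0. *)
Definition gagliardo s f : \bar R :=
  (\int[mu]_x \int[mu]_y
     (abs2 (f x - f y) / `|x - y| `^ (1 + 2 * s))%:E)%E.

(* H^s of the line for s >= 0. With s = k + r, k natural and 0 <= r < 1, it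
   asks for weak derivatives F 0 = f, F 1, .., F k in L^2 and, when r > 0, for a
   finite Gagliardo seminorm of order r of F k. *)
Definition HsR s : set (R -> R[i]) :=
  [set f | exists F : nat -> R -> R[i],
    let k := Num.truncn s in
    let r := s - k%:R in
    [/\ F 0%N = f,
        forall j, (j <= k)%N -> L2 setT (F j),
        forall j, (j < k)%N -> is_weak_derivative setT (F j) (F j.+1) &
        0 < r -> (gagliardo r (F k) < +oo)%E]].

Definition Hs Omega s : set (R -> R[i]) :=
  [set f | L2 Omega f /\
           exists g, HsR s g /\ (g = f %[ae mu in Omega])].

(* The continuous representative of f on [a, b]. *)
Definition continuous_rep (a b : R) f g : Prop :=
  [/\ {within `[a, b], continuous (fun x => complex.Re (g x))},
      {within `[a, b], continuous (fun x => complex.Im (g x))} &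
      g = f %[ae mu in [set` `]a, b[]]].

(* f(0) = e^{i phi} f(2 pi), read on the continuous representative of f. *)
Definition quasi_periodic (phi : R) f : Prop :=
  exists g, continuous_rep 0 (2 * pi) f g /\ g 0 = expi phi * g (2 * pi).

End Sobolev.

(* A possibly unbounded operator in L^2; [op_app T f] is relevant only for f in
   [op_dom T], and only up to equality almost everywhere. *)
Record operator (R : realType) := Operator {
  op_dom : set (R -> R[i]);
  op_app : (R -> R[i]) -> R -> R[i] }.

Section SpectralTheorem.
Context {R : realType} (Omega : set R).
Local Notation mu := (@lebesgue_measure R).
Local Notation aeq f g := (f = g %[ae mu in Omega]).
Implicit Types (E : set R -> (R -> R[i]) -> R -> R[i]) (f h k : R -> R[i]).

Definition orthogonal_projection (p : (R -> R[i]) -> R -> R[i]) : Prop :=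
  [/\ forall f, L2 Omega f -> L2 Omega (p f),
      forall (a : R[i]) f h, L2 Omega f -> L2 Omega h ->
        aeq (p (fun x => a * f x + h x)) (fun x => a * p f x + p h x),
      forall f, L2 Omega f -> aeq (p (p f)) (p f) &
      forall f h, L2 Omega f -> L2 Omega h ->
        inner Omega (p f) h = inner Omega f (p h)].

(* The measure B |-> ||E(B) f||^2 = (E(B) f, f). *)
Definition spectral_weight E f (B : set R) : \bar R := sqnorm Omega (E B f).

(* Projection-valued measures on the Borel sets of the line. *)
Definition is_pvm E : Prop :=
  [/\ forall B, measurable B -> orthogonal_projection (E B),
      forall f, L2 Omega f -> aeq (E set0 f) (cst 0),
      forall f, L2 Omega f -> aeq (E setT f) f,
      forall B C f, measurable B -> measurable C -> L2 Omega f ->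
        aeq (E (B `&` C) f) (E B (E C f)) &
      forall f, L2 Omega f -> semi_sigma_additive (spectral_weight E f)].

Definition spectral_dom E (u : R -> R) : set (R -> R[i]) :=
  [set f | L2 Omega f /\
     (\int[spectral_weight E f]_x (u x ^+ 2)%:E < +oo)%E].

(* The integral of u against the complex measure B |-> (E(B) f, k), obtained by
   polarization from the measures [spectral_weight E]. *)
Definition spectral_form E (u : R -> R) f k : R[i] :=
  4^-1 * \sum_(j < 4)
    'i ^+ j * (fine (\int[spectral_weight E (fun x => (f x + 'i ^+ j * k x)%R)]_x
                       (u x)%:E)%E)%:C.

(* h is the value at f of the integral of u against dE; the test vectors k
   range over the dense domain of this operator. *)
Definition spectral_value E (u : R -> R) f h : Prop :=
  L2 Omega h /\
  forall k, spectral_dom E u k -> inner Omega h k = spectral_form E u f k.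

Definition spectral_integral E (u : R -> R) : operator R :=
  Operator (spectral_dom E u)
    (fun f => xget (cst 0) [set h | spectral_value E u f h]).

(* T is the integral of lambda dE(lambda). *)
Definition is_spectral_measure (T : operator R) E : Prop :=
  [/\ is_pvm E,
      op_dom T = spectral_dom E id &
      forall f, op_dom T f -> spectral_value E id f (op_app T f)].

(* By the spectral theorem a self-adjoint operator T has a spectral measure,
   and any two of them agree up to equality almost everywhere; the choice made
   here is therefore immaterial. *)
Definition spectral_measure (T : operator R) :
    set R -> (R -> R[i]) -> R -> R[i] :=
  xget (fun _ _ => cst 0) [set E | is_spectral_measure T E].

Definition functional_calculus (T : operator R) (u : R -> R) : operator R :=
  spectral_integral (spectral_measure T) u.

(* T^a for T >= 0; the spectral measure does not charge the negative numbers,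
   so the values of powR there play no role. *)
Definition op_pow (T : operator R) (a : R) : operator R :=
  functional_calculus T (fun x => x `^ a).

(* |T|^a, the function |lambda|^a of T. *)
Definition op_abs_pow (T : operator R) (a : R) : operator R :=
  functional_calculus T (fun x => `|x| `^ a).

End SpectralTheorem.

Section Operators.
Context {R : realType}.
Implicit Types phi : R.

Definition I2pi : set R := `]0, 2 * pi[.

Definition opA phi : operator R :=
  Operator
    [set g | [/\ Hs I2pi 2 g, quasi_periodic phi g &
                 quasi_periodic phi (wderiv I2pi g)]]
    (fun f x => - wderiv I2pi (wderiv I2pi f) x).

Definition opP phi : operator R :=
  Operator
    [set g | Hs I2pi 1 g /\ quasi_periodic phi g]
    (fun f x => 'i * wderiv I2pi f x).

End Operators.

(* Main.v *)
Require Import Defs.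
From HB Require Import structures.
From mathcomp Require Import all_boot all_order all_algebra.
From mathcomp Require Import complex.
From mathcomp Require Import ring lra zify.
From mathcomp Require Import all_classical all_reals all_analysis.
From mathcomp Require Import measurable_realfun.

(** Both operators are diagonal in one orthonormal basis of L^2(0, 2 pi): the
    exponentials e_n of frequency n - phi / (2 pi), which are exactly the
    exponentials that satisfy the boundary condition. Completeness of the basis
    comes from a short argument of Chernoff ([chernoff], [complete_ee]); the
    identification of the domains with the sequences whose coefficients are
    square summable against the squared eigenvalue rests on integration by
    parts and on the fact that weak derivatives in L^2(0, 2 pi) can be read on
    the coefficients ([opP_dom], [opA_dom]). Any spectral measure of a diagonal
    operator acts on the coefficients by the indicator function of the Borel
    set ([spectral_measure_diagonal]), so the domains of A^(s/2) and |P|^s are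
    both the set of f with sum of |frequency k|^(2s) |c_k(f)|^2 finite
    ([op_abs_pow_dom], [op_pow_dom]); in particular they agree.

    Let F be the quasi-periodic extension of f to the line. Translation by h
    multiplies c_k by a phase, so the weighted sum is comparable to
    E(f) = int_0^(2 pi) h^(-1-2s) || F(. + h) - F ||^2 dh, the norm being that
    of one period ([energy_ltyP], from Parseval and the scaling of the kernel).
    If E(f) is finite, a smooth cutoff of F is an H^s function on the line that
    extends f ([Hs_of_energy]). Conversely, if f is the restriction of g in
    H^s, then the part of || F(. + h) - F ||^2 where both points lie in
    (0, 2 pi) is controlled by g, and what remains is the mismatch across the
    boundary, B(h) = int_0^h |e^(i phi) f(x + 2 pi - h) - f(x)|^2 dx
    ([sqnorm_incr_split], where B is [wrap]). For s = 1/2 finiteness of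
    int B(h) h^(-2) dh is literally the additional condition.

    For s <> 1/2, B is bounded by the mass near the two ends of g - c, for
    suitable constants c, and the question becomes a fractional Hardy
    inequality: is int h^(-1-2s) int_0^h |g - c|^2 dx dh finite? For s < 1/2 it
    is for every c ([hardy_small]). For s > 1/2 it is when g - c tends to 0 at
    the endpoint ([hardy_large]); here c is the boundary value of the
    continuous representative, and the two constants fit together because of
    the boundary condition. That the boundary condition is necessary for
    s > 1/2 follows from absolute convergence of the Fourier series
    ([quasi_periodic_of_weight]). *)

Import Order.TTheory GRing.Theory Num.Theory.
Import numFieldNormedType.Exports.

Local Open Scope classical_set_scope.
Local Open Scope ring_scope.
Local Open Scope complex_scope.
Local Open Scope ring_scope.

Set Implicit Arguments.
Unset Strict Implicit.
Unset Printing Implicit Defensive.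

(** * Complex numbers *)

Section ComplexAlgebra.
Context {R : realType}.
Implicit Types (z w : R[i]) (a b t : R).

Lemma cReD z w : complex.Re (z + w) = complex.Re z + complex.Re w.
Proof. by case: z; case: w. Qed.
Lemma cImD z w : complex.Im (z + w) = complex.Im z + complex.Im w.
Proof. by case: z; case: w. Qed.
Lemma cReN z : complex.Re (- z) = - complex.Re z.
Proof. by case: z. Qed.
Lemma cImN z : complex.Im (- z) = - complex.Im z.
Proof. by case: z. Qed.
Lemma cReM z w : complex.Re (z * w) =
  complex.Re z * complex.Re w - complex.Im z * complex.Im w.
Proof. by case: z; case: w. Qed.
Lemma cImM z w : complex.Im (z * w) =
  complex.Re z * complex.Im w + complex.Im z * complex.Re w.
Proof. by case: z; case: w. Qed.
Lemma cReJ z : complex.Re (z^*) = complex.Re z.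
Proof. by case: z. Qed.
Lemma cImJ z : complex.Im (z^*) = - complex.Im z.
Proof. by case: z. Qed.
Lemma cReC a : complex.Re a%:C = a. Proof. by []. Qed.
Lemma cImC a : complex.Im a%:C = 0. Proof. by []. Qed.

Lemma cRe1 : complex.Re (1 : R[i]) = 1. Proof. by []. Qed.
Lemma cIm1 : complex.Im (1 : R[i]) = 0. Proof. by []. Qed.
Lemma cRe0 : complex.Re (0 : R[i]) = 0. Proof. by []. Qed.
Lemma cIm0 : complex.Im (0 : R[i]) = 0. Proof. by []. Qed.

Definition ReImE := (cReD, cImD, cReN, cImN, cReM, cImM, cReJ, cImJ, cReC, cImC,
  cRe1, cIm1, cRe0, cIm0).

Lemma eq_ReIm z w : complex.Re z = complex.Re w -> complex.Im z = complex.Im w ->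
  z = w.
Proof. by case: z w => [a b] [c d] /= -> ->. Qed.

Lemma conjD z w : (z + w)^* = z^* + w^*.
Proof. by apply: eq_ReIm; rewrite !ReImE// opprD. Qed.
Lemma conjM z w : (z * w)^* = z^* * w^*.
Proof. by apply: eq_ReIm; rewrite !ReImE; ring. Qed.
Lemma conjN z : (- z)^* = - z^*.
Proof. by apply: eq_ReIm; rewrite !ReImE. Qed.
Lemma conjCC a : (a%:C)^* = a%:C.
Proof. by apply: eq_ReIm; rewrite !ReImE ?oppr0. Qed.
Lemma realCD a b : (a + b)%:C = a%:C + b%:C.
Proof. by apply: eq_ReIm; rewrite !ReImE ?addr0. Qed.
Lemma realCM a b : (a * b)%:C = a%:C * b%:C.
Proof. by apply: eq_ReIm; rewrite !ReImE; ring. Qed.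
Lemma realCN a : (- a)%:C = - a%:C.
Proof. by apply: eq_ReIm; rewrite !ReImE ?oppr0. Qed.
Lemma conj_sum (I : Type) (r : seq I) (F : I -> R[i]) :
  (\sum_(i <- r) F i)^* = \sum_(i <- r) (F i)^*.
Proof.
by apply: (big_morph (fun z => z^*)) => [z w|]; [exact: conjD|exact: conjC0].
Qed.
Lemma cRe_sum (I : Type) (r : seq I) (F : I -> R[i]) :
  complex.Re (\sum_(i <- r) F i) = \sum_(i <- r) complex.Re (F i).
Proof. by apply: (big_morph (@complex.Re R)) => // z w; exact: cReD. Qed.
Lemma cIm_sum (I : Type) (r : seq I) (F : I -> R[i]) :
  complex.Im (\sum_(i <- r) F i) = \sum_(i <- r) complex.Im (F i).
Proof. by apply: (big_morph (@complex.Im R)) => // z w; exact: cImD. Qed.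
Lemma realC_sum (I : Type) (r : seq I) (F : I -> R) :
  (\sum_(i <- r) F i)%:C = \sum_(i <- r) (F i)%:C.
Proof. by apply: (big_morph (@real_complex R)) => // z w; exact: realCD. Qed.

Lemma abs2_ge0 z : 0 <= abs2 z.
Proof. by rewrite addr_ge0 ?sqr_ge0. Qed.
Lemma abs20 : abs2 (0 : R[i]) = 0.
Proof. by rewrite /abs2 /= expr0n addr0. Qed.
Lemma abs2_eq0 z : abs2 z = 0 -> z = 0.
Proof.
rewrite /abs2 => /eqP; rewrite paddr_eq0 ?sqr_ge0// !sqrf_eq0.
by move=> /andP[/eqP h1 /eqP h2]; exact: eq_ReIm.
Qed.
Lemma abs2M z w : abs2 (z * w) = abs2 z * abs2 w.
Proof. by rewrite /abs2 !ReImE; ring. Qed.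
Lemma abs2J z : abs2 (z^*) = abs2 z.
Proof. by rewrite /abs2 !ReImE sqrrN. Qed.
Lemma abs2N z : abs2 (- z) = abs2 z.
Proof. by rewrite /abs2 !ReImE !sqrrN. Qed.
Lemma abs2C a : abs2 a%:C = a ^+ 2.
Proof. by rewrite /abs2 !ReImE expr0n addr0. Qed.
Lemma abs2D z w :
  abs2 (z + w) = abs2 z + abs2 w + 2 * complex.Re (z * w^*).
Proof. by rewrite /abs2 !ReImE; ring. Qed.
Lemma abs2B_sym z w : abs2 (z - w) = abs2 (w - z).
Proof. by rewrite -abs2N opprB. Qed.
Lemma mulCJ z : z * z^* = (abs2 z)%:C.
Proof. by apply: eq_ReIm; rewrite /abs2 !ReImE; ring. Qed.

Lemma Re_mulJ_le z w : `|complex.Re (z * w^*)| <= abs2 z + abs2 w.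
Proof.
rewrite /abs2 !ReImE; case: z w => [a b] [c d] /=.
have h1 := sqr_ge0 (a + c); have h2 := sqr_ge0 (b + d).
have h3 := sqr_ge0 (a - c); have h4 := sqr_ge0 (b - d).
have := sqr_ge0 a; have := sqr_ge0 b; have := sqr_ge0 c; have := sqr_ge0 d.
by move=> ? ? ? ?; rewrite ler_norml; apply/andP; split; nra.
Qed.

Lemma Im_mulJ_le z w : `|complex.Im (z * w^*)| <= abs2 z + abs2 w.
Proof.
rewrite /abs2 !ReImE; case: z w => [a b] [c d] /=.
have h1 := sqr_ge0 (a + d); have h2 := sqr_ge0 (b + c).
have h3 := sqr_ge0 (a - d); have h4 := sqr_ge0 (b - c).
have := sqr_ge0 a; have := sqr_ge0 b; have := sqr_ge0 c; have := sqr_ge0 d.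
by move=> ? ? ? ?; rewrite ler_norml; apply/andP; split; nra.
Qed.

Lemma abs2D_eps (e : R) z w : 0 < e ->
  abs2 (z + w) <= (1 + e) * abs2 z + (1 + e^-1) * abs2 w.
Proof.
move=> e0; rewrite -subr_ge0.
have -> : (1 + e) * abs2 z + (1 + e^-1) * abs2 w - abs2 (z + w) =
    e^-1 * abs2 (e%:C * z - w).
  by rewrite /abs2 !ReImE; field; rewrite gt_eqF.
by rewrite mulr_ge0 ?abs2_ge0// invr_ge0 ltW.
Qed.

Lemma abs2D_le z w : abs2 (z + w) <= 2 * abs2 z + 2 * abs2 w.
Proof.
by have := @abs2D_eps 1 z w ltr01; rewrite invr1.
Qed.

Lemma abs2B_le z w : abs2 (z - w) <= 2 * abs2 z + 2 * abs2 w.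
Proof. by rewrite -(abs2N w); exact: abs2D_le. Qed.

Lemma Re2_le z : complex.Re z ^+ 2 <= abs2 z.
Proof. by rewrite /abs2 lerDl sqr_ge0. Qed.
Lemma Im2_le z : complex.Im z ^+ 2 <= abs2 z.
Proof. by rewrite /abs2 lerDr sqr_ge0. Qed.

Lemma expi_add a b : expi (a + b) = expi a * expi b.
Proof. by apply: eq_ReIm; rewrite !ReImE /= ?cosD ?sinD; ring. Qed.
Lemma expi0 : expi 0 = 1 :> R[i].
Proof. by rewrite /expi cos0 sin0. Qed.
Lemma expiJ a : (expi a)^* = expi (- a).
Proof. by rewrite /expi cosN sinN. Qed.
Lemma abs2_expi a : abs2 (expi a) = 1.
Proof. by rewrite /abs2 /= cos2Dsin2. Qed.
Lemma expiVr a : expi a * expi (- a) = 1.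
Proof. by rewrite -expi_add subrr expi0. Qed.
Lemma expi2pi : expi (2 * pi) = 1 :> R[i].
Proof. by rewrite /expi mulr_natl cos2pi sin2pi. Qed.
Lemma expi2piM (n : int) : expi (n%:~R * (2 * pi)) = 1 :> R[i].
Proof.
have nat_case (k : nat) : expi (k%:R * (2 * pi)) = 1 :> R[i].
  elim: k => [|k IH]; first by rewrite mul0r expi0.
  by rewrite -natr1 mulrDl mul1r expi_add IH expi2pi mulr1.
case: n => k; first exact: nat_case.
rewrite NegzE mulrNz mulNr -expiJ.
by rewrite (_ : (k.+1%:~R) = k.+1%:R)// nat_case conjC1.
Qed.

End ComplexAlgebra.

(** * Almost everywhere *)

Section AlmostEverywhere.
Context {R : realType}.
Local Notation mu := (@lebesgue_measure R).

Lemma aeS (P Q : R -> Prop) : (forall x, P x -> Q x) ->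
  {ae mu, forall x, P x} -> {ae mu, forall x, Q x}.
Proof.
move=> PQ h; have hF : Filter (almost_everywhere mu).
  exact: ae_filter_ringOfSetsType.
exact: filterS h.
Qed.

Lemma aeS2 (P1 P2 Q : R -> Prop) : (forall x, P1 x -> P2 x -> Q x) ->
  {ae mu, forall x, P1 x} -> {ae mu, forall x, P2 x} -> {ae mu, forall x, Q x}.
Proof.
move=> PQ h1 h2; have hF : Filter (almost_everywhere mu).
  exact: ae_filter_ringOfSetsType.
exact: filterS2 h1 h2.
Qed.

Lemma aeT (P : R -> Prop) : (forall x, P x) -> {ae mu, forall x, P x}.
Proof.
move=> h; have hF : Filter (almost_everywhere mu).
  exact: ae_filter_ringOfSetsType.
exact: filterE.
Qed.

Lemma ae_forall_nat (P : nat -> R -> Prop) :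
  (forall n, {ae mu, forall x, P n x}) -> {ae mu, forall x, forall n, P n x}.
Proof. exact: ae_foralln. Qed.

End AlmostEverywhere.

(** * Square integrable complex functions *)

Section ComplexIntegral.
Context {R : realType}.
Local Notation mu := (@lebesgue_measure R).
Variable D : set R.
Hypothesis mD : measurable D.
Implicit Types (f g h : R -> R[i]) (z : R[i]).

Definition cmeas f := measurable_fun D (fun x => complex.Re (f x)) /\
  measurable_fun D (fun x => complex.Im (f x)).

Definition cint f := mu.-integrable D (fun x => (complex.Re (f x))%:E) /\
  mu.-integrable D (fun x => (complex.Im (f x))%:E).

Lemma integrableZlR (k : R) (u : R -> R) :
  mu.-integrable D (fun x => (u x)%:E) ->
  mu.-integrable D (fun x => (k * u x)%:E).
Proof. by move=> hu; under eq_fun do rewrite EFinM; exact: integrableZl. Qed.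

Lemma integrableDR (u v : R -> R) :
  mu.-integrable D (fun x => (u x)%:E) ->
  mu.-integrable D (fun x => (v x)%:E) ->
  mu.-integrable D (fun x => (u x + v x)%:E).
Proof. by move=> hu hv; under eq_fun do rewrite EFinD; exact: integrableD. Qed.

Lemma cmeas_cst z : cmeas (fun=> z).
Proof. by split; apply: measurable_cst. Qed.

Lemma cmeasD f g : cmeas f -> cmeas g -> cmeas (fun x => f x + g x).
Proof.
by move=> [f1 f2] [g1 g2]; split; under eq_fun do rewrite ?cReD ?cImD;
  apply: measurable_funD.
Qed.

Lemma cmeasN f : cmeas f -> cmeas (fun x => - f x).
Proof.
by move=> [f1 f2]; split; under eq_fun do rewrite ?cReN ?cImN;
  apply: measurableT_comp.
Qed.

Lemma cmeasM f g : cmeas f -> cmeas g -> cmeas (fun x => f x * g x).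
Proof.
move=> [f1 f2] [g1 g2]; split; under eq_fun do rewrite ?cReM ?cImM.
  by apply: measurable_funB; apply: measurable_funM.
by apply: measurable_funD; apply: measurable_funM.
Qed.

Lemma cmeasJ f : cmeas f -> cmeas (fun x => (f x)^*).
Proof.
move=> [f1 f2]; split; first by under eq_fun do rewrite cReJ.
by under eq_fun do rewrite cImJ; exact: measurable_funN.
Qed.

Lemma cmeasB f g : cmeas f -> cmeas g -> cmeas (fun x => f x - g x).
Proof. by move=> hf hg; apply: cmeasD => //; exact: cmeasN. Qed.

Lemma cmeasC (u : R -> R) : measurable_fun D u -> cmeas (fun x => (u x)%:C).
Proof. by split => //=; exact: measurable_cst. Qed.

Lemma measurable_abs2 f : cmeas f -> measurable_fun D (fun x => abs2 (f x)).
Proof.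
by move=> [f1 f2]; apply: measurable_funD; apply: measurable_funX.
Qed.

Lemma measurable_abs2E f : cmeas f ->
  measurable_fun D (fun x => (abs2 (f x))%:E).
Proof. by move=> ?; apply/measurable_EFinP; exact: measurable_abs2. Qed.

Lemma cint_meas f : cint f -> cmeas f.
Proof.
by move=> [/measurable_int/measurable_EFinP ? /measurable_int/measurable_EFinP ?].
Qed.

Lemma eq_cint f g : {in D, f =1 g} -> cint f -> cint g.
Proof.
move=> fg [f1 f2]; split.
  by apply: eq_integrable f1 => // x /fg ->.
by apply: eq_integrable f2 => // x /fg ->.
Qed.

Lemma cint0 : cint (fun=> 0).
Proof. by split; exact: integrable0. Qed.

Lemma cintD f g : cint f -> cint g -> cint (fun x => f x + g x).
Proof.
by move=> [f1 f2] [g1 g2]; split; under eq_fun do rewrite ?cReD ?cImD EFinD;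
  apply: integrableD.
Qed.

Lemma cintZ z f : cint f -> cint (fun x => z * f x).
Proof.
move=> [f1 f2]; split; under eq_fun do rewrite ?cReM ?cImM.
  under eq_fun do rewrite EFinB !EFinM.
  by apply: integrableB => //; apply: integrableZl.
under eq_fun do rewrite EFinD !EFinM.
by apply: integrableD => //; apply: integrableZl.
Qed.

Lemma cintN f : cint f -> cint (fun x => - f x).
Proof.
by move=> hf; under eq_fun do rewrite -mulN1r; exact: cintZ.
Qed.

Lemma eq_cintegral f g : {in D, f =1 g} -> cintegral D f = cintegral D g.
Proof.
move=> fg; rewrite /cintegral; congr (_ +i* _);
  by apply: eq_Rintegral => x /fg ->.
Qed.

Lemma cintegralD f g : cint f -> cint g ->
  cintegral D (fun x => f x + g x) = cintegral D f + cintegral D g.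
Proof.
move=> [f1 f2] [g1 g2]; apply: eq_ReIm; rewrite !ReImE /=.
  by rewrite -RintegralD//; apply: eq_Rintegral => x _; rewrite cReD.
by rewrite -RintegralD//; apply: eq_Rintegral => x _; rewrite cImD.
Qed.

Lemma cintegralZ z f : cint f ->
  cintegral D (fun x => z * f x) = z * cintegral D f.
Proof.
move=> [f1 f2]; apply: eq_ReIm; rewrite !ReImE /=.
  rewrite -!RintegralZl// -RintegralB//=.
  - by apply: eq_Rintegral => x _; rewrite cReM.
  - exact: integrableZlR f1.
  - exact: integrableZlR f2.
rewrite -!RintegralZl// -RintegralD//=.
- by apply: eq_Rintegral => x _; rewrite cImM.
- exact: integrableZlR f2.
- exact: integrableZlR f1.
Qed.

Lemma cintegral0 : cintegral D (fun=> 0 : R[i]) = 0.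
Proof. by rewrite /cintegral /Rintegral !integral0. Qed.

Lemma cintegralN f : cint f -> cintegral D (fun x => - f x) = - cintegral D f.
Proof.
move=> hf; rewrite -mulN1r -cintegralZ//.
by apply: eq_cintegral => x _; rewrite mulN1r.
Qed.

Lemma cintegralB f g : cint f -> cint g ->
  cintegral D (fun x => f x - g x) = cintegral D f - cintegral D g.
Proof.
by move=> hf hg; rewrite cintegralD ?cintegralN//; exact: cintN.
Qed.

Lemma cintegralJ f : cint f -> cintegral D (fun x => (f x)^*) = (cintegral D f)^*.
Proof.
move=> [f1 f2]; apply: eq_ReIm; rewrite !ReImE /=.
  by apply: eq_Rintegral => x _; rewrite cReJ.
rewrite -mulN1r -RintegralZl//; apply: eq_Rintegral => x _.
by rewrite cImJ mulN1r.
Qed.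

Lemma cint_sum (I : Type) (r : seq I) (F : I -> R -> R[i]) :
  (forall i, cint (F i)) -> cint (fun x => \sum_(i <- r) F i x).
Proof.
move=> hF; elim: r => [|i r IH].
  by under eq_fun do rewrite big_nil; exact: cint0.
by under eq_fun do rewrite big_cons; exact: cintD.
Qed.

Lemma cintegral_sum (I : Type) (r : seq I) (F : I -> R -> R[i]) :
  (forall i, cint (F i)) ->
  cintegral D (fun x => \sum_(i <- r) F i x) =
  \sum_(i <- r) cintegral D (F i).
Proof.
move=> hF; elim: r => [|i r IH].
  by rewrite big_nil; under eq_fun do rewrite big_nil; rewrite cintegral0.
rewrite big_cons -IH -cintegralD//; last exact: cint_sum.
by apply: eq_cintegral => x _; rewrite big_cons.
Qed.

Lemma ae_eq_cintegral f g : cmeas f -> cmeas g -> f = g %[ae mu in D] ->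
  cintegral D f = cintegral D g.
Proof.
move=> [f1 f2] [g1 g2] fg; rewrite /cintegral /Rintegral; congr (fine _ +i* fine _).
  apply: ae_eq_integral => //; try exact/measurable_EFinP.
  by apply: aeS fg => x h Dx; rewrite h.
apply: ae_eq_integral => //; try exact/measurable_EFinP.
by apply: aeS fg => x h Dx; rewrite h.
Qed.

Lemma sqnorm_ge0 f : (0 <= sqnorm D f)%E.
Proof. by apply: integral_ge0 => x _; rewrite lee_fin abs2_ge0. Qed.

Lemma L2_cmeas f : L2 D f -> cmeas f.
Proof. by case. Qed.

Lemma L2_lty f : L2 D f -> (sqnorm D f < +oo)%E.
Proof. by case. Qed.

Lemma L2P f : cmeas f -> (sqnorm D f < +oo)%E -> L2 D f.
Proof. by move=> [? ?] ?; split. Qed.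

Lemma L2_abs2 f : L2 D f -> mu.-integrable D (fun x => (abs2 (f x))%:E).
Proof.
move=> h; apply/integrableP; split.
  by apply: measurable_abs2E; exact: L2_cmeas.
apply: le_lt_trans (L2_lty h); rewrite le_eqVlt; apply/orP; left; apply/eqP.
by apply: eq_integral => x _; rewrite gee0_abs// lee_fin abs2_ge0.
Qed.

Lemma integrable_leR (u v : R -> R) : measurable_fun D u ->
  (forall x, D x -> `|u x| <= v x) ->
  mu.-integrable D (fun x => (v x)%:E) -> mu.-integrable D (fun x => (u x)%:E).
Proof.
move=> mu_ uv; apply: le_integrable => //; first exact/measurable_EFinP.
move=> x Dx; rewrite !abse_EFin lee_fin [leRHS]ger0_norm ?uv//.
exact: le_trans (normr_ge0 _) (uv _ Dx).
Qed.

Lemma cint_le (f : R -> R[i]) (v : R -> R) : cmeas f ->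
  (forall x, D x -> `|complex.Re (f x)| <= v x) ->
  (forall x, D x -> `|complex.Im (f x)| <= v x) ->
  mu.-integrable D (fun x => (v x)%:E) -> cint f.
Proof. by move=> [f1 f2] h1 h2 hv; split; apply: integrable_leR hv. Qed.

Lemma cint_mulJ f g : L2 D f -> L2 D g -> cint (fun x => f x * (g x)^*).
Proof.
move=> hf hg; apply: (@cint_le _ (fun x => abs2 (f x) + abs2 (g x))).
- by apply: cmeasM; [exact: L2_cmeas|apply: cmeasJ; exact: L2_cmeas].
- by move=> x _; exact: Re_mulJ_le.
- by move=> x _; exact: Im_mulJ_le.
- by apply: integrableDR; exact: L2_abs2.
Qed.

Lemma sqnorm_eqae f g : cmeas f -> cmeas g -> f = g %[ae mu in D] ->
  sqnorm D f = sqnorm D g.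
Proof.
move=> mf mg fg; apply: ae_eq_integral => //; try exact: measurable_abs2E.
by apply: aeS fg => x h Dx; rewrite h.
Qed.

Lemma L2_eqae f g : L2 D f -> cmeas g -> f = g %[ae mu in D] -> L2 D g.
Proof.
move=> hf mg fg; apply: L2P => //; rewrite -(sqnorm_eqae _ mg fg).
  exact: L2_lty.
exact: L2_cmeas.
Qed.

Lemma L2_eqin f g : {in D, f =1 g} -> L2 D f -> L2 D g.
Proof.
move=> fg [h1 h2 h3]; split.
- by apply: eq_measurable_fun h1 => x /fg ->.
- by apply: eq_measurable_fun h2 => x /fg ->.
- rewrite (_ : sqnorm D g = sqnorm D f)//; apply: eq_integral => x Dx.
  by rewrite fg.
Qed.

Lemma L2_le f (v : R -> R) : cmeas f -> (forall x, D x -> abs2 (f x) <= v x) ->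
  mu.-integrable D (fun x => (v x)%:E) -> L2 D f.
Proof.
move=> mf fv hv; apply: L2P => //.
have : mu.-integrable D (fun x => (abs2 (f x))%:E).
  apply: integrable_leR hv; first exact: measurable_abs2.
  by move=> x Dx; rewrite ger0_norm ?abs2_ge0 ?fv.
by apply: integrable_lty.
Qed.

Lemma L2_0 : L2 D (fun=> 0).
Proof.
apply: (@L2_le _ (fun=> 0)); first exact: cmeas_cst.
  by move=> x _; rewrite abs20.
exact: integrable0.
Qed.

Lemma L2D f g : L2 D f -> L2 D g -> L2 D (fun x => f x + g x).
Proof.
move=> hf hg; apply: (@L2_le _ (fun x => 2 * abs2 (f x) + 2 * abs2 (g x))).
- by apply: cmeasD; exact: L2_cmeas.
- by move=> x _; exact: abs2D_le.
- by apply: integrableDR; apply: integrableZlR; exact: L2_abs2.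
Qed.

Lemma L2Z z f : L2 D f -> L2 D (fun x => z * f x).
Proof.
move=> hf; apply: (@L2_le _ (fun x => abs2 z * abs2 (f x))).
- by apply: cmeasM; [exact: cmeas_cst|exact: L2_cmeas].
- by move=> x _; rewrite abs2M.
- by apply: integrableZlR; exact: L2_abs2.
Qed.

Lemma L2N f : L2 D f -> L2 D (fun x => - f x).
Proof. by move=> hf; under eq_fun do rewrite -mulN1r; exact: L2Z. Qed.

Lemma L2B f g : L2 D f -> L2 D g -> L2 D (fun x => f x - g x).
Proof. by move=> hf hg; apply: L2D => //; exact: L2N. Qed.

Lemma L2_sum (I : Type) (r : seq I) (F : I -> R -> R[i]) :
  (forall i, L2 D (F i)) -> L2 D (fun x => \sum_(i <- r) F i x).
Proof.
move=> hF; elim: r => [|i r IH].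
  by under eq_fun do rewrite big_nil; exact: L2_0.
by under eq_fun do rewrite big_cons; exact: L2D.
Qed.

Lemma L2_bdM (b f : R -> R[i]) (M : R) : cmeas b ->
  (forall x, D x -> abs2 (b x) <= M) -> L2 D f -> L2 D (fun x => b x * f x).
Proof.
move=> mb bM hf; apply: (@L2_le _ (fun x => M * abs2 (f x))).
- by apply: cmeasM => //; exact: L2_cmeas.
- by move=> x Dx; rewrite abs2M ler_wpM2r ?abs2_ge0 ?bM.
- by apply: integrableZlR; exact: L2_abs2.
Qed.

Lemma innerDl f g h : L2 D f -> L2 D g -> L2 D h ->
  inner D (fun x => f x + g x) h = inner D f h + inner D g h.
Proof.
move=> hf hg hh; rewrite /inner -cintegralD; try exact: cint_mulJ.
by apply: eq_cintegral => x _; rewrite mulrDl.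
Qed.

Lemma innerZl z f h : L2 D f -> L2 D h ->
  inner D (fun x => z * f x) h = z * inner D f h.
Proof.
move=> hf hh; rewrite /inner -cintegralZ; last exact: cint_mulJ.
by apply: eq_cintegral => x _; rewrite mulrA.
Qed.

Lemma innerJ f h : L2 D f -> L2 D h -> (inner D f h)^* = inner D h f.
Proof.
move=> hf hh; rewrite /inner -cintegralJ; last exact: cint_mulJ.
by apply: eq_cintegral => x _; rewrite conjM conjCK mulrC.
Qed.

Lemma innerNl f h : L2 D f -> L2 D h -> inner D (fun x => - f x) h = - inner D f h.
Proof.
move=> hf hh; rewrite -mulN1r -innerZl//.
by apply: eq_cintegral => x _; rewrite mulN1r.
Qed.

Lemma innerBl f g h : L2 D f -> L2 D g -> L2 D h ->
  inner D (fun x => f x - g x) h = inner D f h - inner D g h.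
Proof. by move=> *; rewrite innerDl ?innerNl//; exact: L2N. Qed.

Lemma innerDr f g h : L2 D f -> L2 D g -> L2 D h ->
  inner D h (fun x => f x + g x) = inner D h f + inner D h g.
Proof.
move=> hf hg hh; rewrite -innerJ//; last exact: L2D.
by rewrite innerDl// conjD !innerJ.
Qed.

Lemma innerZr z f h : L2 D f -> L2 D h ->
  inner D h (fun x => z * f x) = z^* * inner D h f.
Proof.
move=> hf hh; rewrite -innerJ//; last exact: L2Z.
by rewrite innerZl// conjM innerJ.
Qed.

Lemma innerBr f g h : L2 D f -> L2 D g -> L2 D h ->
  inner D h (fun x => f x - g x) = inner D h f - inner D h g.
Proof.
move=> hf hg hh; rewrite -innerJ//; last exact: L2B.
by rewrite innerBl// conjD conjN !innerJ.
Qed.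

Lemma inner0l h : inner D (fun=> 0) h = 0.
Proof.
by rewrite -[RHS]cintegral0; apply: eq_cintegral => x _; rewrite mul0r.
Qed.

Lemma inner_suml (I : Type) (r : seq I) (F : I -> R -> R[i]) h :
  (forall i, L2 D (F i)) -> L2 D h ->
  inner D (fun x => \sum_(i <- r) F i x) h = \sum_(i <- r) inner D (F i) h.
Proof.
move=> hF hh; rewrite /inner -cintegral_sum; last first.
  by move=> i; exact: cint_mulJ.
by apply: eq_cintegral => x _; rewrite mulr_suml.
Qed.

Lemma eqae_inner f g f' g' : L2 D f -> L2 D g -> L2 D f' -> L2 D g' ->
  f = f' %[ae mu in D] -> g = g' %[ae mu in D] -> inner D f g = inner D f' g'.
Proof.
move=> hf hg hf' hg' ff' gg'; apply: ae_eq_cintegral.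
- by apply: cmeasM; [exact: L2_cmeas|apply: cmeasJ; exact: L2_cmeas].
- by apply: cmeasM; [exact: L2_cmeas|apply: cmeasJ; exact: L2_cmeas].
- by apply: aeS2 ff' gg' => x h1 h2 Dx; rewrite h1// h2.
Qed.

Definition nsq f : R := \int[mu]_(x in D) abs2 (f x).

Lemma sqnormE f : L2 D f -> sqnorm D f = (nsq f)%:E.
Proof.
move=> hf; rewrite /nsq /Rintegral fineK//.
by apply: integrable_fin_num => //; exact: L2_abs2.
Qed.

Lemma nsq_ge0 f : 0 <= nsq f.
Proof. by apply: Rintegral_ge0 => x _; exact: abs2_ge0. Qed.

Lemma inner_self f : inner D f f = (nsq f)%:C.
Proof.
apply: eq_ReIm => /=.
  by apply: eq_Rintegral => x _; rewrite mulCJ.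
by rewrite /Rintegral integral0_eq// => x _; rewrite mulCJ.
Qed.

Lemma nsq_eq0 f : L2 D f -> nsq f = 0 -> f = (fun=> 0) %[ae mu in D].
Proof.
move=> hf n0; have := sqnormE hf; rewrite n0 => h.
have : ae_eq mu D (fun x => (abs2 (f x))%:E) (cst 0%E).
  apply/ae_eq_integral_abs => //; first by apply: measurable_abs2E; exact: L2_cmeas.
  rewrite -[RHS]h; apply: eq_integral => x _.
  by rewrite gee0_abs// lee_fin abs2_ge0.
by apply: aeS => x H1 Dx; apply: abs2_eq0; have := H1 Dx => -[].
Qed.

Lemma nsqD f g : L2 D f -> L2 D g ->
  nsq (fun x => f x + g x) = nsq f + nsq g + 2 * complex.Re (inner D f g).
Proof.
move=> hf hg; apply: complexI; rewrite -inner_self.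
rewrite innerDl ?innerDr//; try exact: L2D.
rewrite !inner_self -(innerJ hf hg).
by apply: eq_ReIm; rewrite !ReImE; ring.
Qed.

Lemma nsqZ z f : L2 D f -> nsq (fun x => z * f x) = abs2 z * nsq f.
Proof.
move=> hf; rewrite /nsq -RintegralZl//; last exact: L2_abs2.
by apply: eq_Rintegral => x _; rewrite abs2M.
Qed.

Lemma nsqN f : nsq (fun x => - f x) = nsq f.
Proof. by apply: eq_Rintegral => x _; rewrite abs2N. Qed.

Lemma nsqB f g : L2 D f -> L2 D g ->
  nsq (fun x => f x - g x) = nsq f + nsq g - 2 * complex.Re (inner D f g).
Proof.
move=> hf hg; rewrite nsqD//; last exact: L2N.
rewrite nsqN -(innerJ (L2N hg) hf) innerNl//.
by rewrite -(innerJ hf hg) !ReImE mulrN.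
Qed.

Lemma nsq_eqae f g : L2 D f -> L2 D g -> f = g %[ae mu in D] -> nsq f = nsq g.
Proof.
move=> hf hg fg; have := sqnorm_eqae (L2_cmeas hf) (L2_cmeas hg) fg.
by rewrite !sqnormE// => -[].
Qed.

Lemma nsqD_le f g : L2 D f -> L2 D g ->
  nsq (fun x => f x + g x) <= 2 * nsq f + 2 * nsq g.
Proof.
move=> hf hg; have := nsq_ge0 (fun x => f x - g x).
by rewrite nsqB// nsqD//; lra.
Qed.

(** Cauchy-Schwarz. *)
Lemma inner_le f g : L2 D f -> L2 D g ->
  abs2 (inner D f g) <= nsq f * nsq g.
Proof.
move=> hf hg; set z := inner D f g.
have key (t : R) : 0 <= nsq f - 2 * t * abs2 z + t ^+ 2 * abs2 z * nsq g.
  have hzg : L2 D (fun x => (t%:C * z) * g x) by exact: L2Z.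
  have := nsq_ge0 (fun x => f x - (t%:C * z) * g x).
  rewrite nsqB// nsqZ// innerZr// -/z abs2M abs2C conjM conjCC.
  have -> : complex.Re (t%:C * z^* * z) = t * abs2 z.
    by rewrite -mulrA [z^* * z]mulrC mulCJ !ReImE mulr0 subr0.
  by rewrite !mulrA; lra.
have g0 := nsq_ge0 g; have f0 := nsq_ge0 f; have z0 := abs2_ge0 z.
have [ng0|ng0] := eqVneq (nsq g) 0.
  rewrite ng0 mulr0; rewrite leNgt; apply/negP => zp.
  have := key ((nsq f + 1) / (2 * abs2 z)); rewrite ng0 mulr0 addr0.
  have -> : 2 * ((nsq f + 1) / (2 * abs2 z)) * abs2 z = nsq f + 1.
    by field; rewrite gt_eqF.
  by lra.
have gp : 0 < nsq g by rewrite lt_def ng0 g0.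
have := key (nsq g)^-1.
have -> : nsq f - 2 * (nsq g)^-1 * abs2 z + (nsq g)^-1 ^+ 2 * abs2 z * nsq g
  = (nsq f * nsq g - abs2 z) / nsq g by field; rewrite gt_eqF.
by rewrite pmulr_lge0 ?invr_gt0// subr_ge0.
Qed.

End ComplexIntegral.

(** * Summability and limits in L^2 *)

Section Sequences.
Context {R : realType}.
Implicit Types (u v : nat -> R).

(** Summability of a nonnegative sequence, in the form of bounded partial sums, so
    that it can be transferred by termwise estimates. *)
Definition bsum u := exists M, forall N, \sum_(0 <= k < N) u k <= M.

Lemma bsumP u : (forall k, 0 <= u k) ->
  bsum u <-> (\sum_(k <oo) (u k)%:E < +oo)%E.
Proof.
move=> u0; split=> [[M hM]|h].
  apply: (@le_lt_trans _ _ M%:E); last exact: ltry.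
  apply: lime_le; first by apply: is_cvg_nneseries => n _ _; rewrite lee_fin.
  by apply: nearW => n; rewrite sumEFin lee_fin.
have h0 : (0 <= \sum_(k <oo) (u k)%:E)%E.
  by apply: nneseries_ge0 => n _ _; rewrite lee_fin.
exists (fine (\sum_(k <oo) (u k)%:E)%E) => N.
rewrite -lee_fin -sumEFin fineK ?ge0_fin_numE//.
by apply: nneseries_lim_ge => n _ _; rewrite lee_fin.
Qed.

Lemma bsum_le u v : (forall k, u k <= v k) -> bsum v -> bsum u.
Proof.
move=> uv [M hM]; exists M => N; apply: le_trans (hM N).
by apply: ler_sum => i _.
Qed.

Lemma bsumD u v : bsum u -> bsum v -> bsum (fun k => u k + v k).
Proof.
move=> [M hM] [M' hM']; exists (M + M') => N.
by rewrite big_split; apply: lerD.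
Qed.

Lemma bsumZ u (a : R) : 0 <= a -> bsum u -> bsum (fun k => a * u k).
Proof.
by move=> a0 [M hM]; exists (a * M) => N; rewrite -mulr_sumr ler_wpM2l.
Qed.

Lemma bsum_cvg u : (forall k, 0 <= u k) -> bsum u ->
  exists l, [/\ (fun N => \sum_(0 <= k < N) u k) @ \oo --> l,
    forall N, \sum_(0 <= k < N) u k <= l &
    forall e, 0 < e -> exists N, l - e < \sum_(0 <= k < N) u k].
Proof.
move=> u0 [M hM]; pose s N := \sum_(0 <= k < N) u k.
have nd : nondecreasing_seq s by exact: nondecreasing_series.
have ub : has_ubound (range s) by exists M => _ [N _ <-]; exact: hM.
have cs := nondecreasing_cvgn nd ub.
exists (sup (range s)); split => //.
  by move=> N; apply: ub_le_sup => //; exists N.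
move=> e e0; have hs : has_sup (range s) by split => //; exists (s 0%N), 0%N.
by have [_ [N _ <-] h] := sup_adherent e0 hs; exists N.
Qed.

Lemma cvg0_le (u v : nat -> R) : (forall n, 0 <= u n <= v n) ->
  v @ \oo --> 0 -> u @ \oo --> 0.
Proof.
move=> uv v0; apply: squeeze_cvgr v0; last exact: (cvg_cst 0).
by apply: nearW.
Qed.

(** Convergence of complex sequences through real and imaginary parts, which is
    how all integrals of complex functions are defined here. *)
Definition ccvg (u : nat -> R[i]) (l : R[i]) :=
  (fun n => complex.Re (u n)) @ \oo --> complex.Re l /\
  (fun n => complex.Im (u n)) @ \oo --> complex.Im l.

Lemma ccvg_unique (u : nat -> R[i]) (l l' : R[i]) :
  ccvg u l -> ccvg u l' -> l = l'.
Proof.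
move=> [h1 h2] [h1' h2']; apply: eq_ReIm.
  by rewrite -(cvg_lim (@Rhausdorff R) h1) -(cvg_lim (@Rhausdorff R) h1').
by rewrite -(cvg_lim (@Rhausdorff R) h2) -(cvg_lim (@Rhausdorff R) h2').
Qed.

Lemma ccvg_abs2 (u : nat -> R[i]) (l : R[i]) : ccvg u l ->
  (fun n => abs2 (u n)) @ \oo --> abs2 l.
Proof. by move=> [h1 h2]; rewrite /abs2; apply: cvgD; apply: cvgM. Qed.

Lemma ccvgD (u v : nat -> R[i]) (l m : R[i]) : ccvg u l -> ccvg v m ->
  ccvg (fun n => u n + v n) (l + m).
Proof.
move=> [h1 h2] [h1' h2']; split; rewrite !ReImE.
  by under eq_fun do rewrite cReD; apply: cvgD.
by under eq_fun do rewrite cImD; apply: cvgD.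
Qed.

Lemma ccvgM (u v : nat -> R[i]) (l m : R[i]) : ccvg u l -> ccvg v m ->
  ccvg (fun n => u n * v n) (l * m).
Proof.
move=> [h1 h2] [h1' h2']; split; rewrite !ReImE.
  by under eq_fun do rewrite cReM; apply: cvgB; apply: cvgM.
by under eq_fun do rewrite cImM; apply: cvgD; apply: cvgM.
Qed.

Lemma ccvg_cst (l : R[i]) : ccvg (fun=> l) l.
Proof. by split; exact: cvg_cst. Qed.

Lemma cvg0_sqr (u : nat -> R) : (fun n => u n ^+ 2) @ \oo --> 0 -> u @ \oo --> 0.
Proof.
move=> h; apply/cvgrPdist_lt => e e0.
have e2 : 0 < e ^+ 2 by exact: exprn_gt0.
near=> n; rewrite sub0r normrN.
have : `|0 - u n ^+ 2| < e ^+ 2 by near: n; exact: (cvgrPdist_lt _ _).1.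
rewrite sub0r normrN ger0_norm ?sqr_ge0// => hn.
by rewrite -(@ltr_pXn2r _ 2)// ?nnegrE ?normr_ge0 ?(ltW e0)// real_normK ?num_real.
Unshelve. all: by end_near. Qed.

Lemma ccvgP (u : nat -> R[i]) (l : R[i]) :
  (fun n => abs2 (l - u n)) @ \oo --> 0 -> ccvg u l.
Proof.
move=> h.
have h1 : (fun n => complex.Re (l - u n)) @ \oo --> 0.
  by apply: cvg0_sqr; apply: cvg0_le h => n; rewrite sqr_ge0 Re2_le.
have h2 : (fun n => complex.Im (l - u n)) @ \oo --> 0.
  by apply: cvg0_sqr; apply: cvg0_le h => n; rewrite sqr_ge0 Im2_le.
split.
  have -> : (fun n => complex.Re (u n)) = (fun n => complex.Re l - complex.Re (l - u n)).
    by apply/funext => n; rewrite !ReImE; ring.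
  by rewrite -[X in _ --> X]subr0; apply: cvgB => //; exact: cvg_cst.
have -> : (fun n => complex.Im (u n)) = (fun n => complex.Im l - complex.Im (l - u n)).
  by apply/funext => n; rewrite !ReImE; ring.
by rewrite -[X in _ --> X]subr0; apply: cvgB => //; exact: cvg_cst.
Qed.

Lemma cvg_series_abs u : bsum (fun k => `|u k|) ->
  cvgn (fun N => \sum_(0 <= k < N) u k).
Proof.
move=> h; apply: (@normed_cvg R R^o u).
have [l [hl _ _]] := bsum_cvg (fun k => normr_ge0 (u k)) h.
by apply/cvg_ex; exists l.
Qed.

End Sequences.

Section L2Limits.
Context {R : realType}.
Local Notation mu := (@lebesgue_measure R).
Variable D : set R.
Hypothesis mD : measurable D.
Implicit Types (f g h : R -> R[i]).

Lemma sqnorm_lim (gk : nat -> R -> R[i]) g (C : \bar R) :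
  (forall k, cmeas D (gk k)) -> cmeas D g ->
  {ae mu, forall x, D x -> ccvg (gk ^~ x) (g x)} ->
  (forall k, (sqnorm D (gk k) <= C)%E) -> (sqnorm D g <= C)%E.
Proof.
move=> mgk mg cg hC.
pose F k x := (abs2 (gk k x))%:E.
have mF k : measurable_fun D (F k) by exact: measurable_abs2E.
have -> : sqnorm D g = (\int[mu]_(x in D) limn_einf (F^~ x))%E.
  apply: ge0_ae_eq_integral => //.
  - exact: measurable_abs2E.
  - under eq_fun do rewrite /limn_einf.
    apply: measurableT_comp => //; apply: measurable_fun_limn_esup => k.
    by apply: measurableT_comp => //; exact: mF.
  - by move=> x _; rewrite lee_fin abs2_ge0.
  - move=> x _; rewrite limn_einf_lim; apply: lime_ge; first exact: is_cvg_einfs.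
    apply: nearW => k; apply: le_ereal_inf_tmp => _ [n _ <-].
    by rewrite lee_fin abs2_ge0.
  - apply: aeS cg => x h Dx; apply/esym.
    have hx : (F^~ x) @ \oo --> (abs2 (g x))%:E.
      by apply/cvg_EFin; [exact: nearW|exact: ccvg_abs2 (h Dx)].
    by have [-> _] := cvg_limn_einf_sup hx.
apply: le_trans (fatou mu mD mF _) _.
  by move=> n x _; rewrite lee_fin abs2_ge0.
rewrite limn_einf_lim; apply: lime_le; first exact: is_cvg_einfs.
apply: nearW => k; apply: le_trans (hC k).
by apply: ereal_inf_lbound; exists k => /=.
Qed.

(** A limit function along a sequence that converges almost everywhere; the
    upper limits keep it measurable off the set of convergence as well. *)
(** The real and imaginary parts use the limit superior, which is measurable
    without any assumption of convergence. *)
Definition climit (gk : nat -> R -> R[i]) (x : R) : R[i] :=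
  fine (limn_esup (fun k => (complex.Re (gk k x))%:E)) +i*
  fine (limn_esup (fun k => (complex.Im (gk k x))%:E)).

Lemma cmeas_climit (gk : nat -> R -> R[i]) : (forall k, cmeas D (gk k)) ->
  cmeas D (climit gk).
Proof.
move=> mgk; split; apply: measurableT_comp => //;
  apply: measurable_fun_limn_esup => k; apply/measurable_EFinP;
  by have [] := mgk k.
Qed.

Lemma climitE (gk : nat -> R -> R[i]) x l : ccvg (gk ^~ x) l ->
  climit gk x = l.
Proof.
move=> [h1 h2]; apply: eq_ReIm => /=.
  have h : (fun k => (complex.Re (gk k x))%:E) @ \oo --> (complex.Re l)%:E.
    by apply/cvg_EFin => //; exact: nearW.
  by have [_ ->] := cvg_limn_einf_sup h.
have h : (fun k => (complex.Im (gk k x))%:E) @ \oo --> (complex.Im l)%:E.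
  by apply/cvg_EFin => //; exact: nearW.
by have [_ ->] := cvg_limn_einf_sup h.
Qed.

(** If the increments decay fast in L^2, the series of increments converges
    absolutely almost everywhere. *)
Lemma fast_cauchy_ae (t : nat -> R -> R[i]) : (forall k, L2 D (t k)) ->
  (forall k, nsq D (t k) <= (4 ^- k)) ->
  {ae mu, forall x, D x -> exists l, ccvg (fun N => \sum_(0 <= k < N) t k x) l}.
Proof.
move=> ht nt.
pose F k x := (2 ^+ k * abs2 (t k x))%:E.
have mF k : measurable_fun D (F k).
  apply/measurable_EFinP; apply: measurable_funM; first exact: measurable_cst.
  by apply: measurable_abs2; exact: L2_cmeas.
have F0 k x : D x -> (0 <= F k x)%E.
  by move=> _; rewrite lee_fin mulr_ge0 ?abs2_ge0 ?exprn_ge0.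
have geo : bsum (fun k : nat => (2 ^- k : R)).
  exists 2 => N; suff -> : \sum_(0 <= k < N) 2 ^- k = 2 - 2 * 2 ^- N :> R.
    by rewrite gerBl mulr_ge0// invr_ge0 exprn_ge0.
  elim: N => [|N IH]; first by rewrite big_nil expr0 invr1 mulr1 subrr.
  rewrite big_nat_recr//= IH exprS invfM.
  by field; rewrite expf_neq0.
have iF : (\int[mu]_(x in D) (\sum_(k <oo) F k x) < +oo)%E.
  rewrite integral_nneseries//.
  have -> : (\sum_(k <oo) (\int[mu]_(x in D) F k x) =
            \sum_(k <oo) (2 ^+ k * nsq D (t k))%:E)%E.
    apply: eq_eseriesr => k _; rewrite /F.
    under eq_integral do rewrite EFinM.
    rewrite ge0_integralZl//.
    - by rewrite EFinM -sqnormE.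
    - by apply: measurable_abs2E; exact: L2_cmeas.
    - by move=> x _; rewrite lee_fin abs2_ge0.
  apply/bsumP; first by move=> k; rewrite mulr_ge0 ?exprn_ge0 ?nsq_ge0.
  apply: bsum_le geo => k.
  apply: (@le_trans _ _ (2 ^+ k * 4 ^- k)).
    by rewrite ler_wpM2l// exprn_ge0.
  rewrite (_ : (4 : R) = 2 * 2); last by ring.
  by rewrite exprMn invfM mulrA divff ?mul1r// expf_neq0.
have : mu.-integrable D (fun x => \sum_(k <oo) F k x)%E.
  apply/integrableP; split.
    by apply: ge0_emeasurable_sum => [k x Dx _|k _]; [exact: F0|exact: mF].
  under eq_integral => x /set_mem Dx.
    by rewrite gee0_abs; [over|apply: nneseries_ge0 => k _ _; exact: F0].
  exact: iF.
move=> hi; have := @integrable_ae _ _ _ mu D mD _ hi; apply: aeS => x h Dx.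
have : (\sum_(k <oo) F k x < +oo)%E by have := h Dx; rewrite ltey_eq => ->.
move=> /bsumP-/(_ (fun k => mulr_ge0 (exprn_ge0 _ (ler0n _ 2)) (abs2_ge0 _))) bF.
have key (k : nat) (y : R) : y ^+ 2 <= abs2 (t k x) ->
    `|y| <= 2 ^+ k * abs2 (t k x) + 2 ^- k.
  move=> hy; set p := 2 ^+ k; have p0 : 0 < p :> R by exact: exprn_gt0.
  have h1 : p * y ^+ 2 <= p * abs2 (t k x) by rewrite ler_wpM2l// ltW.
  apply: le_trans (_ : p * y ^+ 2 + p^-1 <= _); last by rewrite lerD2r.
  have : 0 <= p^-1 * ((p * `|y|) ^+ 2 - p * `|y| + 1).
    apply: mulr_ge0; first by rewrite invr_ge0 ltW.
    by have := sqr_ge0 (p * `|y| - 1); have := sqr_ge0 (p * `|y|); lra.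
  rewrite -[y ^+ 2]real_normK ?num_real//.
  have -> : p^-1 * ((p * `|y|) ^+ 2 - p * `|y| + 1) = p * `|y| ^+ 2 + p^-1 - `|y|.
    by field; rewrite gt_eqF.
  by rewrite subr_ge0.
have b1 : bsum (fun k => `|complex.Re (t k x)|).
  by apply: bsum_le (bsumD bF geo) => k; apply: key; exact: Re2_le.
have b2 : bsum (fun k => `|complex.Im (t k x)|).
  by apply: bsum_le (bsumD bF geo) => k; apply: key; exact: Im2_le.
have /cvg_ex[l1 h1] := cvg_series_abs b1.
have /cvg_ex[l2 h2] := cvg_series_abs b2.
exists (l1 +i* l2); split => /=.
  by under eq_fun do rewrite cRe_sum.
by under eq_fun do rewrite cIm_sum.
Qed.

End L2Limits.

(** * Orthonormal bases *)

Section Orthonormal.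
Context {R : realType}.
Local Notation mu := (@lebesgue_measure R).
Variable D : set R.
Hypothesis mD : measurable D.
Variable e : nat -> R -> R[i].
Hypothesis he : forall n, L2 D (e n).
Hypothesis one : forall m n, inner D (e m) (e n) = (m == n)%:R.
Implicit Types (f g h : R -> R[i]) (a b : nat -> R[i]).

Definition coef f n : R[i] := inner D f (e n).
Definition partial_sum a N (x : R) : R[i] := \sum_(0 <= k < N) a k * e k x.

Lemma L2_psum a N : L2 D (partial_sum a N).
Proof. by apply: L2_sum => // k; exact: L2Z. Qed.

Lemma coef_psum a N n : coef (partial_sum a N) n = if (n < N)%N then a n else 0.
Proof.
rewrite /coef /partial_sum inner_suml//; last by move=> k; exact: L2Z.
under eq_bigr do rewrite innerZl// one.
case: ltnP => nN.
  rewrite (bigD1_seq n) ?mem_index_iota ?iota_uniq//= eqxx mulr1.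
  by rewrite big1 ?addr0// => k /negbTE ->; rewrite mulr0.
rewrite big_nat big1// => k /andP[_ kN].
by rewrite ltn_eqF ?mulr0// (leq_trans kN).
Qed.

Lemma inner_psum f a N : L2 D f ->
  inner D (partial_sum a N) f = \sum_(0 <= k < N) a k * (coef f k)^*.
Proof.
move=> hf; rewrite /partial_sum inner_suml//; last by move=> k; exact: L2Z.
by apply: eq_bigr => k _; rewrite innerZl// innerJ.
Qed.

Lemma inner_psumr f a N : L2 D f ->
  inner D f (partial_sum a N) = \sum_(0 <= k < N) (a k)^* * coef f k.
Proof.
move=> hf; rewrite -innerJ ?inner_psum//; last exact: L2_psum.
by rewrite conj_sum; apply: eq_bigr => k _; rewrite conjM conjCK.
Qed.

Lemma nsq_psum a N : nsq D (partial_sum a N) = \sum_(0 <= k < N) abs2 (a k).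
Proof.
apply: complexI; rewrite -inner_self// inner_psum; last exact: L2_psum.
rewrite realC_sum big_nat [RHS]big_nat; apply: eq_bigr => k /andP[_ kN].
by rewrite coef_psum kN mulCJ.
Qed.

Lemma nsq_sub_psum f N : L2 D f ->
  nsq D (fun x => f x - partial_sum (coef f) N x) =
  nsq D f - \sum_(0 <= k < N) abs2 (coef f k).
Proof.
move=> hf; rewrite nsqB//; last exact: L2_psum.
rewrite nsq_psum inner_psumr//.
have -> : \sum_(0 <= k < N) (coef f k)^* * coef f k =
    (\sum_(0 <= k < N) abs2 (coef f k))%:C.
  by rewrite realC_sum; apply: eq_bigr => k _; rewrite mulrC mulCJ.
by rewrite cReC; ring.
Qed.

Lemma bessel f N : L2 D f -> \sum_(0 <= k < N) abs2 (coef f k) <= nsq D f.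
Proof.
by move=> hf; rewrite -subr_ge0 -nsq_sub_psum// nsq_ge0.
Qed.

Lemma bsum_coef f : L2 D f -> bsum (fun k => abs2 (coef f k)).
Proof. by move=> hf; exists (nsq D f) => N; exact: bessel. Qed.

Lemma coef_eqae f g n : L2 D f -> L2 D g -> f = g %[ae mu in D] ->
  coef f n = coef g n.
Proof. by move=> hf hg fg; apply: eqae_inner => //; exact: aeT. Qed.

Lemma coef_add f g n : L2 D f -> L2 D g ->
  coef (fun x => f x + g x) n = coef f n + coef g n.
Proof. by move=> hf hg; rewrite /coef innerDl. Qed.
Lemma coef_sub f g n : L2 D f -> L2 D g ->
  coef (fun x => f x - g x) n = coef f n - coef g n.
Proof. by move=> hf hg; rewrite /coef innerBl. Qed.
Lemma coef_scale z f n : L2 D f -> coef (fun x => z * f x) n = z * coef f n.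
Proof. by move=> hf; rewrite /coef innerZl. Qed.
Lemma coef_e m n : coef (e m) n = (m == n)%:R.
Proof. exact: one. Qed.

Lemma psumB a M N x : (M <= N)%N ->
  partial_sum a N x - partial_sum a M x = \sum_(M <= k < N) a k * e k x.
Proof.
by move=> MN; rewrite /partial_sum (big_cat_nat _ MN)//= addrAC subrr add0r.
Qed.

Lemma psumB_psum a M N : (M <= N)%N ->
  (fun x => partial_sum a N x - partial_sum a M x) =
  partial_sum (fun k => if (M <= k)%N then a k else 0) N.
Proof.
move=> MN; apply/funext => x; rewrite psumB// /partial_sum [RHS](@big_cat_nat _ _ _ M)//=.
rewrite [X in _ = X + _]big_nat [X in _ = X + _]big1 ?add0r.
  rewrite big_nat [RHS]big_nat; apply: eq_bigr => k /andP[Mk _].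
  by rewrite Mk.
by move=> k /andP[_ kM]; rewrite leqNgt kM mul0r.
Qed.

Lemma nsq_psumB a M N : (M <= N)%N ->
  nsq D (fun x => partial_sum a N x - partial_sum a M x) = \sum_(M <= k < N) abs2 (a k).
Proof.
move=> MN; rewrite psumB_psum// nsq_psum (@big_cat_nat _ _ _ M)//=.
rewrite [X in X + _]big_nat [X in X + _]big1 ?add0r.
  rewrite big_nat [RHS]big_nat; apply: eq_bigr => k /andP[Mk _].
  by rewrite Mk.
by move=> k /andP[_ kM]; rewrite leqNgt kM abs20.
Qed.

(** Riesz-Fischer. A subsequence of the partial sums with fast decaying
    increments converges almost everywhere, and Fatou's lemma bounds the
    distance from its limit to each partial sum by the tail of the series. *)
Lemma riesz_fischer a : bsum (fun k => abs2 (a k)) ->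
  exists f, [/\ L2 D f, forall n, coef f n = a n &
    (fun N => nsq D (fun x => f x - partial_sum a N x)) @ \oo --> 0].
Proof.
move=> /bsum_cvg-/(_ (fun k => abs2_ge0 _))[l [hl lub ladh]].
set s := fun N => \sum_(0 <= k < N) abs2 (a k) in hl.
have tail M N : (M <= N)%N -> \sum_(M <= k < N) abs2 (a k) <= l - s M.
  by move=> MN; rewrite lerBrDl /s -big_cat_nat//; exact: lub.
have smono M N : (M <= N)%N -> s M <= s N.
  by move=> MN; rewrite /s (@big_cat_nat _ _ _ M 0 N)//= lerDl sumr_ge0// => *; exact: abs2_ge0.
have pick k M : exists N, (M < N)%N /\ l - 4 ^- k < s N.
  have [|N hN] := ladh (4 ^- k); first by rewrite invr_gt0 exprn_gt0.
  exists (maxn M.+1 N); split; first exact: leq_maxl.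
  by apply: (lt_le_trans hN); apply: smono; exact: leq_maxr.
have [nn hnn] : exists nn : nat -> nat -> nat,
    forall k M, (M < nn k M)%N /\ l - 4 ^- k < s (nn k M).
  by exists (fun k M => sval (cid (pick k M))) => k M; case: cid.
pose p := fix p k := if k is k'.+1 then nn k (p k') else nn 0%N 0%N.
have p1 k : (p k < p k.+1)%N by have [] := hnn k.+1 (p k).
have p2 k : l - 4 ^- k < s (p k).
  by case: k => [|k]; [have [] := hnn 0%N 0%N|have [] := hnn k.+1 (p k)].
have kp k : (k <= p k)%N by elim: k => // k IH; exact: leq_ltn_trans IH (p1 k).
pose t k x := partial_sum a (p k.+1) x - partial_sum a (p k) x.
have tL k : L2 D (t k) by apply: L2B => //; exact: L2_psum.
have nt k : nsq D (t k) <= 4 ^- k.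
  rewrite nsq_psumB; last exact: ltnW.
  apply: le_trans (tail _ _ (ltnW (p1 k))) _.
  by have := p2 k; lra.
pose f := climit (fun k => partial_sum a (p k)).
have cae : {ae mu, forall x, D x -> ccvg ((fun k => partial_sum a (p k)) ^~ x) (f x)}.
  have := fast_cauchy_ae mD tL nt; apply: aeS => x h Dx.
  have [l' hl'] := h Dx.
  have cv : ccvg ((fun k => partial_sum a (p k)) ^~ x) (partial_sum a (p 0%N) x + l').
    have tel : (fun k => partial_sum a (p k) x) =
        (fun k => partial_sum a (p 0%N) x + \sum_(0 <= j < k) t j x).
      apply/funext => k; rewrite (telescope_sumr (fun j => partial_sum a (p j) x))//.
      by rewrite addrC subrK.
    by rewrite tel; apply: ccvgD => //; exact: ccvg_cst.
  by rewrite /f (climitE cv).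
have mf : cmeas D f.
  by apply: cmeas_climit => // k; apply: L2_cmeas; exact: L2_psum.
have bound M : (sqnorm D (fun x => (f x - partial_sum a M x)%R) <= (l - s M)%:E)%E.
  have Mp k : (M <= p (k + M))%N by apply: leq_trans (kp _); exact: leq_addl.
  apply: (@sqnorm_lim _ _ mD (fun k x => partial_sum a (p (k + M)) x - partial_sum a M x)).
  - by move=> k; apply: cmeasB => //; apply: L2_cmeas; exact: L2_psum.
  - by apply: cmeasB => //; apply: L2_cmeas; exact: L2_psum.
  - move: cae; apply: aeS => x h Dx; have [h1 h2] := h Dx.
    apply: ccvgD; last exact: ccvg_cst.
    by split; [rewrite -(cvg_shiftn M) in h1|rewrite -(cvg_shiftn M) in h2].
  - move=> k; rewrite sqnormE//; last by apply: L2B => //; exact: L2_psum.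
    by rewrite lee_fin nsq_psumB//; exact: tail.
have fL : L2 D f.
  apply: L2P => //; have := bound 0%N.
  have -> : (fun x => f x - partial_sum a 0 x) = f.
    by apply/funext => x; rewrite /partial_sum big_nil subr0.
  by move=> /le_lt_trans; apply; exact: ltry.
have bound' M : nsq D (fun x => f x - partial_sum a M x) <= l - s M.
  by rewrite -lee_fin -sqnormE//; apply: L2B => //; exact: L2_psum.
have lim0 : (fun M => l - s M) @ \oo --> 0.
  by rewrite -[X in _ --> X](subrr l); apply: cvgB => //; exact: cvg_cst.
have nlim : (fun M => nsq D (fun x => f x - partial_sum a M x)) @ \oo --> 0.
  by apply: cvg0_le lim0 => M; rewrite nsq_ge0 bound'.
exists f; split=> // n.
apply/eqP; rewrite -subr_eq0; apply/eqP; apply: abs2_eq0.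
apply/eqP; rewrite eq_le abs2_ge0 andbT.
have h M : (n < M)%N -> abs2 (coef f n - a n) <= l - s M.
  move=> nM; apply: le_trans (bound' M).
  have -> : coef f n - a n = coef (fun x => f x - partial_sum a M x) n.
    by rewrite coef_sub//; [rewrite coef_psum nM|exact: L2_psum].
  apply: le_trans (inner_le mD _ (he n)) _; first by apply: L2B => //; exact: L2_psum.
  rewrite -[leRHS]mulr1 ler_wpM2l ?nsq_ge0//.
  by have := one n n; rewrite inner_self// eqxx => /(congr1 (@complex.Re R)) /= ->.
rewrite -(cvg_lim (@Rhausdorff R) lim0); apply: limr_ge; first exact: cvgP lim0.
by exists n.+1 => // M /= nM; exact: h.
Qed.

Section Complete.
Hypothesis comp : forall f, L2 D f -> (forall n, coef f n = 0) ->
  f = (fun=> 0) %[ae mu in D].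

Lemma coef_inj f g : L2 D f -> L2 D g -> (forall n, coef f n = coef g n) ->
  f = g %[ae mu in D].
Proof.
move=> hf hg fg.
have : (fun x => f x - g x) = (fun=> 0) %[ae mu in D].
  by apply: comp => [|n]; [exact: L2B|rewrite coef_sub// fg subrr].
by apply: aeS => x h Dx; apply/eqP; rewrite -subr_eq0; apply/eqP; exact: h.
Qed.

Lemma cvg_psum f : L2 D f ->
  (fun N => nsq D (fun x => f x - partial_sum (coef f) N x)) @ \oo --> 0.
Proof.
move=> hf; have [g [hg cg ng]] := riesz_fischer (bsum_coef hf).
have gf : g = f %[ae mu in D] by apply: coef_inj.
suff -> : (fun N => nsq D (fun x => f x - partial_sum (coef f) N x)) =
          (fun N => nsq D (fun x => g x - partial_sum (coef f) N x)) by [].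
apply/funext => N; apply: nsq_eqae => //.
- by apply: L2B => //; exact: L2_psum.
- by apply: L2B => //; exact: L2_psum.
- by move: gf; apply: aeS => x h Dx; rewrite h.
Qed.

Lemma parseval f : L2 D f ->
  (fun N => \sum_(0 <= k < N) abs2 (coef f k)) @ \oo --> nsq D f.
Proof.
move=> hf; have h := cvg_psum hf.
have -> : (fun N => \sum_(0 <= k < N) abs2 (coef f k)) =
    (fun N => nsq D f - nsq D (fun x => f x - partial_sum (coef f) N x)).
  by apply/funext => N; rewrite nsq_sub_psum//; ring.
by rewrite -[X in _ --> X]subr0; apply: cvgB => //; exact: cvg_cst.
Qed.

Lemma parsevalE f : L2 D f ->
  (sqnorm D f = \sum_(k <oo) (abs2 (coef f k))%:E)%E.
Proof.
move=> hf; rewrite sqnormE//; apply/esym/cvg_lim => //.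
rewrite (_ : (fun n => _) =
  EFin \o (fun N => \sum_(0 <= k < N) abs2 (coef f k))%R); last first.
  by apply/funext => n /=; rewrite sumEFin.
by apply/cvg_EFin; [exact: nearW|exact: parseval].
Qed.

Lemma parseval_inner f g : L2 D f -> L2 D g ->
  ccvg (fun N => \sum_(0 <= k < N) coef f k * (coef g k)^*) (inner D f g).
Proof.
move=> hf hg; apply: ccvgP.
have h := cvg_psum hf.
have h' : (fun N => nsq D (fun x => f x - partial_sum (coef f) N x) * nsq D g) @ \oo --> 0.
  by rewrite -[X in _ --> X](mul0r (nsq D g)); apply: cvgM => //; exact: cvg_cst.
apply: cvg0_le h' => N; rewrite abs2_ge0/= -inner_psum// -innerBl//.
  by apply: inner_le => //; apply: L2B => //; exact: L2_psum.
exact: L2_psum.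
Qed.

End Complete.
End Orthonormal.

(** * Spectral measures of diagonal operators *)

Section SetFunctions.
Context {R : realType}.
Import HBNNSimple.

(** The integral against a set function only reads its values on Borel sets. *)
Lemma integral_setfun (m : set R -> \bar R) (M : {measure set R -> \bar R})
    (f : R -> \bar R) : (forall A, measurable A -> m A = M A) ->
  (\int[m]_x f x = \int[M]_x f x)%E.
Proof.
move=> mM; rewrite /integral.
congr (ereal_sup _ - ereal_sup _)%E; rewrite eqEsubset; split;
  move=> _ [h hf <-] /=; exists h => //; apply: eq_fsbigr => r _;
  by rewrite mM.
Qed.

Lemma measure_of_setfun (m : set R -> \bar R) : m set0 = 0%E ->
  (forall A, 0 <= m A)%E -> semi_sigma_additive m ->
  exists M : {measure set R -> \bar R}, forall A, M A = m A.
Proof.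
move=> m0 mge ms.
pose mx := isMeasure.Build _ R R m m0 mge ms.
pose M : {measure set R -> \bar R} := HB.pack m mx.
by exists M.
Qed.

Lemma max_sub_max (x : R) : Num.max x 0 - Num.max (- x) 0 = x.
Proof.
by have [h|h] := leP 0 x; rewrite /Num.max; case: ltP; case: ltP; lra.
Qed.

End SetFunctions.

Section Diagonal.
Context {R : realType}.
Local Notation mu := (@lebesgue_measure R).
Variable D : set R.
Hypothesis mD : measurable D.
Variable e : nat -> R -> R[i].
Hypothesis he : forall n, L2 D (e n).
Hypothesis one : forall m n, inner D (e m) (e n) = (m == n)%:R.
Hypothesis comp : forall f, L2 D f -> (forall n, coef D e f n = 0) ->
  f = (fun=> 0) %[ae mu in D].
Variable lam : nat -> R.
Implicit Types (f g h : R -> R[i]).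
Local Notation coef := (coef D e).
Local Notation aeq f g := (f = g %[ae mu in D]).

Lemma coef_innerE f n : coef f n = inner D f (e n).
Proof. by []. Qed.

Lemma iE : 'i = 0 +i* 1 :> R[i].
Proof. by rewrite -complexiE. Qed.
Lemma cRei : complex.Re ('i : R[i]) = 0.
Proof. by rewrite iE. Qed.
Lemma cImi : complex.Im ('i : R[i]) = 1.
Proof. by rewrite iE. Qed.
Lemma i2 : 'i * 'i = -1 :> R[i].
Proof. by rewrite -expr2 sqrCi. Qed.
Lemma abs2_i : abs2 ('i : R[i]) = 1.
Proof. by rewrite iE /abs2 /= expr0n expr1n add0r. Qed.
Lemma abs2X (z : R[i]) n : abs2 (z ^+ n) = abs2 z ^+ n.
Proof.
elim: n => [|n IH]; first by rewrite !expr0 abs2C expr1n.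
by rewrite !exprS abs2M IH.
Qed.
Lemma abs2_iX n : abs2 ('i ^+ n : R[i]) = 1.
Proof. by rewrite abs2X abs2_i expr1n. Qed.

(** E acts on the coefficients in the basis as multiplication by the indicator
    function of B at the eigenvalue. *)
Definition diagonal (E : set R -> (R -> R[i]) -> R -> R[i]) :=
  forall B f, measurable B -> L2 D f -> L2 D (E B f) /\
    forall n, coef (E B f) n = (\1_B (lam n))%:C * coef f n.

Section Weight.
Variable E : set R -> (R -> R[i]) -> R -> R[i].
Hypothesis dE : diagonal E.

Lemma weightE f B : L2 D f -> measurable B ->
  spectral_weight D E f B = (\sum_(k <oo) (\1_B (lam k) * abs2 (coef f k))%:E)%E.
Proof.
move=> hf mB; have [h1 h2] := dE mB hf.
rewrite /spectral_weight (parsevalE mD he one comp)//.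
apply: eq_eseriesr => k _; rewrite h2 abs2M abs2C indicE.
by case: (lam k \in B); rewrite ?expr1n ?expr0n.
Qed.

(** The spectral weight of f as a sum of point masses at the eigenvalues. *)
Definition nu f : {measure set R -> \bar R} :=
  mseries (fun k => mscale (NngNum (abs2_ge0 (coef f k))) \d_(lam k)) 0.

Lemma weight_nu f B : L2 D f -> measurable B -> spectral_weight D E f B = nu f B.
Proof.
move=> hf mB; rewrite weightE// /nu /= /mseries.
by apply: eq_eseriesr => k _; rewrite /mscale /= /dirac mulrC EFinM.
Qed.

Lemma integral_weight f (u : R -> R) : L2 D f -> measurable_fun setT u ->
  (forall x, 0 <= u x) ->
  (\int[spectral_weight D E f]_x (u x)%:E =
  \sum_(k <oo) (u (lam k) * abs2 (coef f k))%:E)%E.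
Proof.
move=> hf hu u0.
rewrite (@integral_setfun _ _ (nu f)); last by move=> A mA; rewrite weight_nu.
have mu_ : measurable_fun setT (fun x => (u x)%:E) by exact/measurable_EFinP.
rewrite ge0_integral_measure_series//; last first.
  by move=> x _; rewrite lee_fin.
apply: eq_eseriesr => k _; rewrite ge0_integral_mscale//; last first.
  by move=> x _; rewrite lee_fin.
by rewrite integral_dirac// diracT mul1e /= mulrC EFinM.
Qed.

Lemma integral_weight_id f : L2 D f ->
  bsum (fun k => lam k ^+ 2 * abs2 (coef f k)) ->
  (fun N => \sum_(0 <= k < N) lam k * abs2 (coef f k)) @ \oo -->
  fine (\int[spectral_weight D E f]_x (x)%:E)%E.
Proof.
move=> hf b2; have wn A : measurable A -> spectral_weight D E f A = nu f A.
  by move=> mA; rewrite weight_nu.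
rewrite (integral_setfun _ wn) integralE.
have -> : (EFin : R -> \bar R)^\+%E = fun x => (Num.max x 0)%:E.
  by apply/funext => x; rewrite funeposE EFin_max.
have -> : (EFin : R -> \bar R)^\-%E = fun x => (Num.max (- x) 0)%:E.
  by apply/funext => x; rewrite funenegE EFin_max.
have max0 (x : R) : 0 <= Num.max x 0 by rewrite le_max lexx orbT.
have m1 : measurable_fun setT (fun x : R => Num.max x 0).
  by apply: measurable_maxr => //; exact: measurable_cst.
have m2 : measurable_fun setT (fun x : R => Num.max (- x) 0).
  by apply: measurable_maxr; [exact: measurable_funN|exact: measurable_cst].
rewrite -!(integral_setfun _ wn) !integral_weight//.
have bnd (w : R -> R) : (forall x, 0 <= w x <= 1 + x ^+ 2) ->
    bsum (fun k => w (lam k) * abs2 (coef f k)).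
  move=> hw; apply: bsum_le (bsumD (bsum_coef mD he one hf) b2) => k.
  rewrite -[X in X + _]mul1r -mulrDl ler_wpM2r ?abs2_ge0//.
  by have /andP[] := hw (lam k).
have le1 (x : R) : Num.max x 0 <= 1 + x ^+ 2.
  have h := sqr_ge0 (x - 1); have h' := sqr_ge0 x.
  by rewrite ge_max; apply/andP; split; lra.
have bp : bsum (fun k => Num.max (lam k) 0 * abs2 (coef f k)).
  by apply: (bnd (fun x => Num.max x 0)) => x; rewrite max0 le1.
have bn : bsum (fun k => Num.max (- lam k) 0 * abs2 (coef f k)).
  by apply: (bnd (fun x => Num.max (- x) 0)) => x; rewrite max0 -sqrrN le1.
have lim (w : nat -> R) : (forall k, 0 <= w k) -> bsum w ->
    (\sum_(k <oo) (w k)%:E)%E \is a fin_num /\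
    (fun N => \sum_(0 <= k < N) w k) @ \oo --> fine (\sum_(k <oo) (w k)%:E)%E.
  move=> w0 bw; have [l [hl _ _]] := bsum_cvg w0 bw.
  have -> : (\sum_(k <oo) (w k)%:E)%E = l%:E.
    apply: cvg_lim => //.
    rewrite (_ : (fun n => _) = EFin \o (fun N => \sum_(0 <= k < N) w k)%R).
      by apply/cvg_EFin; [exact: nearW|].
    by apply/funext => n /=; rewrite sumEFin.
  by split.
have w0 (x : R) k : 0 <= Num.max x 0 * abs2 (coef f k).
  by rewrite mulr_ge0 ?abs2_ge0.
have [f1 c1] := lim _ (fun k => w0 (lam k) k) bp.
have [f2 c2] := lim _ (fun k => w0 (- lam k) k) bn.
rewrite fineB//.
have -> : (fun N => \sum_(0 <= k < N) lam k * abs2 (coef f k)) =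
  (fun N => \sum_(0 <= k < N) Num.max (lam k) 0 * abs2 (coef f k) -
            \sum_(0 <= k < N) Num.max (- lam k) 0 * abs2 (coef f k)).
  apply/funext => N; rewrite -sumrB; apply: eq_bigr => k _.
  rewrite -mulrBl; congr (_ * _).
  exact/esym/max_sub_max.
exact: cvgB.
Qed.

Lemma spectral_dom_diagonal (u : R -> R) : measurable_fun setT u ->
  spectral_dom D E u =
  [set f | L2 D f /\ bsum (fun k => u (lam k) ^+ 2 * abs2 (coef f k))].
Proof.
move=> mu_; apply/seteqP; split => f [hf h]; split=> //.
  apply/bsumP; first by move=> k; rewrite mulr_ge0 ?sqr_ge0 ?abs2_ge0.
  rewrite -(integral_weight hf (u := fun x => u x ^+ 2))//.
    exact: measurable_funX.
  by move=> x; exact: sqr_ge0.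
rewrite (integral_weight hf (u := fun x => u x ^+ 2))//.
- by apply/bsumP => // k; rewrite mulr_ge0 ?sqr_ge0 ?abs2_ge0.
- exact: measurable_funX.
- by move=> x; exact: sqr_ge0.
Qed.

End Weight.

Lemma polarization (z w : R[i]) :
  4^-1 * \sum_(j < 4) 'i ^+ j * (abs2 (z + 'i ^+ j * w))%:C = z * w^*.
Proof.
rewrite !big_ord_recl big_ord0 /= /bump /= !addn0 addr0 !add1n.
rewrite expr0 expr1 (_ : 'i ^+ 3 = - 'i); last first.
  by rewrite exprS sqrCi mulrN1.
rewrite sqrCi.
have -> : (4^-1 : R[i]) = (4^-1)%:C.
  have h4 : (4 : R[i]) = (4 : R)%:C by rewrite rmorph_nat.
  have h40 : (4 : R[i]) != 0 by rewrite pnatr_eq0.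
  by apply: (mulfI h40); rewrite divff// h4 -realCM divff.
by apply: eq_ReIm; rewrite /abs2 !(ReImE, cRei, cImi); field.
Qed.

Lemma polar_const (b c : R) :
  4^-1 * \sum_(j < 4) 'i ^+ j * (abs2 (1 + 'i ^+ j) * b + c)%:C = b%:C.
Proof.
have h := polarization 1 1; rewrite conjC1 mulr1 in h.
under eq_bigr do rewrite realCD realCM mulrDr mulrA.
rewrite big_split /= mulrDr -!mulr_suml mulrA.
rewrite (_ : \sum_(i < 4) 'i ^+ i = 0 :> R[i]) ?mul0r ?mulr0 ?addr0; last first.
  rewrite !big_ord_recl big_ord0 /= /bump /= !addn0 addr0 !add1n.
  by rewrite expr0 expr1 (exprS _ 2) sqrCi mulrN1; ring.
rewrite -[RHS]mul1r; congr (_ * _); rewrite -[RHS]h; congr (_ * _).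
by apply: eq_bigr => j _; rewrite mulr1.
Qed.

(** The polarization identity turns the integrals against the four spectral
    weights, each of which is a series by [integral_weight_id], into the series
    of the sesquilinear form. *)
Lemma polarization_form (E : set R -> (R -> R[i]) -> R -> R[i]) f k :
  diagonal E -> L2 D f -> L2 D k ->
  bsum (fun n => lam n ^+ 2 * abs2 (coef f n)) ->
  bsum (fun n => lam n ^+ 2 * abs2 (coef k n)) ->
  ccvg (fun N => \sum_(0 <= n < N) (lam n)%:C * coef f n * (coef k n)^*)
    (spectral_form D E id f k).
Proof.
move=> dE hf hk bf bk.
pose w j x := f x + 'i ^+ j * k x.
have wL j : L2 D (w j) by apply: L2D => //; exact: L2Z.
have cw j n : coef (w j) n = coef f n + 'i ^+ j * coef k n.
  by rewrite coef_add ?coef_scale//; exact: L2Z.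
have bw j : bsum (fun n => lam n ^+ 2 * abs2 (coef (w j) n)).
  apply: bsum_le (bsumD (bsumZ (ler0n _ 2) bf) (bsumZ (ler0n _ 2) bk)) => n.
  rewrite cw; have := abs2D_le (coef f n) ('i ^+ j * coef k n).
  rewrite abs2M abs2_iX mul1r => h; have := ler_wpM2l (sqr_ge0 (lam n)) h.
  by move: (lam n ^+ 2) => l2; lra.
pose q j N := \sum_(0 <= n < N) lam n * abs2 (coef (w j) n).
pose I j := fine (\int[spectral_weight D E (w j)]_x (x)%:E)%E.
have qI j : q j @ \oo --> I j by exact: integral_weight_id.
have cq j : ccvg (fun N => (q j N)%:C) (I j)%:C.
  by split => //=; exact: cvg_cst.
have -> : (fun N => \sum_(0 <= n < N) (lam n)%:C * coef f n * (coef k n)^*) =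
    (fun N => 4^-1 * \sum_(j < 4) 'i ^+ j * (q j N)%:C).
  apply/funext => N.
  under [in RHS]eq_bigr do rewrite /q realC_sum mulr_sumr.
  rewrite exchange_big mulr_sumr; apply: eq_bigr => n _ /=.
  rewrite -mulrA -polarization mulrCA mulr_sumr; congr (_ * _).
  by apply: eq_bigr => j _; rewrite cw realCM mulrCA.
apply: ccvgM; first exact: ccvg_cst.
rewrite !big_ord_recl big_ord0; under eq_fun do rewrite !big_ord_recl big_ord0.
do 4 (apply: ccvgD; first by apply: ccvgM; [exact: ccvg_cst|exact: cq]).
exact: ccvg_cst.
Qed.

(** The diagonal family, with values chosen through Riesz-Fischer; it witnesses
    that a spectral measure exists. *)
Definition dproj B f : R -> R[i] :=
  xget (fun=> 0) [set g | L2 D g /\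
    forall n, coef g n = (\1_B (lam n))%:C * coef f n].

Lemma diagonal_dproj : diagonal dproj.
Proof.
move=> B f _ hf.
have [|g [hg cg _]] := @riesz_fischer R D mD e he one
    (fun n => (\1_B (lam n))%:C * coef f n).
  apply: bsum_le (bsum_coef mD he one hf) => n.
  rewrite abs2M abs2C indicE; case: (_ \in _); rewrite ?expr1n ?mul1r//.
  by rewrite expr0n mul0r abs2_ge0.
apply: (@xgetPex _ (fun=> 0) [set g | L2 D g /\
    forall n, coef g n = (\1_B (lam n))%:C * coef f n]).
by exists g.
Qed.

Lemma coef_zero n : coef (cst 0) n = 0.
Proof. exact: inner0l. Qed.

Lemma is_pvm_diagonal E : diagonal E -> is_pvm D E.
Proof.
move=> dE.
have inj f g : L2 D f -> L2 D g -> (forall n, coef f n = coef g n) -> aeq f g.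
  exact: coef_inj.
have dL B f : measurable B -> L2 D f -> L2 D (E B f).
  by move=> mB hf; have [] := dE _ _ mB hf.
have dC B f n : measurable B -> L2 D f ->
    coef (E B f) n = (\1_B (lam n))%:C * coef f n.
  by move=> mB hf; have [] := dE _ _ mB hf.
split.
- move=> B mB; split.
  + by move=> f; exact: dL.
  + move=> a f h hf hh; have hafh : L2 D (fun x => a * f x + h x).
      by apply: L2D => //; exact: L2Z.
    apply: inj => [||n]; first exact: dL.
      by apply: L2D => //; [apply: L2Z => //|]; exact: dL.
    rewrite dC// !coef_add ?coef_scale ?dC//; try exact: dL; try exact: L2Z.
      by ring.
    by apply: L2Z => //; exact: dL.
  + move=> f hf; apply: inj => [||n]; [exact: dL _ _ mB (dL _ _ mB hf)|exact: dL|].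
    rewrite !dC//; try exact: dL.
    by rewrite indicE; case: (_ \in _); rewrite ?mul1r ?mul0r.
  + move=> f h hf hh.
    apply: (ccvg_unique (parseval_inner mD he one comp (dL _ _ mB hf) hh)).
    have := parseval_inner mD he one comp hf (dL _ _ mB hh).
    congr (ccvg _ _); apply/funext => N; apply: eq_bigr => k _.
    by rewrite !dC// conjM (_ : (_%:C)^* = (\1_B (lam k))%:C) ?conjCC//; ring.
- move=> f hf; apply: inj => [||n]; [exact: dL|exact: L2_0|].
  by rewrite dC// coef_zero indicE in_set0 mul0r.
- move=> f hf; apply: inj => [||n] //; first exact: dL.
  by rewrite dC// indicE in_setT mul1r.
- move=> B C f mB mC hf; have mBC := measurableI _ _ mB mC.
  apply: inj => [||n]; [exact: dL|exact: dL _ _ mB (dL _ _ mC hf)|].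
  rewrite !dC//; last exact: dL.
  by rewrite indicI realCM mulrA.
- move=> f hf F mF tF mUF.
  have := @measure_semi_sigma_additive _ _ _ (nu f) F mF tF mUF.
  rewrite [spectral_weight D E f (\bigcup_n F n)](weight_nu dE)//.
  under [in X in _ -> X]eq_fun do
    (under eq_bigr do rewrite (weight_nu dE hf (mF _))).
  exact.
Qed.

Section Operator.
Variable T : operator R.
Hypothesis hT : op_dom T =
  [set f | L2 D f /\ bsum (fun n => lam n ^+ 2 * abs2 (coef f n))].
Hypothesis hTa : forall f, op_dom T f -> L2 D (op_app T f) /\
  forall n, coef (op_app T f) n = (lam n)%:C * coef f n.

Lemma spectral_measure_dproj : is_spectral_measure D T dproj.
Proof.
have dE := diagonal_dproj.
split; first exact: is_pvm_diagonal.
  by rewrite (spectral_dom_diagonal dE)//; exact: measurable_id.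
move=> f domf; have [hL hc] := hTa domf.
move: (domf); rewrite hT => -[hf bf].
split=> // k; rewrite (spectral_dom_diagonal dE)//= => -[hk bk].
apply: (ccvg_unique (parseval_inner mD he one comp hL hk)).
have := polarization_form dE hf hk bf bk.
by congr (ccvg _ _); apply/funext => N; apply: eq_bigr => n _; rewrite hc.
Qed.

Section Uniqueness.
Variable E : set R -> (R -> R[i]) -> R -> R[i].
Hypothesis hE : is_spectral_measure D T E.

Let pE : is_pvm D E. Proof. by have [] := hE. Qed.

Let EL B f : measurable B -> L2 D f -> L2 D (E B f).
Proof. by have [h _ _ _ _] := pE; move=> mB; have [h' _ _ _] := h B mB; exact: h'. Qed.

Let E_lin B a f h : measurable B -> L2 D f -> L2 D h ->
  aeq (E B (fun x => a * f x + h x)) (fun x => a * E B f x + E B h x).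
Proof. by have [h1 _ _ _ _] := pE; move=> mB; have [_ h' _ _] := h1 B mB; exact: h'. Qed.

Let E_sym B f h : measurable B -> L2 D f -> L2 D h ->
  inner D (E B f) h = inner D f (E B h).
Proof. by have [h1 _ _ _ _] := pE; move=> mB; have [_ _ _ h'] := h1 B mB; exact: h'. Qed.

Let E_I B C f : measurable B -> measurable C -> L2 D f ->
  aeq (E (B `&` C) f) (E B (E C f)).
Proof. by have [_ _ _ h _] := pE; exact: h. Qed.

Let inner_E B C f : measurable B -> measurable C -> C `<=` B -> L2 D f ->
  inner D (E B f) (E C f) = (nsq D (E C f))%:C.
Proof.
move=> mB mC CB hf; rewrite E_sym//; last exact: EL.
have eC h : L2 D h -> aeq (E C h) (E C (E C h)).
  by move=> hh; have := E_I mC mC hh; rewrite setIid.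
have eBC : aeq (E B (E C f)) (E C (E C f)).
  have := E_I mB mC hf; rewrite (_ : B `&` C = C); last by apply/setIidPr.
  by have := eC f hf; apply: aeS2 => x h1 h2 Dx; rewrite -h2// h1.
have h2 : L2 D (E C (E C f)) by exact: EL _ (EL mC hf).
have h3 : L2 D (E B (E C f)) by exact: EL _ (EL mC hf).
have h1 : L2 D (E C f) by exact: EL.
rewrite (eqae_inner mD hf h3 hf h2 (aeT _) eBC)// -E_sym// inner_self//.
Qed.

Let measE f : L2 D f -> exists M : {measure set R -> \bar R},
  forall A, measurable A -> M A = (nsq D (E A f))%:E.
Proof.
move=> hf; have [_ h0 _ _ hs] := pE.
have [||| M hM] := @measure_of_setfun R (spectral_weight D E f).
- rewrite /spectral_weight (@sqnorm_eqae _ _ mD _ (fun=> 0)) //.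
  + by rewrite sqnormE// ?/nsq; [rewrite /Rintegral integral0_eq// => x _; rewrite abs20|exact: L2_0].
  + by apply: L2_cmeas; exact: EL.
  + exact: h0.
- by move=> A; exact: sqnorm_ge0.
- exact: hs.
- by exists M => A mA; rewrite hM /spectral_weight sqnormE//; exact: EL.
Qed.

Let nsq_E_pert f (z : R[i]) B C : L2 D f -> measurable B -> measurable C ->
  nsq D (E C (fun x => f x + z * E B f x)) =
  nsq D (E C f) + (abs2 (1 + z) - 1) * nsq D (E (C `&` B) f).
Proof.
move=> hf mB mC; have mCB := measurableI _ _ mC mB.
have hB : L2 D (E B f) by exact: EL.
have hC : L2 D (E C f) by exact: EL.
have hCB : L2 D (E (C `&` B) f) by exact: EL.
have hCEB : L2 D (E C (E B f)) by exact: EL.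
have h1 : aeq (E C (fun x => f x + z * E B f x))
              (fun x => E C f x + z * E (C `&` B) f x).
  have -> : (fun x => f x + z * E B f x) = (fun x => z * E B f x + f x).
    by apply/funext => x; rewrite addrC.
  have := E_lin z mC hB hf; have := E_I mC mB hf.
  by apply: aeS2 => x h1 h2 Dx; rewrite h2// h1// addrC.
rewrite (nsq_eqae mD _ _ h1); last 2 first.
- by apply: EL => //; apply: L2D => //; exact: L2Z.
- by apply: L2D => //; exact: L2Z.
rewrite nsqD//; last exact: L2Z.
rewrite nsqZ// innerZr// inner_E// abs2D.
have -> : complex.Re (z^* * (nsq D (E (C `&` B) f))%:C) =
  complex.Re z * nsq D (E (C `&` B) f) by rewrite !ReImE mulr0 subr0.
rewrite (_ : complex.Re (1 * z^*) = complex.Re z); last by rewrite mul1r cReJ.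
by rewrite (_ : abs2 1 = 1); [ring|rewrite (abs2C 1) expr1n].
Qed.

Let integral_pert f (z : R[i]) B (M : {measure set R -> \bar R}) (g : R -> R) :
  (forall A, measurable A -> M A = (nsq D (E A f))%:E) ->
  L2 D f -> measurable B -> measurable_fun setT g -> (forall x, 0 <= g x) ->
  (\int[spectral_weight D E (fun x => (f x + z * E B f x)%R)]_x (g x)%:E =
   (abs2 (1 + z))%:E * \int[M]_(x in B) (g x)%:E +
   \int[M]_(x in ~` B) (g x)%:E)%E.
Proof.
move=> hM hf mB mg g0.
have hfz : L2 D (fun x => f x + z * E B f x).
  by apply: L2D => //; apply: L2Z => //; exact: EL.
have [M' hM'] := measE hfz.
rewrite (@integral_setfun _ _ M'); last first.
  by move=> A mA; rewrite hM'// /spectral_weight sqnormE//; exact: EL.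
have mgE : measurable_fun setT (fun x => (g x)%:E) by exact/measurable_EFinP.
have mgS (A : set R) : measurable_fun A (fun x => (g x)%:E).
  exact: measurable_funS mgE.
rewrite -(setUv B) ge0_integral_setU//; last 3 first.
- exact: measurableC.
- by move=> x _; rewrite lee_fin.
- by rewrite disj_set2E setICr.
congr (_ + _)%E.
  rewrite -(@ge0_integral_mscale _ _ _ M B mB (NngNum (abs2_ge0 (1 + z))))//=; last first.
    by move=> x _; rewrite lee_fin.
  apply: eq_measure_integral => A mA AB.
  rewrite hM'// nsq_E_pert// [RHS](_ : _ = (abs2 (1 + z))%:E * M A)%E// hM//.
  by rewrite (setIidl AB) -EFinM; congr EFin; ring.
apply: eq_measure_integral => A mA AB.
rewrite hM'// nsq_E_pert// hM// (_ : A `&` B = set0).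
  have [_ h0 _ _ _] := pE.
  rewrite (nsq_eqae mD _ _ (h0 _ hf)); [|exact: EL|exact: L2_0].
  rewrite [X in _ * X](_ : _ = 0) ?mulr0 ?addr0//.
  by rewrite /nsq /Rintegral integral0_eq// => x _; rewrite abs20.
by apply/disjoints_subset => x /AB.
Qed.

Let dom_e n : op_dom T (e n).
Proof.
rewrite hT; split=> //.
apply: bsum_le (bsumZ (sqr_ge0 (lam n)) (bsum_coef mD he one (he n))) => k.
rewrite coef_e//; case: eqVneq => [->//|_].
by rewrite (_ : abs2 _ = 0) ?mulr0// abs20.
Qed.

Let app_e n : aeq (op_app T (e n)) (fun x => (lam n)%:C * e n x).
Proof.
have [h1 h2] := hTa (dom_e n).
apply: (coef_inj mD he comp) => // [|k]; first exact: L2Z.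
rewrite h2 coef_scale// coef_e//; case: eqVneq => [->//|_].
by rewrite !mulr0.
Qed.

Let measure_eq0 (M : {measure set R -> \bar R}) (B : set R) (g : R -> R) :
  measurable B -> measurable_fun setT g -> (forall x, B x -> 0 < g x) ->
  (\int[M]_(x in B) (g x)%:E)%E = 0%E -> M B = 0%E.
Proof.
move=> mB mg g0 ig.
have : ae_eq M B (fun x => (g x)%:E) (cst 0%E).
  apply/ae_eq_integral_abs => //.
    by apply/measurable_EFinP; exact: measurable_funS mg.
  rewrite -[RHS]ig; apply: eq_integral => x /set_mem Bx.
  by rewrite gee0_abs// lee_fin ltW// g0.
move=> [N [mN N0 hN]]; apply/eqP; rewrite -measure_le0 -N0.
apply: le_measure; rewrite ?inE// => x Bx; apply: hN => /= /(_ Bx) -[] h.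
by have := g0 x Bx; rewrite h ltxx.
Qed.

(** Tested against E(B) e_n, the eigenvalue equation says that the measure
    (E(.) e_n, e_n) has mean lam n on every Borel set, so it is a point mass. *)
Let spectral_eigen n B : measurable B -> nsq D (E B (e n)) = \1_B (lam n).
Proof.
set v := e n; set l := lam n; have hv : L2 D v := he n.
have [M hM] := measE hv.
have [_ domE valE] := hE.
have domv : spectral_dom D E id v by rewrite -domE; exact: dom_e.
have MT : M setT = 1%:E.
  rewrite hM//; have [_ _ h1 _ _] := pE.
  rewrite (nsq_eqae mD _ hv (h1 _ hv)); last exact: EL.
  have := one n n; rewrite inner_self// eqxx => /(congr1 (@complex.Re R)) /= ->.
  by [].
have Mfin A : measurable A -> (M A < +oo)%E by move=> mA; rewrite hM// ltry.
have M2 : (\int[M]_x (x ^+ 2)%:E < +oo)%E.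
  have [_] := domv; rewrite (@integral_setfun _ _ M)// => A mA.
  by rewrite hM// /spectral_weight sqnormE//; exact: EL.
have mid : measurable_fun setT (fun x : R => x) by exact: measurable_id.
have mX2 : measurable_fun setT (fun x : R => (x ^+ 2)%:E).
  by apply/measurable_EFinP; exact: measurable_funX.
have int1 A : measurable A -> M.-integrable A (cst 1%:E).
  move=> mA; apply/integrableP; split; first exact: measurable_cst.
  by rewrite (eq_integral (cst 1%:E)) ?integral_cst ?mul1e ?Mfin// => x _; rewrite /= normr1.
have int2 A : measurable A -> M.-integrable A (fun x => (x ^+ 2)%:E).
  move=> mA; apply/integrableP; split; first exact: measurable_funS mX2.
  apply: le_lt_trans M2.
  under eq_integral do rewrite gee0_abs ?lee_fin ?sqr_ge0//.
  by apply: ge0_subset_integral => // x _; rewrite lee_fin sqr_ge0.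
have absle (x : R) : `|x| <= 1 + x ^+ 2.
  have h := sqr_ge0 (x - 1); have h' := sqr_ge0 (x + 1).
  by rewrite ler_norml; apply/andP; split; lra.
have intid A : measurable A -> M.-integrable A (fun x => x%:E).
  move=> mA; apply: (@le_integrable _ _ _ _ _ mA _ (fun x => (1 + x ^+ 2)%:E)).
  - by apply/measurable_EFinP; exact: measurable_funS mid.
  - by move=> x _; rewrite /= lee_fin (le_trans (absle x)) ?ler_norm.
  - by under eq_fun do rewrite EFinD; apply: integrableD; [|exact: int1|exact: int2].
have max0 (x : R) : 0 <= Num.max x 0 by rewrite le_max lexx orbT.
have m1 : measurable_fun setT (fun x : R => Num.max x 0).
  by apply: measurable_maxr => //; exact: measurable_cst.
have m2 : measurable_fun setT (fun x : R => Num.max (- x) 0).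
  by apply: measurable_maxr; [exact: measurable_funN|exact: measurable_cst].
have maxle (x : R) : Num.max x 0 <= `|x|.
  by rewrite ge_max normr_ge0 ler_norm.
pose P A := \int[M]_(x in A) Num.max x 0.
pose N A := \int[M]_(x in A) Num.max (- x) 0.
have intP A : measurable A -> M.-integrable A (fun x => (Num.max x 0)%:E).
  move=> mA; apply: le_integrable (intid _ mA) => //.
    by apply/measurable_EFinP; exact: measurable_funS m1.
  by move=> x _; rewrite /= lee_fin ger0_norm.
have intN A : measurable A -> M.-integrable A (fun x => (Num.max (- x) 0)%:E).
  move=> mA; apply: le_integrable (intid _ mA) => //.
    by apply/measurable_EFinP; exact: measurable_funS m2.
  by move=> x _; rewrite /= lee_fin ger0_norm// -(normrN x).
have PNE A : measurable A -> P A - N A = \int[M]_(x in A) x.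
  move=> mA; rewrite -RintegralB//; [|exact: intP|exact: intN].
  by apply: eq_Rintegral => x _; exact: max_sub_max.
have mean A : measurable A -> \int[M]_(x in A) x = l * nsq D (E A v).
  move=> mA; have mcA := measurableC mA.
  pose k := E A v; have hk : L2 D k by exact: EL.
  have domk : spectral_dom D E id k.
    split=> //; apply: le_lt_trans M2.
    have [M' hM'] := measE hk.
    rewrite (@integral_setfun _ _ M'); last first.
      by move=> C mC; rewrite hM'// /spectral_weight sqnormE//; exact: EL.
    have M'E C : measurable C -> M' C = (nsq D (E (C `&` A) v))%:E.
      move=> mC; rewrite hM'//; congr EFin; apply: nsq_eqae => //.
      - exact: EL.
      - by apply: EL => //; exact: measurableI.
      - by have := E_I mC mA hv; apply: aeS => x h Dx; rewrite h.
    rewrite -(setUv A) ge0_integral_setU//; last 3 first.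
    - by rewrite setUv.
    - by move=> x _; rewrite lee_fin sqr_ge0.
    - by rewrite disj_set2E setICr.
    rewrite (@eq_measure_integral _ _ _ A M); last first.
      by move=> C mC CA; rewrite M'E// hM// (setIidl CA).
    rewrite (@eq_measure_integral _ _ _ (~` A) mzero); last first.
      move=> C mC CA; rewrite M'E// (_ : C `&` A = set0); last first.
        by apply/disjoints_subset.
      have [_ h0 _ _ _] := pE.
      rewrite (nsq_eqae mD _ _ (h0 _ hv)); [|exact: EL|exact: L2_0].
      by rewrite /nsq /Rintegral integral0_eq// => x _; rewrite abs20.
    rewrite integral_measure_zero adde0 setUv.
    by apply: ge0_subset_integral => // x _; rewrite lee_fin sqr_ge0.
  have form z : fine (\int[spectral_weight D E (fun x => (v x + z * k x)%R)]_x (x)%:E)%E =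
      abs2 (1 + z) * (P A - N A) + (P (~` A) - N (~` A)).
    have hz : L2 D (fun x => v x + z * k x) by apply: L2D => //; exact: L2Z.
    have [Mz hMz] := measE hz.
    have wn C : measurable C ->
        spectral_weight D E (fun x => v x + z * k x) C = Mz C.
      by move=> mC; rewrite hMz// /spectral_weight sqnormE//; exact: EL.
    rewrite (integral_setfun _ wn) integralE.
    have -> : (EFin : R -> \bar R)^\+%E = fun x => (Num.max x 0)%:E.
      by apply/funext => x; rewrite funeposE EFin_max.
    have -> : (EFin : R -> \bar R)^\-%E = fun x => (Num.max (- x) 0)%:E.
      by apply/funext => x; rewrite funenegE EFin_max.
    rewrite -!(integral_setfun _ wn) !(integral_pert z hM)//.
    have PE B' : measurable B' -> (\int[M]_(x in B') (Num.max x 0)%:E = (P B')%:E)%E.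
      by move=> mB'; rewrite fineK//; apply: integrable_fin_num => //; exact: intP.
    have NE B' : measurable B' -> (\int[M]_(x in B') (Num.max (- x) 0)%:E = (N B')%:E)%E.
      by move=> mB'; rewrite fineK//; apply: integrable_fin_num => //; exact: intN.
    by rewrite !PE// !NE//= ; ring.
  have [hTL _] := hTa (dom_e n).
  have [_ /(_ k domk)] := valE v (dom_e n).
  rewrite (eqae_inner mD hTL hk _ hk (app_e n) (aeT _))//; last exact: L2Z.
  have [_ _ hT1 _ _] := pE.
  have -> : inner D (fun x => (lam n)%:C * v x) k = (l * nsq D k)%:C.
    rewrite innerZl// realCM; congr (_ * _).
    rewrite -(inner_E measurableT mA (@subsetT _ _) hv).
    apply: eqae_inner => //; [exact: EL| |exact: aeT].
    by have := hT1 v hv; apply: aeS => x h Dx; rewrite h.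
  rewrite /spectral_form; under eq_bigr do rewrite form.
  by rewrite polar_const PNE// => -[<-].
have Rint0 A (g : R -> R) : measurable A -> M.-integrable A (EFin \o g) ->
    \int[M]_(x in A) g x = 0 -> (\int[M]_(x in A) (g x)%:E = 0)%E.
  by move=> mA ig h; rewrite -[LHS]fineK ?integrable_fin_num// -[fine _]/(Rintegral _ _ _) h.
have intl A : measurable A -> M.-integrable A (cst l%:E).
  by move=> mA; have := integrableZl mA l (int1 A mA); under eq_fun do rewrite /= mule1.
have Rl A : measurable A -> \int[M]_(x in A) l = l * nsq D (E A v).
  by move=> mA; rewrite Rintegral_cst// hM.
have up : M `]l, +oo[%classic = 0%E.
  have mA : measurable (`]l, +oo[%classic : set R) by exact: measurable_itv.
  apply: (@measure_eq0 _ _ (fun x => x - l)) => //.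
  - by apply: measurable_funB => //; exact: measurable_cst.
  - by move=> x /=; rewrite in_itv /= andbT subr_gt0.
  - apply: Rint0 => //.
      by apply: eq_integrable (integrableB mA (intid _ mA) (intl _ mA)).
    by rewrite RintegralB// ?mean ?Rl ?subrr//; [exact: intid|exact: intl].
have dn : M `]-oo, l[%classic = 0%E.
  have mA : measurable (`]-oo, l[%classic : set R) by exact: measurable_itv.
  apply: (@measure_eq0 _ _ (fun x => l - x)) => //.
  - by apply: measurable_funB => //; exact: measurable_cst.
  - by move=> x /=; rewrite in_itv /= subr_gt0.
  - apply: Rint0 => //.
      by apply: eq_integrable (integrableB mA (intl _ mA) (intid _ mA)).
    by rewrite RintegralB// ?mean ?Rl ?subrr//; [exact: intl|exact: intid].
have ml1 : measurable ([set l] : set R) by exact: measurable_set1.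
have off : M (~` [set l]) = 0%E.
  have -> : ~` [set l] = (`]-oo, l[%classic `|` `]l, +oo[%classic : set R).
    apply/seteqP; split => x /=; rewrite !in_itv/= andbT.
      by move=> /eqP; rewrite neq_lt => /orP.
    by case=> h; apply/eqP; rewrite neq_lt h ?orbT.
  apply/eqP; rewrite -measure_le0; apply: le_trans (measureU2 _ _ _) _.
  - exact: measurable_itv.
  - exact: measurable_itv.
  - have le0 (a : \bar R) : a = 0%E -> (a <= 0)%E by move=> ->.
    apply: (@le_trans _ _ (0 + 0)%E); last by rewrite adde0.
    by apply: leeD; apply: le0; [exact: dn|exact: up].
have Bl C : measurable C -> ~ C l -> M C = 0%E.
  move=> mC Cl; apply/eqP; rewrite -measure_le0 -off.
  apply: le_measure; rewrite ?inE//; first exact: measurableC.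
  by move=> x Cx /= xl; apply: Cl; rewrite -xl.
move=> mB; rewrite indicE; have [Bl1|Bl0] := pselect (B l).
  have nBl : ~ (~` B) l by move/(_ Bl1).
  have mcB := measurableC mB.
  have hU : (M (B `|` ~` B) = M B + M (~` B))%E := measureU M mB mcB (setICr B).
  move: (Bl _ mcB nBl); rewrite hM// => -[h0].
  by move: hU; rewrite setUv MT !hM// h0 adde0 => -[<-]; rewrite mem_set.
by rewrite memNset//; have := Bl _ mB Bl0; rewrite hM// => -[].
Qed.

(** A projection E(B) fixes e_n when it contains the eigenvalue and kills it
    otherwise, and it is symmetric; this determines all the coefficients of
    E(B) f. *)
Lemma spectral_measure_diagonal : diagonal E.
Proof.
move=> B f mB hf; split; first exact: EL.
move=> n; rewrite !coef_innerE E_sym//.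
have hv := he n; have hE' : L2 D (E B (e n)) by exact: EL.
have eE : aeq (E B (e n)) (fun x => (\1_B (lam n))%:C * e n x).
  have := spectral_eigen n mB; have [_ _ hT1 _ _] := pE.
  rewrite indicE; case: (lam n \in B) => h.
    have d0 : nsq D (fun x => e n x - E B (e n) x) = 0.
      rewrite nsqB// h.
      have -> : inner D (e n) (E B (e n)) = inner D (E setT (e n)) (E B (e n)).
        apply: eqae_inner => //; [exact: EL| |exact: aeT].
        by have := hT1 _ hv; apply: aeS => x h' Dx; rewrite h'.
      rewrite inner_E// h.
      have := one n n; rewrite inner_self// eqxx => /(congr1 (@complex.Re R)) /= ->.
      by rewrite /=; ring.
    have := nsq_eq0 mD (L2B mD hv hE') d0; apply: aeS => x h' Dx.
    by rewrite mul1r; apply/esym/eqP; rewrite -subr_eq0 h'.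
  have := nsq_eq0 mD hE' h; apply: aeS => x h' Dx.
  by rewrite h'// mul0r.
rewrite (eqae_inner mD hf hE' hf _ (aeT _) eE)//; last exact: L2Z.
by rewrite innerZr// conjCC.
Qed.

End Uniqueness.

(** The choice of the spectral measure is harmless because every one of them is
    diagonal in the basis. *)
Lemma functional_calculus_dom (u : R -> R) : measurable_fun setT u ->
  op_dom (functional_calculus D T u) =
  [set f | L2 D f /\ bsum (fun n => u (lam n) ^+ 2 * abs2 (coef f n))].
Proof.
move=> mu_; rewrite /functional_calculus /=.
apply: spectral_dom_diagonal => //; apply: spectral_measure_diagonal.
apply: (@xgetPex _ (fun _ _ => cst 0) [set E | is_spectral_measure D T E]).
by exists dproj; exact: spectral_measure_dproj.
Qed.

End Operator.

End Diagonal.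

(** * Calculus for complex functions *)

Section Calculus.
Context {R : realType}.
Local Notation mu := (@lebesgue_measure R).
Implicit Types (f g F G : R -> R[i]) (u v U : R -> R) (a b : R).

Lemma is_derive_cont u (x du : R) : is_derive x 1 u du -> {for x, continuous u}.
Proof.
by move=> [h _]; apply: differentiable_continuous; exact/derivable1_diffP.
Qed.

Lemma is_derive_compR u U (x du dU : R) : is_derive (U x) 1 u du ->
  is_derive x 1 U dU -> is_derive x 1 (u \o U) (du * dU).
Proof.
move=> [h1 h2] [h3 h4]; apply: DeriveDef.
  apply/derivable1_diffP; apply: differentiable_comp; exact/derivable1_diffP.
by rewrite -derive1E derive1_comp// !derive1E h2 h4.
Qed.

Lemma FTC_R u U a b : a <= b -> (forall x : R, is_derive x 1 U (u x)) ->
  continuous u -> \int[mu]_(x in `]a, b[) u x = U b - U a.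
Proof.
rewrite le_eqVlt => /predU1P[->|ab] dU cu.
  by rewrite set_itvoo0 Rintegral_set0 subrr.
have cU : continuous U by move=> x; exact: is_derive_cont (dU x).
rewrite /Rintegral -(@integral_itv_bndoo _ a b _ true false); last first.
  apply/measurable_EFinP; apply: measurable_funTS.
  exact: continuous_measurable_fun.
rewrite (@continuous_FTC2 _ u U a b ab)//.
- by apply: continuous_subspaceT.
- split; first by move=> x _; have [] := dU x.
  + by apply: cvg_at_right_filter; exact: cU.
  + by apply: cvg_at_left_filter; exact: cU.
- by move=> x _; rewrite derive1E; have [_ ->] := dU x.
Qed.

Lemma continuous_integrable u a b : continuous u ->
  mu.-integrable `]a, b[ (fun x => (u x)%:E).
Proof.
move=> cu; apply: (@integrableS _ _ _ mu `[a, b]) => //.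
  by apply: subset_itv; rewrite bnd_simp.
apply: continuous_compact_integrable; first exact: segment_compact.
exact: continuous_subspaceT.
Qed.

(** An integrable function with vanishing integral over all the intervals
    starting at A vanishes, by differentiation of its primitive. *)
Lemma integral_eq0_ae u (A B : R) :
  mu.-integrable `]A, B[ (fun x => (u x)%:E) ->
  (forall b, A < b < B -> \int[mu]_(x in `]A, b[) u x = 0) ->
  u = (fun=> 0) %[ae mu in `]A, B[%classic].
Proof.
move=> iu u0.
have mI : measurable (`]A, B[%classic : set R) by exact: measurable_itv.
pose f := u \_ (`]A, B[%classic : set R).
have if' : mu.-integrable setT (EFin \o f).
  by rewrite -restrict_EFin; apply/integrable_restrict; rewrite ?setTI.
have lf : locally_integrable [set: R] f by exact: integrable_locally.
have if'' (y : R) : mu.-integrable [set` Interval (BRight A) (BRight y)] (EFin \o f).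
  by apply: integrableS if'.
have := FTC1 if'' lf => /=; apply: aeS => x h /=; rewrite in_itv /= => /andP[Ax xB].
have [_] := h Ax.
have fx : f x = u x by rewrite /f patchE mem_set//= in_itv/= Ax xB.
rewrite fx => <-.
rewrite derive1E (@near_eq_derive _ _ _ _ (fun=> 0)) ?derive_cst//.
have nx : \forall y \near x, A < y < B.
  have xI : x \in `]A, B[ by rewrite in_itv /= Ax xB.
  by have := near_in_itvoo xI; apply: filterS => y; rewrite in_itv.
move: nx; apply: filterS => y /andP[Ay yB].
rewrite -(u0 y) ?Ay//.
rewrite /Rintegral -(@integral_itv_bndoo _ A y _ false false); last first.
  apply/measurable_EFinP; have /integrableP[/measurable_EFinP mu_ _] := iu.
  apply: measurable_funS mu_ => // z /=; rewrite !in_itv/= => /andP[-> h2].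
  exact: lt_trans yB.
rewrite (@integral_itv_bndoo _ A y _ false false); last first.
  apply/measurable_EFinP; have /integrableP[/measurable_EFinP mu_ _] := iu.
  apply: measurable_funS mu_ => // z /=; rewrite !in_itv/= => /andP[-> h2].
  exact: lt_trans yB.
rewrite (@integral_itv_bndoo _ A y _ false false); last first.
  have /integrableP[mf _] := if'; exact: measurable_funTS.
congr fine; apply: eq_integral => z; rewrite inE /= in_itv/= => /andP[Az zy].
by rewrite /f patchE mem_set//= in_itv/= Az (lt_trans zy).
Qed.

Definition ccont f := continuous (fun x => complex.Re (f x)) /\
  continuous (fun x => complex.Im (f x)).

Definition cderiv F f :=
  (forall x : R, is_derive x 1 (fun x => complex.Re (F x)) (complex.Re (f x))) /\
  (forall x : R, is_derive x 1 (fun x => complex.Im (F x)) (complex.Im (f x))).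

Lemma cderiv_cont F f : cderiv F f -> ccont F.
Proof. by move=> [h1 h2]; split=> x; [exact: is_derive_cont (h1 x)|exact: is_derive_cont (h2 x)]. Qed.

Lemma ccont_cst (z : R[i]) : ccont (fun=> z).
Proof. by split => x; exact: cvg_cst. Qed.

Lemma ccontD f g : ccont f -> ccont g -> ccont (fun x => f x + g x).
Proof.
move=> [f1 f2] [g1 g2]; split => x.
  by under eq_fun do rewrite cReD; apply: cvgD; [exact: f1|exact: g1].
by under eq_fun do rewrite cImD; apply: cvgD; [exact: f2|exact: g2].
Qed.

Lemma ccontM f g : ccont f -> ccont g -> ccont (fun x => f x * g x).
Proof.
move=> [f1 f2] [g1 g2]; split => x.
  under eq_fun do rewrite cReM.
  by apply: cvgB; apply: cvgM; [exact: f1|exact: g1|exact: f2|exact: g2].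
under eq_fun do rewrite cImM.
by apply: cvgD; apply: cvgM; [exact: f1|exact: g2|exact: f2|exact: g1].
Qed.

Lemma ccontJ f : ccont f -> ccont (fun x => (f x)^*).
Proof.
move=> [f1 f2]; split => x.
  by under eq_fun do rewrite cReJ; exact: f1.
by under eq_fun do rewrite cImJ; apply: cvgN; exact: f2.
Qed.

Lemma ccontC u : continuous u -> ccont (fun x => (u x)%:C).
Proof. by split => //= x; exact: cvg_cst. Qed.

Lemma ccont_cmeas (D : set R) f : measurable D -> ccont f -> cmeas D f.
Proof.
by move=> mD [f1 f2]; split; apply: measurable_funTS;
  exact: continuous_measurable_fun.
Qed.

Lemma ccont_cint f a b : ccont f -> cint `]a, b[ f.
Proof. by move=> [f1 f2]; split; exact: continuous_integrable. Qed.

Lemma ccont_L2 f a b : ccont f -> L2 `]a, b[ f.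
Proof.
move=> cf; apply: L2P; first exact: ccont_cmeas.
have : mu.-integrable `]a, b[ (fun x => (abs2 (f x))%:E).
  apply: continuous_integrable => x; have [f1 f2] := cf.
  by apply: cvgD; apply: cvgM; [exact: f1|exact: f1|exact: f2|exact: f2].
by apply: integrable_lty.
Qed.

Lemma cFTC F f a b : a <= b -> cderiv F f -> ccont f ->
  cintegral `]a, b[ f = F b - F a.
Proof.
move=> ab [d1 d2] [c1 c2]; apply: eq_ReIm; rewrite !ReImE /=; exact: FTC_R.
Qed.

Lemma cderivD F G f g : cderiv F f -> cderiv G g ->
  cderiv (fun x => F x + G x) (fun x => f x + g x).
Proof.
move=> [f1 f2] [g1 g2]; split => x.
  by under eq_fun do rewrite cReD; rewrite cReD; apply: is_deriveD.
by under eq_fun do rewrite cImD; rewrite cImD; apply: is_deriveD.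
Qed.

Lemma cderivM F G f g : cderiv F f -> cderiv G g ->
  cderiv (fun x => F x * G x) (fun x => f x * G x + F x * g x).
Proof.
move=> [f1 f2] [g1 g2]; split => x.
  under eq_fun do rewrite cReM; rewrite !ReImE.
  by apply: is_derive_eq; rewrite /GRing.scale /=; ring.
under eq_fun do rewrite cImM; rewrite !ReImE.
by apply: is_derive_eq; rewrite /GRing.scale /=; ring.
Qed.

Lemma cderiv_cst (z : R[i]) : cderiv (fun=> z) (fun=> 0).
Proof. by split => x; apply: is_derive_cst. Qed.

Lemma cderivJ F f : cderiv F f -> cderiv (fun x => (F x)^*) (fun x => (f x)^*).
Proof.
move=> [f1 f2]; split => x.
  by under eq_fun do rewrite cReJ; rewrite cReJ; exact: f1.
by under eq_fun do rewrite cImJ; rewrite cImJ; apply: is_deriveN.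
Qed.

Lemma cderivC U u : (forall x : R, is_derive x 1 U (u x)) ->
  cderiv (fun x => (U x)%:C) (fun x => (u x)%:C).
Proof. by split => //= x; apply: is_derive_cst. Qed.

Lemma mul_iC (a : R) (z : R[i]) :
  'i * a%:C * z = (- a * complex.Im z) +i* (a * complex.Re z).
Proof.
apply: eq_ReIm.
  by rewrite cReM cReM cImM cRei cImi cReC cImC [RHS]/=; ring.
by rewrite cImM cReM cImM cRei cImi cReC cImC [RHS]/=; ring.
Qed.

Lemma cderiv_expi a : cderiv (fun x => expi (a * x))
  (fun x => 'i * a%:C * expi (a * x)).
Proof.
have da (x : R) : is_derive x 1 (fun x : R => a * x) a.
  by apply: is_derive_eq; rewrite /GRing.scale /= mulr1.
split => x; rewrite mul_iC /=.
  have -> : - a * sin (a * x) = - sin (a * x) * a by ring.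
  exact: (@is_derive_compR cos (fun x => a * x)).
have -> : a * cos (a * x) = cos (a * x) * a by ring.
exact: (@is_derive_compR sin (fun x => a * x)).
Qed.

Lemma ccont_expi a : ccont (fun x => expi (a * x)).
Proof. exact: cderiv_cont (cderiv_expi a). Qed.

End Calculus.

(** * The basis of quasi-periodic exponentials *)

Section Exponentials.
Context {R : realType}.
Local Notation mu := (@lebesgue_measure R).
Variable phi : R.
Implicit Types (f g h : R -> R[i]) (m n : int) (k : nat).

Lemma measurable_I2pi : measurable (I2pi : set R).
Proof. exact: measurable_itv. Qed.
Local Notation mI := measurable_I2pi.
Local Hint Resolve measurable_I2pi : core.

Lemma twopi_gt0 : 0 < 2 * pi :> R.
Proof. by rewrite mulr_gt0// pi_gt0. Qed.

Lemma mu_I2pi : mu I2pi = (2 * pi)%:E.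
Proof.
have := @lebesgue_measure_itv R `]0, 2 * pi[.
by rewrite /= lte_fin twopi_gt0 oppr0 adde0.
Qed.

Lemma I2piP (x : R) : I2pi x -> 0 < x < 2 * pi.
Proof. by rewrite /I2pi /= in_itv. Qed.

Definition zfreq n : R := n%:~R - phi / (2 * pi).
Definition eint n (x : R) : R[i] :=
  ((Num.sqrt (2 * pi))^-1)%:C * expi (zfreq n * x).

Lemma zfreqB m n : zfreq m - zfreq n = (m - n)%:~R.
Proof. by rewrite /zfreq rmorphB /=; ring. Qed.

Lemma eintJ m n x : eint m x * (eint n x)^* =
  ((2 * pi)^-1)%:C * expi ((m - n)%:~R * x).
Proof.
rewrite /eint conjM expiJ conjCC mulrACA -realCM -expi_add; congr (_%:C * expi _).
  by rewrite -invfM -expr2 sqr_sqrtr// ltW// twopi_gt0.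
by rewrite -mulNr -mulrDl zfreqB.
Qed.

Lemma abs2_eint n x : abs2 (eint n x) = (2 * pi)^-1.
Proof.
rewrite /eint abs2M abs2_expi mulr1 abs2C exprVn sqr_sqrtr//.
by rewrite ltW// twopi_gt0.
Qed.

Lemma eintD n (x y : R) : eint n (x + y) = eint n x * expi (zfreq n * y).
Proof. by rewrite /eint (mulrDr (zfreq n)) expi_add mulrA. Qed.

Lemma ccont_eint n : ccont (eint n).
Proof. by apply: ccontM; [exact: ccont_cst|exact: ccont_expi]. Qed.

Lemma L2_eint n : L2 I2pi (eint n).
Proof. exact: ccont_L2 (ccont_eint n). Qed.

Lemma cderiv_eint n : cderiv (eint n) (fun x => 'i * (zfreq n)%:C * eint n x).
Proof.
have := cderivM (cderiv_cst ((Num.sqrt (2 * pi))^-1)%:C) (cderiv_expi (zfreq n)).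
by congr cderiv; apply/funext => x; rewrite /eint; ring.
Qed.

Lemma integral_expi n : n != 0 -> cintegral I2pi (fun x => expi (n%:~R * x)) = 0 :> R[i].
Proof.
move=> n0; set a : R := n%:~R.
have ia0 : 'i * a%:C != 0 :> R[i].
  rewrite mulf_neq0 ?neq0Ci//; apply/eqP => /(congr1 (@complex.Re R)) /= /eqP.
  by rewrite intr_eq0 (negbTE n0).
pose F x := ('i * a%:C)^-1 * expi (a * x).
have dF : cderiv F (fun x => expi (a * x)).
  have := cderivM (cderiv_cst ('i * a%:C)^-1) (cderiv_expi a).
  by congr cderiv; apply/funext => x; rewrite mul0r add0r mulrA mulVf// mul1r.
rewrite /I2pi (cFTC _ dF); [|exact: ltW twopi_gt0|exact: ccont_expi].
by rewrite /F mulr0 expi0 expi2piM subrr.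
Qed.

Lemma orthonormal_eint m n : inner I2pi (eint m) (eint n) = (m == n)%:R.
Proof.
have -> : inner I2pi (eint m) (eint n) =
    ((2 * pi)^-1)%:C * cintegral I2pi (fun x => expi ((m - n)%:~R * x)).
  rewrite -cintegralZ; [|exact: mI|exact: ccont_cint (ccont_expi _)].
  by apply: eq_cintegral => x _; exact: eintJ.
have [->|mn] := eqVneq m n; last by rewrite integral_expi ?subr_eq0// mulr0.
rewrite subrr.
have -> : cintegral I2pi (fun x : R => expi (0%:~R * x)) = (2 * pi)%:C.
  have h1 : Rintegral mu I2pi (cst 1) = 2 * pi.
    rewrite Rintegral_cst ?mul1r; last exact: mI.
    exact: (congr1 fine mu_I2pi).
  apply: eq_ReIm => /=.
    by rewrite -h1; apply: eq_Rintegral => x _; rewrite mul0r cos0.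
  by rewrite /Rintegral integral0_eq// => x _; rewrite mul0r sin0.
by rewrite -realCM mulVf// gt_eqF// twopi_gt0.
Qed.

(** An enumeration of the integers 0, -1, 1, -2, 2, ... for which the partial
    sums of odd length are the symmetric ones. *)
Definition zk k : int := if odd k then - (k./2.+1)%:Z else k./2%:Z.

Lemma zk_inj : injective zk.
Proof.
move=> j k; rewrite /zk; have := odd_double_half j; have := odd_double_half k.
by rewrite -!muln2; case: (odd j); case: (odd k) => /= h1 h2 h; lia.
Qed.

Lemma zk_even N : zk N.*2 = N%:Z.
Proof. by rewrite /zk odd_double doubleK. Qed.
Lemma zk_odd N : zk N.*2.+1 = - (N.+1)%:Z.
Proof. by rewrite /zk /= odd_double /= uphalf_double. Qed.

Definition frequency k : R := zfreq (zk k).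
Definition ee k : R -> R[i] := eint (zk k).

Lemma L2_ee k : L2 I2pi (ee k). Proof. exact: L2_eint. Qed.
Lemma orthonormal_ee j k : inner I2pi (ee j) (ee k) = (j == k)%:R.
Proof. by rewrite orthonormal_eint (inj_eq zk_inj). Qed.

Local Notation coef f := (coef I2pi ee f).
Local Notation psum a := (partial_sum ee a).

Lemma telescope_zk (G : int -> R[i]) N :
  \sum_(0 <= k < N.*2.+1) (G (zk k - 1) - G (zk k)) =
  G (- (N.+1)%:Z) - G N%:Z.
Proof.
elim: N => [|N IH].
  by rewrite big_nat1 (_ : zk 0 = 0)// sub0r.
rewrite doubleS big_nat_recr// big_nat_recr// IH zk_odd -doubleS zk_even.
have -> : - (N.+1)%:Z - 1 = - (N.+2)%:Z by lia.
have -> : (N.+1)%:Z - 1 = N%:Z by lia.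
by rewrite /=; ring.
Qed.

(** If g vanishes near x0, then g = (e^{i(x-x0)} - 1) h with h in L^2, the
    partial Fourier sums of g at x0 telescope, and Bessel's inequality for h
    sends them to 0. *)
Lemma chernoff g x0 (d : R) : L2 I2pi g -> 0 < d -> d <= x0 -> d <= 2 * pi - x0 ->
  (forall x, I2pi x -> `|x - x0| < d -> g x = 0) ->
  ccvg (fun N => psum (coef g) N.*2.+1 x0) 0.
Proof.
move=> hg d0 dx0 dx1 gd.
pose q (x : R) := 2 - 2 * cos (x - x0).
pose c := 2 - 2 * cos d.
have pi0 : 0 < pi :> R by exact: pi_gt0.
have dpi : d <= pi by lra.
have c0 : 0 < c.
  by rewrite subr_gt0 gtr_pMr// -cos0 ltr_cos ?in_itv/= ?lexx ?(ltW d0) ?(ltW pi0).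
have qc x : I2pi x -> d <= `|x - x0| -> c <= q x.
  move=> /I2piP/andP[x1 x2] dx.
  rewrite lerD2l lerN2 ler_pM2l// -(cos_norm (x - x0)).
  set t := `|x - x0| in dx *.
  have t2 : t <= 2 * pi - d by rewrite /t ler_norml; apply/andP; split; lra.
  have [tpi|tpi] := leP t pi.
    have [->//|dt] := eqVneq t d.
    by rewrite ltW// ltr_cos ?in_itv/=; [rewrite lt_def dt|apply/andP; split; lra|apply/andP; split; lra].
  have -> : cos t = cos (2 * pi - t).
    by rewrite cosB mulr_natl cos2pi sin2pi mul1r mul0r addr0.
  have [<-//|dt] := eqVneq (2 * pi - t) d.
  rewrite ltW// ltr_cos ?in_itv/=; [|apply/andP; split; lra|apply/andP; split; lra].
  by rewrite lt_def dt; lra.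
have cq : continuous q.
  move=> x; apply: cvgB; first exact: cvg_cst.
  apply: cvgM; first exact: cvg_cst.
  apply: (@continuous_comp _ _ _ (fun x => x - x0) cos); last exact: continuous_cos.
  by apply: cvgB; [exact: cvg_id|exact: cvg_cst].
pose u (x : R) : R[i] := expi (x - x0) - 1.
have uE x : u x = expi (1 * x) * expi (- x0) - 1 by rewrite /u mul1r -expi_add.
have cu : ccont u.
  rewrite (_ : u = fun x => expi (1 * x) * expi (- x0) + (- 1)); last first.
    by apply/funext => x; exact: uE.
  apply: ccontD; last exact: ccont_cst.
  by apply: ccontM; [exact: ccont_expi|exact: ccont_cst].
have abs2u x : abs2 (u x) = q x.
  rewrite /u /abs2 !ReImE /= oppr0 addr0 /q.
  by have := cos2Dsin2 (x - x0); move: (cos _) (sin _) => C S h; nra.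
pose w (x : R) : R[i] := (u x)^* * ((Num.max c (q x))^-1)%:C.
have cmax0 x : 0 < Num.max c (q x) by rewrite lt_max c0.
have cm : continuous (fun x => Num.max c (q x)).
  move=> x; apply: (@continuous_max _ _ (fun=> c) q); last exact: cq.
  exact: cvg_cst.
have cw : ccont w.
  apply: ccontM; first exact: ccontJ.
  apply: ccontC => x; apply: cvgV; first by rewrite gt_eqF.
  exact: cm.
have wb x : abs2 (w x) <= c^-1.
  rewrite /w abs2M abs2J abs2u abs2C exprVn.
  have h := cmax0 x; set M := Num.max c (q x) in h *.
  have cM : c <= M by rewrite le_max lexx.
  have qM : q x <= M by rewrite le_max lexx orbT.
  have q0 : 0 <= q x by rewrite -abs2u abs2_ge0.
  apply: (@le_trans _ _ (M / M ^+ 2)).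
    by rewrite ler_wpM2r// invr_ge0 exprn_ge0// ltW.
  by rewrite expr2 invfM mulrA divff ?gt_eqF// mul1r lef_pV2 ?posrE.
pose h x := w x * g x.
have hL : L2 I2pi h.
  by apply: (@L2_bdM _ _ mI w g c^-1 (ccont_cmeas mI cw)).
have gh x : I2pi x -> g x = u x * h x.
  move=> Ix; have [/(gd x Ix) g0|dx] := ltP (`|x - x0|) d.
    by rewrite /h g0 !mulr0.
  have qc' := qc x Ix dx; rewrite /h /w (max_idPr qc').
  by rewrite !mulrA mulCJ abs2u -realCM divff ?mul1r// gt_eqF// (lt_le_trans c0).
pose G n := inner I2pi h (eint n) * eint n x0.
have eint1 n x : eint (n - 1) x = eint n x * expi (- (1 * x)).
  rewrite /eint -mulrA -expi_add; congr (_ * expi _).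
  by rewrite /zfreq rmorphB /=; ring.
have hE : L2 I2pi (fun x => expi (1 * x) * h x).
  apply: (@L2_bdM _ _ mI _ _ 1) => //.
    by apply: ccont_cmeas mI _; exact: ccont_expi.
  by move=> x _; rewrite abs2_expi.
have hE2 : L2 I2pi (fun x => expi (- x0) * (expi (1 * x) * h x)).
  by apply: L2Z => //; exact: mI.
have key n : inner I2pi g (eint n) * eint n x0 = G (n - 1) - G n.
  have -> : inner I2pi g (eint n) =
      inner I2pi (fun x => expi (- x0) * (expi (1 * x) * h x) - h x) (eint n).
    apply: eq_cintegral => x /set_mem Ix; rewrite gh// uE; ring.
  rewrite innerBl//; last exact: L2_eint.
  rewrite innerZl//; last exact: L2_eint.
  have -> : inner I2pi (fun x => expi (1 * x) * h x) (eint n) =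
      inner I2pi h (eint (n - 1)).
    by apply: eq_cintegral => x _; rewrite eint1 conjM expiJ opprK; ring.
  by rewrite /G eint1 mul1r; ring.
have -> : (fun N => psum (coef g) N.*2.+1 x0) =
    (fun N => G (- (N.+1)%:Z) - G N%:Z).
  apply/funext => N; rewrite -telescope_zk /partial_sum; apply: eq_bigr => k _.
  by rewrite -key.
have bh := bsum_coef mI L2_ee orthonormal_ee hL.
have h0 : (fun k => abs2 (coef h k)) @ \oo --> 0.
  have [l [hl _ _]] := bsum_cvg (fun k => abs2_ge0 _) bh.
  by apply: cvg_series_cvg_0; apply/cvg_ex; exists l.
have sub (p : nat -> nat) : (forall N, (N <= p N)%N) ->
    ccvg (fun N => G (zk (p N))) 0.
  move=> Np; apply: ccvgP.
  have -> : (fun N => abs2 (0 - G (zk (p N)))) =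
      (fun N => abs2 (coef h (p N)) * (2 * pi)^-1).
    by apply/funext => N; rewrite sub0r abs2N /G abs2M abs2_eint.
  rewrite -[X in _ --> X](mul0r ((2 * pi)^-1)); apply: cvgM; last exact: cvg_cst.
  apply: (cvg_comp p (fun k => abs2 (coef h k))) h0.
  by apply/cvgnyPge => A; exists A => // N /= AN; exact: leq_trans (Np N).
rewrite -[X in ccvg _ X](addr0 0) -[X in ccvg _ (_ + X)]oppr0.
have c1 : ccvg (fun N => G (- (N.+1)%:Z)) 0.
  under eq_fun do rewrite -zk_odd.
  by apply: (sub (fun N => N.*2.+1)) => N; rewrite -addnn -addSn leq_addl.
have c2 : ccvg (fun N => - G N%:Z) (- 0).
  rewrite -mulN1r; under eq_fun do rewrite -mulN1r.
  apply: ccvgM; first exact: ccvg_cst.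
  under eq_fun do rewrite -zk_even.
  by apply: (sub (fun N => N.*2)) => N; rewrite -addnn leq_addl.
exact: ccvgD.
Qed.

Let step (b : R) (x : R) : R[i] := (\1_(`]0, b[%classic : set R) x)%:C * ee 0 x.

Let L2_step b : L2 I2pi (step b).
Proof.
apply: (@L2_bdM _ _ mI _ _ 1); last exact: L2_ee.
  by apply: cmeasC; apply: measurable_indic; exact: measurable_itv.
by move=> x _; rewrite abs2C indicE; case: (_ \in _); rewrite ?expr1n// expr0n.
Qed.

Let step_cvg b x : 0 < b < 2 * pi -> I2pi x -> x != b ->
  ccvg (fun N => psum (coef (step b)) N.*2.+1 x) (step b x).
Proof.
move=> /andP[b0 b1] /I2piP/andP[x0 x1] xb.
have stepE y : step b y = if (0 < y) && (y < b) then ee 0 y else 0.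
  rewrite /step indicE; have [h|h] := boolP ((0 < y) && (y < b)).
    by rewrite mem_set ?mul1r//= in_itv.
  by rewrite memNset ?mul0r//= in_itv/=; apply/negP.
have [xltb|bltx|xeb] := ltgtP x b; last by rewrite xeb eqxx in xb.
- pose d := Num.min x (b - x).
  have d0 : 0 < d by rewrite lt_min x0 subr_gt0.
  have dx : d <= x by rewrite ge_min lexx.
  have db : d <= b - x by rewrite ge_min lexx orbT.
  pose g y := step b y - ee 0 y.
  have gL : L2 I2pi g by apply: L2B => //; exact: L2_ee.
  have gd y : I2pi y -> `|y - x| < d -> g y = 0.
    move=> /I2piP/andP[y0 y1]; rewrite ltr_norml => /andP[h1 h2].
    by rewrite /g stepE y0 (_ : y < b) ?subrr//; lra.
  have := chernoff gL d0 dx _ gd; rewrite (_ : d <= 2 * pi - x); last by lra.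
  move=> /(_ isT) h.
  have -> : (fun N => psum (coef (step b)) N.*2.+1 x) =
      (fun N => psum (coef g) N.*2.+1 x + ee 0 x).
    apply/funext => N.
    have -> : ee 0 x = psum (coef (ee 0)) N.*2.+1 x.
      rewrite /partial_sum big_nat_recl// (coef_e orthonormal_ee) eqxx mul1r big1 ?addr0// => i _.
      by rewrite (coef_e orthonormal_ee) mul0r.
    rewrite /partial_sum -big_split; apply: eq_bigr => i _ /=.
    rewrite (coef_sub mI L2_ee) ?(coef_e orthonormal_ee)//; last exact: L2_ee.
    by ring.
  rewrite stepE x0 xltb/= -[X in ccvg _ X]add0r.
  by apply: ccvgD => //; exact: ccvg_cst.
- pose d := Num.min (x - b) (2 * pi - x).
  have d0 : 0 < d by rewrite lt_min !subr_gt0 bltx.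
  have dx : d <= x - b by rewrite ge_min lexx.
  have db : d <= 2 * pi - x by rewrite ge_min lexx orbT.
  have gd y : I2pi y -> `|y - x| < d -> step b y = 0.
    move=> _; rewrite ltr_norml => /andP[h1 h2].
    by rewrite stepE (_ : y < b = false) ?andbF//; apply/negP; lra.
  have := chernoff (L2_step b) d0 _ db gd; rewrite (_ : d <= x); last by lra.
  move=> /(_ isT); rewrite stepE (_ : x < b = false) ?andbF//.
  by apply/negP; lra.
Qed.

Let step_psum b : 0 < b < 2 * pi ->
  (fun M => nsq I2pi (fun x => step b x - psum (coef (step b)) M x)) @ \oo --> 0.
Proof.
move=> hb; have hg := L2_step b.
have [l [hl lub _]] := bsum_cvg (fun k => abs2_ge0 _)
  (bsum_coef mI L2_ee orthonormal_ee hg).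
have gl : nsq I2pi (step b) <= l.
  rewrite -lee_fin -sqnormE//.
  apply: (@sqnorm_lim _ _ mI (fun N => psum (coef (step b)) N.*2.+1)).
  - by move=> N; apply: L2_cmeas; apply: L2_psum => //; exact: L2_ee.
  - exact: L2_cmeas.
  - have hN : {ae mu, forall x, x != b}.
      exists [set b]; split; [exact: measurable_set1|exact: lebesgue_measure_set1|].
      by move=> x /= /negP; rewrite negbK => /eqP.
    by move: hN; apply: aeS => x xb Ix; exact: step_cvg.
  - move=> N; rewrite sqnormE//; last by apply: L2_psum => //; exact: L2_ee.
    by rewrite lee_fin nsq_psum//; [exact: L2_ee|exact: orthonormal_ee].
have lim0 : (fun M => l - \sum_(0 <= k < M) abs2 (coef (step b) k)) @ \oo --> 0.
  by rewrite -[X in _ --> X](subrr l); apply: cvgB => //; exact: cvg_cst.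
apply: cvg0_le lim0 => M; rewrite nsq_ge0/= nsq_sub_psum ?lerB//;
  [exact: L2_ee|exact: orthonormal_ee].
Qed.

(** Indicator functions of intervals are limits of their Fourier series in L^2:
    the pointwise limit given by [chernoff] identifies the Riesz-Fischer limit.
    A function with zero coefficients is therefore orthogonal to them, so that
    its integral over every interval vanishes. *)
Lemma complete_ee f : L2 I2pi f -> (forall k, coef f k = 0) ->
  f = (fun=> 0) %[ae mu in I2pi].
Proof.
move=> hf f0.
have ortho b : 0 < b < 2 * pi -> inner I2pi f (step b) = 0.
  move=> hb; apply: abs2_eq0; apply/eqP; rewrite eq_le abs2_ge0 andbT.
  have lim0 : (fun M => nsq I2pi f *
      nsq I2pi (fun x => step b x - psum (coef (step b)) M x)) @ \oo --> 0.
    rewrite -[X in _ --> X](mulr0 (nsq I2pi f)); apply: cvgM; first exact: cvg_cst.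
    exact: step_psum.
  rewrite -(cvg_lim (@Rhausdorff R) lim0); apply: limr_ge; first exact: cvgP lim0.
  apply: nearW => M.
  have pL : L2 I2pi (psum (coef (step b)) M) by apply: L2_psum => //; exact: L2_ee.
  have -> : inner I2pi f (step b) =
      inner I2pi f (fun x => step b x - psum (coef (step b)) M x).
    rewrite innerBr// (inner_psumr mI L2_ee)// big1 ?subr0// => k _.
    by rewrite f0 mulr0.
  by apply: inner_le => //; apply: L2B.
pose F x := f x * (ee 0 x)^*.
have iF : cint I2pi F by apply: cint_mulJ => //; exact: L2_ee.
have stepI b (u : R -> R) : 0 < b < 2 * pi ->
    \int[mu]_(x in I2pi) ((\1_(`]0, b[%classic : set R) x) * u x) =
    \int[mu]_(x in `]0, b[) u x.
  move=> /andP[b0 b1].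
  have -> : (`]0, b[%classic : set R) = I2pi `&` `]0, b[%classic.
    apply/esym/setIidr => x; rewrite /I2pi /= !in_itv/= => /andP[-> h].
    exact: lt_trans b1.
  rewrite Rintegral_mkcondr; apply: eq_Rintegral => x Ix.
  rewrite patchE indicE in_setI Ix /=.
  by case: (x \in _); rewrite ?mul1r ?mul0r.
have [Re0 Im0] : (forall b, 0 < b < 2 * pi ->
    \int[mu]_(x in `]0, b[) complex.Re (F x) = 0) /\
   (forall b, 0 < b < 2 * pi -> \int[mu]_(x in `]0, b[) complex.Im (F x) = 0).
  split => b hb; have /(congr1 (@complex.Re R)) := ortho b hb;
    have /(congr1 (@complex.Im R)) := ortho b hb; rewrite /= => hI hR.
    rewrite -stepI// -[RHS]hR; apply: eq_Rintegral => x _.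
    by rewrite /step conjM conjCC mulrCA [in RHS]cReM cReC cImC mul0r subr0.
  rewrite -stepI// -[RHS]hI; apply: eq_Rintegral => x _.
  by rewrite /step conjM conjCC mulrCA [in RHS]cImM cReC cImC mul0r addr0.
have [i1 i2] := iF.
have := integral_eq0_ae i1 Re0; have := integral_eq0_ae i2 Im0.
apply: aeS2 => x h1 h2 Ix; apply: abs2_eq0.
have : abs2 (F x) = 0 by rewrite /abs2 h1// h2// expr0n addr0.
rewrite /F abs2M abs2J /ee abs2_eint => /eqP.
by rewrite mulf_eq0 invr_eq0 [2 * pi == 0]gt_eqF ?twopi_gt0// orbF => /eqP.
Qed.

End Exponentials.

(** * Changes of variables *)

Section Transformations.
Context {R : realType}.
Local Notation mu := (@lebesgue_measure R).

Let preim_shift (a p q : R) :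
  (fun x : R => x + a) @^-1` (`]p, q]%classic : set R) = `]p - a, q - a]%classic.
Proof.
by apply/seteqP; split => x /=; rewrite !in_itv/= ltrBlDr lerBrDr.
Qed.

Let preim_scale (c p q : R) : 0 < c ->
  (fun x : R => c * x) @^-1` (`]p, q]%classic : set R) = `]c^-1 * p, c^-1 * q]%classic.
Proof.
move=> c0; apply/seteqP; split => x /=; rewrite !in_itv/=;
  by rewrite !(mulrC c^-1) ltr_pdivrMr// ler_pdivlMr// (mulrC x).
Qed.

Lemma measurable_shift (a : R) : measurable_fun [set: R] (fun x : R => x + a).
Proof. by apply: measurable_funD => //; exact: measurable_cst. Qed.

Lemma measurable_scale (c : R) : measurable_fun [set: R] (fun x : R => c * x).
Proof. by apply: measurable_funM => //; exact: measurable_cst. Qed.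

Lemma lebesgue_measure_shift (a : R) (A : set R) : measurable A ->
  pushforward mu (fun x : measurableTypeR R => (x : R) + a : measurableTypeR R) A = mu A.
Proof.
move=> mA; apply/esym/lebesgue_measure_unique => //=.
  exact: measurable_shift.
move=> _ _ [[p q]] _ <-.
rewrite /pushforward preim_shift !lebesgue_measure_itv/=.
rewrite !lte_fin ltrD2r -!EFinD.
by have -> : q - a + - (p - a) = q + - p by ring.
Qed.

Lemma lebesgue_measure_scale (c : R) (A : set R) : 0 < c -> measurable A ->
  (c%:E * pushforward mu (fun x : measurableTypeR R => (c * (x : R))%R : measurableTypeR R) A
   = mu A)%E.
Proof.
move=> c0 mA.
have mc : measurable_fun [set: measurableTypeR R]
    (fun x : measurableTypeR R => c * (x : R) : measurableTypeR R).
  exact: measurable_scale.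
have c0' : 0 <= c by exact: ltW.
pose m : {measure set (measurableTypeR R) -> \bar R} :=
  pushforward mu (fun x : measurableTypeR R => c * (x : R) : measurableTypeR R).
apply/esym; apply: (@lebesgue_measure_unique R (mscale (NngNum c0') (m mc)) _ A mA).
move=> _ [[p q]] _ <-.
pose J : set R := `]c^-1 * p, c^-1 * q]%classic.
transitivity (c%:E * mu J)%E; last by rewrite /J -preim_scale.
rewrite /J !lebesgue_measure_itv/=.
rewrite !lte_fin ltr_pM2l ?invr_gt0// -!EFinD.
case: ifP => _; last by rewrite mule0.
by rewrite -EFinM; congr EFin; field; rewrite gt_eqF.
Qed.

Lemma integral_shift (u : R -> \bar R) (a : R) : measurable_fun setT u ->
  (forall x, 0 <= u x)%E ->
  (\int[mu]_x u (x + a)%R = \int[mu]_x u x)%E.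
Proof.
move=> mu_ u0.
transitivity (\int[mu]_(x in (fun x : measurableTypeR R => ((x : R) + a)%R : measurableTypeR R) @^-1` setT)
  (u \o (fun x : measurableTypeR R => ((x : R) + a)%R : measurableTypeR R)) x)%E => //.
rewrite -ge0_integral_pushforward//; last exact: measurable_shift.
apply: eq_measure_integral => [|? A mA _]; first exact: measurable_shift.
exact: lebesgue_measure_shift.
Qed.

Lemma integral_scale (u : R -> \bar R) (c : R) : 0 < c -> measurable_fun setT u ->
  (forall x, 0 <= u x)%E ->
  (c%:E * \int[mu]_x u (c * x)%R = \int[mu]_x u x)%E.
Proof.
move=> c0 mu_ u0.
have -> : (\int[mu]_x u (c * x)%R =
  \int[mu]_(x in (fun x : measurableTypeR R => (c * (x : R))%R : measurableTypeR R) @^-1` setT)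
  (u \o (fun x : measurableTypeR R => (c * (x : R))%R : measurableTypeR R)) x)%E by [].
rewrite -ge0_integral_pushforward//; last exact: measurable_scale.
have c0' : 0 <= c by exact: ltW.
have -> : c = (NngNum c0')%:num by [].
rewrite -ge0_integral_mscale//; first exact: measurable_scale.
move=> mf; apply: eq_measure_integral => A mA _.
exact: lebesgue_measure_scale.
Qed.

Lemma integral_reflect (u : R -> \bar R) : measurable_fun setT u ->
  (forall x, 0 <= u x)%E ->
  (\int[mu]_x u (- x)%R = \int[mu]_x u x)%E.
Proof.
move=> mu_ u0.
have mN : measurable_fun [set: R] (fun x : R => - x) by exact: measurable_funN.
transitivity (\int[mu]_(x in (fun x : measurableTypeR R => (- (x : R))%R : measurableTypeR R) @^-1` setT)
  (u \o (fun x : measurableTypeR R => (- (x : R))%R : measurableTypeR R)) x)%E => //.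
rewrite -ge0_integral_pushforward//.
apply: eq_measure_integral => A mA _.
exact: lebesgue_measureN.
Qed.

(** Integrals over an interval in terms of integrals over the line. *)
Lemma integral_itv_indic (u : R -> \bar R) (I : interval R) :
  (\int[mu]_(x in [set` I]) u x =
   \int[mu]_x (if x \in I then u x else 0))%E.
Proof.
rewrite integral_mkcond; apply: eq_integral => x _; rewrite patchE.
by have [h|h] := boolP (x \in I); [rewrite mem_set|rewrite memNset//=; exact/negP].
Qed.

Lemma measurable_itv_indic (u : R -> \bar R) (I : interval R) :
  measurable_fun [set` I] u ->
  measurable_fun setT (fun x => if x \in I then u x else 0%E).
Proof.
move=> /(measurable_restrictT _ (measurable_itv I)).1.
congr (measurable_fun _ _); apply/funext => x; rewrite patchE.
by have [h|h] := boolP (x \in I); [rewrite mem_set|rewrite memNset//=; exact/negP].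
Qed.

Lemma integral_shift_itv (u : R -> \bar R) (p q a : R) :
  measurable_fun `]p + a, q + a[ u ->
  (forall x, 0 <= u x)%E ->
  (\int[mu]_(x in `]p, q[) u (x + a)%R = \int[mu]_(x in `](p + a)%R, (q + a)%R[) u x)%E.
Proof.
move=> mu_ u0; rewrite !integral_itv_indic.
rewrite -(integral_shift a (measurable_itv_indic mu_)); last by move=> x; case: ifP.
by apply: eq_integral => x _; rewrite !in_itv/= !ltrD2r.
Qed.

Lemma integral_scale_itv (u : R -> \bar R) (p q c : R) : 0 < c ->
  measurable_fun `](c * p), (c * q)[ u ->
  (forall x, 0 <= u x)%E ->
  (c%:E * \int[mu]_(x in `]p, q[) u (c * x)%R =
   \int[mu]_(x in `](c * p)%R, (c * q)%R[) u x)%E.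
Proof.
move=> c0 mu_ u0; rewrite !integral_itv_indic.
rewrite -(integral_scale c0 (measurable_itv_indic mu_)); last by move=> x; case: ifP.
congr (_ * _)%E.
by apply: eq_integral => x _; rewrite !in_itv/= !ltr_pM2l.
Qed.

Lemma Rintegral_shift_itv (u : R -> R) (p q a : R) :
  measurable_fun `]p + a, q + a[ u ->
  \int[mu]_(x in `]p, q[) u (x + a) = \int[mu]_(x in `](p + a), (q + a)[) u x.
Proof.
move=> mu_; have mE : measurable_fun `]p + a, q + a[ (fun x => (u x)%:E).
  exact/measurable_EFinP.
rewrite /Rintegral integralE [in RHS]integralE.
rewrite -(integral_shift_itv (measurable_funepos mE))//.
rewrite -(integral_shift_itv (measurable_funeneg mE))//.
by congr (fine (_ - _)); apply: eq_integral => x _; rewrite ?funeposE ?funenegE.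
Qed.

End Transformations.

(** * Smooth cutoffs *)

Section Smoothstep.
Context {R : realType}.
Local Notation mu := (@lebesgue_measure R).
Implicit Types (t x a b eps : R).

Definition ramp t : R := Num.max 0 t.
Definition q2 t : R := ramp t ^+ 2.
Definition q3 t : R := ramp t ^+ 3.

Lemma ramp_lt0 t : t <= 0 -> ramp t = 0. Proof. exact: max_idPl. Qed.
Lemma ramp_gt0 t : 0 <= t -> ramp t = t. Proof. exact: max_idPr. Qed.

Lemma continuous_ramp : continuous ramp.
Proof.
move=> t; apply: (@continuous_max _ _ (fun=> 0) id); last exact: cvg_id.
exact: cvg_cst.
Qed.

Lemma is_derive_q2 t : is_derive t 1 q2 (2 * ramp t).
Proof.
have [t0|t0|->] := ltgtP t 0.
- rewrite ramp_lt0 ?(ltW t0)// mulr0.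
  have hd : is_derive t 1 (cst 0 : R -> R) 0 by exact: is_derive_cst.
  apply: near_eq_is_derive hd.
  by near=> y; rewrite /q2 ramp_lt0 ?expr0n// ltW//; near: y; exact: lt_nbhsl.
- rewrite ramp_gt0 ?(ltW t0)//.
  have hd : is_derive t 1 (fun y : R => y ^+ 2) (2 * t).
    by apply: is_derive_eq; rewrite /GRing.scale /=; ring.
  apply: near_eq_is_derive hd.
  by near=> y; rewrite /q2 ramp_gt0// ltW//; near: y; exact: lt_nbhsr.
- rewrite ramp_lt0// mulr0.
  have lim : (fun h : R => h^-1 *: (q2 (h *: 1 + 0) - q2 0)) @ 0^' --> 0.
    apply/cvgrPdist_le => e e0; near=> h.
    have h0 : h != 0 by near: h; exact: nbhs_dnbhs_neq.
    have he : `|h| <= e.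
      near: h; apply: nbhs_dnbhs; have := @nbhs0_le _ R _ e0; exact.
    rewrite sub0r normrN /q2 /GRing.scale /= mulr1 addr0 (ramp_lt0 (lexx 0)) expr0n subr0.
    rewrite normrM normfV; apply: le_trans he.
    rewrite ler_pdivrMl ?normr_gt0// -expr2 normrX ler_pXn2r ?nnegrE//.
    rewrite /ramp /Num.max; case: ltP => _ //.
    by rewrite normr0.
  by apply: DeriveDef; [apply/cvg_ex; exists 0|exact: cvg_lim lim].
Unshelve. all: by end_near. Qed.

Lemma q3E t : q3 t = t * q2 t.
Proof.
rewrite /q3 /q2 exprS; have [t0|t0] := leP 0 t; first by rewrite ramp_gt0.
by rewrite ramp_lt0 ?(ltW t0)// expr0n !mulr0.
Qed.

Lemma is_derive_q3 t : is_derive t 1 q3 (3 * q2 t).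
Proof.
have -> : q3 = (fun t => t * q2 t) by apply/funext => x; exact: q3E.
have h := is_derive_q2 t.
apply: is_derive_eq; rewrite /GRing.scale /= /q2.
have [t0|t0] := leP 0 t; first by rewrite ramp_gt0//; ring.
by rewrite ramp_lt0 ?(ltW t0)//; ring.
Qed.

(** The integrated quadratic B-spline: a step of class C^2 from 0 to 1. *)
(** Every cutoff below is built from this step; being a polynomial spline, it has
    explicit derivatives. *)
Definition sstep t := (q3 t - 3 * q3 (t - 1) + 3 * q3 (t - 2) - q3 (t - 3)) / 6.
Definition sstep1 t := (q2 t - 3 * q2 (t - 1) + 3 * q2 (t - 2) - q2 (t - 3)) / 2.
Definition sstep2 t := ramp t - 3 * ramp (t - 1) + 3 * ramp (t - 2) - ramp (t - 3).

Let is_derive_sh (u du : R -> R) (c x : R) : (forall x : R, is_derive x 1 u (du x)) ->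
  is_derive x 1 (fun x => u (x - c)) (du (x - c)).
Proof.
move=> h; have hx : is_derive x 1 (fun x : R => x - c) 1.
  by apply: is_derive_eq; rewrite subr0.
by have := @is_derive_compR R u (fun x => x - c) x _ _ (h _) hx; rewrite mulr1.
Qed.

Lemma is_derive_sstep t : is_derive t 1 sstep (sstep1 t).
Proof.
have h0 := is_derive_q3 t.
have h1 := is_derive_sh 1 t is_derive_q3.
have h2 := is_derive_sh 2 t is_derive_q3.
have h3 := is_derive_sh 3 t is_derive_q3.
rewrite /sstep /sstep1; under eq_fun do rewrite mulrC.
by apply: is_derive_eq; rewrite /GRing.scale /=; field.
Qed.

Lemma is_derive_sstep1 t : is_derive t 1 sstep1 (sstep2 t).
Proof.
have h0 := is_derive_q2 t.
have h1 := is_derive_sh 1 t is_derive_q2.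
have h2 := is_derive_sh 2 t is_derive_q2.
have h3 := is_derive_sh 3 t is_derive_q2.
rewrite /sstep1 /sstep2; under eq_fun do rewrite mulrC.
by apply: is_derive_eq; rewrite /GRing.scale /=; field.
Qed.

Lemma continuous_sstep2 : continuous sstep2.
Proof.
have h (c : R) : continuous (fun t => ramp (t - c)).
  move=> t; apply: (@continuous_comp _ _ _ (fun t => t - c) ramp).
    by apply: cvgB; [exact: cvg_id|exact: cvg_cst].
  exact: continuous_ramp.
move=> t; apply: cvgB; last exact: h.
apply: cvgD; first apply: cvgB; first exact: continuous_ramp.
  by apply: cvgM; [exact: cvg_cst|exact: h].
by apply: cvgM; [exact: cvg_cst|exact: h].
Qed.

Lemma sstep_le0 t : t <= 0 -> sstep t = 0 /\ sstep1 t = 0.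
Proof.
by move=> t0; rewrite /sstep /sstep1 /q3 /q2 !ramp_lt0; try lra; split; ring.
Qed.

Lemma sstep_ge3 t : 3 <= t -> sstep t = 1 /\ sstep1 t = 0.
Proof.
by move=> t0; rewrite /sstep /sstep1 /q3 /q2 !ramp_gt0; try lra; split; field.
Qed.

Lemma sstep_bnd t : 0 <= sstep t <= 1 /\ 0 <= sstep1 t.
Proof.
have [t0|t0] := leP t 0.
  by have [-> ->] := sstep_le0 t0; rewrite lexx ler01.
have [t3|t3] := leP 3 t.
  by have [-> ->] := sstep_ge3 t3; rewrite lexx ler01.
rewrite /sstep /sstep1 /q3 /q2 (ramp_gt0 (ltW t0)) (@ramp_lt0 (t - 3)); last lra.
have [t1|t1] := leP t 1.
  rewrite (@ramp_lt0 (t - 1)); last lra.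
  rewrite (@ramp_lt0 (t - 2)); last lra.
  have h : 0 <= t ^+ 3 <= 1 by rewrite exprn_ge0 ?exprn_ile1 ?(ltW t0).
  by have := sqr_ge0 t; move: (t ^+ 3) (t ^+ 2) h => a b; lra.
rewrite (@ramp_gt0 (t - 1)); last lra.
have [t2|t2] := leP t 2.
  rewrite (@ramp_lt0 (t - 2)); last lra.
  have [u [tu u0 u1]] : exists u, [/\ t = u + 1, 0 <= u & u <= 1].
    by exists (t - 1); split; lra.
  rewrite tu addrK.
  have e1 : (u + 1) ^+ 3 - 3 * u ^+ 3 + 3 * 0 ^+ 3 - 0 ^+ 3 =
    1 + 3 * u + u * u * (3 - 2 * u) by ring.
  have e2 : (u + 1) ^+ 3 - 3 * u ^+ 3 + 3 * 0 ^+ 3 - 0 ^+ 3 =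
    5 - (1 - u) * (4 + u * (1 - u) + u * (0 - u)) by ring.
  have e3 : (u + 1) ^+ 2 - 3 * u ^+ 2 + 3 * 0 ^+ 2 - 0 ^+ 2 =
    1 + 2 * (u * (1 - u)) by ring.
  have h1 : 0 <= u * u * (3 - 2 * u) by rewrite !mulr_ge0//; lra.
  have h2 : 0 <= (1 - u) * (4 + u * (1 - u) + u * (0 - u)).
    by apply: mulr_ge0; [lra|nra].
  have h3 : 0 <= u * (1 - u) by rewrite mulr_ge0//; lra.
  by rewrite e3; split; [apply/andP; split; [rewrite e1|rewrite e2]; lra|lra].
rewrite (@ramp_gt0 (t - 2)); last lra.
have -> : (t ^+ 3 - 3 * (t - 1) ^+ 3 + 3 * (t - 2) ^+ 3 - 0 ^+ 3) / 6 =
  1 - (3 - t) ^+ 3 / 6 by field.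
have -> : (t ^+ 2 - 3 * (t - 1) ^+ 2 + 3 * (t - 2) ^+ 2 - 0 ^+ 2) / 2 =
  (3 - t) ^+ 2 / 2 by field.
have h : 0 <= (3 - t) ^+ 3 <= 1.
  by rewrite exprn_ge0 ?exprn_ile1//; lra.
by have := sqr_ge0 (3 - t); move: ((3 - t) ^+ 3) ((3 - t) ^+ 2) h => a b; lra.
Qed.

End Smoothstep.

Section Bumps.
Context {R : realType}.
Local Notation mu := (@lebesgue_measure R).
Implicit Types (a b eps x : R).

Definition cutoff a b eps x : R := sstep ((x - a) / eps) * sstep ((b - x) / eps).
Definition cutoffL a eps x : R := eps^-1 * sstep1 ((x - a) / eps).
Definition cutoffR b eps x : R := eps^-1 * sstep1 ((b - x) / eps).
Definition cutoff1 a b eps x : R :=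
  cutoffL a eps x * sstep ((b - x) / eps) - sstep ((x - a) / eps) * cutoffR b eps x.

Let dL a eps x : is_derive x 1 (fun x : R => (x - a) / eps) eps^-1.
Proof.
under eq_fun do rewrite mulrC.
by apply: is_derive_eq; rewrite /GRing.scale /=; ring.
Qed.
Let dR b eps x : is_derive x 1 (fun x : R => (b - x) / eps) (- eps^-1).
Proof.
under eq_fun do rewrite mulrC.
by apply: is_derive_eq; rewrite /GRing.scale /=; ring.
Qed.

Let is_derive_bL a eps x :
  is_derive x 1 (fun x : R => sstep ((x - a) / eps)) (cutoffL a eps x).
Proof.
rewrite /cutoffL mulrC.
exact: (@is_derive_compR R sstep (fun x => (x - a) / eps) _ _ _ (is_derive_sstep _) (dL _ _ _)).
Qed.
Let is_derive_bR b eps x :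
  is_derive x 1 (fun x : R => sstep ((b - x) / eps)) (- cutoffR b eps x).
Proof.
rewrite /cutoffR mulrC -mulrN.
exact: (@is_derive_compR R sstep (fun x => (b - x) / eps) _ _ _ (is_derive_sstep _) (dR _ _ _)).
Qed.
Let is_derive_bL1 a eps x :
  is_derive x 1 (cutoffL a eps) (eps^-1 * (eps^-1 * sstep2 ((x - a) / eps))).
Proof.
have h := @is_derive_compR R sstep1 (fun x => (x - a) / eps) x _ _ (is_derive_sstep1 _) (dL _ _ _).
rewrite [eps^-1 * sstep2 _]mulrC.
by apply: is_derive_eq; rewrite /GRing.scale /=; ring.
Qed.
Let is_derive_bR1 b eps x :
  is_derive x 1 (cutoffR b eps) (- (eps^-1 * (eps^-1 * sstep2 ((b - x) / eps)))).
Proof.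
have h := @is_derive_compR R sstep1 (fun x => (b - x) / eps) x _ _ (is_derive_sstep1 _) (dR _ _ _).
rewrite [eps^-1 * sstep2 _]mulrC.
by apply: is_derive_eq; rewrite /GRing.scale /=; ring.
Qed.

Lemma is_derive_cutoff a b eps x : is_derive x 1 (cutoff a b eps) (cutoff1 a b eps x).
Proof.
have h1 := is_derive_bL a eps x; have h2 := is_derive_bR b eps x.
rewrite /cutoff /cutoff1.
by apply: is_derive_eq; rewrite /GRing.scale /=; ring.
Qed.

Definition cutoff2 a b eps x : R :=
  eps^-1 * (eps^-1 * sstep2 ((x - a) / eps)) * sstep ((b - x) / eps) -
  2 * cutoffL a eps x * cutoffR b eps x +
  sstep ((x - a) / eps) * (eps^-1 * (eps^-1 * sstep2 ((b - x) / eps))).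

Lemma is_derive_cutoff1 a b eps x : is_derive x 1 (cutoff1 a b eps) (cutoff2 a b eps x).
Proof.
have h1 := is_derive_bL a eps x; have h2 := is_derive_bR b eps x.
have h3 := is_derive_bL1 a eps x; have h4 := is_derive_bR1 b eps x.
rewrite /cutoff1 /cutoff2.
by apply: is_derive_eq; rewrite /GRing.scale /=; ring.
Qed.

Let cont_comp (u v : R -> R) : continuous u -> continuous v -> continuous (u \o v).
Proof. by move=> cu cv x; apply: continuous_comp; [exact: cv|exact: cu]. Qed.

Let cL a eps : continuous (fun x : R => (x - a) / eps).
Proof. by move=> x; exact: is_derive_cont (dL a eps x). Qed.
Let cR b eps : continuous (fun x : R => (b - x) / eps).
Proof. by move=> x; exact: is_derive_cont (dR b eps x). Qed.

Lemma continuous_cutoff a b eps : continuous (cutoff a b eps).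
Proof. by move=> x; exact: is_derive_cont (is_derive_cutoff a b eps x). Qed.
Lemma continuous_cutoff1 a b eps : continuous (cutoff1 a b eps).
Proof. by move=> x; exact: is_derive_cont (is_derive_cutoff1 a b eps x). Qed.
Lemma continuous_cutoffL a eps : continuous (cutoffL a eps).
Proof. by move=> x; exact: is_derive_cont (is_derive_bL1 a eps x). Qed.
Lemma continuous_cutoffR b eps : continuous (cutoffR b eps).
Proof. by move=> x; exact: is_derive_cont (is_derive_bR1 b eps x). Qed.

Let contM (u v : R -> R) : continuous u -> continuous v -> continuous (fun x => u x * v x).
Proof. by move=> cu cv x; apply: cvgM; [exact: cu|exact: cv]. Qed.

Lemma continuous_cutoff2 a b eps : continuous (cutoff2 a b eps).
Proof.
have c1 : continuous (fun x => sstep ((x - a) / eps)).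
  by move=> x; exact: is_derive_cont (is_derive_bL a eps x).
have c2 : continuous (fun x => sstep ((b - x) / eps)).
  by move=> x; exact: is_derive_cont (is_derive_bR b eps x).
have c3 : continuous (fun x => sstep2 ((x - a) / eps)).
  by apply: (@cont_comp sstep2); [exact: continuous_sstep2|exact: cL].
have c4 : continuous (fun x => sstep2 ((b - x) / eps)).
  by apply: (@cont_comp sstep2); [exact: continuous_sstep2|exact: cR].
have cc (c : R) : continuous (fun _ : R => c) by move=> x; exact: cvg_cst.
have k1 := contM (contM (cc eps^-1) (contM (cc eps^-1) c3)) c2.
have k2 := contM c1 (contM (cc eps^-1) (contM (cc eps^-1) c4)).
have k3 := contM (contM (cc 2) (@continuous_cutoffL a eps)) (@continuous_cutoffR b eps).
by move=> x; apply: cvgD; [apply: cvgB; [exact: k1|exact: k3]|exact: k2].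
Qed.

Lemma cutoff_bnd a b eps x : 0 <= cutoff a b eps x <= 1.
Proof.
have [/andP[h1 h2] _] := sstep_bnd ((x - a) / eps).
have [/andP[h3 h4] _] := sstep_bnd ((b - x) / eps).
by rewrite /cutoff mulr_ge0//= mulr_ile1.
Qed.

Lemma cutoff_out a b eps x : 0 < eps -> ~~ (a < x < b) -> cutoff a b eps x = 0 /\ cutoff1 a b eps x = 0.
Proof.
move=> e0; rewrite negb_and -!leNgt => /orP[h|h].
  have [h1 h2] : sstep ((x - a) / eps) = 0 /\ sstep1 ((x - a) / eps) = 0.
    by apply: sstep_le0; rewrite ler_pdivrMr// mul0r subr_le0.
  by rewrite /cutoff /cutoff1 /cutoffL h1 h2 !(mulr0, mul0r) subr0.
have [h1 h2] : sstep ((b - x) / eps) = 0 /\ sstep1 ((b - x) / eps) = 0.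
  by apply: sstep_le0; rewrite ler_pdivrMr// mul0r subr_le0.
by rewrite /cutoff /cutoff1 /cutoffR h1 h2 !(mulr0, mul0r) subr0.
Qed.

Lemma cutoff_in a b eps x : 0 < eps -> a + 3 * eps <= x <= b - 3 * eps ->
  cutoff a b eps x = 1.
Proof.
move=> e0 /andP[h1 h2]; rewrite /cutoff.
have [-> _] : sstep ((x - a) / eps) = 1 /\ sstep1 ((x - a) / eps) = 0.
  by apply: sstep_ge3; rewrite ler_pdivlMr//; lra.
have [-> _] : sstep ((b - x) / eps) = 1 /\ sstep1 ((b - x) / eps) = 0.
  by apply: sstep_ge3; rewrite ler_pdivlMr//; lra.
by rewrite mulr1.
Qed.

Lemma cutoff1E a b eps x : 0 < eps -> 6 * eps <= b - a ->
  cutoff1 a b eps x = cutoffL a eps x - cutoffR b eps x.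
Proof.
move=> e0 ab; rewrite /cutoff1; congr (_ - _).
  have [h|h] := leP (3 * eps) (b - x).
    have [-> _] := @sstep_ge3 R ((b - x) / eps) (ltac:(by rewrite ler_pdivlMr)).
    by rewrite mulr1.
  have [_ h1] := @sstep_ge3 R ((x - a) / eps) (ltac:(by rewrite ler_pdivlMr//; lra)).
  by rewrite /cutoffL h1 mulr0 mul0r.
have [h|h] := leP (3 * eps) (x - a).
  have [-> _] := @sstep_ge3 R ((x - a) / eps) (ltac:(by rewrite ler_pdivlMr)).
  by rewrite mul1r.
have [_ h1] := @sstep_ge3 R ((b - x) / eps) (ltac:(by rewrite ler_pdivlMr//; lra)).
by rewrite /cutoffR h1 !mulr0.
Qed.

Lemma cutoffL_ge0 a eps x : 0 < eps -> 0 <= cutoffL a eps x.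
Proof. by move=> e0; have [_ h] := sstep_bnd ((x - a) / eps); rewrite mulr_ge0// invr_ge0 ltW. Qed.
Lemma cutoffR_ge0 b eps x : 0 < eps -> 0 <= cutoffR b eps x.
Proof. by move=> e0; have [_ h] := sstep_bnd ((b - x) / eps); rewrite mulr_ge0// invr_ge0 ltW. Qed.

Lemma cutoffL_supp a eps x : 0 < eps -> cutoffL a eps x != 0 -> a < x < a + 3 * eps.
Proof.
move=> e0; apply: contraNT; rewrite negb_and -!leNgt => /orP[h|h].
  have [_ h1] := @sstep_le0 R ((x - a) / eps) (ltac:(by rewrite ler_pdivrMr// mul0r subr_le0)).
  by rewrite /cutoffL h1 mulr0.
have [_ h1] := @sstep_ge3 R ((x - a) / eps) (ltac:(by rewrite ler_pdivlMr//; lra)).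
by rewrite /cutoffL h1 mulr0.
Qed.
Lemma cutoffR_supp b eps x : 0 < eps -> cutoffR b eps x != 0 -> b - 3 * eps < x < b.
Proof.
move=> e0; apply: contraNT; rewrite negb_and -!leNgt => /orP[h|h].
  have [_ h1] := @sstep_ge3 R ((b - x) / eps) (ltac:(by rewrite ler_pdivlMr//; lra)).
  by rewrite /cutoffR h1 mulr0.
have [_ h1] := @sstep_le0 R ((b - x) / eps) (ltac:(by rewrite ler_pdivrMr// mul0r subr_le0)).
by rewrite /cutoffR h1 mulr0.
Qed.

Lemma integral_cutoffL p q a eps : 0 < eps -> p <= a -> a + 3 * eps <= q ->
  \int[mu]_(x in `]p, q[) cutoffL a eps x = 1.
Proof.
move=> e0 pa aq.
have pq : p <= q by lra.
have -> := @FTC_R R (cutoffL a eps) (fun x => sstep ((x - a) / eps)) p q pq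
  (is_derive_bL a eps) (@continuous_cutoffL a eps).
have [-> _] := @sstep_le0 R ((p - a) / eps) (ltac:(by rewrite ler_pdivrMr// mul0r subr_le0)).
have [-> _] := @sstep_ge3 R ((q - a) / eps) (ltac:(by rewrite ler_pdivlMr//; lra)).
by rewrite subr0.
Qed.

Lemma integral_cutoffR p q b eps : 0 < eps -> b <= q -> p <= b - 3 * eps ->
  \int[mu]_(x in `]p, q[) cutoffR b eps x = 1.
Proof.
move=> e0 bq pb.
have pq : p <= q by lra.
have dNR (x : R) : is_derive x 1 (fun x => - sstep ((b - x) / eps)) (cutoffR b eps x).
  have h := is_derive_bR b eps x; rewrite -[cutoffR b eps x]opprK.
  exact: is_deriveN.
have -> := @FTC_R R (cutoffR b eps) (fun x => - sstep ((b - x) / eps)) p q pq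
  dNR (@continuous_cutoffR b eps).
have [-> _] := @sstep_le0 R ((b - q) / eps) (ltac:(by rewrite ler_pdivrMr// mul0r subr_le0)).
have [-> _] := @sstep_ge3 R ((b - p) / eps) (ltac:(by rewrite ler_pdivlMr//; lra)).
by rewrite oppr0 opprK add0r.
Qed.

Lemma test_function_C1 (Omega : set R) (psi dpsi : R -> R) a b :
  (forall x : R, is_derive x 1 psi (dpsi x)) -> continuous dpsi ->
  `[a, b] `<=` Omega -> (forall x, ~~ (a <= x <= b) -> psi x = 0) ->
  test_function Omega psi /\ derive1 psi = dpsi.
Proof.
move=> d c ab out.
have e : derive1 psi = dpsi.
  by apply/funext => x; rewrite derive1E; have [_ ->] := d x.
split => //; split.
- by move=> x; have [] := d x.
- by rewrite e.
- exists `[a, b]%classic; split => //; first exact: segment_compact.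
  by move=> x /=; rewrite in_itv/= => /negP; exact: out.
Qed.

End Bumps.

(** * Limits of integrals *)

Section Limits.
Context {R : realType}.
Local Notation mu := (@lebesgue_measure R).
Variable D : set R.
Hypothesis mD : measurable D.
Implicit Types (u v l : R -> R) (f g : R -> R[i]).

Lemma dominated_cvg (u : nat -> R -> R) l v :
  (forall n, measurable_fun D (u n)) -> measurable_fun D l ->
  mu.-integrable D (fun x => (v x)%:E) ->
  (forall n x, D x -> `|u n x| <= v x) ->
  (forall x, D x -> u ^~ x @ \oo --> l x) ->
  (fun n => \int[mu]_(x in D) u n x) @ \oo --> \int[mu]_(x in D) l x.
Proof.
move=> mu_ ml iv uv ul.
have mU n : measurable_fun D (fun x => (u n x)%:E) by exact/measurable_EFinP.
have mL : measurable_fun D (fun x => (l x)%:E) by exact/measurable_EFinP.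
have cU : {ae mu, forall x, D x -> (fun n => (u n x)%:E) @ \oo --> (l x)%:E}.
  by apply: aeT => x Dx; apply: cvg_EFin; [exact: nearW|exact: ul].
have bU : {ae mu, forall x, forall n, D x -> (`|(u n x)%:E| <= (v x)%:E)%E}.
  by apply: aeT => x n Dx; rewrite /= lee_fin; exact: uv.
have [il _ h] := @dominated_convergence _ _ _ mu D mD
  (fun n x => (u n x)%:E) _ _ mU mL cU iv bU.
rewrite /Rintegral; apply: fine_cvg.
rewrite fineK//; exact: integrable_fin_num.
Qed.

Lemma cintegralE_cC f (k : R -> R) :
  cintegral D (fun x => f x * (k x)%:C) =
  (\int[mu]_(x in D) (complex.Re (f x) * k x)) +i*
  (\int[mu]_(x in D) (complex.Im (f x) * k x)).
Proof.
rewrite /cintegral; congr (_ +i* _); congr (fine _); apply: eq_integral => x _.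
  by rewrite !ReImE mulr0 subr0.
by rewrite !ReImE mulr0 add0r.
Qed.

Lemma integrable_bdM (u k : R -> R) M : mu.-integrable D (fun x => (u x)%:E) ->
  measurable_fun D k -> (forall x, D x -> `|k x| <= M) ->
  mu.-integrable D (fun x => (u x * k x)%:E).
Proof.
move=> iu mk kM.
have mu_ : measurable_fun D u by apply/measurable_EFinP; exact: measurable_int iu.
apply: (@integrable_leR _ D mD _ (fun x => M * `|u x|)).
- exact: measurable_funM.
- by move=> x Dx; rewrite normrM mulrC ler_wpM2r// kM.
- by apply: integrableZlR => //; have := integrable_abse iu.
Qed.

Lemma cint_bdM f (k : R -> R) M : cint D f -> measurable_fun D k ->
  (forall x, D x -> `|k x| <= M) -> cint D (fun x => f x * (k x)%:C).
Proof.
move=> [fr fi] mk kM.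
have := integrable_bdM fr mk kM; have := integrable_bdM fi mk kM => h1 h2.
split.
  by apply: eq_integrable h2 => // x _; rewrite !ReImE mulr0 subr0.
by apply: eq_integrable h1 => // x _; rewrite !ReImE mulr0 add0r.
Qed.

Lemma ccvg_cintegral_bd f (k : nat -> R -> R) (k0 : R -> R) : cint D f ->
  (forall n, measurable_fun D (k n)) -> measurable_fun D k0 ->
  (forall n x, D x -> `|k n x| <= 1) ->
  (forall x, D x -> k ^~ x @ \oo --> k0 x) ->
  ccvg (fun n => cintegral D (fun x => f x * (k n x)%:C))
       (cintegral D (fun x => f x * (k0 x)%:C)).
Proof.
move=> f_ mk mk0 k1 kk.
have [m1 m2] := cint_meas f_; have [i1 i2] := f_.
have dc (u : R -> R) : measurable_fun D u -> mu.-integrable D (fun x => (u x)%:E) ->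
    (fun n => \int[mu]_(x in D) (u x * k n x)) @ \oo --> \int[mu]_(x in D) (u x * k0 x).
  move=> mu_ iu; apply: (@dominated_cvg _ _ (fun x => `|u x|)).
  - by move=> n; exact: measurable_funM.
  - exact: measurable_funM.
  - by have := integrable_abse iu.
  - by move=> n x Dx; rewrite normrM ler_piMr// k1.
  - by move=> x Dx; apply: cvgM; [exact: cvg_cst|exact: kk].
by split; under eq_fun do rewrite cintegralE_cC; rewrite cintegralE_cC /=; exact: dc.
Qed.
End Limits.

Section Concentration.
Context {R : realType}.
Local Notation mu := (@lebesgue_measure R).
Implicit Types (u v l : R -> R) (f g : R -> R[i]).

Lemma continuous_bounded_itv (k : R -> R) p q : continuous k ->
  exists M, forall x, p <= x <= q -> `|k x| <= M.
Proof.
move=> ck; have [pq|qp] := leP p q; last first.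
  by exists 0 => x /andP[h1 h2]; have := le_trans h1 h2; rewrite leNgt qp.
have [c _ h] := @EVT_max R (fun x => `|k x|) p q pq
  (continuous_subspaceT (fun x => cvg_norm (ck x))).
by exists `|k c| => x hx; apply: h; rewrite in_itv.
Qed.

(** The kernels have mass one and concentrate where u is close to l. *)
Lemma concentration (p q : R) (u : R -> R) (k : nat -> R -> R) (l : R) :
  mu.-integrable `]p, q[ (fun x => (u x)%:E) ->
  (forall n, continuous (k n)) -> (forall n x, 0 <= k n x) ->
  (forall n, \int[mu]_(x in `]p, q[) k n x = 1) ->
  (forall e, 0 < e -> \forall n \near \oo, forall x, p < x < q -> k n x != 0 ->
    `|u x - l| <= e) ->
  (fun n => \int[mu]_(x in `]p, q[) (u x * k n x)) @ \oo --> l.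
Proof.
move=> iu ck k0 k1 hk; have mI : measurable `]p, q[%classic by exact: measurable_itv.
have ik n := @continuous_integrable R (k n) p q (ck n).
have iuk n : mu.-integrable `]p, q[ (fun x => (u x * k n x)%:E).
  have [M hM] := continuous_bounded_itv p q (ck n).
  apply: (@integrable_bdM _ _ mI u (k n) M) => //.
    by apply/measurable_EFinP; exact: measurable_int (ik n).
  by move=> x /=; rewrite in_itv/= => /andP[/ltW h1 /ltW h2]; apply: hM; rewrite h1.
apply/cvgrPdist_le => e e0; apply: filterS (hk _ e0) => n hn.
have ilk : mu.-integrable `]p, q[ (fun x => (l * k n x)%:E) by apply: integrableZlR.
have kZ c : \int[mu]_(x in `]p, q[) (c * k n x) = c.
  by transitivity (c * \int[mu]_(x in `]p, q[) k n x); [exact: (@RintegralZl _ _ _ mu _ (k n) c mI (ik n))|rewrite k1 mulr1].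
have -> : l - \int[mu]_(x in `]p, q[) (u x * k n x) =
    \int[mu]_(x in `]p, q[) (l * k n x - u x * k n x).
  by transitivity (\int[mu]_(x in `]p, q[) (l * k n x) - \int[mu]_(x in `]p, q[) (u x * k n x));
    [rewrite kZ|symmetry; exact: (@RintegralB _ _ _ mu _ _ _ mI ilk (iuk n))].
have ib : mu.-integrable `]p, q[ (fun x => (l * k n x - u x * k n x)%:E).
  exact: (@integrableB _ _ _ mu _ mI _ _ ilk (iuk n)).
apply: le_trans (@le_normr_Rintegral _ _ _ mu _ _ mI ib) _.
rewrite -(kZ e).
apply: (@le_Rintegral _ _ _ mu _ _ _ mI).
- by have := integrable_abse ib.
- exact: integrableZlR.
move=> x /=; rewrite in_itv/= => hx.
rewrite -mulrBl normrM (ger0_norm (k0 n x)).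
have [->|kx] := eqVneq (k n x) 0; first by rewrite !mulr0.
by rewrite ler_wpM2r// distrC; exact: hn.
Qed.

Lemma cconcentration (p q : R) f (k : nat -> R -> R) (l : R[i]) :
  cint `]p, q[ f ->
  (forall n, continuous (k n)) -> (forall n x, 0 <= k n x) ->
  (forall n, \int[mu]_(x in `]p, q[) k n x = 1) ->
  (forall e, 0 < e -> \forall n \near \oo, forall x, p < x < q -> k n x != 0 ->
    `|complex.Re (f x) - complex.Re l| <= e /\ `|complex.Im (f x) - complex.Im l| <= e) ->
  ccvg (fun n => cintegral `]p, q[ (fun x => f x * (k n x)%:C)) l.
Proof.
move=> [i1 i2] ck k0 k1 hk.
split; under eq_fun do rewrite cintegralE_cC /=; apply: concentration => // e e0;
  by apply: filterS (hk _ e0) => n h x hx kx; have [] := h x hx kx.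
Qed.
End Concentration.

(** * Weak derivatives *)

Section Support.
Context {R : realType}.
Local Notation mu := (@lebesgue_measure R).
Implicit Types (u v l : R -> R) (f g : R -> R[i]) (A B D K : set R).

Lemma cintegral_supp A B f : A `<=` B -> (forall x, B x -> ~ A x -> f x = 0) ->
  cintegral B f = cintegral A f.
Proof.
move=> AB f0.
suff h (u : R -> R) : (forall x, B x -> ~ A x -> u x = 0) ->
    \int[mu]_(x in B) u x = \int[mu]_(x in A) u x.
  by congr (_ +i* _); apply: h => x Bx Ax; rewrite f0.
move=> u0; rewrite /Rintegral; congr fine.
rewrite integral_mkcond [RHS]integral_mkcond; apply: eq_integral => x _.
rewrite !patchE; have [|] := boolP (x \in A); have [|] := boolP (x \in B) => //.
  by rewrite notin_setE inE => nB /AB.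
by rewrite notin_setE inE => Bx nA; rewrite u0.
Qed.

Lemma cmeas_sub A B f : measurable B -> A `<=` B -> cmeas B f -> cmeas A f.
Proof. by move=> mB AB [h1 h2]; split; exact: measurable_funS h1 || exact: measurable_funS h2. Qed.

Lemma L2_sub A B f : measurable A -> measurable B -> A `<=` B -> L2 B f -> L2 A f.
Proof.
move=> mA mB AB [h1 h2 h3]; split; first exact: measurable_funS h1.
  exact: measurable_funS h2.
apply: le_lt_trans h3; apply: ge0_subset_integral => //.
  exact: measurable_abs2E.
by move=> x _; rewrite lee_fin abs2_ge0.
Qed.

Lemma L2_cint A f : measurable A -> (mu A < +oo)%E -> L2 A f -> cint A f.
Proof.
move=> mA fA hf.
have h1 : L2 A (fun=> 1 : R[i]).
  apply: L2P; first exact: cmeas_cst.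
  rewrite /sqnorm (_ : abs2 1 = 1); last by rewrite /abs2 /= expr1n expr0n addr0.
  by rewrite integral_cst// mul1e.
apply: (@eq_cint _ A mA (fun x => f x * (1 : R[i])^*)).
  by move=> x _ /=; rewrite rmorph1 mulr1.
exact: cint_mulJ.
Qed.

Lemma L2_cint_itv (a b : R) f : L2 `]a, b[ f -> cint `]a, b[ f.
Proof.
apply: L2_cint; first exact: measurable_itv.
by rewrite lebesgue_measure_itv/=; case: ifPn => _; rewrite -?EFinD ltry.
Qed.

Lemma L2_clocally D f : measurable D -> open D -> L2 D f -> clocally_integrable D f.
Proof.
move=> mD oD hf; have [m1 m2] := L2_cmeas hf.
suff h K : K `<=` D -> compact K -> cint K f.
  split; split => // K KD cK; have [h1 h2] := h K KD cK.
    by have /integrableP[_] := h1.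
  by have /integrableP[_] := h2.
move=> KD cK; have mK : measurable K by exact: compact_measurable.
apply: L2_cint => //; first exact: compact_finite_measure.
exact: L2_sub hf.
Qed.

Lemma derive1_out K (psi : R -> R) x : compact K -> (forall x, ~ K x -> psi x = 0) ->
  ~ K x -> derive1 psi x = 0.
Proof.
move=> cK p0 Kx; have cl : closed K by apply: compact_closed => //; exact: Rhausdorff.
rewrite derive1E (@near_eq_derive _ _ _ psi (fun=> 0)).
  by rewrite derive_cst.
have : nbhs x (~` K) by apply: open_nbhs_nbhs; split => //; exact: closed_openC.
by apply: filterS => y /= Ky; exact: p0.
Qed.

Lemma continuous_measurable D u : measurable D -> continuous u -> measurable_fun D u.
Proof. by move=> mD cu; apply: measurable_funTS; exact: continuous_measurable_fun. Qed.

Lemma test_functionS A B psi : A `<=` B -> test_function A psi -> test_function B psi.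
Proof. by move=> AB [d c [K [cK KA h]]]; split => //; exists K; split => // x /KA /AB. Qed.
End Support.

Lemma cReIm {R : realType} (z : R[i]) :
  z = (complex.Re z)%:C + 'i * (complex.Im z)%:C.
Proof.
by apply: eq_ReIm; rewrite cReD cReC || rewrite cImD cImC; rewrite mulrC iE /=; ring.
Qed.

Section Weak.
Context {R : realType}.
Local Notation mu := (@lebesgue_measure R).
Implicit Types (u v l : R -> R) (f g : R -> R[i]) (A B D K : set R).

Lemma is_weak_derivative_restrict D F G f : measurable D -> open D ->
  L2 setT F -> L2 setT G -> is_weak_derivative setT F G ->
  L2 D f -> F = f %[ae mu in D] -> is_weak_derivative D f G.
Proof.
move=> mD oD LF LG [_ _ w] Lf Ff.
have LGD : L2 D G by exact: L2_sub LG.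
have LFD : L2 D F by exact: L2_sub LF.
split; [exact: L2_clocally|exact: L2_clocally|move=> psi tpsi].
have [d c [K [cK KD p0]]] := tpsi.
have mpsi : cmeas D (fun x => (psi x)%:C).
  apply: cmeasC => //; apply: continuous_measurable => // x.
  by apply: differentiable_continuous; apply/derivable1_diffP.
have mdpsi : cmeas D (fun x => (derive1 psi x)%:C).
  by apply: cmeasC => //; exact: continuous_measurable.
have := w psi (test_functionS (@subsetT _ D) tpsi).
rewrite (@cintegral_supp _ D setT)//; last first.
  by move=> x _ Dx; rewrite (derive1_out cK p0) ?mulr0// => /KD.
rewrite (@cintegral_supp _ D setT)//; last first.
  by move=> x _ Dx; rewrite p0 ?mulr0// => /KD.
move=> <-; apply: ae_eq_cintegral => //.
- by apply: cmeasM => //; exact: L2_cmeas.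
- by apply: cmeasM => //; exact: L2_cmeas.
by move: Ff; apply: aeS => x h Dx; rewrite h.
Qed.

(** Weak derivative tested against complex functions. *)
(** Weak derivatives tested against complex C^1 functions of compact support in
    ]a, b[, stated without a choice of the compact set. *)
Definition cweak (a b : R) f g := forall Psi dPsi c d, a < c -> d < b ->
  cderiv Psi dPsi -> ccont dPsi ->
  (forall x, ~~ (c <= x <= d) -> Psi x = 0) ->
  cintegral `]a, b[ (fun x => f x * dPsi x) = - cintegral `]a, b[ (fun x => g x * Psi x).

Lemma cint_ccontM (a b : R) f (k : R -> R) : cint `]a, b[ f -> continuous k ->
  cint `]a, b[ (fun x => f x * (k x)%:C).
Proof.
move=> hf ck; have [M hM] := continuous_bounded_itv a b ck.
have mI : measurable (`]a, b[%classic : set R) by exact: measurable_itv.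
apply: (@cint_bdM _ _ mI f k M) => //; first exact: continuous_measurable.
by move=> x /=; rewrite in_itv/= => /andP[/ltW h1 /ltW h2]; rewrite hM// h1.
Qed.

Lemma cint_ccont (a b : R) f g : cint `]a, b[ f -> ccont g ->
  cint `]a, b[ (fun x => f x * g x).
Proof.
move=> hf [c1 c2]; have mI : measurable (`]a, b[%classic : set R) by exact: measurable_itv.
have h1 := cint_ccontM hf c1; have h2 := cintZ mI 'i (cint_ccontM hf c2).
apply: (eq_cint mI _ (cintD mI h1 h2)) => x _.
by rewrite {3}(cReIm (g x)) mulrDr mulrCA.
Qed.

Lemma cintegral_ccont (a b : R) f g : cint `]a, b[ f -> ccont g ->
  cintegral `]a, b[ (fun x => f x * g x) =
  cintegral `]a, b[ (fun x => f x * (complex.Re (g x))%:C) +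
  'i * cintegral `]a, b[ (fun x => f x * (complex.Im (g x))%:C).
Proof.
move=> hf [c1 c2]; have mI : measurable (`]a, b[%classic : set R) by exact: measurable_itv.
have h1 := cint_ccontM hf c1; have h2 := cint_ccontM hf c2.
rewrite -cintegralZ// -cintegralD//; last exact: cintZ.
apply: eq_cintegral => x _.
by rewrite {1}(cReIm (g x)) mulrDr mulrCA.
Qed.

Lemma is_weak_derivative_cweak (a b : R) f g : L2 `]a, b[ f -> L2 `]a, b[ g ->
  is_weak_derivative `]a, b[%classic f g -> cweak a b f g.
Proof.
move=> Lf Lg [_ _ w] Psi dPsi c d ac db [d1 d2] [c1 c2] out.
have sub : `[c, d] `<=` (`]a, b[ : set R).
  by move=> x /=; rewrite !in_itv/= => /andP[h1 h2]; apply/andP; split; lra.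
have [t1 e1] := @test_function_C1 R `]a, b[%classic _ _ c d d1 c1 sub
  (fun x h => congr1 _ (out x h)).
have [t2 e2] := @test_function_C1 R `]a, b[%classic _ _ c d d2 c2 sub
  (fun x h => congr1 _ (out x h)).
have cP : ccont Psi by apply: cderiv_cont; split; [exact: d1|exact: d2].
rewrite (cintegral_ccont (L2_cint_itv Lf) (conj c1 c2)).
rewrite (cintegral_ccont (L2_cint_itv Lg) cP).
have := w _ t1; rewrite e1 => ->; have := w _ t2; rewrite e2 => ->.
by rewrite mulrN opprD.
Qed.

End Weak.

Section Uniqueness.
Context {R : realType}.
Local Notation mu := (@lebesgue_measure R).
Implicit Types (u v l : R -> R) (f g : R -> R[i]).

Lemma cvg_invS : (fun n => (n.+1%:R : R)^-1) @ \oo --> (0 : R).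
Proof.
apply/cvgrPdist_lt => e e0; have [N hN] : exists N : nat, e^-1 < N%:R.
  by exists (Num.truncn e^-1).+1; exact: truncnS_gt.
near=> n; rewrite sub0r normrN ger0_norm ?invr_ge0// -[e]invrK ltf_pV2 ?posrE ?invr_gt0//.
apply: lt_le_trans hN _; rewrite ler_nat; near: n; exists N => // n /= h; exact: leqW.
Unshelve. all: by end_near. Qed.

Lemma near_invS (e : R) : 0 < e -> \forall n \near \oo, n.+1%:R^-1 < e.
Proof.
move=> e0; have /cvgrPdist_lt/(_ e e0) := cvg_invS; apply: filterS => n.
by rewrite sub0r normrN ger0_norm ?invr_ge0.
Qed.

Lemma cvg_cutoff_indic (a b x : R) :
  (fun n => cutoff a b n.+1%:R^-1 x) @ \oo --> (\1_(`]a, b[%classic : set R) x : R).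
Proof.
rewrite indicE mem_setE in_itv /=; have [/andP[xa xb]|xab] := boolP (a < x < b); last first.
  by under eq_fun do rewrite (cutoff_out _ xab).1//; exact: cvg_cst.
apply: cvg_near_cst.
have e0 : 0 < Num.min (x - a) (b - x) / 3 by rewrite divr_gt0// lt_min !subr_gt0 xa.
apply: filterS (near_invS e0) => n; rewrite ltr_pdivlMr// lt_min => /andP[h1 h2].
have i0 : (0 : R) < n.+1%:R^-1 by rewrite invr_gt0.
by rewrite (cutoff_in i0)//; apply/andP; split; move: (n.+1%:R^-1) h1 h2 {i0} => i h1 h2; lra.
Qed.

Lemma cint_itv_locally (a b A B : R) f : a < A -> A <= B -> B < b ->
  clocally_integrable `]a, b[%classic f -> cint `]A, B[ f.
Proof.
move=> aA AB Bb [].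
suff h (u : R -> R) : locally_integrable `]a, b[%classic u ->
    mu.-integrable `]A, B[ (fun x => (u x)%:E) by move=> /h h1 /h h2.
move=> [m o h]; have sub : `[A, B] `<=` (`]a, b[ : set R).
  by move=> x /=; rewrite !in_itv/= => /andP[h1 h2]; apply/andP; split; lra.
have mS : measurable (`]A, B[%classic : set R) by exact: measurable_itv.
have mC : measurable (`[A, B]%classic : set R) by exact: measurable_itv.
have mO : measurable (`]a, b[%classic : set R) by exact: measurable_itv.
have mu_C : measurable_fun `[A, B] u by exact: measurable_funS m.
apply: (@integrableS _ _ _ mu `[A, B]) => //; first exact: subset_itv_oo_cc.
apply/integrableP; split; first exact/measurable_EFinP.
exact: (h _ sub (segment_compact (a := A) (b := B))).
Qed.

(** The integrals of the difference over all intervals vanish: smooth cutoffs of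
    the interval are admissible test functions, and they tend to its indicator
    function. *)
Lemma weak_derivative_unique (a b : R) f g1 g2 :
  is_weak_derivative `]a, b[%classic f g1 -> is_weak_derivative `]a, b[%classic f g2 ->
  g1 = g2 %[ae mu in `]a, b[%classic].
Proof.
move=> [_ l1 w1] [_ l2 w2].
have loc A B : a < A -> A < B -> B < b -> g1 = g2 %[ae mu in `]A, B[%classic].
  move=> aA AB Bb.
  have mS : measurable (`]A, B[%classic : set R) by exact: measurable_itv.
  have i1 := cint_itv_locally aA (ltW AB) Bb l1.
  have i2 := cint_itv_locally aA (ltW AB) Bb l2.
  have eqI b' : A < b' < B ->
      cintegral `]A, B[ (fun x => g1 x * (\1_(`]A, b'[%classic : set R) x)%:C) =
      cintegral `]A, B[ (fun x => g2 x * (\1_(`]A, b'[%classic : set R) x)%:C).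
    move=> /andP[Ab bB].
    have lim g : cint `]A, B[ g ->
        ccvg (fun n => cintegral `]A, B[ (fun x => g x * (cutoff A b' n.+1%:R^-1 x)%:C))
        (cintegral `]A, B[ (fun x => g x * (\1_(`]A, b'[%classic : set R) x)%:C)).
      move=> ig; apply: (@ccvg_cintegral_bd _ _ mS g) => //.
      - by move=> n; apply: continuous_measurable => //; exact: continuous_cutoff.
      - by move=> n x _; have /andP[h1 h2] := cutoff_bnd A b' n.+1%:R^-1 x; rewrite ger0_norm.
      - by move=> x _; exact: cvg_cutoff_indic.
    apply: ccvg_unique (lim _ i1) _.
    suff -> : (fun n => cintegral `]A, B[ (fun x => g1 x * (cutoff A b' n.+1%:R^-1 x)%:C)) =
      (fun n => cintegral `]A, B[ (fun x => g2 x * (cutoff A b' n.+1%:R^-1 x)%:C)) by exact: lim.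
    apply/funext => n.
    have e0 : (0 : R) < n.+1%:R^-1 by rewrite invr_gt0.
    have sub : `[A, b'] `<=` (`]a, b[ : set R).
      by move=> x /=; rewrite !in_itv/= => /andP[h1 h2]; apply/andP; split; lra.
    have [t _] := @test_function_C1 R `]a, b[%classic _ _ A b'
      (is_derive_cutoff A b' n.+1%:R^-1) (@continuous_cutoff1 R A b' n.+1%:R^-1) sub
      (fun x h => (cutoff_out e0 (contra (fun h' : A < x < b' =>
         (ltac:(by case/andP: h' => /ltW -> /ltW ->) : A <= x <= b')) h)).1).
    have := w2 _ t; rewrite (w1 _ t) => /oppr_inj.
    have supp g : cintegral `]a, b[ (fun x => g x * (cutoff A b' n.+1%:R^-1 x)%:C) =
      cintegral `]A, B[ (fun x => g x * (cutoff A b' n.+1%:R^-1 x)%:C).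
      apply: cintegral_supp.
        by move=> x /=; rewrite !in_itv/= => /andP[h1 h2]; apply/andP; split; lra.
      move=> x _ /= /negP nx; rewrite (cutoff_out e0 _).1 ?mulr0//.
      by apply: contra nx => /andP[h1 h2]; rewrite in_itv/= h1 (lt_trans h2 bB).
    by rewrite !supp.
  have real (u1 u2 : R -> R) : mu.-integrable `]A, B[ (fun x => (u1 x)%:E) ->
      mu.-integrable `]A, B[ (fun x => (u2 x)%:E) ->
      (forall b', A < b' < B -> \int[mu]_(x in `]A, B[) (u1 x * \1_(`]A, b'[%classic : set R) x) =
        \int[mu]_(x in `]A, B[) (u2 x * \1_(`]A, b'[%classic : set R) x)) ->
      u1 = u2 %[ae mu in `]A, B[%classic].
    move=> iu1 iu2 e12.
    have ib : mu.-integrable `]A, B[ (fun x => (u1 x - u2 x)%:E).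
      exact: (@integrableB _ _ _ mu _ mS _ _ iu1 iu2).
    suff : (fun x => u1 x - u2 x) = (fun=> 0) %[ae mu in `]A, B[%classic].
      by apply: aeS => x h /h /subr0_eq.
    apply: integral_eq0_ae => // b' /andP[Ab bB].
    have sub : `]A, b'[ `<=` (`]A, B[ : set R).
      by move=> x /=; rewrite !in_itv/= => /andP[-> h2]; rewrite (lt_trans h2).
    have mS' : measurable (`]A, b'[%classic : set R) by exact: measurable_itv.
    transitivity (\int[mu]_(x in `]A, b'[) u1 x - \int[mu]_(x in `]A, b'[) u2 x).
      apply: (@RintegralB _ _ _ mu _ _ _ mS'); exact: (@integrableS _ _ _ mu `]A, B[).
    have Abb : A < b' < B by rewrite Ab.
    have tr (u : R -> R) : \int[mu]_(x in `]A, B[) (u x * \1_(`]A, b'[%classic : set R) x) =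
        \int[mu]_(x in `]A, b'[) u x.
      rewrite /Rintegral; congr fine.
      rewrite integral_mkcond [RHS]integral_mkcond; apply: eq_integral => x _.
      rewrite !patchE; have [h|h] := boolP (x \in (`]A, b'[%classic : set R)).
        have -> : x \in (`]A, B[%classic : set R) by rewrite inE; apply: sub; rewrite -inE.
        by rewrite indicE h mulr1.
      by rewrite indicE (negbTE h) mulr0; case: ifP.
    by rewrite -!tr e12// subrr.
  have [r1 s1] := i1; have [r2 s2] := i2.
  have a1 := real _ _ r1 r2 (fun b' h => ltac:(by have := congr1 (@complex.Re R) (eqI b' h); rewrite !cintegralE_cC)).
  have a2 := real _ _ s1 s2 (fun b' h => ltac:(by have := congr1 (@complex.Im R) (eqI b' h); rewrite !cintegralE_cC)).
  by move: a1 a2; apply: aeS2 => x h1 h2 Dx; apply: eq_ReIm; [exact: h1|exact: h2].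
have [ab|ba] := ltP a b; last first.
  by apply: aeT => x /=; rewrite in_itv/= => /andP[h1 h2]; have := lt_trans h1 h2; rewrite ltNge ba.
pose d : R := (b - a) / 3.
have d0 : 0 < d by rewrite divr_gt0// subr_gt0.
have dE : b - a = 3 * d by rewrite /d; field.
have cov n : g1 = g2 %[ae mu in `](a + d * n.+1%:R^-1), (b - d * n.+1%:R^-1)[%classic].
  have n0 : (0 : R) < n.+1%:R^-1 by rewrite invr_gt0.
  have n1 : (n.+1%:R^-1 : R) <= 1 by rewrite invf_le1// ler1n.
  have p0 : 0 < d * n.+1%:R^-1 by rewrite mulr_gt0.
  have p1 : d * n.+1%:R^-1 <= d by rewrite ler_piMr// ltW.
  move: (d * _) p0 p1 => t p0 p1; clearbody d.
  by apply: loc; move: dE p0 p1; clear; move=> *; lra.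
move: (ae_forall_nat cov); apply: aeS => x h /=; rewrite in_itv/= => /andP[xa xb].
have e0 : 0 < Num.min (x - a) (b - x) / d by rewrite divr_gt0// lt_min !subr_gt0 xa.
have [N _ hN] := near_invS e0.
have := hN N (leqnn N); rewrite /= ltr_pdivlMr// lt_min => /andP[h1 h2].
apply: (h N); rewrite /= in_itv/= [d * _]mulrC.
by move: (_^-1 * d) h1 h2 => t h1 h2; apply/andP; split; lra.
Qed.

Lemma wderivP f g : is_weak_derivative I2pi f g ->
  is_weak_derivative I2pi f (wderiv I2pi f) /\ wderiv I2pi f = g %[ae mu in I2pi].
Proof.
move=> w; have h : is_weak_derivative I2pi f (wderiv I2pi f).
  by apply: (@xgetPex _ (cst 0) [set g | is_weak_derivative I2pi f g]); exists g.
by split => //; exact: weak_derivative_unique h w.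
Qed.

End Uniqueness.

(** * Fourier coefficients of weak derivatives *)

Section Boundary.
Context {R : realType}.
Local Notation mu := (@lebesgue_measure R).
Variable phi : R.
Local Notation ee := (ee phi).
Local Notation freq := (frequency phi).
Local Hint Resolve measurable_I2pi : core.

Lemma within_eps (u : R -> R) (a b p e : R) : {within `[a, b], continuous u} ->
  a <= p <= b -> 0 < e -> exists2 d : R, 0 < d &
    forall x, a <= x <= b -> `|x - p| < d -> `|u x - u p| <= e.
Proof.
move=> cu hp e0; have pI : `[a, b]%classic p by rewrite /= in_itv.
have : u x @[x --> within `[a, b]%classic (nbhs p)] --> u p.
  by rewrite (nbhs_subspace_in pI); exact: cu.
move=> /cvgrPdist_le/(_ e e0).
rewrite nearE /within/= => /nbhs_ballP[d /= d0 h]; exists d => // x hx xd.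
rewrite distrC; apply: h; last by rewrite /= in_itv.
by rewrite /ball/= distrC.
Qed.

Lemma ee_shift k x : ee k (x + 2 * pi) = expi (- phi) * ee k x.
Proof.
rewrite [LHS]eintD mulrC; congr (_ * _).
have t0 := @twopi_gt0 R.
have -> : zfreq phi (zk k) * (2 * pi) = - phi + (zk k)%:~R * (2 * pi).
  by rewrite /zfreq mulrBl divfK ?gt_eqF// addrC.
by rewrite expi_add expi2piM mulr1.
Qed.

Lemma ee_2pi k : ee k (2 * pi) = expi (- phi) * ee k 0.
Proof. by rewrite -ee_shift add0r. Qed.

(** The continuous representative, with continuity restated in terms of products
    with continuous functions; values at the endpoints are then limits of
    averages against concentrating kernels. *)
Lemma continuous_rep_bound f : quasi_periodic phi f -> L2 I2pi f ->
  exists h, [/\ L2 I2pi h, h = f %[ae mu in I2pi], h 0 = expi phi * h (2 * pi) &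
    forall v, ccont v -> forall p e, 0 <= p <= 2 * pi -> 0 < e ->
    exists2 d : R, 0 < d & forall x, 0 <= x <= 2 * pi -> `|x - p| < d ->
      `|complex.Re (h x * v x) - complex.Re (h p * v p)| <= e /\
      `|complex.Im (h x * v x) - complex.Im (h p * v p)| <= e].
Proof.
move=> [h [[c1 c2 hf] h0]] Lf; exists h.
have mh : cmeas I2pi h.
  have ms : measurable (`[0, 2 * pi]%classic : set R) by exact: measurable_itv.
  have sub : I2pi `<=` (`[0, 2 * pi] : set R) by exact: subset_itv_oo_cc.
  by split; apply: (measurable_funS ms sub);
    apply: subspace_continuous_measurable_fun.
split => //.
  by apply: L2_eqae Lf mh _ => //; move: hf; apply: aeS => x h1 h2; rewrite h1.
move=> v [v1 v2] p e hp e0.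
have w1 := continuous_subspaceT (A := `[0, 2 * pi]) v1.
have w2 := continuous_subspaceT (A := `[0, 2 * pi]) v2.
have k1 : {within `[0, 2 * pi], continuous (fun x => complex.Re (h x * v x))}.
  rewrite (funext (fun x => cReM (h x) (v x))).
  by move=> x; apply: cvgB; apply: cvgM;
    [exact: c1|exact: w1|exact: c2|exact: w2].
have k2 : {within `[0, 2 * pi], continuous (fun x => complex.Im (h x * v x))}.
  rewrite (funext (fun x => cImM (h x) (v x))).
  by move=> x; apply: cvgD; apply: cvgM;
    [exact: c1|exact: w2|exact: c2|exact: w1].
have [d1 d10 h1] := within_eps k1 hp e0; have [d2 d20 h2] := within_eps k2 hp e0.
exists (Num.min d1 d2); first by rewrite lt_min d10.
by move=> x hx; rewrite lt_min => /andP[x1 x2]; split; [exact: h1|exact: h2].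
Qed.

Lemma twopi_ge4 : 4 <= 2 * pi :> R.
Proof. by have := @pi_ge2 R; lra. Qed.

(** Integration by parts against the conjugate exponential: the boundary terms,
    obtained as limits of integrals against the derivative of a cutoff, cancel
    because of quasi-periodicity. *)
Lemma weak_coef f g k : L2 I2pi f -> L2 I2pi g -> cweak 0 (2 * pi) f g ->
  quasi_periodic phi f ->
  coef I2pi ee g k = 'i * (freq k)%:C * coef I2pi ee f k.
Proof.
move=> Lf Lg w /continuous_rep_bound/(_ Lf)[h [Lh hf h0 hc]].
pose e x := ee k x.
pose v x := (ee k x)^*; pose dv x := ('i * (freq k)%:C * ee k x)^*.
have cv : cderiv v dv by apply: cderivJ; exact: cderiv_eint.
have kv : ccont v by exact: cderiv_cont cv.
have kdv : ccont dv by apply: ccontJ; apply: ccontM; [exact: ccont_cst|exact: ccont_eint].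
pose eps n : R := n.+2%:R^-1.
have p4 := twopi_ge4.
have eps0 n : 0 < eps n by rewrite invr_gt0.
have eps2 n : eps n <= 1 / 2 by rewrite div1r lef_pV2 ?posrE// ler_nat.
pose a n := eps n; pose b n := 2 * pi - eps n.
have If := L2_cint_itv Lf; have Ig := L2_cint_itv Lg.
have ifv := cint_ccont If kv; have ifdv := cint_ccont If kdv; have igv := cint_ccont Ig kv.
have ihv := cint_ccont (L2_cint_itv Lh) kv.
have eqn n : cintegral `]0, (2 * pi)[ (fun x => f x * v x * (cutoffL (a n) (eps n) x)%:C)
  + (-1) * cintegral `]0, (2 * pi)[ (fun x => f x * v x * (cutoffR (b n) (eps n) x)%:C)
  + cintegral `]0, (2 * pi)[ (fun x => f x * dv x * (cutoff (a n) (b n) (eps n) x)%:C)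
  = (-1) * cintegral `]0, (2 * pi)[ (fun x => g x * v x * (cutoff (a n) (b n) (eps n) x)%:C).
  have d1 := cderivM (cderivC (is_derive_cutoff (a n) (b n) (eps n))) cv.
  have bn : b n < 2 * pi by rewrite /b; have := eps0 n; lra.
  have cd1 : ccont (fun x => (cutoff1 (a n) (b n) (eps n) x)%:C * v x +
      (cutoff (a n) (b n) (eps n) x)%:C * dv x).
    by apply: ccontD; apply: ccontM => //; apply: ccontC;
      [exact: continuous_cutoff1|exact: continuous_cutoff].
  have out x : ~~ (a n <= x <= b n) -> (cutoff (a n) (b n) (eps n) x)%:C * v x = 0.
    move=> hx; rewrite (cutoff_out (eps0 n) _).1 ?mul0r//.
    by apply: contra hx => /andP[/ltW -> /ltW ->].
  have := w _ _ (a n) (b n) (eps0 n) bn d1 cd1 out.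
  have -> : cintegral `]0, (2 * pi)[ (fun x => g x * ((cutoff (a n) (b n) (eps n) x)%:C * v x)) =
     cintegral `]0, (2 * pi)[ (fun x => g x * v x * (cutoff (a n) (b n) (eps n) x)%:C).
    by apply: eq_cintegral => x _; ring.
  rewrite !mulN1r => <-.
  have i1 := cint_ccontM ifv (@continuous_cutoffL R (a n) (eps n)).
  have i2 := cint_ccontM ifv (@continuous_cutoffR R (b n) (eps n)).
  have i3 := cint_ccontM ifdv (@continuous_cutoff R (a n) (b n) (eps n)).
  have mI := @measurable_I2pi R.
  rewrite -(cintegralN mI i2) -(cintegralD mI i1 (cintN mI i2)).
  rewrite -(cintegralD mI (cintD mI i1 (cintN mI i2)) i3).
  apply: eq_cintegral => x _; rewrite cutoff1E//; last first.
    by rewrite /a /b; have := eps2 n; lra.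
  by rewrite realCD realCN; ring.
have lim0 : ccvg (fun n => cintegral `]0, (2 * pi)[
    (fun x => f x * v x * (cutoffL (a n) (eps n) x)%:C)) (h 0 * v 0).
  suff -> : (fun n => cintegral `]0, (2 * pi)[ (fun x => f x * v x * (cutoffL (a n) (eps n) x)%:C)) =
     (fun n => cintegral `]0, (2 * pi)[ (fun x => h x * v x * (cutoffL (a n) (eps n) x)%:C)).
    apply: cconcentration => //.
    - by move=> n; exact: continuous_cutoffL.
    - by move=> n x; exact: cutoffL_ge0.
    - move=> n; apply: integral_cutoffL => //; first exact: ltW.
      by rewrite /a; have := eps2 n; lra.
    move=> r r0; have [d d0 hd] := hc v kv 0 r ltac:(by apply/andP; split; lra) r0.
    have d4 : 0 < d / 4 by rewrite divr_gt0.
    apply: filterS (near_invS d4) => n hn x /andP[x0 x2] /(cutoffL_supp (eps0 n)) /andP[_ hx].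
    apply: hd; first by apply/andP; split; exact: ltW.
    rewrite subr0 gtr0_norm//; apply: lt_le_trans hx _.
    have : eps n <= n.+1%:R^-1 by rewrite lef_pV2 ?posrE// ler_nat.
    by rewrite /a; move: (eps n) (_^-1) hn => ? ? ? ?; lra.
  apply/funext => n; apply: ae_eq_cintegral => //.
  - by apply: cint_meas; apply: cint_ccontM => //; exact: continuous_cutoffL.
  - by apply: cint_meas; apply: cint_ccontM => //; exact: continuous_cutoffL.
  - by move: hf; apply: aeS => x hx Dx; rewrite hx.
have lim2 : ccvg (fun n => cintegral `]0, (2 * pi)[
    (fun x => f x * v x * (cutoffR (b n) (eps n) x)%:C)) (h (2 * pi) * v (2 * pi)).
  suff -> : (fun n => cintegral `]0, (2 * pi)[ (fun x => f x * v x * (cutoffR (b n) (eps n) x)%:C)) =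
     (fun n => cintegral `]0, (2 * pi)[ (fun x => h x * v x * (cutoffR (b n) (eps n) x)%:C)).
    apply: cconcentration => //.
    - by move=> n; exact: continuous_cutoffR.
    - by move=> n x; exact: cutoffR_ge0.
    - move=> n; apply: integral_cutoffR => //; rewrite /b.
        by have := eps0 n; lra.
      by have := eps2 n; lra.
    move=> r r0; have [d d0 hd] := hc v kv (2 * pi) r ltac:(by apply/andP; split; lra) r0.
    have d4 : 0 < d / 4 by rewrite divr_gt0.
    apply: filterS (near_invS d4) => n hn x /andP[x0 x2] /(cutoffR_supp (eps0 n)) /andP[hx _].
    apply: hd; first by apply/andP; split; exact: ltW.
    rewrite distrC gtr0_norm ?subr_gt0//.
    have : eps n <= n.+1%:R^-1 by rewrite lef_pV2 ?posrE// ler_nat.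
    by move: hx; rewrite /b; move: (eps n) (_^-1) hn => ? ? ? ? ?; lra.
  apply/funext => n; apply: ae_eq_cintegral => //.
  - by apply: cint_meas; apply: cint_ccontM => //; exact: continuous_cutoffR.
  - by apply: cint_meas; apply: cint_ccontM => //; exact: continuous_cutoffR.
  - by move: hf; apply: aeS => x hx Dx; rewrite hx.
have limC u : cint `]0, (2 * pi)[ u ->
   ccvg (fun n => cintegral `]0, (2 * pi)[ (fun x => u x * (cutoff (a n) (b n) (eps n) x)%:C))
     (cintegral `]0, (2 * pi)[ u).
  move=> iu; have -> : cintegral `]0, (2 * pi)[ u = cintegral `]0, (2 * pi)[ (fun x => u x * (1 : R)%:C).
    by apply: eq_cintegral => x _; rewrite mulr1.
  apply: (@ccvg_cintegral_bd _ _ measurable_I2pi u) => //.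
  - by move=> n; apply: continuous_measurable => //; exact: continuous_cutoff.
  - by move=> n x _; have /andP[h1 h2] := cutoff_bnd (a n) (b n) (eps n) x; rewrite ger0_norm.
  move=> x /I2piP /andP[x0 x2]; apply: cvg_near_cst.
  have d4 : 0 < Num.min x (2 * pi - x) / 4 by rewrite divr_gt0// lt_min x0 subr_gt0.
  apply: filterS (near_invS d4) => n; rewrite ltr_pdivlMr// lt_min => /andP[h1 h2].
  rewrite (cutoff_in (eps0 n))//.
  have : eps n <= n.+1%:R^-1 by rewrite lef_pV2 ?posrE// ler_nat.
  by rewrite /a /b; move: (eps n) (_^-1) h1 h2 => ? ? ? ? ?; apply/andP; split; lra.
have L := ccvgD (ccvgD lim0 (ccvgM (ccvg_cst (-1)) lim2)) (limC _ ifdv).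
have Rl := ccvgM (ccvg_cst (-1)) (limC _ igv).
rewrite (funext eqn) in L.
have := ccvg_unique L Rl.
have -> : h 0 * v 0 + -1 * (h (2 * pi) * v (2 * pi)) = 0.
  rewrite /v ee_2pi h0 conjM expiJ opprK; ring.
rewrite add0r mulN1r => E.
have -> : coef I2pi ee g k = cintegral `]0, (2 * pi)[ (fun x => g x * v x) by [].
rewrite -[LHS]opprK -E.
transitivity (- cintegral `]0, (2 * pi)[ (fun x => (- ('i * (freq k)%:C)) * (f x * v x))).
  congr (- _); apply: eq_cintegral => x _.
  rewrite /dv /v !conjM conjCC (_ : ('i : R[i])^* = - 'i); first by ring.
  by rewrite conjCi.
by rewrite cintegralZ// mulNr opprK.
Qed.

End Boundary.

(** * Integrals over adjacent intervals *)

Section Splitting.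
Context {R : realType}.
Local Notation mu := (@lebesgue_measure R).
Implicit Types (f g : R -> R[i]) (A B : set R).

Lemma integral_supp A B (u : R -> \bar R) : A `<=` B ->
  (forall x, B x -> ~ A x -> u x = 0%E) ->
  (\int[mu]_(x in B) u x = \int[mu]_(x in A) u x)%E.
Proof.
move=> AB u0.
rewrite integral_mkcond [RHS]integral_mkcond; apply: eq_integral => x _.
rewrite !patchE; have [|] := boolP (x \in A); have [|] := boolP (x \in B) => //.
  by rewrite notin_setE inE => nB /AB.
by rewrite notin_setE inE => Bx nA; rewrite u0.
Qed.

Lemma ge0_integral_itv_split (u : R -> \bar R) (a b c : R) : a <= b -> b <= c ->
  measurable_fun setT u -> (forall x, 0 <= u x)%E ->
  (\int[mu]_(x in `]a, c[) u x =
   \int[mu]_(x in `]a, b[) u x + \int[mu]_(x in `]b, c[) u x)%E.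
Proof.
move=> ab bc mu_ u0.
have m I : measurable_fun [set` I] u by exact: measurable_funTS.
have [->|nab] := eqVneq a b; first by rewrite set_itvoo0 integral_set0 add0e.
have [->|nbc] := eqVneq c b; first by rewrite (@set_itvoo0 _ _ b) integral_set0 adde0.
have ab' : a < b by rewrite lt_neqAle nab.
have bc' : b < c by rewrite lt_neqAle eq_sym nbc.
rewrite [X in (X + _)%E]integral_itv_bndo_bndc//.
rewrite -ge0_integral_setU//=.
- congr integral; rewrite -itv_bndbnd_setU// bnd_simp; exact: ltW.
- exact: measurable_funTS.
- apply/disj_setPS => x [/=]; rewrite !in_itv/= => /andP[_ h1] /andP[h2 _].
  by have := le_lt_trans h1 h2; rewrite ltxx.
Qed.

Lemma cintegral_itv_split f (a b c : R) : a <= b -> b <= c -> cint `]a, c[ f ->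
  cintegral `]a, c[ f = cintegral `]a, b[ f + cintegral `]b, c[ f.
Proof.
move=> ab bc [i1 i2].
have [->|nab] := eqVneq a b.
  by rewrite [cintegral `]b, b[ _](_ : _ = 0) ?add0r// /cintegral /Rintegral set_itvoo0 !integral_set0.
have [->|nbc] := eqVneq c b.
  by rewrite [cintegral `]b, b[ _](_ : _ = 0) ?addr0// /cintegral /Rintegral set_itvoo0 !integral_set0.
have ab' : a < b by rewrite lt_neqAle nab.
have bc' : b < c by rewrite lt_neqAle eq_sym nbc.
suff h (u : R -> R) : mu.-integrable `]a, c[ (fun x => (u x)%:E) ->
    \int[mu]_(x in `]a, c[) u x = \int[mu]_(x in `]a, b[) u x + \int[mu]_(x in `]b, c[) u x.
  by apply: eq_ReIm; rewrite ?cReD ?cImD /=; exact: h.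
move=> iu.
have iab : mu.-integrable `]a, b[ (fun x => (u x)%:E).
  have mac : measurable (`]a, c[%classic : set R) by exact: measurable_itv.
  have mab : measurable (`]a, b[%classic : set R) by exact: measurable_itv.
  apply: (@integrableS _ _ _ mu `]a, c[) => //.
  by move=> x /=; rewrite !in_itv/= => /andP[-> h]; exact: lt_trans bc'.
rewrite [X in _ = X + _]Rintegral_itv_bndo_bndc//.
have := @Rintegral_itvB R u (BRight a) (BLeft c) b iu _ _.
rewrite !bnd_simp => /(_ (ltW ab') bc') <-.
by rewrite addrC subrK.
Qed.

Lemma cmeas_comp f (T : R -> R) (A : set R) : cmeas setT f -> measurable_fun A T ->
  cmeas A (fun x => f (T x)).
Proof. by move=> [h1 h2] mT; split; [exact: measurableT_comp h1 mT|exact: measurableT_comp h2 mT]. Qed.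

Lemma cintegral_shift f (a p q : R) : cmeas setT f ->
  cintegral `]p, q[ (fun x => f (x + a)) = cintegral `](p + a), (q + a)[ f.
Proof.
move=> [h1 h2]; rewrite /cintegral; congr (_ +i* _).
  by rewrite (Rintegral_shift_itv (measurable_funTS h1)).
by rewrite (Rintegral_shift_itv (measurable_funTS h2)).
Qed.

Lemma eq_sqnorm A f g : {in A, f =1 g} -> sqnorm A f = sqnorm A g.
Proof. by move=> fg; apply: eq_integral => x xA; rewrite fg. Qed.

End Splitting.

Section Cutoff.
Context {R : realType}.
Local Notation mu := (@lebesgue_measure R).
Implicit Types (f g d : R -> R[i]).

Lemma continuous_supp_bounded (eta : R -> R) (p q : R) : continuous eta ->
  (forall x, ~~ (p <= x <= q) -> eta x = 0) -> exists2 M, 0 <= M & forall x, `|eta x| <= M.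
Proof.
move=> ce e0; have [M hM] := continuous_bounded_itv p q ce.
exists (Num.max M 0); first by rewrite le_max lexx orbT.
move=> x; rewrite le_max; have [h|h] := boolP (p <= x <= q); first by rewrite hM.
by rewrite e0// normr0 lexx orbT.
Qed.

Lemma L2_cutoff (a b p q : R) (eta : R -> R) f : a < p -> q < b -> continuous eta ->
  (forall x, ~~ (p <= x <= q) -> eta x = 0) -> cmeas setT f -> L2 `]a, b[ f ->
  L2 setT (fun x => (eta x)%:C * f x).
Proof.
move=> ap qb ce e0 mf Lf; have [M M0 hM] := continuous_supp_bounded ce e0.
have mI : measurable (`]a, b[%classic : set R) by exact: measurable_itv.
have me : cmeas setT (fun x => (eta x)%:C) by apply: cmeasC; exact: continuous_measurable.
apply: L2P; first exact: cmeasM.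
rewrite /sqnorm (@integral_supp _ `]a, b[%classic)//; last first.
  move=> x _ /= /negP nx; rewrite e0 ?mul0r ?abs20//; apply: contra nx => /andP[h1 h2].
  by rewrite in_itv/=; apply/andP; split; [exact: lt_le_trans h1|exact: le_lt_trans qb].
apply: L2_lty; apply: (@L2_bdM _ _ mI _ _ (M ^+ 2)) => //.
  by apply: (cmeas_sub _ _ me).
by move=> x _; rewrite abs2C -real_normK ?num_real// ler_sqr ?nnegrE.
Qed.

Lemma weak_cutoff (a b p q : R) (eta eta1 : R -> R) f d : a < p -> q < b ->
  (forall x : R, is_derive x 1 eta (eta1 x)) -> continuous eta1 ->
  (forall x, ~~ (p <= x <= q) -> eta x = 0 /\ eta1 x = 0) ->
  cmeas setT f -> cmeas setT d -> L2 `]a, b[ f -> L2 `]a, b[ d -> cweak a b f d ->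
  is_weak_derivative setT (fun x => (eta x)%:C * f x)
    (fun x => (eta1 x)%:C * f x + (eta x)%:C * d x).
Proof.
move=> ap qb de ce1 out mf md Lf Ld w.
have ce : continuous eta by move=> x; exact: is_derive_cont (de x).
have out0 x h := (out x h).1; have out1 x h := (out x h).2.
have L0 := L2_cutoff ap qb ce out0 mf Lf.
have L1 := L2_cutoff ap qb ce1 out1 mf Lf.
have L2_ := L2_cutoff ap qb ce out0 md Ld.
split.
- by apply: L2_clocally => //; exact: openT.
- by apply: L2_clocally => //; [exact: openT|exact: L2D].
move=> psi [dpsi cpsi _].
have dpsi' (x : R) : is_derive x 1 psi (derive1 psi x).
  by rewrite derive1E; apply: derivableP.
have cps : continuous psi by move=> x; exact: is_derive_cont (dpsi' x).
have sub : `[p, q] `<=` (`]a, b[ : set R).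
  by move=> x /=; rewrite !in_itv/= => /andP[h1 h2]; apply/andP; split;
    [exact: lt_le_trans h1|exact: le_lt_trans qb].
have nI x : ~ (`]a, b[%classic : set R) x -> ~~ (p <= x <= q).
  by move=> h; apply/negP => h'; apply: h; apply: sub; rewrite /= in_itv.
have mI : measurable (`]a, b[%classic : set R) by exact: measurable_itv.
rewrite (@cintegral_supp _ `]a, b[%classic)//; last first.
  by move=> x _ /nI h; rewrite out0// !mul0r.
rewrite [X in _ = - X](@cintegral_supp _ `]a, b[%classic)//; last first.
  by move=> x _ /nI h; rewrite out0// out1// !mul0r addr0 mul0r.
have dP := cderivM (cderivC de) (cderivC dpsi').
have c1 : ccont (fun x => (eta1 x)%:C * (psi x)%:C + (eta x)%:C * (derive1 psi x)%:C).
  by apply: ccontD; apply: ccontM; apply: ccontC.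
have oP x : ~~ (p <= x <= q) -> (eta x)%:C * (psi x)%:C = 0.
  by move=> h; rewrite out0// mul0r.
have := w _ _ p q ap qb dP c1 oP.
have If := L2_cint_itv Lf; have Id := L2_cint_itv Ld.
have i1 := cint_ccont If (ccontM (ccontC ce1) (ccontC cps)).
have i2 := cint_ccont If (ccontM (ccontC ce) (ccontC cpsi)).
have i3 := cint_ccont Id (ccontM (ccontC ce) (ccontC cps)).
have -> : cintegral `]a, b[ (fun x => f x * ((eta1 x)%:C * (psi x)%:C + (eta x)%:C * (derive1 psi x)%:C)) =
  cintegral `]a, b[ (fun x => f x * ((eta1 x)%:C * (psi x)%:C)) +
  cintegral `]a, b[ (fun x => f x * ((eta x)%:C * (derive1 psi x)%:C)).
  by rewrite -cintegralD//; apply: eq_cintegral => x _; rewrite mulrDr.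
move=> E; transitivity (cintegral `]a, b[ (fun x => f x * ((eta x)%:C * (derive1 psi x)%:C))).
  by apply: eq_cintegral => x _; ring.
transitivity (- (cintegral `]a, b[ (fun x => f x * ((eta1 x)%:C * (psi x)%:C)) +
   cintegral `]a, b[ (fun x => d x * ((eta x)%:C * (psi x)%:C)))); last first.
  by rewrite -cintegralD//; congr (- _); apply: eq_cintegral => x _; ring.
by rewrite opprD -E addrA addNr add0r.
Qed.
End Cutoff.

(** * The quasi-periodic extension *)

Section Extension.
Context {R : realType}.
Local Notation mu := (@lebesgue_measure R).
Variable phi : R.
Local Notation freq := (frequency phi).
Local Notation coef f := (coef I2pi (ee phi) f).
Local Hint Resolve measurable_I2pi : core.
Implicit Types (f g d : R -> R[i]).
Local Notation I := (`]0, (2 * pi)[%classic : set R).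

Definition winding (x : R) : int := Num.floor (x / (2 * pi)).
(** The indicator function makes the extension vanish on the null set of the
    multiples of 2 pi, where f need not be meaningful. *)
Definition ext f (x : R) : R[i] :=
  let y := x - (winding x)%:~R * (2 * pi) in
  expi (- ((winding x)%:~R * phi)) * (\1_I y)%:C * f y.

Lemma winding_shift (x : R) : winding (x + 2 * pi) = winding x + 1.
Proof.
have t0 := @twopi_gt0 R.
rewrite /winding mulrDl divff ?gt_eqF// floorDrz; last exact: (intr_int _ 1).
by rewrite floor1.
Qed.

Lemma winding_I (x : R) : 0 <= x < 2 * pi -> winding x = 0.
Proof.
have t0 := @twopi_gt0 R; move=> /andP[h1 h2].
by apply: floor_def; rewrite add0r divr_ge0//= ?ltW// ltr_pdivrMr// mul1r.
Qed.

Lemma ext_shift f x : ext f (x + 2 * pi) = expi (- phi) * ext f x.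
Proof.
rewrite /ext winding_shift.
have -> : x + 2 * pi - (winding x + 1)%:~R * (2 * pi) = x - (winding x)%:~R * (2 * pi).
  by rewrite intrD; ring.
have -> : - ((winding x + 1)%:~R * phi) = - phi + - ((winding x)%:~R * phi).
  by rewrite intrD; ring.
by rewrite expi_add !mulrA.
Qed.

Lemma ext_in f x : I2pi x -> ext f x = f x.
Proof.
move=> Ix; have /andP[h1 h2] := I2piP Ix.
rewrite /ext winding_I ?(ltW h1)// !mul0r subr0 oppr0 expi0 mul1r.
by rewrite indicE mem_set// mul1r.
Qed.

Lemma cmeas_ext f : cmeas I2pi f -> cmeas setT (ext f).
Proof.
move=> mf; have t0 := @twopi_gt0 R.
have mw : measurable_fun setT (fun x : R => (winding x)%:~R : R).
  apply: nondecreasing_measurable => // x y xy.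
  by rewrite ler_int; apply: le_floor; rewrite ler_pM2r ?invr_gt0.
have my : measurable_fun setT (fun x : R => x - (winding x)%:~R * (2 * pi)).
  apply: measurable_funB => //; apply: measurable_funM => //.
have m0 : cmeas setT (fun y => (\1_I y)%:C * f y).
  have h (u : R -> R) : measurable_fun I2pi u -> measurable_fun setT (fun y => \1_I y * u y).
    move=> m; rewrite (_ : (fun y => _) = u \_ I).
      exact/(measurable_restrictT u (@measurable_I2pi R)).
    apply/funext => y; rewrite patchE indicE; case: ifP => _; by rewrite ?mul1r ?mul0r.
  split; (have [h1 h2] := mf).
    rewrite (_ : (fun y => _) = (fun y => \1_I y * complex.Re (f y))); first exact: h.
    by apply/funext => y; rewrite !ReImE mul0r subr0.
  rewrite (_ : (fun y => _) = (fun y => \1_I y * complex.Im (f y))); first exact: h.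
  by apply/funext => y; rewrite !ReImE mul0r addr0.
have me : cmeas setT (fun x => expi (- ((winding x)%:~R * phi))).
  have mp : measurable_fun setT (fun x : R => - ((winding x)%:~R * phi)).
    by apply: measurable_funN; exact: measurable_funM.
  split; apply: (measurableT_comp _ mp); apply: continuous_measurable_fun.
    exact: continuous_cos.
  exact: continuous_sin.
have -> : ext f = (fun x => expi (- ((winding x)%:~R * phi)) *
   ((fun y => (\1_I y)%:C * f y) (x - (winding x)%:~R * (2 * pi)))).
  by apply/funext => x; rewrite /ext mulrA.
exact: cmeasM me (cmeas_comp m0 my).
Qed.

Lemma sqnorm_quasi_shift (G : R -> R[i]) (p q : R) : cmeas setT G ->
  (forall x, G (x + 2 * pi) = expi (- phi) * G x) ->
  sqnorm `](p + 2 * pi), (q + 2 * pi)[ G = sqnorm `]p, q[ G.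
Proof.
move=> mG qG; rewrite /sqnorm -integral_shift_itv.
- by apply: eq_integral => x _; rewrite qG abs2M abs2_expi mul1r.
- by apply: measurable_funTS; exact: measurable_abs2E mG.
- by move=> x; rewrite lee_fin abs2_ge0.
Qed.

Lemma sqnorm_quasi3 (G : R -> R[i]) : cmeas setT G ->
  (forall x, G (x + 2 * pi) = expi (- phi) * G x) ->
  (sqnorm `](- (2 * pi))%R, (2 * (2 * pi))%R[ G =
   sqnorm I2pi G + sqnorm I2pi G + sqnorm I2pi G)%E.
Proof.
move=> me qG; have t0 := @twopi_gt0 R.
have m2 : measurable_fun setT (fun x => (abs2 (G x))%:E) by exact: measurable_abs2E me.
have p2 x : (0 <= (abs2 (G x))%:E)%E by rewrite lee_fin abs2_ge0.
have := sqnorm_quasi_shift (- (2 * pi)) 0 me qG; rewrite addNr add0r => s1.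
have := sqnorm_quasi_shift 0 (2 * pi) me qG; rewrite add0r => s2.
have d2 : 2 * (2 * pi) = 2 * pi + 2 * pi :> R by ring.
rewrite d2 -{3}s2 {1}s1 /sqnorm.
have a1 : - (2 * pi) <= 0 :> R by lra.
have a2 : 0 <= 2 * pi + 2 * pi :> R by lra.
have a3 : 0 <= 2 * pi :> R by lra.
have a4 : 2 * pi <= 2 * pi + 2 * pi :> R by lra.
rewrite (ge0_integral_itv_split a1 a2 m2 p2) (ge0_integral_itv_split a3 a4 m2 p2).
by rewrite addeA.
Qed.

Lemma sqnorm_ext_I f : sqnorm I2pi (ext f) = sqnorm I2pi f.
Proof. by apply: eq_sqnorm => x; rewrite inE => Ix; rewrite ext_in. Qed.

Lemma L2_ext f : L2 I2pi f -> L2 `](- (2 * pi)), (2 * (2 * pi))[ (ext f).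
Proof.
move=> Lf; have mf := L2_cmeas Lf.
apply: L2P; first by apply: (cmeas_sub _ _ (cmeas_ext mf)).
by rewrite (sqnorm_quasi3 (cmeas_ext mf) (ext_shift f)) sqnorm_ext_I sqnormE// -!EFinD ltry.
Qed.

Lemma L2_ext_sub f (p q : R) : L2 I2pi f -> - (2 * pi) <= p -> q <= 2 * (2 * pi) ->
  L2 `]p, q[ (ext f).
Proof.
move=> Lf hp hq; apply: L2_sub (L2_ext Lf); [exact: measurable_itv|exact: measurable_itv|].
by move=> x /=; rewrite !in_itv/= => /andP[h1 h2]; rewrite (le_lt_trans hp)//= (lt_le_trans h2).
Qed.

Lemma cintegral_periodic (p : R -> R[i]) (h : R) : cmeas setT p ->
  (forall x, p (x + 2 * pi) = p x) -> 0 <= h <= 2 * pi ->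
  cint `]0, (2 * (2 * pi))[ p ->
  cintegral `]0, (2 * pi)[ (fun x => p (x + h)) = cintegral `]0, (2 * pi)[ p.
Proof.
move=> mp pp /andP[h0 h2] ip; have t0 := @twopi_gt0 R.
have sub (a b : R) : 0 <= a -> b <= 2 * (2 * pi) -> cint `]a, b[ p.
  move=> a0 b2; have [i1 i2] := ip.
  have s : `]a, b[ `<=` (`]0, (2 * (2 * pi))[ : set R).
    by move=> x /=; rewrite !in_itv/= => /andP[k1 k2]; rewrite (le_lt_trans a0)//= (lt_le_trans k2).
  split; apply: (@integrableS _ _ _ mu _ _ _ _ _ s) => //; exact: measurable_itv.
rewrite cintegral_shift// add0r.
rewrite (@cintegral_itv_split _ _ _ (2 * pi))//; [|lra|by apply: sub => //; lra].
rewrite [RHS](@cintegral_itv_split _ _ _ h)//; last by apply: sub => //; lra.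
rewrite addrC; congr (_ + _).
have := @cintegral_shift _ p (2 * pi) 0 h mp; rewrite add0r [h + _]addrC => <-.
by apply: eq_cintegral => x _; rewrite pp.
Qed.

Lemma L2_translate f (h : R) : L2 I2pi f -> 0 <= h <= 2 * pi ->
  L2 I2pi (fun x => ext f (x + h)).
Proof.
move=> Lf /andP[h0 h2]; have me := cmeas_ext (L2_cmeas Lf); have t0 := @twopi_gt0 R.
apply: L2P; first by apply: cmeas_comp => //; exact: measurable_funTS (@measurable_shift R h).
rewrite /sqnorm (@integral_shift_itv _ (fun x => (abs2 (ext f x))%:E)).
- by apply: L2_lty; apply: L2_ext_sub => //; lra.
- by apply: measurable_funTS; exact: measurable_abs2E me.
- by move=> x; rewrite lee_fin abs2_ge0.
Qed.

Lemma coef_translate f (h : R) k : L2 I2pi f -> 0 <= h <= 2 * pi ->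
  coef (fun x => ext f (x + h)) k = expi (freq k * h) * coef f k.
Proof.
move=> Lf hh; have t0 := @twopi_gt0 R; have /andP[h0 h2] := hh.
pose P x := ext f x * (ee phi k x)^*.
have me := cmeas_ext (L2_cmeas Lf).
have mP : cmeas setT P.
  by apply: cmeasM => //; apply: cmeasJ; apply: ccont_cmeas => //; exact: ccont_eint.
have pP x : P (x + 2 * pi) = P x.
  by rewrite /P ext_shift ee_shift conjM mulrACA mulCJ abs2_expi mul1r.
have iP : cint `]0, (2 * (2 * pi))[ P.
  apply: cint_ccont; last by apply: ccontJ; exact: ccont_eint.
  by apply: L2_cint_itv; apply: L2_ext_sub => //; lra.
have iPh : cint I2pi (fun x => ext f (x + h) * (ee phi k x)^*).
  apply: cint_ccont; last by apply: ccontJ; exact: ccont_eint.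
  by apply: L2_cint_itv; exact: L2_translate.
have -> : coef f k = cintegral `]0, (2 * pi)[ P.
  by apply: eq_cintegral => x; rewrite inE => Ix; rewrite /P ext_in.
rewrite -(cintegral_periodic mP pP hh iP) -cintegralZ//.
  apply: eq_cintegral => x _; rewrite /P [ee phi k (x + h)]eintD conjM expiJ.
  rewrite [RHS]mulrCA; congr (_ * _).
  by rewrite mulrCA expiVr mulr1.
apply: (@eq_cint _ _ _ (fun x => expi (- (freq k * h)) * (ext f (x + h) * (ee phi k x)^*))) => //.
  move=> x _; rewrite /P [ee phi k (x + h)]eintD conjM expiJ mulrCA; congr (_ * _).
  exact: mulrC.
exact: cintZ.
Qed.

End Extension.

Section WeakExtension.
Context {R : realType}.
Local Notation mu := (@lebesgue_measure R).
Variable phi : R.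
Local Notation freq := (frequency phi).
Local Notation coef f := (coef I2pi (ee phi) f).
Local Notation ext := (ext phi).
Local Hint Resolve measurable_I2pi : core.
Implicit Types (f g d Psi : R -> R[i]).

Lemma cderiv_shift F f (a : R) : cderiv F f -> cderiv (fun x => F (x + a)) (fun x => f (x + a)).
Proof.
move=> [h1 h2].
have da (x : R) : is_derive x 1 (fun x : R => x + a) 1.
  by apply: is_derive_eq; rewrite addr0.
split=> x.
  have := @is_derive_compR R (fun x => complex.Re (F x)) _ x _ _ (h1 (x + a)) (da x).
  by rewrite mulr1.
have := @is_derive_compR R (fun x => complex.Im (F x)) _ x _ _ (h2 (x + a)) (da x).
by rewrite mulr1.
Qed.

Lemma ccont_shift f (a : R) : ccont f -> ccont (fun x => f (x + a)).
Proof.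
have ca : continuous (fun x : R => x + a) by move=> x; apply: cvgD; [exact: cvg_id|exact: cvg_cst].
have cc (u v : R -> R) : continuous u -> continuous v -> continuous (u \o v).
  by move=> cu cv x; apply: continuous_comp; [exact: cv|exact: cu].
by move=> [h1 h2]; split; [exact: (cc _ _ h1 ca)|exact: (cc _ _ h2 ca)].
Qed.

(** Folds a test function on the line into one period; adjoint to [ext] for test
    functions supported in three periods. *)
Definition periodize Psi (x : R) : R[i] :=
  expi phi * Psi (x + - (2 * pi)) + Psi x + expi (- phi) * Psi (x + 2 * pi).

Lemma cderiv_periodize Psi dPsi : cderiv Psi dPsi -> cderiv (periodize Psi) (periodize dPsi).
Proof.
move=> h.
have c (z : R[i]) F f : cderiv F f -> cderiv (fun x => z * F x) (fun x => z * f x).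
  move=> hF; have := cderivM (cderiv_cst z) hF.
  by under [X in cderiv _ X]funext do rewrite mul0r add0r.
by apply: cderivD; [apply: cderivD => //|]; apply: c; exact: cderiv_shift.
Qed.

Lemma ccont_periodize Psi : ccont Psi -> ccont (periodize Psi).
Proof.
by move=> h; apply: ccontD; [apply: ccontD => //|];
  apply: ccontM; (try exact: ccont_cst); exact: ccont_shift.
Qed.

Lemma ext_shiftN f x : ext f (x + - (2 * pi)) = expi phi * ext f x.
Proof.
have := ext_shift phi f (x + - (2 * pi)); rewrite subrK => ->.
by rewrite mulrA expiVr mul1r.
Qed.

Lemma cintegral_ext f Psi : L2 I2pi f -> ccont Psi ->
  cintegral `](- (2 * pi)), (2 * (2 * pi))[ (fun x => ext f x * Psi x) =
  cintegral I2pi (fun x => f x * periodize Psi x).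
Proof.
move=> Lf cP; have t0 := @twopi_gt0 R.
have me := cmeas_ext phi (L2_cmeas Lf).
have mP : cmeas setT (fun x => ext f x * Psi x) by apply: cmeasM => //; exact: ccont_cmeas.
have sub (a b : R) : - (2 * pi) <= a -> b <= 2 * (2 * pi) -> cint `]a, b[ (fun x => ext f x * Psi x).
  by move=> ha hb; apply: cint_ccont => //; apply: L2_cint_itv; exact: L2_ext_sub.
have a1 : - (2 * pi) <= 0 :> R by lra.
have a2 : 0 <= 2 * (2 * pi) :> R by lra.
have a3 : 0 <= 2 * pi :> R by lra.
have a4 : 2 * pi <= 2 * (2 * pi) :> R by lra.
rewrite (cintegral_itv_split a1 a2)//; last exact: sub.
rewrite (cintegral_itv_split a3 a4)//; last exact: sub.
have := @cintegral_shift _ _ (- (2 * pi)) 0 (2 * pi) mP; rewrite add0r subrr => <-.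
have := @cintegral_shift _ _ (2 * pi) 0 (2 * pi) mP; rewrite add0r (_ : 2 * pi + 2 * pi = 2 * (2 * pi)) => [<-|]; last by ring.
have Ie : cint `]0, (2 * pi)[ (ext f) by apply: L2_cint_itv; apply: L2_ext_sub => //; lra.
have i1 : cint `]0, (2 * pi)[ (fun x => ext f (x + - (2 * pi)) * Psi (x + - (2 * pi))).
  apply: (@eq_cint _ _ _ (fun x => ext f x * (expi phi * Psi (x + - (2 * pi))))) => //.
    by move=> x _; rewrite ext_shiftN mulrA [ext f x * _]mulrC.
  by apply: cint_ccont => //; apply: ccontM; [exact: ccont_cst|exact: ccont_shift].
have i2 : cint `]0, (2 * pi)[ (fun x => ext f (x + 2 * pi) * Psi (x + 2 * pi)).
  apply: (@eq_cint _ _ _ (fun x => ext f x * (expi (- phi) * Psi (x + 2 * pi)))) => //.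
    by move=> x _; rewrite ext_shift mulrA [ext f x * _]mulrC.
  by apply: cint_ccont => //; apply: ccontM; [exact: ccont_cst|exact: ccont_shift].
have i0 : cint `]0, (2 * pi)[ (fun x => ext f x * Psi x) by exact: cint_ccont.
have mI : measurable (`]0, (2 * pi)[%classic : set R) by exact: measurable_itv.
rewrite -(cintegralD mI i0 i2) -(cintegralD mI i1 (cintD mI i0 i2)).
apply: eq_cintegral => x; rewrite inE => Ix.
rewrite ext_shiftN ext_shift ext_in// /periodize; ring.
Qed.

(** If multiplication by the frequency takes the coefficients of f to those of d,
    then the extension of d is the weak derivative of that of f over three
    periods: after folding the test function, this is Parseval. *)
Lemma cweak_ext f d : L2 I2pi f -> L2 I2pi d ->
  (forall k, coef d k = 'i * (freq k)%:C * coef f k) ->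
  cweak (- (2 * pi)) (2 * (2 * pi)) (ext f) (ext d).
Proof.
move=> Lf Ld dk Psi dPsi p q hp hq dP cdP out; have t0 := @twopi_gt0 R.
have cP : ccont Psi by exact: cderiv_cont dP.
rewrite !cintegral_ext//.
pose V x := (periodize Psi x)^*; pose dV x := (periodize dPsi x)^*.
have LV : L2 I2pi V by apply: ccont_L2; apply: ccontJ; exact: ccont_periodize.
have LdV : L2 I2pi dV by apply: ccont_L2; apply: ccontJ; exact: ccont_periodize.
have -> : cintegral I2pi (fun x => f x * periodize dPsi x) = inner I2pi f dV.
  by apply: eq_cintegral => x _; rewrite /dV conjCK.
have -> : cintegral I2pi (fun x => d x * periodize Psi x) = inner I2pi d V.
  by apply: eq_cintegral => x _; rewrite /V conjCK.
have Vk k : coef dV k = 'i * (freq k)%:C * coef V k.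
  have ce := ccont_eint phi (zk k).
  have de : cderiv (fun x => periodize Psi x * ee phi k x)
      (fun x => periodize dPsi x * ee phi k x + periodize Psi x * ('i * (freq k)%:C * ee phi k x)).
    exact: cderivM (cderiv_periodize dP) (cderiv_eint phi (zk k)).
  have c1 : ccont (fun x => periodize dPsi x * ee phi k x).
    by apply: ccontM => //; exact: ccont_periodize.
  have c2 : ccont (fun x => periodize Psi x * ee phi k x).
    by apply: ccontM => //; exact: ccont_periodize.
  have c3 : ccont (fun x => periodize Psi x * ('i * (freq k)%:C * ee phi k x)).
    by apply: ccontM; [exact: ccont_periodize|apply: ccontM => //; exact: ccont_cst].
  have E := cFTC (ltW t0) de (ccontD c1 c3).
  have bd : periodize Psi (2 * pi) * ee phi k (2 * pi) = periodize Psi 0 * ee phi k 0.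
    rewrite ee_2pi mulrA; congr (_ * _); rewrite /periodize subrr !add0r.
    rewrite (out (- (2 * pi))); last by apply/negP => /andP[h _]; lra.
    rewrite (out (2 * pi + 2 * pi)); last by apply/negP => /andP[_ h]; lra.
    rewrite !mulr0 addr0 add0r mulrDl mulrAC expiVr mul1r; congr (_ + _).
    by rewrite mulrC.
  have {}E : cintegral I2pi (fun x => periodize dPsi x * ee phi k x) =
      - ('i * (freq k)%:C) * cintegral I2pi (fun x => periodize Psi x * ee phi k x).
    have i1 := @ccont_cint _ _ 0 (2 * pi) c1; have i2 := @ccont_cint _ _ 0 (2 * pi) c2.
    have i3 := @ccont_cint _ _ 0 (2 * pi) c3.
    rewrite -cintegralZ//; apply/eqP; rewrite -subr_eq0 -cintegralB//; last exact: cintZ.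
    apply/eqP; transitivity (periodize Psi (2 * pi) * ee phi k (2 * pi) - periodize Psi 0 * ee phi k 0).
      by rewrite -E; apply: eq_cintegral => x _; rewrite mulNr opprK; congr (_ + _); rewrite mulrCA.
    by rewrite bd subrr.
  have J (F : R -> R[i]) : ccont F -> coef (fun x => (F x)^*) k = (cintegral I2pi (fun x => F x * ee phi k x))^*.
    move=> cF; rewrite -cintegralJ//; last by apply: ccont_cint; exact: ccontM.
    by apply: eq_cintegral => x _; rewrite conjM.
  rewrite /dV /V !J ?E; [|exact: ccont_periodize|exact: ccont_periodize].
  rewrite conjM; congr (_ * _).
  by rewrite conjN conjM conjCi conjCC mulNr opprK.
have pv := @parseval_inner R I2pi (@measurable_I2pi R) _ (L2_ee phi) (orthonormal_ee phi)
  (@complete_ee R phi).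
have P1_ := pv _ _ Lf LdV.
have P2_ := ccvgM (ccvg_cst (-1)) (pv _ _ Ld LV).
rewrite -mulN1r; apply: ccvg_unique P1_ _.
rewrite (_ : (fun N => _) = (fun N => -1 * (\sum_(0 <= k < N) coef d k * (coef V k)^*))); first exact: P2_.
apply/funext => N; rewrite mulN1r -sumrN; apply: eq_bigr => k _.
by rewrite Vk dk !conjM conjCi conjCC; ring.
Qed.

End WeakExtension.

(** * Decay of the coefficients and boundary values *)

Section Summability.
Context {R : realType}.
Implicit Types (u v a : nat -> R).

Lemma bsum_near u v (K : nat) : (forall k, (K <= k)%N -> u k <= v k) ->
  (forall k, 0 <= v k) -> bsum v -> bsum u.
Proof.
move=> uv v0 [M hM]; pose w k := `|u k| + v k.
exists (\sum_(0 <= k < K) `|u k| + M) => N.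
have le1 : \sum_(0 <= k < N) u k <= \sum_(0 <= k < maxn N K) ((if (k < K)%N then `|u k| else 0) + v k).
  rewrite (@big_cat_nat _ _ _ N 0 (maxn N K)) ?leq_maxl//=.
  rewrite -[leLHS]addr0 lerD//.
    apply: ler_sum => k _; case: ltnP => h; last by rewrite add0r uv.
    by rewrite (le_trans (ler_norm _))// lerDl.
  by apply: sumr_ge0 => k _; rewrite addr_ge0//; case: ifP.
apply: le_trans le1 _; rewrite big_split/= lerD//.
rewrite (@big_cat_nat _ _ _ K 0 (maxn N K)) ?leq_maxr//= [X in _ + X]big_nat_cond [X in _ + X]big1.
  by rewrite addr0 le_eqVlt; apply/orP; left; apply/eqP; rewrite big_nat_cond [RHS]big_nat_cond;
    apply: eq_bigr => k /andP[/andP[_ ->]].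
by move=> k /andP[/andP[h _] _]; rewrite ltnNge h.
Qed.

Lemma geometric_le (q : R) N : 0 <= q < 1 -> \sum_(0 <= j < N) q ^+ j <= (1 - q)^-1.
Proof.
move=> /andP[q0 q1]; rewrite -[leRHS]mul1r ler_pdivlMr ?subr_gt0//.
suff -> : (\sum_(0 <= j < N) q ^+ j) * (1 - q) = 1 - q ^+ N.
  by rewrite gerBl exprn_ge0.
elim: N => [|N IH]; first by rewrite big_geq// mul0r expr0 subrr.
by rewrite big_nat_recr//= mulrDl IH exprS; ring.
Qed.

Lemma bsum_powR (p : R) : 1 < p -> bsum (fun k => k.+1%:R `^ (- p)).
Proof.
move=> p1; pose q : R := 2 `^ (1 - p).
have q0 : 0 < q by rewrite powR_gt0.
have q1 : q < 1.
  have p0 : 0 < p - 1 by lra.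
  rewrite /q -(opprB p 1) powRN invf_lt1 ?powR_gt0//.
  have := @gt0_ltr_powR R _ p0 1 2; rewrite !nnegrE powR1; apply => //.
  by rewrite ltr1n.
have S N : \sum_(0 <= k < (2 ^ N).-1) k.+1%:R `^ (- p) <= \sum_(0 <= j < N) q ^+ j.
  elim: N => [|N IH]; first by rewrite !big_geq.
  have le2 : ((2 ^ N).-1 <= (2 ^ N.+1).-1)%N by have := leq_pexp2l (isT : 0 < 2)%N (leqnSn N); lia.
  rewrite (big_cat_nat (leq0n _) le2)//= [leRHS]big_nat_recr//=; apply: lerD => //.
  apply: le_trans (_ : \sum_((2 ^ N).-1 <= k < (2 ^ N.+1).-1) (2 ^ N)%:R `^ (- p) <= _).
    rewrite big_nat_cond [leRHS]big_nat_cond; apply: ler_sum => k /andP[/andP[h _] _].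
    rewrite !powRN lef_pV2 ?posrE ?powR_gt0 ?ltr0n ?expn_gt0//.
    rewrite ge0_ler_powR ?nnegrE ?ler0n// ?ler_nat; [lra|].
    by have := expn_gt0 2 N; lia.
  rewrite sumr_const_nat -[leLHS]mulr_natl.
  have -> : ((2 ^ N.+1).-1 - (2 ^ N).-1)%N = (2 ^ N)%N.
    by have := expn_gt0 2 N; rewrite expnS; lia.
  rewrite le_eqVlt; apply/orP; left; apply/eqP.
  rewrite natrX -!powR_mulrn ?powR_ge0// -!powRrM.
  rewrite -powRD; last by rewrite pnatr_eq0 implybT.
  by congr (_ `^ _); ring.
exists (1 - q)^-1 => N.
apply: le_trans (geometric_le N _); last by rewrite ltW.
apply: le_trans (S N).
have N2 : (N <= (2 ^ N).-1)%N by have := ltn_expl N (isT : 1 < 2)%N; lia.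
rewrite [leRHS](big_cat_nat (leq0n _) N2)//= lerDl.
by apply: sumr_ge0 => k _; exact: powR_ge0.
Qed.

Lemma weierstrass_M (u : nat -> R -> R) a : (forall k, continuous (u k)) ->
  (forall k x, `|u k x| <= a k) -> bsum a ->
  exists2 U : R -> R, continuous U & forall x, (fun N => \sum_(0 <= k < N) u k x) @ \oo --> U x.
Proof.
move=> cu ua ba.
have a0 k : 0 <= a k by exact: le_trans (normr_ge0 _) (ua k 0).
have [l [_ al le]] := bsum_cvg a0 ba.
pose S N x : R := \sum_(0 <= k < N) u k x.
pose U x : R := limn (S ^~ x).
have cS x : S ^~ x @ \oo --> U x.
  by apply: cvg_series_abs; apply: bsum_le ba => k; exact: ua.
have cSN N : continuous (S N).
  rewrite /S; elim: N => [|N IH] x.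
    by under [X in continuous_at _ X]funext do rewrite big_geq//; exact: cvg_cst.
  rewrite (funext (fun y => big_nat_recr N 0 (u^~ y) (leq0n N))) /=.
  by apply: cvgD; [exact: IH|exact: cu].
have unif e : 0 < e -> exists N, forall x, `|U x - S N x| <= e.
  move=> e0; have [N hN] := le e e0; exists N => x.
  suff h : \forall M \near \oo, `|S M x - S N x| <= e.
    have c : (fun M => `|S M x - S N x|) @ \oo --> `|U x - S N x|.
      by apply: cvg_norm; apply: cvgB; [exact: cS|exact: cvg_cst].
    by rewrite -(cvg_lim _ c)//; apply: limr_le; [apply/cvg_ex; eexists; exact: c|exact: h].
  exists N => // M /= NM; rewrite /S (big_cat_nat (leq0n _) NM)//= addrAC subrr add0r.
  apply: le_trans (ler_norm_sum _ _ _) _.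
  apply: le_trans (_ : \sum_(N <= k < M) a k <= _); first by apply: ler_sum => k _; exact: ua.
  have := al M; rewrite (big_cat_nat (leq0n _) NM)//= => h; lra.
exists U => // x; apply/cvgrPdist_le => e e0.
have e3 : 0 < e / 3 by rewrite divr_gt0.
have [N hN] := unif _ e3.
have := cSN N x; move=> /cvgrPdist_le/(_ _ e3); apply: filterS => y hy.
have -> : U x - U y = (U x - S N x) + (S N x - S N y) - (U y - S N y) by ring.
have h1 := hN x; have h2 := hN y.
apply: le_trans (ler_normB _ _) _; apply: le_trans (lerD (ler_normD _ _) h2) _.
by move: h1 hy; move: (`|_|) (`|_|) => ? ? ? ?; lra.
Qed.

Lemma cvg_shift (u : nat -> R) (l : R) N : u @ \oo --> l ->
  (fun k => u (k + N)%N) @ \oo --> l.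
Proof. by move=> h; have := h; rewrite -(cvg_shiftn N). Qed.

End Summability.

Section Regularity.
Context {R : realType}.
Local Notation mu := (@lebesgue_measure R).
Variable phi : R.
Hypothesis hphi : 0 <= phi < 2 * pi.
Local Notation freq := (frequency phi).
Local Notation coef f := (coef I2pi (ee phi) f).
Local Notation psum := (partial_sum (ee phi)).
Local Hint Resolve measurable_I2pi : core.
Implicit Types (f g d : R -> R[i]).

(** The squared modulus of the eigenvalue of |P|^s. *)
Definition weight (s : R) k : R := (`|freq k| `^ s) ^+ 2.

Lemma freq_ge k : (5 <= k)%N -> k.+1%:R / 4 <= `|freq k|.
Proof.
move=> k5; have t0 := @twopi_gt0 R; have /andP[p0 p1] := hphi.
have c0 : 0 <= phi / (2 * pi) by rewrite divr_ge0// ltW.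
have c1 : phi / (2 * pi) <= 1 by rewrite ler_pdivrMr// mul1r ltW.
rewrite /frequency /zfreq /zk; move: (phi / (2 * pi)) c0 c1 => c c0 c1.
have := odd_double_half k; set m := k./2; case: (odd k) => /= km.
  have -> : ((- m.+1%:Z)%:~R : R) = - (m%:R + 1) by rewrite mulrNz -[(m.+1%:Z)%:~R]/(m.+1%:R) -natr1.
  have -> : k.+1%:R = 2 * m%:R + 2 :> R by rewrite -km -addn1 !natrD -muln2 natrM; ring.
  by rewrite ler0_norm; have : (0 : R) <= m%:R by []; move: (m%:R : R) => r; lra.
have -> : ((m%:Z)%:~R : R) = m%:R by [].
have -> : k.+1%:R = 2 * m%:R + 1 :> R by rewrite -km -addn1 !natrD -muln2 natrM; ring.
have m2 : (3 : R) <= m%:R by rewrite ler_nat; lia.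
by rewrite ger0_norm; move: (m%:R : R) m2 => r; lra.
Qed.

Lemma bsum_weight_inv s : 1 / 2 < s -> bsum (fun k => if (k < 5)%N then 0 else (weight s k)^-1).
Proof.
move=> hs; have p1 : 1 < 2 * s by lra.
apply: (@bsum_near _ _ (fun k => 4 `^ (2 * s) * k.+1%:R `^ (- (2 * s))) 5).
- move=> k k5; rewrite ltnNge k5 /=.
  rewrite powRN -[4 `^ _]invrK -invfM lef_pV2 ?posrE; last first.
  + by rewrite mulr_gt0 ?invr_gt0 ?powR_gt0.
  + rewrite exprn_gt0// powR_gt0//; apply: lt_le_trans (freq_ge k5).
    by rewrite divr_gt0.
  rewrite mulrC [leRHS]/weight -(powR_mulrn 2 (powR_ge0 _ _)) -powRrM [s * 2]mulrC.
  rewrite -powRN.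
  apply: le_trans (_ : (k.+1%:R / 4) `^ (2 * s) <= _).
    rewrite powRM ?invr_ge0// -[4^-1](powR_inv1 (ler0n _ 4)) -powRrM mulN1r.
    by rewrite powRN.
  by rewrite ge0_ler_powR ?nnegrE ?divr_ge0 ?freq_ge//; lra.
- by move=> k; rewrite mulr_ge0 ?powR_ge0.
- by apply: bsumZ; [exact: powR_ge0|exact: bsum_powR].
Qed.

Lemma amgm (w r : R) : 0 < w -> `|r| <= w * r ^+ 2 + w^-1.
Proof.
move=> w0; rewrite -(ler_pM2l w0) mulrDr divff ?gt_eqF//.
rewrite -[r ^+ 2]real_normK ?num_real//; have := normr_ge0 r.
move: (`|r|) => t t0.
have -> : w * (w * t ^+ 2) = (w * t) ^+ 2 by ring.
have : 0 <= w * t by rewrite mulr_ge0// ltW.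
move: (w * t) => x x0; have := sqr_ge0 (x - 1); rewrite !expr2; nra.
Qed.

(** For s > 1/2 the weight is summable after inversion, so the arithmetic-geometric
    inequality makes the Fourier series absolutely convergent; its sum is
    continuous and inherits quasi-periodicity from the exponentials. *)
Lemma quasi_periodic_of_weight s f : 1 / 2 < s -> L2 I2pi f ->
  bsum (fun k => weight s k * abs2 (coef f k)) -> quasi_periodic phi f.
Proof.
move=> hs Lf bf; have t0 := @twopi_gt0 R; have t4 := @twopi_ge4 R.
pose c k := coef f k.
pose a k := if (k < 5)%N then 1 + abs2 (c k) else weight s k * abs2 (c k) + (weight s k)^-1.
have w0 k : 0 <= weight s k by exact: exprn_even_ge0.
have ba : bsum a.
  have b1 := bsumD bf (bsum_weight_inv hs).
  apply: (@bsum_near _ _ _ 5 _ _ b1).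
    by move=> k k5; rewrite /a ltnNge k5 /=.
  move=> k; rewrite addr_ge0 ?mulr_ge0 ?abs2_ge0//.
  by case: ifP => // _; rewrite invr_ge0.
have bnd k (r x : R) : r ^+ 2 <= abs2 (c k * ee phi k x) -> `|r| <= a k.
  rewrite abs2M abs2_eint => hr.
  have {}hr : r ^+ 2 <= abs2 (c k).
    by apply: le_trans hr _; rewrite ler_piMr ?abs2_ge0// invf_le1//; lra.
  rewrite /a; case: ltnP => k5.
    rewrite -[r ^+ 2]real_normK ?num_real// in hr.
    by have := sqr_ge0 (`|r| - 1); rewrite !expr2 in hr *; move: (`|r|) hr => t; nra.
  have wk : 0 < weight s k.
    rewrite exprn_gt0// powR_gt0//; apply: lt_le_trans (freq_ge k5).
    by rewrite divr_gt0.
  apply: le_trans (amgm r wk) _; rewrite lerD2r ler_wpM2l//.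
have ck k : ccont (fun x => c k * ee phi k x).
  by apply: ccontM; [exact: ccont_cst|exact: ccont_eint].
have [U cU hU] := @weierstrass_M R (fun k x => complex.Re (c k * ee phi k x)) a
  (fun k => (ck k).1) (fun k x => bnd k _ x (Re2_le _)) ba.
have [V cV hV] := @weierstrass_M R (fun k x => complex.Im (c k * ee phi k x)) a
  (fun k => (ck k).2) (fun k x => bnd k _ x (Im2_le _)) ba.
pose g x : R[i] := U x +i* V x.
have cg : ccont g by split; [exact: cU|exact: cV].
have pg x : ccvg (fun N => psum c N x) (g x).
  split; rewrite /partial_sum.
    by under eq_fun do rewrite cRe_sum; exact: hU.
  by under eq_fun do rewrite cIm_sum; exact: hV.
have g0 : g 0 = expi phi * g (2 * pi).
  have e1 N : psum c N 0 = expi phi * psum c N (2 * pi).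
    rewrite /partial_sum mulr_sumr; apply: eq_bigr => k _.
    by rewrite ee_2pi [RHS]mulrCA; congr (_ * _); rewrite mulrA expiVr mul1r.
  apply: ccvg_unique (pg 0) _; rewrite (funext e1).
  by apply: ccvgM; [exact: ccvg_cst|exact: pg].
have mg : cmeas I2pi g by exact: ccont_cmeas.
have mS N : L2 I2pi (psum c N) by apply: L2_psum => //; exact: L2_ee.
have Ld N : L2 I2pi (fun x => f x - psum c N x) by exact: L2B.
have small e : 0 < e -> (sqnorm I2pi (fun x => (f x - g x)%R) <= e%:E)%E.
  move=> e0.
  have /cvgrPdist_le/(_ _ e0)[N _ hN] := cvg_psum (@measurable_I2pi R) (L2_ee phi) (orthonormal_ee phi) (@complete_ee R phi) Lf.
  apply: (@sqnorm_lim _ _ _ (fun k x => f x - psum c (k + N) x)) => //.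
  - by move=> k; exact: L2_cmeas.
  - by apply: cmeasB => //; exact: L2_cmeas.
  - apply: aeT => x Dx; have h := pg x.
    have h' : ccvg (fun k => psum c (k + N) x) (g x).
      by have [h1 h2] := h; split; [exact: (cvg_shift N h1)|exact: (cvg_shift N h2)].
    have := ccvgD (ccvg_cst (f x)) (ccvgM (ccvg_cst (-1)) h').
    by rewrite mulN1r; under eq_fun do rewrite mulN1r.
  move=> k; rewrite sqnormE// lee_fin.
  by have := hN (k + N)%N (leq_addl _ _); rewrite sub0r normrN ger0_norm ?nsq_ge0.
have Lfg : L2 I2pi (fun x => f x - g x).
  apply: L2P; first by apply: cmeasB => //; exact: L2_cmeas.
  by apply: le_lt_trans (small 1 ltr01) _; rewrite ltry.
have z : nsq I2pi (fun x => f x - g x) = 0.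
  apply/eqP; rewrite eq_le nsq_ge0 andbT; apply/ler_addgt0Pr => e e0; rewrite add0r.
  by have := small e e0; rewrite sqnormE// lee_fin.
exists g; split => //; split.
- exact: continuous_subspaceT cg.1.
- exact: continuous_subspaceT cg.2.
- by have := nsq_eq0 (@measurable_I2pi R) Lfg z; apply: aeS => x h Dx; have /subr0_eq := h Dx.
Qed.

End Regularity.

(** * Domains of the operators and of their powers *)

Section Operators.
Context {R : realType}.
Local Notation mu := (@lebesgue_measure R).
Variable phi : R.
Hypothesis hphi : 0 <= phi < 2 * pi.
Local Notation freq := (frequency phi).
Local Notation coef f := (coef I2pi (ee phi) f).
Local Notation ext := (ext phi).
Local Hint Resolve measurable_I2pi : core.
Implicit Types (f g d : R -> R[i]).

Lemma open_I2pi : open (I2pi : set R). Proof. exact: interval_open. Qed.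

Lemma test_function_cmeas (D : set R) (psi : R -> R) : measurable D -> test_function D psi ->
  cmeas D (fun x => (psi x)%:C) /\ cmeas D (fun x => (derive1 psi x)%:C).
Proof.
move=> mD [d c _]; split; apply: cmeasC; last exact: continuous_measurable.
by apply: continuous_measurable => // x; apply: differentiable_continuous; apply/derivable1_diffP.
Qed.

Lemma is_weak_derivative_eqae f f' g : L2 I2pi f -> L2 I2pi f' -> f = f' %[ae mu in I2pi] ->
  is_weak_derivative I2pi f g -> is_weak_derivative I2pi f' g.
Proof.
move=> Lf Lf' ff' [_ lg w]; split => //; first by apply: L2_clocally => //; exact: open_I2pi.
move=> psi tp; rewrite -(w _ tp); have [m1 m2] := test_function_cmeas (@measurable_I2pi R) tp.
apply: ae_eq_cintegral => //.
- by apply: cmeasM => //; exact: L2_cmeas.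
- by apply: cmeasM => //; exact: L2_cmeas.
by move: ff'; apply: aeS => x h Dx; rewrite h.
Qed.

Lemma L2_test (psi : R -> R) K : continuous psi -> compact K ->
  (forall x, ~ K x -> psi x = 0) -> L2 setT (fun x => (psi x)%:C).
Proof.
move=> cp cK p0.
have [M hM] : exists M : R, K `<=` `[- M, M].
  have [M [_ hM]] := compact_bounded cK.
  exists (`|M| + 1) => x Kx.
  have M1 : M < `|M| + 1 by rewrite (le_lt_trans (ler_norm _)) ?ltrDl.
  by have := hM _ M1 x Kx; rewrite /= in_itv/= ler_norml.
have out x : ~~ (- M <= x <= M) -> psi x = 0.
  by move=> h; apply: p0 => /hM /=; rewrite in_itv/=; exact/negP.
have L1 : L2 `](- M - 1), (M + 1)[ (fun=> 1 : R[i]) by apply: ccont_L2; exact: ccont_cst.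
have h1 : - M - 1 < - M by lra.
have h2 : M < M + 1 by lra.
have := L2_cutoff h1 h2 cp out (@cmeas_cst R setT 1) L1.
by apply: L2_eqin => // x _; rewrite mulr1.
Qed.

Lemma is_weak_derivativeD f g f' g' : L2 setT f -> L2 setT g -> L2 setT f' -> L2 setT g' ->
  is_weak_derivative setT f g -> is_weak_derivative setT f' g' ->
  is_weak_derivative setT (fun x => f x + f' x) (fun x => g x + g' x).
Proof.
move=> Lf Lg Lf' Lg' [_ _ w] [_ _ w'].
split; [apply: L2_clocally|apply: L2_clocally|] => //; try exact: openT; try exact: L2D.
move=> psi tp; have [d c [K [cK _ p0]]] := tp.
have L1 : L2 setT (fun x => (psi x)%:C).
  apply: (fun h => L2_test h cK p0) => x.
  by apply: differentiable_continuous; apply/derivable1_diffP.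
have L2_ : L2 setT (fun x => (derive1 psi x)%:C).
  exact: (L2_test c cK (fun x => derive1_out cK p0 (x := x))).
have ci h (q : R -> R) : L2 setT h -> L2 setT (fun x => (q x)%:C) ->
    cint setT (fun x => h x * (q x)%:C).
  move=> Lh Lq; apply: (@eq_cint _ _ _ (fun x => h x * ((q x)%:C)^*)) => //.
    by move=> x _; rewrite conjCC.
  exact: cint_mulJ.
transitivity (cintegral setT (fun x => f x * (derive1 psi x)%:C) +
  cintegral setT (fun x => f' x * (derive1 psi x)%:C)).
  rewrite -cintegralD//; [|exact: ci|exact: ci].
  by apply: eq_cintegral => x _; rewrite mulrDl.
rewrite w// w'// -opprD -cintegralD//; [|exact: ci|exact: ci].
by congr (- _); apply: eq_cintegral => x _; rewrite mulrDl.
Qed.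

Let chi : R -> R := cutoff (- 3) (2 * pi + 3) 1.
Let chi1 : R -> R := cutoff1 (- 3) (2 * pi + 3) 1.
Let chi2 : R -> R := cutoff2 (- 3) (2 * pi + 3) 1.

Let p3 : - (2 * pi) < - 3 :> R. Proof. by have := @twopi_ge4 R; lra. Qed.
Let q3 : 2 * pi + 3 < 2 * (2 * pi) :> R. Proof. by have := @twopi_ge4 R; lra. Qed.

Lemma chi_I x : I2pi x -> chi x = 1 /\ chi1 x = 0.
Proof.
move=> /I2piP /andP[h1 h2]; have t4 := @twopi_ge4 R; split.
  by apply: cutoff_in => //; apply/andP; split; lra.
rewrite /chi1 cutoff1E//; last lra.
apply/eqP; rewrite subr_eq0; apply/eqP.
have -> : cutoffL (-3) 1 x = 0.
  by apply/eqP; apply/negP => /negP /(cutoffL_supp ltr01) /andP[_ h]; lra.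
by apply/esym/eqP; apply/negP => /negP /(cutoffR_supp ltr01) /andP[h _]; lra.
Qed.

Let out1 x : ~~ (- 3 <= x <= 2 * pi + 3) -> chi x = 0 /\ chi1 x = 0.
Proof. by move=> h; apply: cutoff_out => //; apply: contra h => /andP[/ltW -> /ltW ->]. Qed.

Let out2 x : ~~ (- 3 <= x <= 2 * pi + 3) -> chi1 x = 0 /\ chi2 x = 0.
Proof.
move=> h; split; first exact: (out1 h).2.
move: h; rewrite negb_and -!ltNge => /orP[h|h]; rewrite /chi2 /cutoff2.
  have [h1 h2] := @sstep_le0 R ((x - -3) / 1) ltac:(by rewrite divr1; lra).
  by rewrite h1 /cutoffL h2 !(mulr0, mul0r) /sstep2 /ramp !max_l; lra.
have [h1 h2] := @sstep_le0 R ((2 * pi + 3 - x) / 1) ltac:(by rewrite divr1; lra).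
rewrite h1 /cutoffR h2 !(mulr0, mul0r) subr0 add0r.
by rewrite /sstep2 /ramp !max_l; lra.
Qed.

Section Pair.
Variables f d : R -> R[i].
Hypothesis Lf : L2 I2pi f.
Hypothesis Ld : L2 I2pi d.
Hypothesis dk : forall k, coef d k = 'i * (freq k)%:C * coef f k.

Let mf := cmeas_ext phi (L2_cmeas Lf).
Let md := cmeas_ext phi (L2_cmeas Ld).

(** A cutoff of the quasi-periodic extension: a function on the line that extends f. *)
Definition cutext (eta : R -> R) f x : R[i] := (eta x)%:C * ext f x.

Lemma L2_cutext eta g : L2 I2pi g -> continuous eta ->
  (forall x, ~~ (- 3 <= x <= 2 * pi + 3) -> eta x = 0) -> L2 setT (cutext eta g).
Proof.
by move=> Lg ce e0; apply: (L2_cutoff p3 q3 ce e0 (cmeas_ext phi (L2_cmeas Lg)) (L2_ext phi Lg)).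
Qed.

Lemma weak_cutext : is_weak_derivative setT (cutext chi f) (fun x => cutext chi1 f x + cutext chi d x).
Proof.
apply: (weak_cutoff p3 q3 (is_derive_cutoff _ _ _) (@continuous_cutoff1 R _ _ _) _ mf md
  (L2_ext phi Lf) (L2_ext phi Ld)); last exact: cweak_ext.
exact: out1.
Qed.

Lemma weak_cutext1 : is_weak_derivative setT (cutext chi1 f) (fun x => cutext chi2 f x + cutext chi1 d x).
Proof.
apply: (weak_cutoff p3 q3 (is_derive_cutoff1 _ _ _) (@continuous_cutoff2 R _ _ _) _ mf md
  (L2_ext phi Lf) (L2_ext phi Ld)); last exact: cweak_ext.
exact: out2.
Qed.

Lemma cutext_I x : I2pi x -> cutext chi f x = f x.
Proof. by move=> Ix; rewrite /cutext (chi_I Ix).1 mul1r ext_in. Qed.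

Lemma weak_I2pi : is_weak_derivative I2pi f d.
Proof.
have L0 : L2 setT (cutext chi f).
  by apply: L2_cutext => //; [exact: continuous_cutoff|move=> x h; exact: (out1 h).1].
have L1 : L2 setT (fun x => cutext chi1 f x + cutext chi d x).
  apply: L2D => //; apply: L2_cutext => //.
  - exact: continuous_cutoff1.
  - by move=> x h; exact: (out1 h).2.
  - exact: continuous_cutoff.
  - by move=> x h; exact: (out1 h).1.
have w := is_weak_derivative_restrict (@measurable_I2pi R) open_I2pi L0 L1 weak_cutext Lf
  (aeT (fun x Ix => cutext_I Ix)).
have [l1 l2 w'] := w; split => //; first by apply: L2_clocally => //; exact: open_I2pi.
move=> psi tp; rewrite (w' _ tp); congr (- _); apply: eq_cintegral => x; rewrite inE => Ix.
by rewrite /cutext (chi_I Ix).1 (chi_I Ix).2 mul0r add0r mul1r ext_in.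
Qed.
End Pair.

Lemma derivative_coef f : bsum (fun k => freq k ^+ 2 * abs2 (coef f k)) ->
  exists2 d, L2 I2pi d & forall k, coef d k = 'i * (freq k)%:C * coef f k.
Proof.
move=> b; have b' : bsum (fun k => abs2 ('i * (freq k)%:C * coef f k)).
  by apply: bsum_le b => k; rewrite !abs2M abs2_i abs2C mul1r.
have [d [Ld dk _]] := riesz_fischer (@measurable_I2pi R) (L2_ee phi) (orthonormal_ee phi) b'.
by exists d.
Qed.

Lemma truncn_nat n : Num.truncn (n%:R : R) = n.
Proof. by apply: truncn_def; rewrite lexx ltr_nat ltnS leqnn. Qed.

Lemma Hs1P f : L2 I2pi f -> bsum (fun k => freq k ^+ 2 * abs2 (coef f k)) -> Hs I2pi 1 f.
Proof.
move=> Lf b; have [d Ld dk] := derivative_coef b.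
split => //; exists (cutext chi f); split; last by apply: aeT => x; exact: cutext_I.
exists (fun j => if j is 0%N then cutext chi f else fun x => cutext chi1 f x + cutext chi d x).
rewrite /= (truncn_nat 1) subrr; split => //.
- case=> [|[|//]] _.
    by apply: L2_cutext => //; [exact: continuous_cutoff|move=> x h; exact: (out1 h).1].
  apply: L2D => //; apply: L2_cutext => //.
  + exact: continuous_cutoff1.
  + by move=> x h; exact: (out1 h).2.
  + exact: continuous_cutoff.
  + by move=> x h; exact: (out1 h).1.
- by case=> // _; exact: weak_cutext.
- by rewrite ltxx.
Qed.

Lemma Hs2P f d : L2 I2pi f -> L2 I2pi d ->
  (forall k, coef d k = 'i * (freq k)%:C * coef f k) ->
  bsum (fun k => freq k ^+ 2 * abs2 (coef d k)) -> Hs I2pi 2 f.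
Proof.
move=> Lf Ld dk b; have [e Le ek] := derivative_coef b.
split => //; exists (cutext chi f); split; last by apply: aeT => x; exact: cutext_I.
have c0 := @continuous_cutoff R (-3) (2 * pi + 3) 1.
have c1 := @continuous_cutoff1 R (-3) (2 * pi + 3) 1.
have c2 := @continuous_cutoff2 R (-3) (2 * pi + 3) 1.
have L0 g : L2 I2pi g -> L2 setT (cutext chi g).
  by move=> Lg; apply: L2_cutext => // x h; exact: (out1 h).1.
have L1 g : L2 I2pi g -> L2 setT (cutext chi1 g).
  by move=> Lg; apply: L2_cutext => // x h; exact: (out1 h).2.
have L2_ g : L2 I2pi g -> L2 setT (cutext chi2 g).
  by move=> Lg; apply: L2_cutext => // x h; exact: (out2 h).2.
have La : L2 setT (fun x => cutext chi1 f x + cutext chi d x) by apply: L2D => //; [exact: L1|exact: L0].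
have Lb : L2 setT (fun x => cutext chi2 f x + cutext chi1 d x) by apply: L2D => //; [exact: L2_|exact: L1].
have Lc : L2 setT (fun x => cutext chi1 d x + cutext chi e x) by apply: L2D => //; [exact: L1|exact: L0].
exists (fun j => match j with 0%N => cutext chi f | 1%N => fun x => cutext chi1 f x + cutext chi d x
  | _ => fun x => cutext chi2 f x + cutext chi1 d x + (cutext chi1 d x + cutext chi e x) end).
rewrite /= (truncn_nat 2) subrr; split => //.
- case=> [|[|[|//]]] _; [exact: L0|exact: La|exact: L2D].
- case=> [|[|//]] _; first exact: weak_cutext.
  apply: is_weak_derivativeD => //; [exact: L1|exact: L0|exact: weak_cutext1|exact: weak_cutext].
- by rewrite ltxx.
Qed.

Lemma Hs1_weak f : Hs I2pi 1 f -> exists F, L2 I2pi F /\ is_weak_derivative I2pi f F.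
Proof.
move=> [Lf [G [[F [F0 L w _]] Gf]]]; rewrite (truncn_nat 1) in L w.
have mI := @measurable_I2pi R; have L1 := L 1%N isT.
exists (F 1%N); split; first exact: (L2_sub mI measurableT (@subsetT _ _) L1).
rewrite -F0 in Gf.
exact: (is_weak_derivative_restrict mI open_I2pi (L 0%N isT) L1 (w 0%N isT) Lf Gf).
Qed.

Lemma Hs2_weak f : Hs I2pi 2 f -> exists F F', [/\ L2 I2pi F, L2 I2pi F',
  is_weak_derivative I2pi f F & is_weak_derivative I2pi F F'].
Proof.
move=> [Lf [G [[F [F0 L w _]] Gf]]]; rewrite (truncn_nat 2) in L w.
have mI := @measurable_I2pi R; have L1 := L 1%N isT; have L2_ := L 2%N isT.
have LI := L2_sub mI measurableT (@subsetT _ _) L1.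
have ae1 : F 1%N = F 1%N %[ae mu in I2pi] by exact: aeT.
rewrite -F0 in Gf.
exists (F 1%N), (F 2%N); split; [exact: LI| | |].
- exact: (L2_sub mI measurableT (@subsetT _ _) L2_).
- exact: (is_weak_derivative_restrict mI open_I2pi (L 0%N isT) L1 (w 0%N isT) Lf Gf).
- exact: (is_weak_derivative_restrict mI open_I2pi L1 L2_ (w 1%N isT) LI ae1).
Qed.

Lemma quasi_periodic_eqae f g : f = g %[ae mu in I2pi] -> quasi_periodic phi f -> quasi_periodic phi g.
Proof.
move=> fg [h [[c1 c2 hf] h0]]; exists h; split => //; split => //.
by move: hf fg; apply: aeS2 => x h1 h2 Dx; rewrite h1// h2.
Qed.

Lemma wderiv_L2 f F : L2 I2pi F -> is_weak_derivative I2pi f F ->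
  L2 I2pi (wderiv I2pi f) /\ wderiv I2pi f = F %[ae mu in I2pi].
Proof.
move=> LF w; have [[_ [[m1 _ _] [m2 _ _]] _] e] := wderivP w; split => //.
by apply: L2_eqae LF _ _ => //; move: e; apply: aeS => x h Dx; rewrite h.
Qed.

Lemma weak_coef_I f F k : L2 I2pi f -> L2 I2pi F -> is_weak_derivative I2pi f F ->
  quasi_periodic phi f -> coef F k = 'i * (freq k)%:C * coef f k.
Proof. by move=> Lf LF w q; apply: weak_coef => //; exact: is_weak_derivative_cweak. Qed.

Lemma bsum_coef_ee f : L2 I2pi f -> bsum (fun k => abs2 (coef f k)).
Proof. by move=> Lf; exact: (bsum_coef (@measurable_I2pi R) (L2_ee phi) (orthonormal_ee phi)). Qed.

(** Weak derivatives act on the coefficients through the frequencies; conversely a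
    sequence with the right decay defines, by Riesz-Fischer, a function whose
    extension is weakly differentiable. *)
Lemma opP_dom : op_dom (opP phi) =
  [set f | L2 I2pi f /\ bsum (fun k => (- freq k) ^+ 2 * abs2 (coef f k))].
Proof.
apply/seteqP; split => f /=.
  move=> [hs q]; have Lf := hs.1; have [F [LF w]] := Hs1_weak hs; split => //.
  apply: bsum_le (bsum_coef_ee LF) => k.
  by rewrite (weak_coef_I k Lf LF w q) !abs2M abs2_i abs2C mul1r sqrrN.
move=> [Lf b]; have b' : bsum (fun k => freq k ^+ 2 * abs2 (coef f k)).
  by apply: bsum_le b => k; rewrite sqrrN.
split; first exact: Hs1P.
apply: (@quasi_periodic_of_weight _ _ hphi 1) => //; first lra.
by apply: bsum_le b' => k; rewrite /weight powRr1// real_normK ?num_real.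
Qed.

Lemma opP_app f : op_dom (opP phi) f -> L2 I2pi (op_app (opP phi) f) /\
  forall k, coef (op_app (opP phi) f) k = (- freq k)%:C * coef f k.
Proof.
move=> [hs q]; have Lf := hs.1; have [F [LF w]] := Hs1_weak hs.
have [Lw e] := wderiv_L2 LF w; split => [|k]; first exact: L2Z.
rewrite coef_scale//; last exact: L2_ee.
rewrite (coef_eqae (@measurable_I2pi R) (L2_ee phi) k Lw LF e) (weak_coef_I k Lf LF w q).
by rewrite !mulrA i2 mulN1r realCN.
Qed.

Lemma opA_dom : op_dom (opA phi) =
  [set f | L2 I2pi f /\ bsum (fun k => (freq k ^+ 2) ^+ 2 * abs2 (coef f k))].
Proof.
apply/seteqP; split => f /=.
  move=> [hs q q']; have Lf := hs.1; have [F [F' [LF LF' w w']]] := Hs2_weak hs; split => //.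
  have [Lw e] := wderiv_L2 LF w.
  apply: bsum_le (bsum_coef_ee LF') => k.
  rewrite (weak_coef_I k LF LF' w' (quasi_periodic_eqae e q')) (weak_coef_I k Lf LF w q).
  by rewrite !abs2M abs2_i abs2C !mul1r mulrA -expr2.
move=> [Lf b]; have b' : bsum (fun k => freq k ^+ 2 * abs2 (coef f k)).
  apply: bsum_le (bsumD (bsum_coef_ee Lf) b) => k.
  rewrite -[X in X + _]mul1r -mulrDl ler_wpM2r ?abs2_ge0//.
  by have := sqr_ge0 (freq k ^+ 2 - 1); have := sqr_ge0 (freq k); move: (freq k ^+ 2) => x; rewrite !expr2; nra.
have [d Ld dk] := derivative_coef b'.
have w := weak_I2pi Lf Ld dk; have [Lw e] := wderiv_L2 Ld w.
have w1 k : weight phi 1 k = freq k ^+ 2 by rewrite /weight powRr1// real_normK ?num_real.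
have b2 : bsum (fun k => freq k ^+ 2 * abs2 (coef d k)).
  apply: bsum_le b => k; rewrite dk !abs2M abs2_i abs2C mul1r mulrA -expr2//.
split.
- exact: Hs2P dk b2.
- apply: (@quasi_periodic_of_weight _ _ hphi 1) => //; first lra.
  by apply: bsum_le b' => k; rewrite w1.
- apply: (@quasi_periodic_eqae d); first by move: e; apply: aeS => x h Dx; rewrite h.
  apply: (@quasi_periodic_of_weight _ _ hphi 1) => //; first lra.
  by apply: bsum_le b2 => k; rewrite w1.
Qed.

Lemma opA_app f : op_dom (opA phi) f -> L2 I2pi (op_app (opA phi) f) /\
  forall k, coef (op_app (opA phi) f) k = (freq k ^+ 2)%:C * coef f k.
Proof.
move=> [hs q q']; have Lf := hs.1; have [F [F' [LF LF' w w']]] := Hs2_weak hs.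
have [Lw e] := wderiv_L2 LF w.
have e' : F = wderiv I2pi f %[ae mu in I2pi] by move: e; apply: aeS => x h Dx; rewrite h.
have [Lww ee_] := wderiv_L2 LF' (is_weak_derivative_eqae LF Lw e' w').
split => [|k]; first exact: L2N.
have -> : op_app (opA phi) f = (fun x => (-1) * wderiv I2pi (wderiv I2pi f) x).
  by apply/funext => x /=; rewrite mulN1r.
rewrite coef_scale//; last exact: L2_ee.
rewrite (coef_eqae (@measurable_I2pi R) (L2_ee phi) k Lww LF' ee_).
rewrite (weak_coef_I k LF LF' w' (quasi_periodic_eqae e q')) (weak_coef_I k Lf LF w q).
rewrite expr2 realCM !mulrA; congr (_ * _).
by transitivity (- ('i * 'i) * (freq k)%:C * (freq k)%:C); [ring|rewrite i2 opprK mul1r].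
Qed.

Lemma measurable_norm_powR (s : R) : measurable_fun setT (fun x : R => `|x| `^ s).
Proof. by apply: measurableT_comp (measurable_powR s) _; exact: normr_measurable. Qed.

(** Immediate from [functional_calculus_dom] once the action on the coefficients
    is known. *)
Lemma op_abs_pow_dom s : op_dom (op_abs_pow I2pi (opP phi) s) =
  [set f | L2 I2pi f /\ bsum (fun k => weight phi s k * abs2 (coef f k))].
Proof.
rewrite /op_abs_pow (functional_calculus_dom (@measurable_I2pi R) (L2_ee phi)
  (orthonormal_ee phi) (@complete_ee R phi) opP_dom opP_app (@measurable_norm_powR s)).
by apply/seteqP; split => f /= [Lf b]; split => //; apply: bsum_le b => k;
  rewrite normrN.
Qed.

(** The eigenvalues of A are the squares of the frequencies, so that the power
    s / 2 gives back the weight of |P|^s. *)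
Lemma op_pow_dom s : op_dom (op_pow I2pi (opA phi) (s / 2)) =
  [set f | L2 I2pi f /\ bsum (fun k => weight phi s k * abs2 (coef f k))].
Proof.
rewrite /op_pow (functional_calculus_dom (@measurable_I2pi R) (L2_ee phi)
  (orthonormal_ee phi) (@complete_ee R phi) opA_dom opA_app (measurable_powR (s / 2))).
have E k : (freq k ^+ 2) `^ (s / 2) = `|freq k| `^ s.
  rewrite -real_normK ?num_real// -powR_mulrn// -powRrM; congr (_ `^ _); by field.
by apply/seteqP; split => f /= [Lf b]; split => //; apply: bsum_le b => k; rewrite /weight E.
Qed.

End Operators.

(** * The fractional kernel *)

Section NonnegIntegral.
Context {R : realType}.
Local Notation mu := (@lebesgue_measure R).
Implicit Types (u v : R -> R) (D E : set R).

(** Integrals of nonnegative real functions, possibly infinite; the real-valued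
    integrand keeps the pointwise estimates in the real field. *)
Definition ipos D u : \bar R := (\int[mu]_(x in D) (u x)%:E)%E.

Lemma ipos_ge0 D u : (forall x, D x -> 0 <= u x) -> (0 <= ipos D u)%E.
Proof. by move=> u0; apply: integral_ge0 => x Dx; rewrite lee_fin u0. Qed.

Lemma ipos_le D u v : measurable D -> measurable_fun D u -> measurable_fun D v ->
  (forall x, D x -> 0 <= u x <= v x) -> (ipos D u <= ipos D v)%E.
Proof.
move=> mD m1 m2 uv; apply: ge0_le_integral => //.
- by move=> x /uv /andP[]; rewrite lee_fin.
- exact/measurable_EFinP.
- exact/measurable_EFinP.
- by move=> x /uv /andP[]; rewrite lee_fin.
Qed.

Lemma eq_ipos D u v : (forall x, D x -> u x = v x) -> ipos D u = ipos D v.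
Proof. by move=> uv; apply: eq_integral => x; rewrite inE => /uv ->. Qed.

Lemma iposD D u v : measurable D -> measurable_fun D u -> measurable_fun D v ->
  (forall x, D x -> 0 <= u x) -> (forall x, D x -> 0 <= v x) ->
  (ipos D (fun x => (u x + v x)%R) = ipos D u + ipos D v)%E.
Proof.
move=> mD m1 m2 u0 v0; rewrite /ipos -ge0_integralD//; exact/measurable_EFinP.
Qed.

Lemma iposZ D u (k : R) : measurable D -> measurable_fun D u -> 0 <= k ->
  (forall x, D x -> 0 <= u x) -> (ipos D (fun x => (k * u x)%R) = k%:E * ipos D u)%E.
Proof.
move=> mD m1 k0 u0; rewrite /ipos -ge0_integralZl//; exact/measurable_EFinP.
Qed.

Lemma ipos_sub D E u : measurable D -> measurable E -> D `<=` E ->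
  measurable_fun E u -> (forall x, E x -> 0 <= u x) -> (ipos D u <= ipos E u)%E.
Proof.
move=> mD mE DE m1 u0; by apply: ge0_subset_integral => //; exact/measurable_EFinP.
Qed.

Lemma ipos_cst (a b k : R) : a <= b -> ipos `]a, b[ (fun=> k) = (k * (b - a))%:E.
Proof.
move=> ab; have e : mu `]a, b[%classic = (b - a)%:E.
  rewrite lebesgue_measure_itv/= lte_fin; case: ltP => // ba.
  by rewrite (le_anti (introT andP (conj ab ba))) subrr.
have mI : measurable (`]a, b[%classic : set R) by exact: measurable_itv.
transitivity (k%:E * mu `]a, b[%classic)%E; first exact: (integral_cst mu mI k%:E).
by rewrite e.
Qed.

Lemma ipos_split u (a b c : R) : a <= b -> b <= c -> measurable_fun setT u ->
  (forall x, 0 <= u x) -> (ipos `]a, c[ u = ipos `]a, b[ u + ipos `]b, c[ u)%E.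
Proof.
move=> ab bc m1 u0; by apply: ge0_integral_itv_split => //; exact/measurable_EFinP.
Qed.

Lemma ipos_scale u (p q c : R) : 0 < c -> measurable_fun setT u -> (forall x, 0 <= u x) ->
  (c%:E * ipos `]p, q[ (fun x => u (c * x)%R) = ipos `](c * p)%R, (c * q)%R[ u)%E.
Proof.
move=> c0 m1 u0; apply: (@integral_scale_itv _ (fun x => (u x)%:E)) => //.
by apply: measurable_funTS; exact/measurable_EFinP.
Qed.

Lemma ipos_exhaust (F : nat -> set R) u (M : R) : (forall n, measurable (F n)) ->
  (forall m n, (m <= n)%N -> F m `<=` F n) -> measurable_fun setT u ->
  (forall x, 0 <= u x) -> (forall n, (ipos (F n) u <= M%:E)%E) ->
  (ipos (\bigcup_n F n) u <= M%:E)%E.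
Proof.
move=> mF nF m1 u0 hM.
have mE : measurable_fun setT (fun x => (u x)%:E) by exact/measurable_EFinP.
have c : (\int[mu]_(x in F i) (u x)%:E)%E @[i --> \oo] -->
    (\int[mu]_(x in \bigcup_i F i) (u x)%:E)%E.
  apply: ge0_nondecreasing_set_cvg_integral => //.
  - by move=> m n mn; apply/subsetPset; exact: nF.
  - by move=> n; exact: measurable_funTS.
  - by move=> n x _; rewrite lee_fin.
rewrite /ipos -(cvg_lim _ c)//; apply: lime_le; first by apply/cvg_ex; eexists; exact: c.
by apply: nearW => n; exact: hM.
Qed.

(** Monotone convergence along intervals that exhaust ]0, b[ from the left end. *)
Lemma ipos_exhaust0 u (q M : R) : 0 <= M -> measurable_fun setT u -> (forall x, 0 <= u x) ->
  (forall d, 0 < d < q -> (ipos `]d, q[ u <= M%:E)%E) -> (ipos `]0%R, q[ u <= M%:E)%E.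
Proof.
move=> M0 m1 u0 hM; pose F n : set R := `]n.+1%:R^-1, q[%classic.
have -> : `]0, q[%classic = \bigcup_n F n.
  apply/seteqP; split => x /=; rewrite in_itv/=.
    move=> /andP[x0 xq]; have [N _ hN] := near_invS x0.
    by exists N => //; rewrite /F /= in_itv/= xq andbT; exact: (hN N (leqnn N)).
  move=> [n _]; rewrite /F /= in_itv/= => /andP[h ->]; rewrite andbT.
  by apply: lt_trans h; rewrite invr_gt0.
apply: ipos_exhaust => //.
- by move=> n; exact: measurable_itv.
- move=> m n mn x; rewrite /F /= !in_itv/= => /andP[h ->]; rewrite andbT.
  by apply: le_lt_trans h; rewrite lef_pV2 ?posrE// ler_nat.
move=> n; have [h|h] := ltP (n.+1%:R^-1 : R) q.
  by apply: hM; rewrite h invr_gt0 ltr0n.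
by rewrite /F set_itv_ge ?bnd_simp -?leNgt// /ipos integral_set0 lee_fin.
Qed.

Lemma ipos_exhaust_oo u (M : R) : measurable_fun setT u -> (forall x, 0 <= u x) ->
  (forall a b, 0 < a < b -> (ipos `]a, b[ u <= M%:E)%E) -> (ipos `]0%R, +oo[ u <= M%:E)%E.
Proof.
move=> m1 u0 hM; pose F n : set R := `]n.+2%:R^-1, n.+2%:R[%classic.
have -> : `]0, +oo[%classic = \bigcup_n F n.
  apply/seteqP; split => x /=; rewrite in_itv/= ?andbT.
    move=> x0; have [N _ hN] := near_invS x0.
    have [N' hN'] : exists N' : nat, x < N'%:R.
      by exists (Num.truncn x).+1; exact: truncnS_gt.
    exists (maxn N N') => //; rewrite /F /= in_itv/=; apply/andP; split.
      apply: (lt_trans _ (hN N (leqnn N))).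
      by rewrite ltf_pV2 ?posrE// ltr_nat; have := leq_maxl N N'; lia.
    by apply: lt_le_trans hN' _; rewrite ler_nat; have := leq_maxr N N'; lia.
  by move=> [n _]; rewrite /F /= in_itv/= => /andP[h _]; apply: lt_trans h; rewrite invr_gt0.
apply: ipos_exhaust => //.
- by move=> n; exact: measurable_itv.
- move=> m n mn x; rewrite /F /= !in_itv/= => /andP[h1 h2]; apply/andP; split.
    by apply: le_lt_trans h1; rewrite lef_pV2 ?posrE// ler_nat.
  by apply: lt_le_trans h2 _; rewrite ler_nat.
move=> n; apply: hM; rewrite invr_gt0 ltr0n/=.
apply: lt_le_trans (_ : 1 <= _); last by rewrite ler1n.
by rewrite invf_lt1// ltr1n.
Qed.

Lemma integral_powR (a b p : R) : 0 < a -> a < b -> p + 1 != 0 ->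
  ipos `]a, b[ (fun t => t `^ p) = ((b `^ (p + 1) - a `^ (p + 1)) / (p + 1))%:E.
Proof.
move=> a0 ab p1.
have dF (x : R) : 0 < x -> is_derive x 1 (fun t : R => (p + 1)^-1 * t `^ (p + 1)) (x `^ p).
  move=> x0; have h := is_derive1_powR (p + 1) x0.
  by apply: is_derive_eq; rewrite /GRing.scale /= mulrA mulVf// mul1r addrK.
have cf (x : R) : 0 < x -> {for x, continuous (fun t : R => t `^ p)}.
  by move=> x0; exact: is_derive_cont (is_derive1_powR p x0).
have pos x : a <= x -> 0 < x by exact: lt_le_trans.
have mp : measurable_fun setT (fun t : R => (t `^ p)%:E).
  by apply/measurable_EFinP; exact: measurable_powR.
rewrite /ipos integral_itv_bndo_bndc ?integral_itv_obnd_cbnd; try exact: measurable_funTS.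
have := @continuous_FTC2 R (fun t => t `^ p) (fun t => (p + 1)^-1 * t `^ (p + 1)) a b ab.
rewrite -EFinB -mulrBr mulrC; apply.
- apply: continuous_in_subspaceT => x; rewrite inE/= in_itv/= => /andP[h _].
  exact/cf/pos.
- split.
  + by move=> x; rewrite in_itv/= => /andP[/ltW/pos h _]; have [] := dF x h.
  + by apply: cvg_at_right_filter; exact: is_derive_cont (dF _ a0).
  + by apply: cvg_at_left_filter; exact: is_derive_cont (dF _ (lt_trans a0 ab)).
- move=> x; rewrite in_itv/= => /andP[/ltW/pos h _].
  by rewrite derive1E; have [_ ->] := dF x h.
Qed.

End NonnegIntegral.

Section Kernel.
Context {R : realType}.
Local Notation mu := (@lebesgue_measure R).
Implicit Types (s t h a : R).

(** The weight of the Gagliardo seminorm once the integral is written in terms of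
    the increment h = |x - y|. *)
Definition wt s h : R := h `^ (- (1 + 2 * s)).

Lemma wt_ge0 s h : 0 <= wt s h. Proof. exact: powR_ge0. Qed.
Lemma measurable_wt s (D : set R) : measurable_fun D (wt s).
Proof. by apply: measurable_funTS; exact: measurable_powR. Qed.

(** A common upper bound of |e^(it) - 1|^2 for small and for large t. *)
Definition quad t : R := Num.min (t ^+ 2) 4.

Lemma quad_ge0 t : 0 <= quad t. Proof. by rewrite le_min sqr_ge0/=. Qed.
Lemma measurable_quad (D : set R) : measurable_fun D quad.
Proof.
by apply: measurable_funTS; apply: measurable_minr => //; exact: measurable_funX.
Qed.

Lemma powRD_gt0 (x r s : R) : 0 < x -> x `^ (r + s) = x `^ r * x `^ s.
Proof. by move=> x0; apply: powRD; apply/implyP => _; rewrite gt_eqF. Qed.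

Lemma ipos_quad s : 0 < s < 1 -> exists2 C, 0 <= C & (ipos `]0%R, +oo[ (fun t => (quad t * wt s t)%R) <= C%:E)%E.
Proof.
move=> /andP[s0 s1].
have mq D : measurable_fun D (fun t => quad t * wt s t).
  by apply: measurable_funM; [exact: measurable_quad|exact: measurable_wt].
have q0 t : 0 <= quad t * wt s t by rewrite mulr_ge0 ?quad_ge0 ?wt_ge0.
have c1 : 0 <= (2 - 2 * s)^-1 by rewrite invr_ge0; lra.
have c2 : 0 <= (2 * s)^-1 by rewrite invr_ge0; lra.
exists ((2 - 2 * s)^-1 + 4 * (2 * s)^-1); first by rewrite addr_ge0// mulr_ge0.
apply: ipos_exhaust_oo => // a b /andP[a0 ab].
pose a' := Num.min a (1 / 2); pose b' := Num.max b 2.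
have a'0 : 0 < a' by rewrite lt_min a0/=; lra.
have a'1 : a' < 1 by rewrite gt_min; apply/orP; right; lra.
have b'1 : 1 < b' by rewrite lt_max; apply/orP; right; lra.
apply: (@le_trans _ _ (ipos `]a', b'[ (fun t => quad t * wt s t))).
  apply: ipos_sub => //; try exact: measurable_itv.
  move=> x /=; rewrite !in_itv/= => /andP[h1 h2]; apply/andP; split.
    by rewrite gt_min h1.
  by rewrite lt_max h2.
rewrite (@ipos_split _ _ _ 1)//; [|exact: ltW|exact: ltW].
rewrite EFinD; apply: leeD.
  apply: (@le_trans _ _ (ipos `]a', 1[ (fun t => t `^ (1 - 2 * s)))).
    apply: ipos_le => //.
      by apply: measurable_funTS; exact: measurable_powR.
    move=> t; rewrite /= in_itv/= => /andP[ha t1]; rewrite q0/=.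
    have t0 : 0 < t by exact: lt_trans ha.
    apply: le_trans (_ : t ^+ 2 * wt s t <= _).
      by rewrite ler_wpM2r ?wt_ge0// ge_min lexx.
    rewrite -powR_mulrn ?(ltW t0)// /wt -powRD_gt0//.
    by rewrite le_eqVlt; apply/orP; left; apply/eqP; congr (_ `^ _); ring.
  rewrite integral_powR//; last by apply/eqP; lra.
  rewrite lee_fin powR1 (_ : 1 - 2 * s + 1 = 2 - 2 * s); last by ring.
  by rewrite ler_piMl// gerBl powR_ge0.
apply: (@le_trans _ _ (ipos `]1, b'[ (fun t => 4 * wt s t))).
  apply: ipos_le => //.
    by apply: measurable_funM => //; exact: measurable_wt.
  by move=> t _; rewrite q0/= ler_wpM2r ?wt_ge0// ge_min lexx orbT.
rewrite iposZ//; [|exact: measurable_wt|by move=> *; exact: wt_ge0].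
rewrite integral_powR//; last by apply/eqP; lra.
rewrite -EFinM lee_fin ler_wpM2l// powR1 (_ : - (1 + 2 * s) + 1 = - (2 * s)); last by ring.
by rewrite invrN mulrN -mulNr opprB ler_piMl// gerBl powR_ge0.
Qed.

Lemma abs2_expiB1 t : abs2 (expi t - 1) = 2 - 2 * cos t.
Proof.
rewrite /abs2 /expi !ReImE /=.
have := cos2Dsin2 t; move: (cos t) (sin t) => c d; rewrite !expr2 => h; lra.
Qed.

Lemma abs2_expiB1_norm (t h : R) : abs2 (expi (t * h) - 1) = abs2 (expi (`|t| * h) - 1).
Proof.
rewrite !abs2_expiB1; case: (ger0P t) => // _.
by rewrite mulNr cosN.
Qed.

Lemma abs2_expiB1_le t : 0 <= t -> abs2 (expi t - 1) <= quad t.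
Proof.
move=> t0; rewrite le_min; apply/andP; split; last first.
  by rewrite abs2_expiB1; have := cos_geN1 t; lra.
have mI : measurable (`]0, t[%classic : set R) by exact: measurable_itv.
have n1 (f : R -> R[i]) : (forall x, abs2 (f x) = 1) -> nsq `]0, t[ f = t.
  move=> hf; rewrite /nsq (_ : (fun x => abs2 (f x)) = cst 1); last exact/funext.
  have := @ipos_cst R 0 t 1 t0; rewrite /ipos mul1r subr0 => h.
  by rewrite /Rintegral h.
have cf : ccont (fun x : R => 'i * (1 : R)%:C * expi (1 * x)).
  by apply: ccontM; [exact: ccont_cst|exact: ccont_expi].
have := cFTC t0 (cderiv_expi 1) cf; rewrite !mul1r expi0 => <-.
have L1 : L2 `]0, t[ (fun=> 1 : R[i]) by apply: ccont_L2; exact: ccont_cst.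
have Lf : L2 `]0, t[ (fun x : R => 'i * (1 : R)%:C * expi (1 * x)) by exact: ccont_L2.
have := inner_le mI Lf L1; rewrite !n1 -?expr2.
- rewrite /inner (_ : cintegral _ _ = cintegral `]0, t[ (fun x : R => 'i * (1 : R)%:C * expi (1 * x)))//.
  by apply: eq_cintegral => x _; rewrite conjC1 mulr1.
- by move=> x; rewrite abs2C expr1n.
- by move=> x; rewrite !abs2M abs2_i abs2_expi abs2C expr1n !mulr1.
Qed.

(** The multiplier by which the energy acts on a coefficient of frequency a. *)
Definition kern s a : \bar R := ipos `]0%R, (2 * pi)[ (fun h => abs2 (expi (a * h) - 1) * wt s h).

Lemma measurable_kern s a (D : set R) : measurable D -> measurable_fun D (fun h => abs2 (expi (a * h) - 1) * wt s h).
Proof.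
move=> mD; apply: measurable_funM; last exact: measurable_wt.
have c : ccont (fun h : R => expi (a * h) - 1) by apply: ccontD; [exact: ccont_expi|exact: ccont_cst].
exact: measurable_abs2 (ccont_cmeas mD c).
Qed.

Lemma wt_scale s a h : 0 < a -> 0 < h -> wt s h = a `^ (1 + 2 * s) * wt s (a * h).
Proof.
move=> a0 h0; by rewrite /wt powRM ?ltW// mulrA -powRD_gt0// subrr powRr0 mul1r.
Qed.

Lemma powR_sqr s a : (a `^ s) ^+ 2 = a `^ (2 * s).
Proof. by rewrite -(powR_mulrn 2 (powR_ge0 _ _)) -powRrM mulrC. Qed.

Lemma kern_le s : 0 < s < 1 -> exists2 C, 0 <= C & forall a, (kern s a <= (C * (`|a| `^ s) ^+ 2)%:E)%E.
Proof.
move=> hs; have [C C0 hC] := ipos_quad hs; have /andP[s0 s1] := hs; exists C => // a.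
have t0 := @twopi_gt0 R; have mI := @measurable_I2pi R.
have [->|na] := eqVneq a 0.
  rewrite /kern (@eq_ipos _ _ _ (fun=> 0)).
    by rewrite (ipos_cst _ (ltW t0)) mul0r lee_fin mulr_ge0// sqr_ge0.
  by move=> h _; rewrite mul0r expi0 subrr abs20 mul0r.
set b := `|a|; have b0 : 0 < b by rewrite normr_gt0.
have mq D : measurable_fun D (fun t => quad t * wt s t).
  by apply: measurable_funM; [exact: measurable_quad|exact: measurable_wt].
have q0 t : 0 <= quad t * wt s t by rewrite mulr_ge0 ?quad_ge0 ?wt_ge0.
have mqb D : measurable D -> measurable_fun D (fun h => quad (b * h) * wt s (b * h)).
  move=> mD; apply: (measurableT_comp (mq setT)).
  by apply: measurable_funTS; exact: measurable_scale.
apply: (@le_trans _ _ (ipos `]0%R, (2 * pi)[ (fun h => b `^ (1 + 2 * s) * (quad (b * h) * wt s (b * h))))).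
  apply: ipos_le => //.
  - exact: measurable_kern.
  - by apply: measurable_funM => //; exact: mqb.
  move=> h; rewrite /= in_itv/= => /andP[h0 _].
  rewrite mulr_ge0 ?abs2_ge0 ?wt_ge0//= abs2_expiB1_norm -/b (wt_scale s b0 h0).
  rewrite mulrCA ler_wpM2l ?powR_ge0// ler_wpM2r ?wt_ge0//.
  by apply: abs2_expiB1_le; rewrite mulr_ge0// ltW.
rewrite iposZ//; [|exact: mqb|exact: powR_ge0].
have -> : (b `^ (1 + 2 * s))%:E = (((b `^ s) ^+ 2)%:E * b%:E)%E.
  rewrite powR_sqr -EFinM -{3}(powRr1 (ltW b0)) -powRD_gt0//.
  by congr (_ `^ _)%:E; ring.
rewrite -muleA (@ipos_scale _ (fun t => quad t * wt s t))// [C * _]mulrC.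
move: (_ ^+ 2) (sqr_ge0 (b `^ s)) => w w0; rewrite [(w * C)%:E]EFinM.
apply: lee_wpmul2l; first by rewrite lee_fin.
apply: le_trans hC; apply: ipos_sub => //; try exact: measurable_itv.
by move=> x; rewrite /= !in_itv/= mulr0 andbT => /andP[].
Qed.

(** On the range 1 < |a| h < 2 the factor |e^(iah) - 1|^2 is bounded below; this
    range lies in ]0, 2 pi[ unless |a| is small, and then the constant suffices. *)
Lemma kern_ge s : 0 < s -> exists2 c, 0 < c & forall a, ((c * (`|a| `^ s) ^+ 2)%:E <= c%:E + kern s a)%E.
Proof.
move=> s0; have t4 := @twopi_ge4 R.
have c1 : cos 1 < 1 :> R.
  by rewrite -[X in _ < X](@cos0 R) ltr_cos ?in_itv/= ?lexx ?ler01//=; have := @pi_ge2 R; lra.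
pose c := (2 - 2 * cos 1) * 2 `^ (- (1 + 2 * s)) : R.
have c0 : 0 < c by rewrite mulr_gt0 ?powR_gt0//; lra.
exists c => // a.
have k0 : (0 <= kern s a)%E.
  by apply: ipos_ge0 => h _; rewrite mulr_ge0 ?abs2_ge0 ?wt_ge0.
have [a1|a1] := ltP `|a| 1.
  rewrite -[leLHS]adde0; apply: leeD => //; rewrite lee_fin ler_piMr ?(ltW c0)// powR_sqr.
  have p0 : 0 <= 2 * s by lra.
  by have := @ge0_ler_powR R _ p0 `|a| 1; rewrite !nnegrE powR1; apply => //; exact: ltW.
set b := `|a| in a1 *; have b0 : 0 < b by exact: lt_le_trans a1.
rewrite -[leLHS]add0e; apply: leeD; first by rewrite lee_fin ltW.
have i1 : b^-1 <= 1 by rewrite invf_le1.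
have i0 : 0 < b^-1 by rewrite invr_gt0.
apply: (@le_trans _ _ (ipos `](b^-1), (2 * b^-1)[ (fun h => abs2 (expi (a * h) - 1) * wt s h))); last first.
  apply: ipos_sub; try exact: measurable_itv.
  - by move=> x /=; rewrite !in_itv/= => /andP[h1 h2]; apply/andP; split; lra.
  - by apply: measurable_kern; exact: measurable_itv.
  - by move=> h _; rewrite mulr_ge0 ?abs2_ge0 ?wt_ge0.
apply: (@le_trans _ _ (ipos `](b^-1), (2 * b^-1)[ (fun=> (2 - 2 * cos 1) * wt s (2 * b^-1)))).
  rewrite ipos_cst; last lra.
  rewrite lee_fin le_eqVlt; apply/orP; left; apply/eqP.
  have e1 : wt s (2 * b^-1) = 2 `^ (- (1 + 2 * s)) * (b `^ (2 * s) * b).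
    rewrite /wt powRM ?invr_ge0 ?(ltW b0)//; congr (_ * _).
    rewrite -[b^-1](powR_inv1 (ltW b0)) -powRrM -[X in _ = _ * X](powRr1 (ltW b0)) -powRD_gt0//.
    by congr (_ `^ _); ring.
  rewrite e1 /c powR_sqr; move: (b `^ _) (2 `^ _) => x y; field.
  by rewrite gt_eqF.
apply: ipos_le; first exact: measurable_itv.
- exact: measurable_cst.
- by apply: measurable_kern; exact: measurable_itv.
move=> h /=; rewrite in_itv/= => /andP[h1 h2]; apply/andP; split.
  by rewrite mulr_ge0 ?wt_ge0//; lra.
have h0 : 0 < h by exact: lt_trans h1.
have c2 : 0 <= 2 - 2 * cos 1 :> R by move: c1; move: (cos 1) => r; clear; move=> h; lra.
apply: ler_pM => //; first exact: wt_ge0.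
  rewrite abs2_expiB1_norm -/b abs2_expiB1.
  have b1 : 1 <= b * h by rewrite mulrC -ler_pdivrMr// mul1r ltW.
  have b2 : b * h <= 2 by rewrite mulrC -ler_pdivlMr// ltW.
  have : cos (b * h) <= cos 1.
    by rewrite leNgt ltr_cos ?in_itv/= -?leNgt//; have := @pi_ge2 R; lra.
  by move: (cos 1) (cos _) => x y; clear; move=> h; lra.
rewrite /wt !powRN lef_pV2 ?posrE ?powR_gt0//; last lra.
by rewrite ge0_ler_powR ?nnegrE//; lra.
Qed.

End Kernel.

(** * The energy of a quasi-periodic function *)

Section SpectralSum.
Context {R : realType}.
Local Notation mu := (@lebesgue_measure R).
Variable phi : R.
Local Notation freq := (frequency phi).
Local Notation coef f := (coef I2pi (ee phi) f).
Local Notation ext := (ext phi).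
Local Hint Resolve measurable_I2pi : core.
Implicit Types (f g d : R -> R[i]).

Definition incr f (h x : R) : R[i] := ext f (x + h) - ext f x.

Lemma L2_incr f h : L2 I2pi f -> 0 <= h <= 2 * pi -> L2 I2pi (incr f h).
Proof.
move=> Lf hh; apply: L2B => //; first exact: L2_translate.
by apply: L2_eqin Lf => // x; rewrite inE => Ix; rewrite ext_in.
Qed.

Lemma coef_incr f h k : L2 I2pi f -> 0 <= h <= 2 * pi ->
  coef (incr f h) k = (expi (freq k * h) - 1) * coef f k.
Proof.
move=> Lf hh.
have Le : L2 I2pi (ext f) by apply: L2_eqin Lf => // x; rewrite inE => Ix; rewrite ext_in.
rewrite (@coef_sub _ _ (@measurable_I2pi R) _ (L2_ee phi) (fun x => ext f (x + h)))//.
  rewrite coef_translate// [RHS]mulrBl [1 * _]mul1r; congr (_ - _).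
  by apply: eq_cintegral => x; rewrite inE => Ix; rewrite ext_in.
exact: L2_translate.
Qed.

(** The Gagliardo seminorm of order s of the quasi-periodic extension over one
    period, written with increments. *)
Definition energy s f : \bar R :=
  (\int[mu]_(h in `]0%R, (2 * pi)%R[) ((wt s h)%:E * sqnorm I2pi (incr f h)))%E.

(** Parseval for each increment, then Tonelli: translation by h multiplies the
    coefficient of frequency a by e^(iah). *)
Lemma energyE s f : L2 I2pi f ->
  (energy s f = \sum_(k <oo) ((abs2 (coef f k))%:E * kern s (freq k)))%E.
Proof.
move=> Lf.
have -> : energy s f = (\int[mu]_(h in `]0%R, (2 * pi)%R[)
    \sum_(k <oo) (abs2 (coef f k) * (abs2 (expi (freq k * h) - 1) * wt s h))%:E)%E.
  apply: eq_integral => h; rewrite inE/= in_itv/= => /andP[h0 h2].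
  have hh : 0 <= h <= 2 * pi by rewrite !ltW.
  rewrite (parsevalE (@measurable_I2pi R) (L2_ee phi) (orthonormal_ee phi) (@complete_ee R phi)
    (L2_incr Lf hh)).
  rewrite -nneseriesZl; last by move=> k _; rewrite lee_fin abs2_ge0.
  by apply: eq_eseriesr => k _; rewrite coef_incr// abs2M -EFinM; congr (_%:E); ring.
rewrite integral_nneseries//.
- apply: eq_eseriesr => k _.
  have mk := @measurable_kern R s (freq k) _ (@measurable_I2pi R).
  apply: (@iposZ _ _ (fun h => abs2 (expi (freq k * h) - 1) * wt s h) _ (@measurable_I2pi R) mk).
    exact: abs2_ge0.
  by move=> h _; rewrite mulr_ge0 ?abs2_ge0 ?wt_ge0.
- move=> k; apply/measurable_EFinP; apply: measurable_funM; first exact: measurable_cst.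
  exact: (@measurable_kern R s (freq k) _ (@measurable_I2pi R)).
- by move=> k h _; rewrite lee_fin !mulr_ge0 ?abs2_ge0 ?wt_ge0.
Qed.

Lemma energy_ltyP s f : 0 < s < 1 -> L2 I2pi f ->
  (energy s f < +oo)%E <-> bsum (fun k => weight phi s k * abs2 (coef f k)).
Proof.
move=> hs Lf; have [C C0 hC] := kern_le hs; have /andP[s0 _] := hs.
have [c c0 hc] := kern_ge s0.
have k0 a : (0 <= kern s a)%E.
  by apply: ipos_ge0 => h _; rewrite mulr_ge0 ?abs2_ge0 ?wt_ge0.
pose r k := fine (kern s (freq k)).
have rE k : kern s (freq k) = (r k)%:E.
  by rewrite fineK// ge0_fin_numE//; apply: le_lt_trans (hC _) _; rewrite ltry.
have r0 k : 0 <= r k by rewrite -lee_fin -rE.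
have -> : energy s f = (\sum_(k <oo) (abs2 (coef f k) * r k)%:E)%E.
  by rewrite energyE//; apply: eq_eseriesr => k _; rewrite rE EFinM.
rewrite -bsumP; last by move=> k; rewrite mulr_ge0 ?abs2_ge0.
split => b.
  have b1 := bsumD (bsum_coef_ee phi Lf) (bsumZ (a := c^-1) ltac:(by rewrite invr_ge0 ltW) b).
  apply: bsum_le b1 => k.
  have := hc (freq k); rewrite rE -EFinD lee_fin -/(weight phi s k) => h.
  have -> : abs2 (coef f k) + c^-1 * (abs2 (coef f k) * r k) = c^-1 * (c + r k) * abs2 (coef f k).
    by field; rewrite gt_eqF.
  by rewrite ler_wpM2r ?abs2_ge0// -ler_pdivrMl ?invr_gt0// invrK.
apply: bsum_le (bsumZ C0 b) => k; rewrite mulrA mulrC ler_wpM2r ?abs2_ge0//.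
by have := hC (freq k); rewrite rE lee_fin.
Qed.

End SpectralSum.

(** * The Gagliardo seminorm in terms of translations *)

Section Gagliardo.
Context {R : realType}.
Local Notation mu := (@lebesgue_measure R).
Implicit Types (f g d : R -> R[i]).

Lemma measurable_diff2 (c : R[i]) f g : cmeas setT f -> cmeas setT g ->
  measurable_fun setT (fun p : R * R => abs2 (c * f (p.1 + p.2) - g p.1)).
Proof.
move=> [f1 f2] [g1 g2].
have mD : measurable_fun setT (fun p : R * R => p.1 + p.2).
  by apply: measurable_funD; [exact: measurable_fst|exact: measurable_snd].
have F1 := measurableT_comp f1 mD; have F2 := measurableT_comp f2 mD.
have G1 : measurable_fun setT (fun p : R * R => complex.Re (g p.1)).
  by apply: (measurableT_comp g1); exact: measurable_fst.
have G2 : measurable_fun setT (fun p : R * R => complex.Im (g p.1)).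
  by apply: (measurableT_comp g2); exact: measurable_fst.
rewrite /abs2; apply: measurable_funD; apply: measurable_funX.
  rewrite (_ : (fun p => _) = (fun p : R * R => complex.Re c * complex.Re (f (p.1 + p.2)) -
    complex.Im c * complex.Im (f (p.1 + p.2)) - complex.Re (g p.1))); last first.
    by apply/funext => p; rewrite !ReImE.
  apply: measurable_funB => //; apply: measurable_funB; apply: measurable_funM => //.
rewrite (_ : (fun p => _) = (fun p : R * R => complex.Re c * complex.Im (f (p.1 + p.2)) +
  complex.Im c * complex.Re (f (p.1 + p.2)) - complex.Im (g p.1))); last first.
  by apply/funext => p; rewrite !ReImE.
by apply: measurable_funB => //; apply: measurable_funD; apply: measurable_funM.
Qed.

(** Squared L^2 modulus of continuity. *)
Definition modulus g (h : R) : \bar R := sqnorm setT (fun x => g (x + h) - g x).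

Lemma modulus_ge0 g h : (0 <= modulus g h)%E. Proof. exact: sqnorm_ge0. Qed.

Lemma measurable_modulus g : cmeas setT g -> measurable_fun setT (modulus g).
Proof.
move=> mg; have m := measurable_diff2 1 mg mg.
have mE : measurable_fun setT (fun p : R * R => (abs2 (1 * g (p.1 + p.2) - g p.1))%:E).
  exact/measurable_EFinP.
have := @measurable_fun_fubini_tonelli_G _ _ _ _ _ mu _ mE
  (fun p => ltac:(by rewrite lee_fin abs2_ge0)).
rewrite (_ : fubini_G mu _ = modulus g)//; apply/funext => h.
by apply: eq_integral => x _; rewrite mul1r.
Qed.

Lemma modulus_opp g h : cmeas setT g -> modulus g (- h) = modulus g h.
Proof.
move=> mg; rewrite /modulus /sqnorm.
rewrite -(@integral_shift _ (fun x => (abs2 (g (x + - h) - g x))%:E) h).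
- by apply: eq_integral => x _; rewrite addrK abs2B_sym.
- apply: measurable_abs2E; apply: cmeasB => //; apply: cmeas_comp => //.
  exact: measurable_shift.
- by move=> x; rewrite lee_fin abs2_ge0.
Qed.

Lemma modulus_le g h : L2 setT g -> (modulus g h <= (4 * nsq setT g)%:E)%E.
Proof.
move=> Lg; have mg := L2_cmeas Lg.
have mgh : cmeas setT (fun x => g (x + h)) by apply: cmeas_comp => //; exact: measurable_shift.
have e : sqnorm setT (fun x => g (x + h)) = sqnorm setT g.
  rewrite /sqnorm (@integral_shift _ (fun x => (abs2 (g x))%:E))//.
    exact: measurable_abs2E.
  by move=> x; rewrite lee_fin abs2_ge0.
have Lgh : L2 setT (fun x => g (x + h)) by apply: L2P => //; rewrite e; exact: L2_lty.
have nE : nsq setT (fun x => g (x + h)) = nsq setT g.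
  by apply: EFin_inj; rewrite -!sqnormE// e.
rewrite /modulus sqnormE//; last exact: L2B.
have := nsqD_le (@measurableT _ R) Lgh (L2N (@measurableT _ R) Lg).
by rewrite nsqN nE lee_fin => h'; lra.
Qed.

(** The substitution y = x + h, for each sign of h. *)
Lemma gagliardoE s g : cmeas setT g ->
  (gagliardo s g = \int[mu]_h ((wt s `|h|)%:E * modulus g h))%E.
Proof.
move=> mg.
have mw : measurable_fun setT (fun p : R * R => wt s `|p.2|).
  apply: (measurableT_comp (@measurable_wt R s setT)); apply: (measurableT_comp (@normr_measurable R setT)).
  exact: measurable_snd.
have m := measurable_diff2 1 mg mg.
have mE : measurable_fun setT (fun p : R * R => (abs2 (1 * g (p.1 + p.2) - g p.1) * wt s `|p.2|)%:E).
  by apply/measurable_EFinP; exact: measurable_funM.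
have p0 (p : R * R) : (0 <= (abs2 (1 * g (p.1 + p.2) - g p.1) * wt s `|p.2|)%:E)%E.
  by rewrite lee_fin mulr_ge0 ?abs2_ge0 ?wt_ge0.
transitivity (\int[mu]_x \int[mu]_h (abs2 (1 * g (x + h)%R - g x) * wt s `|h|)%:E)%E.
  apply: eq_integral => x _.
  rewrite -(@integral_shift _ (fun y => (abs2 (g x - g y) / `|x - y| `^ (1 + 2 * s))%:E) x).
  - apply: eq_integral => h _; rewrite mul1r abs2B_sym [h + x]addrC /wt powRN.
    by rewrite opprD addrA subrr sub0r normrN.
  - apply/measurable_EFinP; apply: measurable_funM.
      by apply: measurable_abs2; apply: cmeasB => //; exact: cmeas_cst.
    rewrite (_ : (fun y => _) = (fun y => wt s `|x - y|)); last first.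
      by apply/funext => y; rewrite /wt powRN.
    apply: (measurableT_comp (@measurable_wt R s setT)).
    apply: (measurableT_comp (@normr_measurable R setT)).
    exact: measurable_funB.
  - by move=> y; rewrite lee_fin mulr_ge0 ?abs2_ge0 ?invr_ge0 ?powR_ge0.
rewrite (@fubini_tonelli _ _ _ _ _ mu mu (fun p => (abs2 (1 * g (p.1 + p.2) - g p.1) * wt s `|p.2|)%:E) mE p0).
apply: eq_integral => h _.
rewrite /modulus /sqnorm -ge0_integralZl//.
- by apply: eq_integral => x _; rewrite /= mul1r mulrC EFinM.
- apply: measurable_abs2E; apply: cmeasB => //; apply: cmeas_comp => //.
  exact: measurable_shift.
- by move=> x _; rewrite lee_fin abs2_ge0.
- by rewrite lee_fin wt_ge0.
Qed.

Lemma measurable_wt_modulus s g (D : set R) : cmeas setT g ->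
  measurable_fun D (fun h => ((wt s h)%:E * modulus g h)%E).
Proof.
move=> mg; apply: measurable_funTS; apply: emeasurable_funM; last exact: measurable_modulus.
by apply/measurable_EFinP; exact: measurable_wt.
Qed.

Lemma measurable_wt_modulus_norm s g : cmeas setT g ->
  measurable_fun setT (fun h : R => ((wt s `|h|)%:E * modulus g h)%E).
Proof.
move=> mg; apply: emeasurable_funM; last exact: measurable_modulus.
apply/measurable_EFinP; apply: (measurableT_comp (@measurable_wt R s setT)).
exact: normr_measurable.
Qed.

Lemma gagliardo_ge s g : cmeas setT g ->
  (\int[mu]_(h in `]0%R, (2 * pi)%R[) ((wt s h)%:E * modulus g h) <= gagliardo s g)%E.
Proof.
move=> mg; rewrite (gagliardoE s mg).
have -> : (\int[mu]_(h in `]0%R, (2 * pi)%R[) ((wt s h)%:E * modulus g h) =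
    \int[mu]_(h in `]0%R, (2 * pi)%R[) ((wt s `|h|)%:E * modulus g h))%E.
  by apply: eq_integral => h; rewrite inE/= in_itv/= => /andP[h0 _]; rewrite gtr0_norm.
apply: ge0_subset_integral => //.
- exact: measurable_wt_modulus_norm.
- by move=> h _; rewrite mule_ge0 ?lee_fin ?wt_ge0 ?modulus_ge0.
Qed.

Lemma itvoyP (h : R) : (`]0, +oo[%classic : set R) h -> 0 < h.
Proof. by rewrite /= in_itv/= andbT. Qed.

Lemma gagliardo_le s g : 0 < s -> cmeas setT g ->
  (gagliardo s g <= 2%:E * \int[mu]_(h in `]0%R, +oo[) ((wt s h)%:E * modulus g h))%E.
Proof.
move=> s0 mg; rewrite (gagliardoE s mg).
pose u h := ((wt s `|h|)%:E * modulus g h)%E.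
pose v h := if h \in `]0, +oo[ then u h else 0%E.
have u0 h : (0 <= u h)%E by rewrite mule_ge0 ?lee_fin ?wt_ge0 ?modulus_ge0.
have v0 h : (0 <= v h)%E by rewrite /v; case: ifP.
have mu_ : measurable_fun setT u by exact: measurable_wt_modulus_norm.
have mv : measurable_fun setT v by apply: measurable_itv_indic; exact: measurable_funTS.
have mvN : measurable_fun setT (fun h : R => v (- h)).
  by apply: (measurableT_comp mv); exact: (measurableT_comp (@oppr_measurable R setT)).
have -> : (\int[mu]_(h in `]0%R, +oo[) ((wt s h)%:E * modulus g h) = \int[mu]_h v h)%E.
  rewrite -integral_itv_indic; apply: eq_integral => h.
  move=> /set_mem /itvoyP h0.
  by rewrite /u; congr ((wt s _)%:E * _)%E; rewrite (gtr0_norm h0).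
apply: (@le_trans _ _ (\int[mu]_h (v h + v (- h)%R))%E).
  apply: ge0_le_integral => //; try exact: emeasurable_funD mv mvN.
    by move=> h _; exact: u0.
  move=> h _; rewrite /v !in_itv/= !andbT oppr_gt0; case: (ltrgt0P h) => h0.
  - by rewrite adde0 /u (gtr0_norm h0).
  - by rewrite add0e /u normrN (ltr0_norm h0) modulus_opp.
  - by rewrite adde0 /wt powR0 ?mul0e//; apply/eqP; lra.
have E : (\int[mu]_h (v h + v (- h)%R) = \int[mu]_h v h + \int[mu]_h v (- h)%R)%E.
  by apply: ge0_integralD.
by rewrite E integral_reflect// -mule2n muleC -mule_natl muleC.
Qed.

End Gagliardo.

(** * Fractional Hardy inequalities *)

Section Hardy.
Context {R : realType}.
Local Notation mu := (@lebesgue_measure R).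
Implicit Types (f g : R -> R[i]).

Lemma nsqD_eps (D : set R) (mD : measurable D) f g (e : R) : 0 < e -> L2 D f -> L2 D g ->
  nsq D (fun x => f x + g x) <= (1 + e) * nsq D f + (1 + e^-1) * nsq D g.
Proof.
move=> e0 Lf Lg; rewrite nsqD//.
have r2 : complex.Re (inner D f g) ^+ 2 <= nsq D f * nsq D g.
  by apply: le_trans (Re2_le _) _; exact: inner_le.
have a0 := nsq_ge0 D f; have b0 := nsq_ge0 D g.
move: (complex.Re _) (nsq D f) (nsq D g) r2 a0 b0 => r a b r2 a0 b0.
suff : 2 * r <= e * a + e^-1 * b by lra.
have t0 : 0 <= e * a by rewrite mulr_ge0// ltW.
have u0 : 0 <= e^-1 * b by rewrite mulr_ge0// invr_ge0 ltW.
have tu : (e * a) * (e^-1 * b) = a * b by field; rewrite gt_eqF.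
rewrite -tu in r2; move: (e * a) (e^-1 * b) r2 t0 u0 => t u r2 t0 u0.
rewrite leNgt; apply/negP => h; rewrite expr2 in r2.
have tu0 := addr_ge0 t0 u0.
have := ltr_pM tu0 tu0 h h; have := sqr_ge0 (t - u); rewrite expr2; lra.
Qed.

(** Optimizing a family of inequalities with weights 1 + e and 1 + 1/e gives the
    triangle inequality for square roots. *)
Lemma sqrt_le_eps (x a b : R) : 0 <= a -> 0 <= b ->
  (forall e, 0 < e -> x <= (1 + e) * a + (1 + e^-1) * b) ->
  Num.sqrt x <= Num.sqrt a + Num.sqrt b.
Proof.
move=> a0 b0 h.
have sa := sqr_sqrtr a0; have sb := sqr_sqrtr b0.
have pa := sqrtr_ge0 a; have pb := sqrtr_ge0 b.
rewrite -[leRHS]ger0_norm ?addr_ge0// -sqrtr_sqr; apply: ler_wsqrtr.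
move: (Num.sqrt a) (Num.sqrt b) sa sb pa pb => p q sa sb pa pb.
have [q0|q0] := eqVneq q 0.
  rewrite -sb q0 expr0n/= in h; rewrite q0 addr0 sa.
  apply/ler_addgt0Pr => e e0.
  have a1 : 0 < 1 + a by rewrite ltr_pwDl.
  have := h (e / (1 + a)) ltac:(by rewrite divr_gt0); rewrite mulr0 addr0 => h1.
  apply: le_trans h1 _; rewrite mulrDl mul1r lerD2l mulrAC ler_pdivrMr// mulrDr mulr1 mulrC.
  by rewrite lerDr ltW.
have [p0|p0] := eqVneq p 0.
  rewrite -sa p0 expr0n/= in h; rewrite p0 add0r sb.
  apply/ler_addgt0Pr => e e0.
  have b1 : 0 < 1 + b by rewrite ltr_pwDl.
  have := h ((1 + b) / e) ltac:(by rewrite divr_gt0); rewrite mulr0 add0r invf_div => h1.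
  apply: le_trans h1 _; rewrite mulrDl mul1r lerD2l mulrAC ler_pdivrMr// mulrDr mulr1.
  by rewrite lerDr ltW.
have q1 : 0 < q by rewrite lt_neqAle eq_sym q0.
have p1 : 0 < p by rewrite lt_neqAle eq_sym p0.
have := h (q / p) ltac:(by rewrite divr_gt0); rewrite -sa -sb invf_div => h1.
apply: le_trans h1 _; rewrite le_eqVlt; apply/orP; left; apply/eqP; field.
by rewrite q0 p0.
Qed.

Lemma powR_exprn (a x : R) n : 0 <= a -> (a ^+ n) `^ x = (a `^ x) ^+ n.
Proof.
move=> a0; elim: n => [|n IH]; first by rewrite !expr0 powR1.
by rewrite !exprS powRM ?exprn_ge0// IH.
Qed.

Variables (s : R) (v g : R -> R[i]).
Hypothesis s0 : 0 < s.
Hypothesis Lv : L2 setT v.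
Hypothesis Lg : L2 setT g.
Hypothesis inc : forall h, 0 < h < pi ->
  (sqnorm `]0%R, h[ (fun x => (v (x + h) - v x)%R) <= modulus g h)%E.
Hypothesis hA : (\int[mu]_(h in `]0%R, (2 * pi)%R[) ((wt s h)%:E * modulus g h) < +oo)%E.

(** Phi(h) is the mass of v on ]0, h[. Translation by h maps ]0, h[ onto ]h, 2h[,
    whose mass is Phi(2h) - Phi(h), so that the modulus of continuity compares
    the masses at the scales h and 2h. *)
Definition hardy_mass h : R := nsq `]0, h[ v.
Local Notation Phi := hardy_mass.
Definition hardy_modulus h : R := fine (modulus g h).
Local Notation m := hardy_modulus.

Let mI (a b : R) : measurable (`]a, b[%classic : set R). Proof. exact: measurable_itv. Qed.

Let mE h : modulus g h = (m h)%:E.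
Proof.
rewrite fineK// ge0_fin_numE ?modulus_ge0//.
by apply: le_lt_trans (modulus_le h Lg) _; rewrite ltry.
Qed.
Let m0 h : 0 <= m h. Proof. by rewrite -lee_fin -mE modulus_ge0. Qed.
Let mm (D : set R) : measurable_fun D m.
Proof.
apply: measurable_funTS; apply/measurable_EFinP.
by rewrite (_ : EFin \o m = modulus g); [exact: measurable_modulus (L2_cmeas Lg)|apply/funext => h /=; rewrite mE].
Qed.
Let LI (a b : R) : L2 `]a, b[ v. Proof. by apply: L2_sub Lv => //; exact: measurableT. Qed.
Let PhiE h : sqnorm `]0, h[ v = (Phi h)%:E. Proof. exact: sqnormE. Qed.
Let Phi0 h : 0 <= Phi h. Proof. exact: nsq_ge0. Qed.
Let mabs (D : set R) : measurable_fun D (fun x => abs2 (v x)).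
Proof. by apply: measurable_funTS; exact: measurable_abs2 (L2_cmeas Lv). Qed.
Let Phi_mono a b : a <= b -> Phi a <= Phi b.
Proof.
move=> ab; rewrite -lee_fin -!PhiE; apply: ipos_sub => //.
- by move=> x /=; rewrite !in_itv/= => /andP[-> h]; exact: lt_le_trans ab.
- by move=> x _; exact: abs2_ge0.
Qed.
Let Phi_bnd h : Phi h <= nsq setT v.
Proof.
rewrite -lee_fin -PhiE -sqnormE//; apply: ipos_sub => //.
by move=> x _; exact: abs2_ge0.
Qed.
Let mPhi (D : set R) : measurable_fun D Phi.
Proof. by apply: measurable_funTS; apply: nondecreasing_measurable. Qed.

Let mshift h : cmeas setT (fun x => v (x + h)).
Proof. by apply: cmeas_comp; [exact: L2_cmeas|exact: measurable_shift]. Qed.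

Let shiftE h : 0 < h -> L2 `]0, h[ (fun x => v (x + h)) /\ nsq `]0, h[ (fun x => v (x + h)) = Phi (2 * h) - Phi h.
Proof.
move=> h0; have e : sqnorm `]0, h[ (fun x => v (x + h)) = sqnorm `]h, (2 * h)[ v.
  rewrite /sqnorm (@integral_shift_itv _ (fun x => (abs2 (v x))%:E)).
  - by rewrite add0r (_ : h + h = 2 * h)//; ring.
  - by apply/measurable_EFinP.
  - by move=> x; rewrite lee_fin abs2_ge0.
have L : L2 `]0, h[ (fun x => v (x + h)).
  apply: L2P; first by apply: (cmeas_sub _ _ (mshift h)).
  by rewrite e; exact: L2_lty.
split => //; apply: EFin_inj; rewrite -sqnormE// e EFinB -!PhiE.
have h1 : 0 <= h by exact: ltW.
have h2 : h <= 2 * h by lra.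
rewrite [X in (_ = X - _)%E](ipos_split h1 h2 (@mabs setT) (fun x => abs2_ge0 (v x))).
have -> : ipos `]0, h[ (fun x => abs2 (v x)) = (Phi h)%:E by exact: PhiE.
by rewrite PhiE [X in (_ = X - _)%E]addeC addeK.
Qed.

Let Linc h : 0 < h -> L2 `]0, h[ (fun x => v (x + h) - v x).
Proof. by move=> /shiftE[L _]; exact: L2B. Qed.

Let inc_m h : 0 < h < pi -> nsq `]0, h[ (fun x => v (x + h) - v x) <= m h.
Proof.
move=> hh; have /andP[h0 _] := hh.
by rewrite -lee_fin -mE -sqnormE; [exact: inc|exact: mI|exact: Linc].
Qed.

Let up h e : 0 < h < pi -> 0 < e -> Phi (2 * h) <= (2 + e) * Phi h + (1 + e^-1) * m h.
Proof.
move=> hh e0; have /andP[h0 _] := hh; have [L E] := shiftE h0.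
have := nsqD_eps (mI 0 h) e0 (LI 0 h) (Linc h0).
rewrite (_ : (fun x => v x + (v (x + h) - v x)) = (fun x => v (x + h))); last first.
  by apply/funext => x; rewrite addrC subrK.
rewrite E -/(Phi h); have := inc_m hh.
have e1 : 0 < 1 + e^-1 by rewrite ltr_pwDl// invr_ge0 ltW.
rewrite -(ler_pM2l e1); move: (1 + e^-1) => c; lra.
Qed.

Let down h e : 0 < h < pi -> 0 < e -> (2 + e) * Phi h <= (1 + e) * Phi (2 * h) + (1 + e^-1) * m h.
Proof.
move=> hh e0; have /andP[h0 _] := hh; have [L E] := shiftE h0.
have := nsqD_eps (mI 0 h) e0 L (L2N (mI 0 h) (Linc h0)).
rewrite (_ : (fun x => v (x + h) + - (v (x + h) - v x)) = v); last first.
  by apply/funext => x; rewrite opprB addrC subrK.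
rewrite nsqN E -/(Phi h); have := inc_m hh.
have e1 : 0 < 1 + e^-1 by rewrite ltr_pwDl// invr_ge0 ltW.
rewrite -(ler_pM2l e1); move: (1 + e^-1) => c; lra.
Qed.

Local Notation w := (wt s).
Let mw (D : set R) : measurable_fun D w. Proof. exact: measurable_wt. Qed.
Let w0 h : 0 <= w h. Proof. exact: wt_ge0. Qed.
Definition hardy_density h := w h * Phi h.
Local Notation u := hardy_density.
Let mu_ (D : set R) : measurable_fun D u. Proof. exact: measurable_funM. Qed.
Let u0 h : 0 <= u h. Proof. exact: mulr_ge0. Qed.
Definition hardy_bound h := w h * m h.
Local Notation wm := hardy_bound.
Let mwm (D : set R) : measurable_fun D wm. Proof. exact: measurable_funM. Qed.
Let wm0 h : 0 <= wm h. Proof. exact: mulr_ge0. Qed.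

Let pi0 : 0 < pi :> R. Proof. exact: pi_gt0. Qed.

Definition hardy_const := fine (ipos `]0, (2 * pi)[ wm).
Local Notation A := hardy_const.
Let AE : ipos `]0, (2 * pi)[ wm = A%:E.
Proof.
rewrite fineK// ge0_fin_numE; last by apply: ipos_ge0 => h _; exact: wm0.
suff -> : ipos `]0, (2 * pi)[ wm = (\int[mu]_(h in `]0%R, (2 * pi)%R[) ((wt s h)%:E * modulus g h))%E by [].
by apply: eq_integral => h _; rewrite mE -EFinM.
Qed.
Let A0 : 0 <= A. Proof. by rewrite -lee_fin -AE; apply: ipos_ge0 => h _; exact: wm0. Qed.

(** Truncating at d > 0 makes the integral finite, so that it can be absorbed. *)
Definition hardy_tail d := fine (ipos `]d, (2 * pi)[ u).
Local Notation X := hardy_tail.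
Let XE d : 0 < d -> ipos `]d, (2 * pi)[ u = (X d)%:E.
Proof.
move=> d0; rewrite fineK// ge0_fin_numE; last by apply: ipos_ge0 => h _; exact: u0.
have [hd|hd] := leP d (2 * pi); last first.
  by rewrite set_itv_ge ?bnd_simp -?leNgt ?(ltW hd)// /ipos integral_set0 ltry.
apply: (@le_lt_trans _ _ (ipos `]d, (2 * pi)[ (fun=> w d * nsq setT v))).
  apply: ipos_le => // h; rewrite /= in_itv/= => /andP[dh _]; rewrite u0/=.
  apply: ler_pM => //; rewrite /wt !powRN lef_pV2 ?posrE ?powR_gt0//; last exact: lt_trans dh.
  have hp : 0 <= 1 + 2 * s by rewrite addr_ge0// mulr_ge0// ltW.
  by rewrite ge0_ler_powR ?nnegrE//; [exact: ltW|exact/ltW/(lt_trans d0)|exact: ltW].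
by rewrite ipos_cst// ltry.
Qed.
Let X0 d : 0 <= X d. Proof. by apply: fine_ge0; apply: ipos_ge0 => h _; exact: u0. Qed.

(** The factor that the weight contributes when the scale doubles. *)
Definition hardy_ratio : R := 2 `^ (2 * s).
Local Notation q := hardy_ratio.
Let q0 : 0 < q. Proof. exact: powR_gt0. Qed.

Let scale d : 0 < d -> ipos `]d, pi[ (fun h => w h * Phi (2 * h)) = (q * X (2 * d))%:E.
Proof.
move=> d0; have d2 : 0 < 2 * d by rewrite mulr_gt0.
have m2 : measurable_fun `]d, pi[ (fun h => u (2 * h)).
  by apply: (measurableT_comp (@mu_ setT)); apply: measurable_funTS; exact: measurable_scale.
rewrite (@eq_ipos _ _ _ (fun h => (q * 2) * u (2 * h))).
  rewrite iposZ//; last by rewrite mulr_ge0// ltW.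
  by rewrite [(q * 2)%:E]EFinM -muleA ipos_scale// XE.
move=> h; rewrite /= in_itv/= => /andP[dh _]; have h0 : 0 < h by exact: lt_trans dh.
rewrite (wt_scale s (ltr0n R 2) h0) /u mulrA; congr (_ * _ * _).
by rewrite powRD_gt0// powRr1// mulrC.
Qed.

Let Xsplit d : 0 < d <= pi -> ipos `]d, pi[ u = (X d - X pi)%:E.
Proof.
move=> /andP[d0 dp]; have p2 : pi <= 2 * pi :> R by rewrite mulr_natl mulr2n lerDl ltW.
have := ipos_split dp p2 (@mu_ setT) u0; rewrite XE// XE// => e.
have f : ipos `]d, pi[ u \is a fin_num.
  rewrite ge0_fin_numE; last by apply: ipos_ge0 => h _; exact: u0.
  apply: (@le_lt_trans _ _ (X d)%:E); last exact: ltry.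
  by rewrite e; apply: leeDl; rewrite lee_fin; exact: X0.
by rewrite EFinB e addeK.
Qed.

Let ipos_wm d : 0 < d -> (ipos `]d, pi[ wm <= A%:E)%E.
Proof.
move=> d0; rewrite -AE; apply: ipos_sub => // x; rewrite /= !in_itv/= => /andP[h1 h2].
by rewrite (lt_trans d0)//= (lt_trans h2)// ltr_pMl// ltr1n.
Qed.

Let mPhi2 (D : set R) : measurable_fun D (fun h => w h * Phi (2 * h)).
Proof.
apply: measurable_funM => //; apply: (measurableT_comp (@mPhi setT)).
by apply: measurable_funTS; exact: measurable_scale.
Qed.

Let concl K : (forall d, 0 < d < pi -> X d <= K) -> (ipos `]0%R, (2 * pi)%R[ u < +oo)%E.
Proof.
move=> hK; apply: (@le_lt_trans _ _ (`|K| + X pi)%:E); last exact: ltry.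
apply: ipos_exhaust0 => //; first by rewrite addr_ge0.
move=> d /andP[d0 d2]; rewrite XE// lee_fin.
have [dp|dp] := ltP d pi.
  by apply: le_trans (hK d _) _; rewrite ?d0// (le_trans (ler_norm _))// lerDl.
apply: (@le_trans _ _ (X pi)); last by rewrite lerDr.
rewrite -lee_fin -!XE//; apply: ipos_sub => // x.
by rewrite /= !in_itv/= => /andP[h1 ->]; rewrite (le_lt_trans dp).
Qed.

Lemma measurable_hardy_density (D : set R) : measurable_fun D u.
Proof. by apply: measurable_funM. Qed.

(** Going down one scale: up to the modulus of continuity, Phi(h) is at most half
    of Phi(2h), while the weight grows by the factor 2^(2s) < 2. Hence the
    truncated integral is absorbed with a bound uniform in the truncation. *)
Lemma hardy_small : s < 1 / 2 -> (ipos `]0%R, (2 * pi)%R[ u < +oo)%E.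
Proof.
move=> s2; have q2 : q < 2.
  have h1 : 0 < 1 - 2 * s by lra.
  have E : 2 = q * 2 `^ (1 - 2 * s) :> R.
    by rewrite /q -powRD_gt0// (_ : 2 * s + (1 - 2 * s) = 1) ?powRr1//; lra.
  have h2 : 1 < 2 `^ (1 - 2 * s) :> R.
    by have := @gt0_ltr_powR R _ h1 1 2; rewrite !nnegrE powR1; apply => //; rewrite ltr1n.
  by rewrite [X in _ < X]E ltr_pMr.
have [e eE] : exists e, e = (2 - q) / 2 by eexists.
have e0 : 0 < e by rewrite eE divr_gt0// subr_gt0.
have [D DE] : exists D, D = (2 - q) * (3 - q) / 2 by eexists.
have D0 : 0 < D by rewrite DE divr_gt0// mulr_gt0//; lra.
apply: (@concl (((2 + e) * X pi + (1 + e^-1) * A) / D)) => d /andP[d0 dp].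
have ei : 0 <= 1 + e^-1 by rewrite addr_ge0// invr_ge0 ltW.
have main : (2 + e) * (X d - X pi) <= (1 + e) * (q * X (2 * d)) + (1 + e^-1) * A.
  rewrite -lee_fin EFinM -Xsplit ?d0 ?(ltW dp)//.
  rewrite -iposZ//; last by rewrite addr_ge0// ltW.
  apply: (@le_trans _ _ (ipos `]d, pi[ (fun h => (1 + e) * (w h * Phi (2 * h)) + (1 + e^-1) * wm h))).
    apply: ipos_le => //; [exact: measurable_funM|by apply: measurable_funD; apply: measurable_funM|].
    move=> h; rewrite /= in_itv/= => /andP[h1 h2].
    rewrite mulr_ge0 ?u0 ?addr_ge0 ?(ltW e0)//=.
    have := down (h := h) (e := e) ltac:(by rewrite h2 (lt_trans d0)) e0.
    move=> /(ler_wpM2l (w0 h)); rewrite /u /wm; move: (w h) (1 + e^-1) => wh c; lra.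
  rewrite iposD//; try (by apply: measurable_funM);
    try (by move=> h _; rewrite !mulr_ge0 ?addr_ge0 ?(ltW e0) ?invr_ge0 ?(ltW e0)).
  rewrite EFinD; apply: leeD.
    rewrite iposZ//; [|by rewrite addr_ge0// ltW|by move=> h _; rewrite mulr_ge0].
    by rewrite scale// -EFinM.
  by rewrite iposZ// [X in (_ <= X)%E]EFinM lee_wpmul2l// ?lee_fin// ipos_wm.
have Xd : X (2 * d) <= X d.
  have d2 : 0 < 2 * d by rewrite mulr_gt0.
  rewrite -lee_fin -!XE//; apply: ipos_sub => // x.
  by rewrite /= !in_itv/= => /andP[h1 ->]; rewrite andbT; lra.
have {}main : (2 + e) * (X d - X pi) <= (1 + e) * (q * X d) + (1 + e^-1) * A.
  apply: le_trans main _; rewrite lerD2r ler_wpM2l ?addr_ge0 ?(ltW e0)//.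
  by rewrite ler_wpM2l// ltW.
rewrite ler_pdivlMr//.
have -> : X d * D = (2 + e) * X d - (1 + e) * (q * X d) by rewrite DE eE; field.
move: main; move: ((1 + e^-1) * A) => c; lra.
Qed.

(** Going up one scale: up to the modulus of continuity, Phi(2h) is at most twice
    Phi(h), while the weight decreases by the factor 2^(2s) > 2. The square
    roots of the truncated integrals at d and d / 2 thus satisfy a contraction;
    iterated down to scale 0, the remainder is controlled by the hypothesis that
    Phi(h) is o(h). *)
Lemma hardy_large : 1 / 2 < s ->
  (forall k, 0 < k -> exists2 eta, 0 < eta & forall h, 0 < h < eta -> Phi h <= k * h) ->
  (ipos `]0%R, (2 * pi)%R[ u < +oo)%E.
Proof.
move=> s2 hk; have [r rE] : exists r : R, r = 2 `^ (1 - 2 * s) by eexists.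
have r0 : 0 < r by rewrite rE powR_gt0.
have r1 : r < 1.
  have p0 : 0 < 2 * s - 1 by lra.
  rewrite rE -(opprB (2 * s) 1) powRN invf_lt1 ?powR_gt0//.
  by have := @gt0_ltr_powR R _ p0 1 2; rewrite !nnegrE powR1; apply => //; rewrite ltr1n.
have rq : 2 = r * q by rewrite rE /q -powRD_gt0// subrK powRr1.
have [a aE] : exists a, a = A / q by eexists.
have a0 : 0 <= a by rewrite aE divr_ge0// ltW.
have [rho rhoE] : exists rho, rho = Num.sqrt r by eexists.
have rho0 : 0 <= rho by rewrite rhoE sqrtr_ge0.
have rho1 : rho < 1 by rewrite rhoE -(@sqrtr1 R) ltr_sqrt.
pose y d := Num.sqrt (X d).
have step d : 0 < d < pi -> y (2 * d) <= rho * y d + Num.sqrt a.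
  move=> /andP[d0 dp]; rewrite /y rhoE -sqrtrM ?(ltW r0)//.
  apply: sqrt_le_eps => //; first by rewrite mulr_ge0// ltW.
  move=> e e0; have ei : 0 <= 1 + e^-1 by rewrite addr_ge0// invr_ge0 ltW.
  have main : q * X (2 * d) <= 2 * (1 + e) * X d + (1 + e^-1) * A.
    rewrite -lee_fin -scale//.
    apply: (@le_trans _ _ (ipos `]d, pi[ (fun h => 2 * (1 + e) * u h + (1 + e^-1) * wm h))).
      apply: ipos_le => //; first by apply: measurable_funD; apply: measurable_funM.
      move=> h; rewrite /= in_itv/= => /andP[h1 h2]; rewrite mulr_ge0//=.
      have := up (h := h) (e := e) ltac:(by rewrite h2 (lt_trans d0)) e0.
      move=> /(ler_wpM2l (w0 h)) h3; apply: le_trans h3 _; rewrite mulrDr lerD//; last first.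
        by rewrite /wm mulrCA.
      have e1 : 2 + e <= 2 * (1 + e) by rewrite mulrDr mulr1 lerD2l ler_peMl ?(ltW e0)// ler1n.
      by rewrite mulrCA; exact: (ler_wpM2r (u0 h) e1).
    have e2 : 0 <= 2 * (1 + e) by rewrite mulr_ge0// addr_ge0// ltW.
    rewrite iposD//; try (by apply: measurable_funM); try (by move=> h _; rewrite mulr_ge0).
    rewrite EFinD; apply: leeD.
      rewrite iposZ// [X in (_ <= X)%E]EFinM lee_wpmul2l// ?lee_fin// -XE//.
      apply: ipos_sub => // x; rewrite /= !in_itv/= => /andP[-> h2] /=.
      by apply: lt_trans h2 _; rewrite ltr_pMl// ltr1n.
    by rewrite iposZ// [X in (_ <= X)%E]EFinM lee_wpmul2l// ?lee_fin// ipos_wm.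
  rewrite -(ler_pM2l q0); apply: le_trans main _.
  rewrite le_eqVlt; apply/orP; left; apply/eqP; rewrite {1}rq aE.
  by field; rewrite !gt_eqF.
have iter n d : 0 < d < pi -> y d <= rho ^+ n * y (d / 2 ^+ n) + Num.sqrt a * \sum_(0 <= j < n) rho ^+ j.
  move=> /andP[d0 dp]; elim: n => [|n IH].
    by rewrite !expr0 mul1r invr1 mulr1 big_geq// mulr0 addr0.
  apply: le_trans IH _; rewrite big_nat_recr//= mulrDr [leLHS]addrC [leRHS]addrCA lerD2l.
  have dn : 0 < d / 2 ^+ n.+1 by rewrite divr_gt0// exprn_gt0.
  have dn' : 0 < d / 2 ^+ n.+1 < pi.
    rewrite dn /=; apply: le_lt_trans dp; rewrite ler_pdivrMr ?exprn_gt0// ler_peMr ?(ltW d0)//.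
    by rewrite exprn_ege1// ler1n.
  have := step _ dn'; rewrite (_ : 2 * (d / 2 ^+ n.+1) = d / 2 ^+ n); last first.
    by rewrite exprS; field; rewrite expf_neq0.
  move=> /(ler_wpM2l (exprn_ge0 n rho0)) h; apply: le_trans h _.
  by rewrite mulrDr mulrA -exprSr [rho ^+ n * Num.sqrt a]mulrC.
pose K := (1 + Num.sqrt a * (1 - rho)^-1) ^+ 2.
apply: (@concl K) => d /andP[d0 dp].
suff yK : y d <= 1 + Num.sqrt a * (1 - rho)^-1.
  have := ler_pM (sqrtr_ge0 _) (sqrtr_ge0 _) yK yK; rewrite -!expr2 sqr_sqrtr ?X0//.
have [c cE] : exists c, c = d `^ (1 - 2 * s) / (2 * s - 1) by eexists.
have c0 : 0 < c by rewrite cE divr_gt0 ?powR_gt0//; lra.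
have k0 : 0 < (2 * c)^-1 by rewrite invr_gt0 mulr_gt0.
have [eta' eta'0 heta'] := hk _ k0.
have [eta etaE] : exists eta, eta = Num.min eta' pi by eexists.
have eta0 : 0 < eta by rewrite etaE lt_min eta'0.
have heta h : 0 < h < eta -> Phi h <= (2 * c)^-1 * h.
  by rewrite etaE lt_min => /andP[h0 /andP[h1 _]]; apply: heta'; rewrite h0.
have e2 : eta <= 2 * pi by rewrite etaE ge_min; apply/orP; right; rewrite mulr_natl mulr2n lerDl ltW.
have [n [hn1 hn2]] : exists n, r ^+ n * X eta <= 1 / 2 /\ d / 2 ^+ n < eta.
  have cr : (fun n => r ^+ n) @ \oo --> 0 by apply: cvg_expr; rewrite gtr0_norm.
  have ch : (fun n => (2^-1 : R) ^+ n) @ \oo --> 0.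
    by apply: cvg_expr; rewrite gtr0_norm ?invr_gt0// invf_lt1// ltr1n.
  have e1 : 0 < 1 / 2 / (X eta + 1) by rewrite !divr_gt0// ltr_wpDl.
  have e3 : 0 < eta / d by rewrite divr_gt0.
  have /cvgrPdist_lt/(_ _ e1)[N1 _ h1] := cr; have /cvgrPdist_lt/(_ _ e3)[N2 _ h2] := ch.
  exists (maxn N1 N2); split.
    have := h1 _ (leq_maxl N1 N2); rewrite /= sub0r normrN gtr0_norm ?exprn_gt0// => /ltW h.
    have X1 : 0 < X eta + 1 by rewrite ltr_wpDl.
    rewrite ler_pdivlMr// in h; apply: le_trans h; rewrite ler_wpM2l ?exprn_ge0 ?(ltW r0)//.
    by rewrite lerDl.
  have := h2 _ (leq_maxr N1 N2); rewrite /= sub0r normrN gtr0_norm ?exprn_gt0 ?invr_gt0//.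
  by rewrite exprVn ltr_pdivlMr// mulrC.
have dn0 : 0 < d / 2 ^+ n by rewrite divr_gt0// exprn_gt0.
apply: le_trans (iter n d ltac:(by rewrite d0)) _; apply: lerD; last first.
  rewrite ler_wpM2l ?sqrtr_ge0//; apply: geometric_le; by rewrite rho0.
have -> : rho ^+ n * y (d / 2 ^+ n) = Num.sqrt (r ^+ n * X (d / 2 ^+ n)).
  rewrite sqrtrM ?exprn_ge0 ?(ltW r0)//; congr (_ * _); rewrite rhoE.
  elim: (n) => [|k IH]; first by rewrite !expr0 sqrtr1.
  by rewrite !exprS IH sqrtrM// ltW.
rewrite -[leRHS](@sqrtr1 R); apply: ler_wsqrtr.
have [b bE] : exists b, b = d / 2 ^+ n by eexists.
rewrite -bE in dn0 hn2 *.
have Xb : X b <= X eta + (2 * c)^-1 * (b `^ (1 - 2 * s) / (2 * s - 1)).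
  rewrite -lee_fin -XE// (@ipos_split _ _ _ eta)//; last exact: ltW.
  rewrite EFinD addeC XE//; apply: leeD => //.
  apply: (@le_trans _ _ (ipos `]b, eta[ (fun h => (2 * c)^-1 * h `^ (- (2 * s))))).
    apply: (ipos_le (mI _ _)); [exact: measurable_hardy_density|by apply: measurable_funM => //; apply: measurable_funTS; exact: measurable_powR|].
    move=> h; rewrite /= in_itv/= => /andP[h1 h2]; rewrite u0/=.
    have h0 : 0 < h by exact: lt_trans h1.
    apply: le_trans (_ : w h * ((2 * c)^-1 * h) <= _); first by rewrite ler_wpM2l// heta// h0.
    rewrite mulrCA ler_wpM2l ?(ltW k0)// /wt -{2}(powRr1 (ltW h0)) -powRD_gt0//.
    by rewrite le_eqVlt; apply/orP; left; apply/eqP; congr (_ `^ _); ring.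
  rewrite iposZ//; [|by apply: measurable_funTS; exact: measurable_powR|exact: ltW|by move=> h _; exact: powR_ge0].
  rewrite integral_powR//; last by apply/eqP; lra.
  rewrite -EFinM lee_fin ler_wpM2l ?(ltW k0)// [- (2 * s) + 1]addrC.
  have i0 : 0 < (2 * s - 1)^-1 by rewrite invr_gt0; lra.
  rewrite -[(1 - 2 * s)^-1]opprK -invrN opprB mulrN -mulNr opprB ler_pM2r//.
  by rewrite gerBl powR_ge0.
apply: le_trans (ler_wpM2l (exprn_ge0 n (ltW r0)) Xb) _; rewrite mulrDr.
have -> : r ^+ n * ((2 * c)^-1 * (b `^ (1 - 2 * s) / (2 * s - 1))) = 1 / 2.
  have -> : b `^ (1 - 2 * s) = d `^ (1 - 2 * s) * (r ^+ n)^-1.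
    rewrite bE powRM ?invr_ge0 ?exprn_ge0 ?(ltW d0)//; congr (_ * _).
    rewrite -[(2 ^+ n)^-1](powR_inv1 (exprn_ge0 n (ler0n R 2))) -powRrM mulN1r powRN; congr (_^-1).
    by rewrite rE; exact: (powR_exprn _ _ (ler0n R 2)).
  have s3 : 2 * s - 1 != 0 by apply/eqP; lra.
  rewrite cE; have := powR_gt0 (1 - 2 * s) d0; move: (d `^ _) => z z0.
  by field; rewrite s3 (gt_eqF z0) expf_neq0// gt_eqF.
lra.
Qed.

End Hardy.

(** * Finite energy implies fractional regularity *)

Section SpectralToSobolev.
Context {R : realType}.
Local Notation mu := (@lebesgue_measure R).
Variable phi : R.
Local Notation coef f := (coef I2pi (ee phi) f).
Local Notation ext := (ext phi).
Local Hint Resolve measurable_I2pi : core.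
Implicit Types (f g d : R -> R[i]).

Lemma cutoff_lipschitz (a b eps : R) : 0 < eps -> exists2 L, 0 <= L &
  forall x h, 0 <= h -> (cutoff a b eps (x + h) - cutoff a b eps x) ^+ 2 <= L * h ^+ 2.
Proof.
move=> e0.
have out x : ~~ (a <= x <= b) -> cutoff1 a b eps x = 0.
  by move=> h; apply: (cutoff_out e0 _).2; apply: contra h => /andP[/ltW -> /ltW ->].
have [M M0 hM] := continuous_supp_bounded (@continuous_cutoff1 R a b eps) out.
exists (M ^+ 2); first exact: sqr_ge0.
move=> x h h0; have xh : x <= x + h by rewrite lerDl.
have := FTC_R xh (is_derive_cutoff a b eps) (@continuous_cutoff1 R a b eps) => <-.
rewrite -exprMn -real_normK ?num_real// ler_sqr ?nnegrE ?mulr_ge0//.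
have mI : measurable (`]x, (x + h)[%classic : set R) by exact: measurable_itv.
have ic := @continuous_integrable R _ x (x + h) (@continuous_cutoff1 R a b eps).
apply: le_trans (@le_normr_Rintegral _ _ _ mu _ _ mI ic) _.
have E : \int[mu]_(y in `]x, (x + h)[) M = M * h.
  by have := @ipos_cst R x (x + h) M xh; rewrite /ipos addrAC subrr add0r /Rintegral => ->.
rewrite -E; apply: (@le_Rintegral _ _ _ mu _ _ _ mI).
- by have := integrable_abse ic.
- by apply: (@continuous_integrable R (fun=> M)) => y; exact: cvg_cst.
- by move=> y _; exact: hM.
Qed.

Local Notation chi := (cutoff (- 3) (2 * pi + 3) 1).

Lemma L2_cutext_chi f : L2 I2pi f -> L2 setT (cutext phi chi f).
Proof.
move=> Lf; apply: L2_cutext => //; first exact: continuous_cutoff.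
by move=> x h; apply: (cutoff_out ltr01 _).1; apply: contra h => /andP[/ltW -> /ltW ->].
Qed.

(** An increment of a product splits into an increment of the extension, of which
    three periods matter, and an increment of the Lipschitz cutoff. *)
Lemma modulus_cutext f : L2 I2pi f -> exists2 C, 0 <= C & forall h, 0 < h < 1 ->
  (modulus (cutext phi chi f) h <= 6%:E * sqnorm I2pi (incr phi f h) + (C * h ^+ 2)%:E)%E.
Proof.
move=> Lf; have t4 := @twopi_ge4 R; have p2 := @pi_ge2 R.
have [L L0 hL] := @cutoff_lipschitz (-3) (2 * pi + 3) 1 ltr01.
have mf := cmeas_ext phi (L2_cmeas Lf).
set J := (`](- (2 * pi)), (2 * (2 * pi))[%classic : set R).
have mJ : measurable J by exact: measurable_itv.
exists (2 * L * nsq J (ext f)); first by rewrite !mulr_ge0// nsq_ge0.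
move=> h /andP[h0 h1].
have mi : cmeas setT (incr phi f h).
  by apply: cmeasB => //; apply: cmeas_comp => //; exact: measurable_shift.
have qi x : incr phi f h (x + 2 * pi) = expi (- phi) * incr phi f h x.
  by rewrite /incr ext_shift addrAC ext_shift mulrBr.
have mg := L2_cmeas (L2_cutext_chi Lf).
have pt x : abs2 (cutext phi chi f (x + h) - cutext phi chi f x) <=
    2 * abs2 (incr phi f h x) + (2 * L * h ^+ 2) * abs2 (ext f x).
  have -> : cutext phi chi f (x + h) - cutext phi chi f x =
     (chi (x + h))%:C * incr phi f h x + (chi (x + h) - chi x)%:C * ext f x.
    by rewrite /cutext /incr realCD realCN; ring.
  apply: le_trans (abs2D_le _ _) _; rewrite (abs2M (chi (x + h))%:C) (abs2M (chi (x + h) - chi x)%:C) !abs2C; apply: lerD.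
    rewrite ler_wpM2l// ler_piMl ?abs2_ge0//.
    by have /andP[c0 c1] := cutoff_bnd (-3) (2 * pi + 3) 1 (x + h); rewrite expr_le1.
  have := ler_wpM2r (abs2_ge0 (ext f x)) (hL x h (ltW h0)).
  by move: (abs2 (ext f x)) (_ ^+ 2) (_ ^+ 2) => E1 E2 E3; lra.
have out x : ~ J x -> cutext phi chi f (x + h) - cutext phi chi f x = 0.
  rewrite /J /= in_itv/= => /negP; rewrite negb_and -!leNgt /cutext => /orP[hx|hx].
    rewrite (cutoff_out ltr01 _).1; last by apply/negP => /andP[k _]; lra.
    rewrite (cutoff_out ltr01 _).1; last by apply/negP => /andP[k _]; lra.
    by rewrite !mul0r subrr.
  rewrite (cutoff_out ltr01 _).1; last by apply/negP => /andP[_ k]; lra.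
  rewrite (cutoff_out ltr01 _).1; last by apply/negP => /andP[_ k]; lra.
  by rewrite !mul0r subrr.
rewrite /modulus /sqnorm (@integral_supp _ J setT)//; last first.
  by move=> x _ /out ->; rewrite abs20.
have m1 : measurable_fun J (fun x => abs2 (incr phi f h x)).
  by apply: measurable_funTS; exact: measurable_abs2.
have m2 : measurable_fun J (fun x => abs2 (ext f x)).
  by apply: measurable_funTS; exact: measurable_abs2.
apply: (@le_trans _ _ (ipos J (fun x => 2 * abs2 (incr phi f h x) + (2 * L * h ^+ 2) * abs2 (ext f x)))).
  apply: ipos_le => //.
  - apply: measurable_funTS; apply: measurable_abs2; apply: cmeasB => //.
    by apply: cmeas_comp => //; exact: measurable_shift.
  - by apply: measurable_funD; apply: measurable_funM.
  - by move=> x _; rewrite abs2_ge0/= pt.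
have c0 : 0 <= 2 * L * h ^+ 2 by rewrite mulr_ge0 ?sqr_ge0// mulr_ge0.
rewrite iposD//; try (by apply: measurable_funM); try (by move=> x _; rewrite mulr_ge0 ?abs2_ge0).
apply: leeD.
  rewrite (iposZ mJ m1 (ler0n R 2) (fun x _ => abs2_ge0 (incr phi f h x))).
  have := sqnorm_quasi3 mi qi; rewrite -/J /sqnorm -/(ipos _ _) => ->.
  have hh : 0 <= h <= 2 * pi by apply/andP; split; lra.
  rewrite -/(sqnorm I2pi (incr phi f h)) (sqnormE (@measurable_I2pi R) (L2_incr phi Lf hh)).
  by rewrite -!EFinD -!EFinM lee_fin; lra.
rewrite (iposZ mJ m2 c0 (fun x _ => abs2_ge0 (ext f x))).
rewrite /ipos -/(sqnorm J (ext f)) (sqnormE mJ (L2_ext phi Lf)).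
by rewrite -EFinM lee_fin; lra.
Qed.

Lemma measurable_wt_incr s f : L2 I2pi f ->
  measurable_fun setT (fun h => ((wt s h)%:E * sqnorm I2pi (incr phi f h))%E).
Proof.
move=> Lf.
have m : measurable_fun setT (fun h => sqnorm I2pi (incr phi f h)).
  have me := cmeas_ext phi (L2_cmeas Lf).
  have m2 := measurable_diff2 1 me me.
  have mE : measurable_fun setT (fun p : R * R =>
      (\1_(I2pi : set R) p.1 * abs2 (1 * ext f (p.1 + p.2) - ext f p.1))%:E).
    apply/measurable_EFinP; apply: measurable_funM => //.
    have mi : measurable_fun setT (\1_(I2pi : set R) : R -> R).
      by apply: measurable_indic; exact: measurable_I2pi.
    exact: (measurableT_comp mi (@measurable_fst _ _ _ _)).
  have := @measurable_fun_fubini_tonelli_G _ _ _ _ _ mu _ mE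
    (fun p => ltac:(by rewrite lee_fin mulr_ge0 ?abs2_ge0)).
  rewrite (_ : fubini_G mu _ = (fun h => sqnorm I2pi (incr phi f h)))//; apply/funext => h.
  rewrite /fubini_G /sqnorm [RHS]integral_mkcond; apply: eq_integral => x _.
  by rewrite patchE indicE /incr /= mul1r; case: ifP => _; rewrite ?mul1r ?mul0r.
apply: emeasurable_funM => //.
by apply/measurable_EFinP; exact: measurable_wt.
Qed.

(** For small h the modulus of continuity of the cutoff is bounded by that of the
    extension up to O(h^2), which is integrable against the weight as s < 1; for
    large h the trivial bound suffices as s > 0. *)
Lemma Hs_of_energy s f : 0 < s < 1 -> L2 I2pi f -> (energy phi s f < +oo)%E -> Hs I2pi s f.
Proof.
move=> hs Lf hE; have /andP[s0 s1] := hs.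
pose g := cutext phi chi f.
have Lg : L2 setT g by exact: L2_cutext_chi.
have mg := L2_cmeas Lg.
have tr : Num.truncn s = 0%N by apply: truncn_def; rewrite ltW.
split => //; exists g; split; last by apply: aeT => x; exact: cutext_I.
exists (fun=> g); rewrite /= tr subr0; split => // _.
have [C C0 hC] := modulus_cutext Lf; have [K K0 hK] := ipos_quad hs.
pose N := C + 4 * nsq setT g.
have N0 : 0 <= N by rewrite addr_ge0// mulr_ge0// nsq_ge0.
apply: (le_lt_trans (gagliardo_le s0 mg)).
have mI1 : measurable (`]0, 1[%classic : set R) by exact: measurable_itv.
have mIo : measurable (`]0, +oo[%classic : set R) by exact: measurable_itv.
have mI2 : measurable (`]0, (2 * pi)[%classic : set R) by exact: measurable_itv.
have mqw D : measurable_fun D (fun t => quad t * wt s t).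
  by apply: measurable_funM; [exact: measurable_quad|exact: measurable_wt].
pose e h : \bar R := if h \in `]0, 1[ then ((wt s h)%:E * (6%:E * sqnorm I2pi (incr phi f h)))%E else 0%E.
have e_ge0 h : (0 <= e h)%E.
  by rewrite /e; case: ifP => // _; rewrite !mule_ge0 ?lee_fin ?wt_ge0 ?sqnorm_ge0.
have mQ' : measurable_fun setT (fun h => ((wt s h)%:E * sqnorm I2pi (incr phi f h))%E).
  exact: measurable_wt_incr.
have mQ : measurable_fun (`]0, 1[%classic : set R) (fun h : R => ((wt s h)%:E * (6%:E * sqnorm I2pi (incr phi f h)))%E).
  rewrite (_ : (fun h => _) = (fun h : R => (6%:E * ((wt s h)%:E * sqnorm I2pi (incr phi f h)))%E)).
    by apply: measurable_funTS; exact: emeasurable_funM.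
  by apply/funext => h; rewrite muleCA.
have me : measurable_fun setT e by exact: measurable_itv_indic mQ.
have b1 : (\int[mu]_(h in `]0%R, +oo[) ((wt s h)%:E * modulus g h) <=
   \int[mu]_(h in `]0%R, +oo[) (e h + (N * (quad h * wt s h))%:E))%E.
  apply: ge0_le_integral => //.
  - by move=> h _; rewrite mule_ge0 ?lee_fin ?wt_ge0 ?modulus_ge0.
  - exact: measurable_wt_modulus.
  - apply: emeasurable_funD; first exact: measurable_funTS.
    by apply/measurable_EFinP; apply: measurable_funM; [exact: measurable_cst|exact: mqw].
  move=> h /itvoyP h0; rewrite /e in_itv/= h0 /=.
  have [h1|h1] := ltP h 1.
    have h01 : 0 < h < 1 by rewrite h0.
    apply: le_trans (lee_wpmul2l _ (hC h h01)) _; first by rewrite lee_fin wt_ge0.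
    have hq : quad h = h ^+ 2.
      apply: min_idPl; apply: le_trans (_ : 1 <= _); last by rewrite ler1n.
      by rewrite expr_le1// ltW.
    rewrite ge0_muleDr; [|by rewrite mule_ge0 ?sqnorm_ge0 ?lee_fin|by rewrite lee_fin mulr_ge0 ?sqr_ge0].
    apply: leeD => //; rewrite hq -EFinM lee_fin mulrCA mulrA [_ * wt s h]mulrC.
    rewrite -mulrA ler_wpM2r//; first by rewrite mulr_ge0 ?wt_ge0 ?sqr_ge0.
    by rewrite /N lerDl mulr_ge0// nsq_ge0.
  rewrite add0e.
  apply: le_trans (lee_wpmul2l _ (modulus_le h Lg)) _; first by rewrite lee_fin wt_ge0.
  have hq : 1 <= quad h.
    rewrite le_min ler1n andbT; have := mulr_ege1 h1 h1; by rewrite -expr2.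
  have k : 4 * nsq setT g <= N * quad h.
    by apply: le_trans (_ : N <= _); [rewrite /N lerDr|rewrite ler_peMr].
  rewrite -EFinM lee_fin [leLHS]mulrC [leRHS]mulrA.
  exact: (ler_wpM2r (wt_ge0 s h) k).
have fin : (\int[mu]_(h in `]0%R, +oo[) ((wt s h)%:E * modulus g h) < +oo)%E.
  apply: (le_lt_trans b1).
  have eN : (\int[mu]_(h in `]0%R, +oo[) (N * (quad h * wt s h))%:E < +oo)%E.
    rewrite -/(ipos _ _) iposZ//; last by move=> h _; rewrite mulr_ge0 ?quad_ge0 ?wt_ge0.
    apply: (le_lt_trans (lee_wpmul2l _ hK)); first by rewrite lee_fin.
    by rewrite -EFinM ltry.
  have eE : (\int[mu]_(h in `]0%R, +oo[) e h < +oo)%E.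
    have -> : (\int[mu]_(h in `]0%R, +oo[) e h = \int[mu]_(h in `]0%R, 1%R[)
       (6%:E * ((wt s h)%:E * sqnorm I2pi (incr phi f h))))%E.
      rewrite (@integral_supp _ `]0, 1[%classic).
      - by apply: eq_integral => h /set_mem /= hh; rewrite /e hh muleCA.
      - by move=> h /=; rewrite !in_itv/= => /andP[->].
      - by move=> h _ /negP hh; rewrite /e; case: ifP => // h'; rewrite h' in hh.
    have p0 h : (0 <= (wt s h)%:E * sqnorm I2pi (incr phi f h))%E.
      by rewrite mule_ge0 ?lee_fin ?wt_ge0 ?sqnorm_ge0.
    rewrite ge0_integralZl//; last exact: measurable_funTS.
    rewrite lte_mul_pinfty//; apply: le_lt_trans hE.
    apply: ge0_subset_integral => //; try exact: measurable_funTS mQ'.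
    move=> h /=; rewrite !in_itv/= => /andP[-> h1]; have := @twopi_ge4 R; lra.
  have -> : (\int[mu]_(h in `]0%R, +oo[) (e h + (N * (quad h * wt s h))%:E) =
     \int[mu]_(h in `]0%R, +oo[) e h + \int[mu]_(h in `]0%R, +oo[) (N * (quad h * wt s h))%:E)%E.
    apply: ge0_integralD => //.
    - exact: measurable_funTS.
    - by move=> h _; rewrite lee_fin !mulr_ge0 ?quad_ge0 ?wt_ge0.
    - by apply/measurable_EFinP; apply: measurable_funM; [exact: measurable_cst|exact: mqw].
  exact: lte_add_pinfty.
by rewrite lte_mul_pinfty// ge0_fin_numE.
Qed.

End SpectralToSobolev.

(** * Fractional regularity and finite energy *)

Section SobolevToSpectral.
Context {R : realType}.
Local Notation mu := (@lebesgue_measure R).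
Local Hint Resolve measurable_I2pi : core.
Implicit Types (f g : R -> R[i]) (s : R).

Let mI (a b : R) : measurable (`]a, b[%classic : set R). Proof. exact: measurable_itv. Qed.
Let two0 : 0 <= 2 :> R. Proof. exact: ler0n. Qed.

Lemma L2_indic (u : R -> R[i]) : cmeas setT u -> (forall x, ~ I2pi x -> u x = 0) ->
  (sqnorm I2pi u < +oo)%E -> L2 setT u.
Proof.
move=> mu_ h hn; apply: L2P => //.
by rewrite /sqnorm (@integral_supp _ I2pi setT)// => x _ /h ->; rewrite abs20.
Qed.

(** The extension is modified on a null set of (0, 2 pi) so as to agree with f at
    every point there; pointwise translates can then be compared directly. *)
Lemma Hs_witness s f : 0 < s < 1 -> Hs I2pi s f -> exists g,
  [/\ L2 setT g, forall x, I2pi x -> g x = f x &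
      (\int[mu]_(h in `]0%R, (2 * pi)%R[) ((wt s h)%:E * modulus g h) < +oo)%E].
Proof.
move=> /andP[s0 s1] [Lf [g [[F]]]].
have tr : Num.truncn s = 0%N by apply: truncn_def; rewrite ltW.
rewrite /= tr subr0 => -[F0 LF _ /(_ s0) hG] gf; have Lg : L2 setT g by rewrite -F0; exact: LF.
rewrite F0 in hG; have mg := L2_cmeas Lg; have mf := cmeas_ext 0 (L2_cmeas Lf).
pose d x := (\1_(I2pi : set R) x)%:C * (ext 0 f x - g x).
have mi : measurable_fun setT (\1_(I2pi : set R) : R -> R) by apply: measurable_indic; exact: measurable_I2pi.
have md : cmeas setT d by apply: cmeasM; [exact: cmeasC|exact: cmeasB].
have d0 : d = (fun=> 0) %[ae mu in setT].
  apply: aeS gf => x hx _; rewrite /d indicE; case: (boolP (x \in _)) => xI; last by rewrite mul0r.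
  by move: xI; rewrite inE => xI; rewrite ext_in// hx// subrr mulr0.
have Ld : L2 setT d.
  by apply: (@L2_eqae _ _ measurableT (fun=> 0)) => //; [exact: L2_0|apply: aeS d0 => x h xT; rewrite h].
have nd : nsq setT d = 0.
  rewrite (nsq_eqae measurableT Ld (L2_0 measurableT) d0).
  apply: EFin_inj; rewrite -sqnormE//; last exact: L2_0.
  by rewrite /sqnorm; under eq_integral do rewrite abs20; rewrite integral0.
exists (fun x => g x + d x); split; first exact: L2D.
  by move=> x xI; rewrite /d indicE mem_set// mul1r ext_in// addrC subrK.
have pt h : (modulus (fun x => g x + d x)%R h <= 2%:E * modulus g h)%E.
  have mshift (u : R -> R[i]) : cmeas setT u -> measurable_fun setT (fun x : R => abs2 (u (x + h) - u x)).
    by move=> mu_; apply: measurable_abs2; apply: cmeasB => //; apply: cmeas_comp => //; exact: measurable_shift.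
  have dh : ipos setT (fun x : R => abs2 (d (x + h) - d x)) = 0%E.
    change (modulus d h = 0%E).
    by apply/eqP; rewrite eq_le modulus_ge0 andbT; have := modulus_le h Ld; rewrite nd mulr0.
  apply: (@le_trans _ _ (ipos setT (fun x => 2 * abs2 (g (x + h) - g x) + 2 * abs2 (d (x + h) - d x)))).
    apply: ipos_le => //; first by apply: mshift; exact: cmeasD.
      by apply: measurable_funD; apply: measurable_funM => //; exact: mshift.
    move=> x _; rewrite abs2_ge0/=; apply: le_trans (abs2D_le _ _).
    by rewrite le_eqVlt; apply/orP; left; apply/eqP; congr abs2; ring.
  rewrite iposD//; try (by apply: measurable_funM => //; exact: mshift); try (by move=> x _; rewrite mulr_ge0 ?abs2_ge0).
  rewrite (iposZ measurableT (mshift _ mg) two0 (fun x _ => abs2_ge0 _)).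
  rewrite (iposZ measurableT (mshift _ md) two0 (fun x _ => abs2_ge0 _)).
  by rewrite dh mule0 adde0.
apply: (@le_lt_trans _ _ (\int[mu]_(h in `]0%R, (2 * pi)%R[) (2%:E * ((wt s h)%:E * modulus g h)))%E).
  apply: ge0_le_integral => //.
  - by move=> h _; rewrite mule_ge0 ?modulus_ge0// lee_fin wt_ge0.
  - by apply: measurable_wt_modulus; exact: cmeasD.
  - by apply: emeasurable_funM => //; exact: measurable_wt_modulus.
  by move=> h _; rewrite muleCA lee_wpmul2l ?lee_fin ?wt_ge0.
rewrite ge0_integralZl//; [|exact: measurable_wt_modulus|by move=> h _; rewrite mule_ge0 ?modulus_ge0// lee_fin wt_ge0].
by apply: lte_mul_pinfty => //; exact: le_lt_trans (gagliardo_ge s mg) hG.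
Qed.

Variable phi : R.
Local Notation ext := (ext phi).

(** The mismatch of f across the boundary: the part of the increment of the
    quasi-periodic extension that crosses 2 pi, up to a phase. *)
Definition wrap f h : \bar R :=
  sqnorm `]0, h[ (fun x => expi phi * ext f (x + (2 * pi - h)) - ext f x).

Lemma sqnorm_incr_split f h : L2 I2pi f -> 0 < h < 2 * pi ->
  sqnorm I2pi (incr phi f h) =
  (sqnorm `]0%R, (2 * pi - h)%R[ (incr phi f h) + wrap f h)%E.
Proof.
move=> Lf /andP[h0 h1]; have mf := cmeas_ext phi (L2_cmeas Lf).
pose U x := (abs2 (incr phi f h x))%:E.
have mU : measurable_fun setT U.
  apply/measurable_EFinP; apply: measurable_abs2; apply: cmeasB => //.
  by apply: cmeas_comp => //; exact: measurable_shift.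
have U0 x : (0 <= U x)%E by rewrite lee_fin abs2_ge0.
rewrite {1}/sqnorm (@ge0_integral_itv_split _ U 0 (2 * pi - h)) ?subr_ge0 ?(ltW h1)//; last first.
  by rewrite gerBl ltW.
congr (_ + _)%E; have := @integral_shift_itv _ U 0 h (2 * pi - h) (measurable_funTS mU) U0.
rewrite add0r [(h + _)%R]addrC subrK => <-; apply: eq_integral => x _.
rewrite /U /incr; congr (EFin _); rewrite (_ : x + (2 * pi - h) + h = x + 2 * pi); last by ring.
rewrite ext_shift -[LHS]mul1r -(abs2_expi phi) -abs2M [RHS]abs2B_sym.
by congr abs2; rewrite mulrBr mulrA expiVr mul1r.
Qed.

Lemma wrap_ge0 f h : (0 <= wrap f h)%E.
Proof. by apply: integral_ge0 => x _; rewrite lee_fin abs2_ge0. Qed.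

Lemma wrap_le_incr f h : L2 I2pi f -> 0 < h < 2 * pi -> (wrap f h <= sqnorm I2pi (incr phi f h))%E.
Proof.
move=> Lf hh; rewrite (sqnorm_incr_split Lf hh) leeDr//.
by apply: integral_ge0 => x _; rewrite lee_fin abs2_ge0.
Qed.

Lemma incr_le_wrap f g h : L2 I2pi f -> L2 setT g -> (forall x, I2pi x -> g x = f x) ->
  0 < h < 2 * pi -> (sqnorm I2pi (incr phi f h) <= modulus g h + wrap f h)%E.
Proof.
move=> Lf Lg gf hh; rewrite (sqnorm_incr_split Lf hh) leeD2r//.
have /andP[h0 h1] := hh.
rewrite (@eq_sqnorm _ _ _ (fun x => g (x + h) - g x)); last first.
  move=> x; rewrite inE/= in_itv/= => /andP[x0 x1].
  have I1 : I2pi x by rewrite /I2pi /= in_itv/= x0; lra.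
  have I2 : I2pi (x + h) by rewrite /I2pi /= in_itv/=; apply/andP; split; lra.
  by rewrite /incr !ext_in// !gf.
apply: ipos_sub => //; first by apply: measurable_abs2; apply: cmeasB; [apply: cmeas_comp; [exact: L2_cmeas|exact: measurable_shift]|exact: L2_cmeas].
by move=> x _; exact: abs2_ge0.
Qed.

Lemma measurable_wt_wrap s f (D : set R) : L2 I2pi f ->
  measurable_fun D (fun h => ((wt s h)%:E * wrap f h)%E).
Proof.
move=> Lf; apply: measurable_funTS.
apply: emeasurable_funM; first by apply/measurable_EFinP; exact: measurable_wt.
have me := cmeas_ext phi (L2_cmeas Lf).
pose S := [set p : R * R | 0 < p.1 < p.2].
have mS : measurable S.
  have -> : S = (setT `&` fst @^-1` `]0, +oo[) `&` (setT `&` (fun p => p.2 - p.1) @^-1` `]0, +oo[).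
    rewrite !setTI; apply/seteqP; split => p /=; rewrite !in_itv/= !andbT subr_gt0.
      by move=> /andP[].
    by move=> [h1 h2]; rewrite /S /= h1.
  apply: measurableI.
    by apply: (@measurable_fst _ _ R R) => //; exact: measurable_itv.
  have ms : measurable_fun setT (fun p : R * R => p.2 - p.1).
    by apply: measurable_funB; [exact: measurable_snd|exact: measurable_fst].
  by apply: ms => //; exact: measurable_itv.
have mE : measurable_fun setT (fun p : R * R =>
    (\1_S p * abs2 (expi phi * ext f (p.1 + (2 * pi - p.2)) - ext f p.1))%:E).
  apply/measurable_EFinP; apply: measurable_funM; first exact: measurable_indic.
  have mp : measurable_fun setT (fun p : R * R => (p.1, 2 * pi - p.2)).
    apply: measurable_fun_pair; first exact: measurable_fst.
    by apply: measurable_funB => //; exact: measurable_snd.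
  exact: (measurableT_comp (measurable_diff2 (expi phi) me me) mp).
have := @measurable_fun_fubini_tonelli_G _ _ _ _ _ mu _ mE
  (fun p => ltac:(by rewrite lee_fin mulr_ge0 ?abs2_ge0)).
rewrite (_ : fubini_G mu _ = (fun h => wrap f h))//; apply/funext => h.
rewrite /fubini_G /wrap /sqnorm [RHS]integral_mkcond; apply: eq_integral => x _.
rewrite patchE indicE /= [in RHS](_ : (x \in `]0, h[%classic) = ((x, h) \in S)).
  by case: ifP => _; rewrite ?mul1r ?mul0r.
by apply/idP/idP => /set_mem h0; apply/mem_set; move: h0; rewrite /S /= in_itv.
Qed.

Lemma energy_of_wrap s f g : L2 I2pi f -> L2 setT g -> (forall x, I2pi x -> g x = f x) ->
  (\int[mu]_(h in `]0%R, (2 * pi)%R[) ((wt s h)%:E * modulus g h) < +oo)%E ->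
  (\int[mu]_(h in `]0%R, (2 * pi)%R[) ((wt s h)%:E * wrap f h) < +oo)%E ->
  (energy phi s f < +oo)%E.
Proof.
move=> Lf Lg gf hA hB.
have mA := @measurable_wt_modulus _ s g `]0, 2 * pi[ (L2_cmeas Lg).
have mB := @measurable_wt_wrap s f `]0, 2 * pi[ Lf.
have A0 h : (0 <= (wt s h)%:E * modulus g h)%E by rewrite mule_ge0 ?modulus_ge0// lee_fin wt_ge0.
have B0 h : (0 <= (wt s h)%:E * wrap f h)%E by rewrite mule_ge0 ?wrap_ge0// lee_fin wt_ge0.
apply: (@le_lt_trans _ _ (\int[mu]_(h in `]0%R, (2 * pi)%R[)
   ((wt s h)%:E * modulus g h + (wt s h)%:E * wrap f h))%E).
  apply: ge0_le_integral => //.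
  - by move=> h _; rewrite mule_ge0 ?lee_fin ?wt_ge0//; apply: integral_ge0 => x _; rewrite lee_fin abs2_ge0.
  - by apply: measurable_funTS; exact: measurable_wt_incr.
  - exact: emeasurable_funD.
  move=> h; rewrite /= in_itv/= => hh.
  by rewrite -ge0_muleDr ?modulus_ge0 ?wrap_ge0// lee_wpmul2l ?lee_fin ?wt_ge0// incr_le_wrap.
rewrite ge0_integralD; [exact: (lte_add_pinfty hA hB)|exact: (mI 0 (2 * pi))|by move=> h _; exact: A0|exact: mA|by move=> h _; exact: B0|exact: mB].
Qed.

Lemma wrap_of_energy s f : L2 I2pi f -> (energy phi s f < +oo)%E ->
  (\int[mu]_(h in `]0%R, (2 * pi)%R[) ((wt s h)%:E * wrap f h) < +oo)%E.
Proof.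
move=> Lf; apply: le_lt_trans; apply: ge0_le_integral => //.
- by move=> h _; rewrite mule_ge0 ?wrap_ge0// lee_fin wt_ge0.
- exact: measurable_wt_wrap.
- by apply: measurable_funTS; exact: measurable_wt_incr.
by move=> h; rewrite /= in_itv/= => hh; rewrite lee_wpmul2l ?lee_fin ?wt_ge0// wrap_le_incr.
Qed.

Lemma wrap_halfE f : (\int[mu]_(h in `]0%R, (2 * pi)%R[) ((wt (1 / 2) h)%:E * wrap f h) =
  \int[mu]_(t in `]0%R, (2 * pi)%R[) ((t ^- 2)%:E *
    \int[mu]_(x in `]0%R, t[) (abs2 (expi phi * f (x + 2 * pi - t) - f x)%R)%:E))%E.
Proof.
apply: eq_integral => h; rewrite inE/= in_itv/= => /andP[h0 h1]; congr (_%:E * _)%E.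
  rewrite /wt powRN; congr (_^-1); rewrite (_ : 1 + 2 * (1 / 2) = 2%:R); last by field.
  by rewrite powR_mulrn// ltW.
apply: eq_integral => x; rewrite inE/= in_itv/= => /andP[x0 x1]; rewrite -addrA.
have I1 : I2pi x by rewrite /I2pi /= in_itv/= x0 (lt_trans x1).
have I2 : I2pi (x + (2 * pi - h)) by rewrite /I2pi /= in_itv/=; apply/andP; split; lra.
by rewrite !ext_in.
Qed.

Lemma integral_flip_at (U : R -> \bar R) (a : R) : measurable_fun setT U -> (forall x, 0 <= U x)%E ->
  (\int[mu]_x U (a - x)%R = \int[mu]_x U x)%E.
Proof.
move=> mU U0; rewrite -(integral_reflect mU U0).
rewrite -(@integral_shift _ (fun x => U (- x)) (- a))//; last first.
  by apply: (measurableT_comp mU); exact: measurable_funN.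
by apply: eq_integral => x _; rewrite opprB.
Qed.

Lemma integral_flip_itv (U : R -> \bar R) (h : R) : measurable_fun setT U -> (forall x, 0 <= U x)%E ->
  (\int[mu]_(x in `]0%R, h[) U (h - x)%R = \int[mu]_(x in `]0%R, h[) U x)%E.
Proof.
move=> mU U0; rewrite [LHS]integral_mkcond [RHS]integral_mkcond.
have mW : measurable_fun setT (U \_ (`]0, h[%classic : set R)).
  by apply/(measurable_restrictT _ (mI 0 h)); exact: measurable_funTS.
have W0 x : (0 <= (U \_ (`]0%R, h[%classic : set R)) x)%E by rewrite patchE; case: ifP.
rewrite -(integral_flip_at h mW W0); apply: eq_integral => x _; rewrite !patchE.
congr (if _ then _ else _); apply/idP/idP; rewrite !inE /= !in_itv/= => /andP[h1 h2];
  by apply/andP; split; lra.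
Qed.

Lemma modulus_flip g (a h : R) : cmeas setT g -> modulus (fun x => g (a - x)) h = modulus g h.
Proof.
move=> mg; rewrite -[RHS]modulus_opp//.
have mU : measurable_fun setT (fun x : R => (abs2 (g (x + - h) - g x))%:E).
  apply/measurable_EFinP; apply: measurable_abs2; apply: cmeasB => //.
  by apply: cmeas_comp => //; exact: measurable_shift.
rewrite /modulus /sqnorm -(integral_flip_at a mU (fun x => ltac:(by rewrite lee_fin abs2_ge0))).
by apply: eq_integral => x _; congr (abs2 (g _ - _))%:E; ring.
Qed.

Lemma L2_flip g (a : R) : L2 setT g -> L2 setT (fun x => g (a - x)).
Proof.
move=> Lg; have mg := L2_cmeas Lg; apply: L2P.
  by apply: cmeas_comp => //; apply: measurable_funB.
have mU : measurable_fun setT (fun x => (abs2 (g x))%:E) by apply/measurable_EFinP; exact: measurable_abs2.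
by rewrite /sqnorm (integral_flip_at a mU (fun x => ltac:(by rewrite lee_fin abs2_ge0))); exact: L2_lty Lg.
Qed.

(** The deviation of g from the value c, cut off to (0, 2 pi) so as to be square
    integrable on the line. *)
Definition endv g (c : R[i]) (x : R) : R[i] := (\1_(I2pi : set R) x)%:C * (g x - c).

Lemma endv_in g c x : I2pi x -> endv g c x = g x - c.
Proof. by move=> xI; rewrite /endv indicE mem_set// mul1r. Qed.

Lemma L2_endv g c : L2 setT g -> L2 setT (endv g c).
Proof.
move=> Lg; have p0 : 0 <= 2 * pi :> R by rewrite mulr_ge0// pi_ge0.
apply: L2_indic.
- rewrite /endv; apply: cmeasM; first by apply: cmeasC; apply: measurable_indic; exact: measurable_I2pi.
  by apply: cmeasB; [exact: L2_cmeas|exact: cmeas_cst].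
- by move=> x xI; rewrite /endv indicE memNset// mul0r.
rewrite (@eq_sqnorm _ _ _ (fun x => g x - c)); last by move=> x /set_mem xI; rewrite endv_in.
have Lc : L2 (I2pi : set R) (fun=> c).
  apply: L2P; first exact: cmeas_cst.
  by have := ipos_cst (abs2 c) p0; rewrite /ipos /sqnorm /I2pi => ->; rewrite ltry.
apply: (@L2_lty _ I2pi (fun x => g x - c)); apply: L2B => //.
by apply: L2_sub Lg => //; exact: measurableT.
Qed.

(** What makes the Hardy integral of g - c at the left end 0 finite. *)
Definition endpoint_condition s g (c : R[i]) : Prop := s < 1 / 2 \/ (1 / 2 < s /\
  forall k, 0 < k -> exists2 eta, 0 < eta & forall x, 0 < x < eta -> abs2 (g x - c) <= k).

Lemma hardy_end s g c : 0 < s -> L2 setT g ->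
  (\int[mu]_(h in `]0%R, (2 * pi)%R[) ((wt s h)%:E * modulus g h) < +oo)%E ->
  endpoint_condition s g c ->
  (ipos `]0%R, (2 * pi)%R[ (hardy_density s (endv g c)) < +oo)%E.
Proof.
move=> s0 Lg hA hc; have Lv := L2_endv c Lg; have p0 := @pi_gt0 R.
have inc h : 0 < h < pi -> (sqnorm `]0%R, h[ (fun x => (endv g c (x + h) - endv g c x)%R) <= modulus g h)%E.
  move=> /andP[h0 h1]; rewrite (@eq_sqnorm _ _ _ (fun x => g (x + h) - g x)); last first.
    move=> x /set_mem; rewrite /= in_itv/= => /andP[x0 x1].
    have I1 : I2pi x by rewrite /I2pi /= in_itv/=; apply/andP; split; lra.
    have I2 : I2pi (x + h) by rewrite /I2pi /= in_itv/=; apply/andP; split; lra.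
    by rewrite !endv_in//; ring.
  apply: ipos_sub => //; last by move=> x _; exact: abs2_ge0.
  apply: measurable_abs2; apply: cmeasB; last exact: L2_cmeas.
  by apply: cmeas_comp; [exact: L2_cmeas|exact: measurable_shift].
case: hc => [s2|[s2 hc]]; first exact: (hardy_small s0 Lv Lg inc hA s2).
apply: (hardy_large s0 Lv Lg inc hA s2) => k k0; have [eta eta0 he] := hc k k0.
exists (Num.min eta (2 * pi)); first by rewrite lt_min eta0 mulr_gt0.
move=> h; rewrite lt_min => /andP[h0 /andP[h1 h2]].
have Lh : L2 `]0, h[ (endv g c) by apply: L2_sub Lv => //; exact: measurableT.
rewrite -lee_fin /hardy_mass -sqnormE//.
have hk := ipos_cst k (ltW h0); rewrite subr0 in hk; rewrite -hk.
apply: ipos_le => //; first by apply: measurable_abs2; exact: L2_cmeas.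
move=> x; rewrite /= in_itv/= => /andP[x0 x1].
have I1 : I2pi x by rewrite /I2pi /= in_itv/= x0 (lt_trans x1).
by rewrite abs2_ge0/= endv_in// he// x0 (lt_trans x1).
Qed.

(** Both ends are compared with constants that match across the boundary; the
    right end is reflected to the left one. *)
Lemma wrap_le_ends f g c h : L2 setT g -> (forall x, I2pi x -> g x = f x) -> 0 < h < 2 * pi ->
  (wrap f h <= (2 * nsq `]0%R, h[ (endv (fun x => g (2 * pi - x)) c) +
               2 * nsq `]0%R, h[ (endv g (expi phi * c)))%:E)%E.
Proof.
move=> Lg gf /andP[h0 h1].
have [v vE] : exists v, v = endv g (expi phi * c) by eexists.
have [w wE] : exists w, w = endv (fun x => g (2 * pi - x)) c by eexists.
have Lv : L2 setT v by rewrite vE; exact: L2_endv.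
have Lw : L2 setT w by rewrite wE; apply: L2_endv; exact: L2_flip.
have mv : measurable_fun setT (fun x => abs2 (v x)) by apply: measurable_abs2; exact: L2_cmeas.
have mw : measurable_fun setT (fun x => abs2 (w x)) by apply: measurable_abs2; exact: L2_cmeas.
have mf : measurable_fun setT (fun x : R => h - x) by apply: measurable_funB.
have mwf : measurable_fun setT (fun x : R => abs2 (w (h - x))) by exact: (measurableT_comp mw mf).
rewrite /wrap -vE -wE (@eq_sqnorm _ _ _ (fun x => expi phi * w (h - x) - v x)); last first.
  move=> x /set_mem; rewrite /= in_itv/= => /andP[x0 x1].
  have I1 : I2pi x by rewrite /I2pi /= in_itv/=; apply/andP; split; lra.
  have I2 : I2pi (x + (2 * pi - h)) by rewrite /I2pi /= in_itv/=; apply/andP; split; lra.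
  have I3 : I2pi (h - x) by rewrite /I2pi /= in_itv/=; apply/andP; split; lra.
  rewrite !ext_in// vE wE !endv_in// -!gf// (_ : 2 * pi - (h - x) = x + (2 * pi - h)); last by ring.
  by ring.
apply: (@le_trans _ _ (ipos `]0, h[ (fun x => 2 * abs2 (w (h - x)) + 2 * abs2 (v x)))).
  apply: ipos_le => //.
  - apply: measurable_funTS; apply: measurable_abs2; apply: cmeasB; last exact: L2_cmeas.
    by apply: cmeasM; [exact: cmeas_cst|apply: cmeas_comp => //; exact: L2_cmeas].
  - by apply: measurable_funTS; apply: measurable_funD; apply: measurable_funM.
  - by move=> x _; rewrite abs2_ge0/=; apply: le_trans (abs2B_le _ _) _; rewrite abs2M abs2_expi mul1r.
rewrite iposD//; try (by apply: measurable_funTS; apply: measurable_funM); try (by move=> x _; rewrite mulr_ge0 ?abs2_ge0).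
rewrite (iposZ (mI 0 h) (measurable_funTS mwf) two0 (fun x _ => abs2_ge0 _)).
rewrite (iposZ (mI 0 h) (measurable_funTS mv) two0 (fun x _ => abs2_ge0 _)).
rewrite /ipos; have mW : measurable_fun setT (fun x => (abs2 (w x))%:E) by exact/measurable_EFinP.
rewrite (integral_flip_itv h mW (fun x => ltac:(by rewrite lee_fin abs2_ge0))).
rewrite -/(sqnorm _ w) -/(sqnorm _ v) !sqnormE//; try (by apply: L2_sub measurableT _ _ => //).
Qed.

Lemma lty_double (x y : \bar R) : (x < +oo -> y < +oo -> 2%:E * x + 2%:E * y < +oo)%E.
Proof. by move=> hx hy; apply: lte_add_pinfty; apply: lte_mul_pinfty. Qed.

Lemma energy_of_ends s f g c : 0 < s -> L2 I2pi f -> L2 setT g -> (forall x, I2pi x -> g x = f x) ->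
  (\int[mu]_(h in `]0%R, (2 * pi)%R[) ((wt s h)%:E * modulus g h) < +oo)%E ->
  endpoint_condition s (fun x => g (2 * pi - x)) c ->
  endpoint_condition s g (expi phi * c) -> (energy phi s f < +oo)%E.
Proof.
move=> s0 Lf Lg gf hA c1 c0; apply: (energy_of_wrap Lf Lg gf hA).
have Lg1 := L2_flip (2 * pi) Lg.
have hA1 : (\int[mu]_(h in `]0%R, (2 * pi)%R[) ((wt s h)%:E * modulus (fun x => g (2 * pi - x)%R) h) < +oo)%E.
  rewrite (_ : modulus (fun x => g (2 * pi - x)%R) = modulus g)//.
  by apply/funext => h; exact: modulus_flip (L2_cmeas Lg).
have h1 := hardy_end s0 Lg1 hA1 c1; have h0 := hardy_end s0 Lg hA c0.
have m1 : measurable_fun (`]0, 2 * pi[%classic : set R) (hardy_density s (endv (fun x => g (2 * pi - x)) c)).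
  exact: (measurable_hardy_density s (L2_endv c Lg1)).
have m0 : measurable_fun (`]0, 2 * pi[%classic : set R) (hardy_density s (endv g (expi phi * c))).
  exact: (measurable_hardy_density s (L2_endv (expi phi * c) Lg)).
set u1 := hardy_density _ _ in h1 m1; set u := hardy_density _ _ in h0 m0.
have u10 x : 0 <= u1 x by rewrite mulr_ge0 ?wt_ge0// nsq_ge0.
have u0 x : 0 <= u x by rewrite mulr_ge0 ?wt_ge0// nsq_ge0.
apply: (@le_lt_trans _ _ (ipos `]0%R, (2 * pi)%R[ (fun h => 2 * u1 h + 2 * u h))).
  apply: ge0_le_integral => //.
  - by move=> h _; rewrite mule_ge0 ?wrap_ge0// lee_fin wt_ge0.
  - exact: measurable_wt_wrap.
  - by apply/measurable_EFinP; apply: measurable_funD; apply: measurable_funM.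
  move=> h; rewrite /= in_itv/= => hh.
  apply: le_trans (lee_wpmul2l _ (wrap_le_ends c Lg gf hh)) _; first by rewrite lee_fin wt_ge0.
  by rewrite -EFinM lee_fin le_eqVlt; apply/orP; left; apply/eqP; rewrite /u /u1 /hardy_density /hardy_mass; ring.
rewrite iposD//; try (by apply: measurable_funM); try (by move=> x _; rewrite mulr_ge0).
rewrite (iposZ (mI _ _) m1 two0 (fun x _ => u10 x)) (iposZ (mI _ _) m0 two0 (fun x _ => u0 x)).
exact: (lty_double h1 h0).
Qed.

Lemma energy_subcritical s f : 0 < s < 1 / 2 -> Hs I2pi s f -> (energy phi s f < +oo)%E.
Proof.
move=> /andP[s0 s2] Hf; have s01 : 0 < s < 1 by rewrite s0; lra.
have [g [Lg gf hA]] := Hs_witness s01 Hf.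
by apply: (energy_of_ends (c := 0) s0 Hf.1 Lg gf hA); left.
Qed.

(** The continuous representative replaces f: its boundary values serve as the
    constants at the two ends. *)
Lemma energy_supercritical s f : 1 / 2 < s < 1 -> Hs I2pi s f -> quasi_periodic phi f ->
  exists p, [/\ L2 I2pi p, p = f %[ae mu in I2pi] & (energy phi s p < +oo)%E].
Proof.
move=> /andP[s2 s1] Hf qf; have s0 : 0 < s by lra.
have [p [Lp pf p0 cp]] := continuous_rep_bound qf Hf.1.
have Hp : Hs I2pi s p.
  split => //; have [_ [g [hg gf]]] := Hf; exists g; split => //.
  by apply: aeS2 gf pf => x h1 h2 xI; rewrite h1// h2.
have t4 := @twopi_ge4 R.
have cont q k : 0 <= q <= 2 * pi -> 0 < k -> exists2 eta, 0 < eta &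
    forall x, 0 <= x <= 2 * pi -> `|x - q| < eta -> abs2 (p x - p q) <= k.
  move=> hq k0; have c1 : ccont (fun=> 1 : R[i]) by split => x; exact: cvg_cst.
  have e0 : 0 < Num.sqrt (k / 2) by rewrite sqrtr_gt0 divr_gt0.
  have [d d0 hd] := cp _ c1 q _ hq e0; exists d => // x hx xd.
  have [] := hd x hx xd; rewrite !mulr1 => hr hi.
  have eq2 : Num.sqrt (k / 2) ^+ 2 = k / 2 by rewrite sqr_sqrtr// divr_ge0// ltW.
  have sq a : `|a| <= Num.sqrt (k / 2) -> a ^+ 2 <= k / 2.
    by move=> ha; rewrite -eq2 -real_normK ?num_real// ler_sqr ?nnegrE// sqrtr_ge0.
  rewrite /abs2 !raddfB/=; apply: le_trans (lerD (sq _ hr) (sq _ hi)) _; lra.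
have [g [Lg gp hA]] := Hs_witness (s := s) ltac:(by rewrite s0) Hp.
exists p; split => //; apply: (energy_of_ends (c := p (2 * pi)) s0 Lp Lg gp hA); right; split => // k k0.
  have [eta eta0 he] := cont (2 * pi) k ltac:(by apply/andP; split; lra) k0.
  exists (Num.min eta (2 * pi)); first by rewrite lt_min eta0; lra.
  move=> x; rewrite lt_min => /andP[x0 /andP[x1 x2]].
  have I1 : I2pi (2 * pi - x) by rewrite /I2pi /= in_itv/=; apply/andP; split; lra.
  rewrite gp//; apply: he; first by apply/andP; split; lra.
  by rewrite addrAC subrr add0r normrN gtr0_norm.
have [eta eta0 he] := cont 0 k ltac:(by apply/andP; split; lra) k0.
exists (Num.min eta (2 * pi)); first by rewrite lt_min eta0; lra.
move=> x; rewrite lt_min => /andP[x0 /andP[x1 x2]].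
have I1 : I2pi x by rewrite /I2pi /= in_itv/= x0.
rewrite gp// -p0; apply: he; first by apply/andP; split; lra.
by rewrite subr0 gtr0_norm.
Qed.

End SobolevToSpectral.

(** * The domains of the fractional powers *)

Section Domains.
Context {R : realType} (phi : R).
Hypothesis hphi : 0 <= phi < 2 * pi.
Implicit Types (f : R -> R[i]) (s : R).

Lemma op_abs_pow_energy s f : 0 < s < 1 ->
  op_dom (op_abs_pow I2pi (opP phi) s) f <-> L2 I2pi f /\ (energy phi s f < +oo)%E.
Proof.
move=> hs; rewrite (op_abs_pow_dom hphi s); split=> -[Lf h]; (split; first exact: Lf).
  exact: ((energy_ltyP phi hs Lf).2 h).
exact: ((energy_ltyP phi hs Lf).1 h).
Qed.

Lemma op_pow_abs_pow s :
  op_dom (op_pow I2pi (opA phi) (s / 2)) = op_dom (op_abs_pow I2pi (opP phi) s).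
Proof. exact: etrans (op_pow_dom hphi s) (esym (op_abs_pow_dom hphi s)). Qed.

Lemma op_abs_pow_subcritical s : 0 < s < 1 / 2 ->
  op_dom (op_abs_pow I2pi (opP phi) s) = Hs I2pi s.
Proof.
move=> h2; have /andP[s0 s2] := h2; have hs : 0 < s < 1 by apply/andP; split; lra.
apply/seteqP; split=> f Hf.
  have [Lf hE] := (op_abs_pow_energy f hs).1 Hf; exact: (Hs_of_energy hs Lf hE).
exact: ((op_abs_pow_energy f hs).2 (conj Hf.1 (energy_subcritical phi h2 Hf))).
Qed.

Lemma op_abs_pow_critical :
  op_dom (op_abs_pow I2pi (opP phi) (1 / 2)) =
  [set f | Hs I2pi (1 / 2) f /\
    (\int[lebesgue_measure]_(t in `]0%R, (2 * pi)%R[)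
       ((t ^- 2)%:E *
        \int[lebesgue_measure]_(x in `]0%R, t[)
          (abs2 (expi phi * f (x + 2 * pi - t) - f x))%:E) < +oo)%E].
Proof.
have hs : 0 < (1 / 2 : R) < 1 by apply/andP; split; lra.
apply/seteqP; split=> f.
  move=> /(op_abs_pow_energy f hs)[Lf hE]; split; first exact: (Hs_of_energy hs Lf hE).
  by rewrite -wrap_halfE; exact: (wrap_of_energy Lf hE).
move=> [Hf hB]; apply: (op_abs_pow_energy f hs).2; split; first exact: Hf.1.
have [g [Lg gf hA]] := Hs_witness hs Hf.
by apply: (energy_of_wrap Hf.1 Lg gf hA); rewrite wrap_halfE.
Qed.

Lemma op_abs_pow_supercritical s : 1 / 2 < s < 1 ->
  op_dom (op_abs_pow I2pi (opP phi) s) = [set f | Hs I2pi s f /\ quasi_periodic phi f].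
Proof.
move=> h2; have /andP[s2 s1] := h2; have hs : 0 < s < 1 by apply/andP; split; lra.
apply/seteqP; split=> f.
  move=> Hf; have [Lf hE] := (op_abs_pow_energy f hs).1 Hf; split; first exact: (Hs_of_energy hs Lf hE).
  exact: (quasi_periodic_of_weight hphi s2 Lf ((energy_ltyP phi hs Lf).1 hE)).
move=> [Hf qf]; have [p [Lp pf hE]] := energy_supercritical h2 Hf qf.
rewrite (op_abs_pow_dom hphi s); split; first exact: Hf.1.
have hb := (energy_ltyP phi hs Lp).1 hE.
have E k : coef I2pi (ee phi) p k = coef I2pi (ee phi) f k.
  by apply: (coef_eqae (@measurable_I2pi R) (L2_ee phi)) => //; exact: Hf.1.
by under eq_fun do rewrite -E.
Qed.

End Domains.

Theorem theoremA6 (R : realType) (phi : R) (hphi : 0 <= phi < 2 * pi) :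
  [/\ forall s : R, 0 < s < 1 / 2 ->
        op_dom (op_pow I2pi (opA phi) (s / 2)) =
          op_dom (op_abs_pow I2pi (opP phi) s) /\
        op_dom (op_abs_pow I2pi (opP phi) s) = Hs I2pi s,
      op_dom (op_pow I2pi (opA phi) (1 / 4)) =
        op_dom (op_abs_pow I2pi (opP phi) (1 / 2)) /\
      op_dom (op_abs_pow I2pi (opP phi) (1 / 2)) =
        [set f | Hs I2pi (1 / 2) f /\
          (\int[lebesgue_measure]_(t in `]0%R, (2 * pi)%R[)
             ((t ^- 2)%:E *
              \int[lebesgue_measure]_(x in `]0%R, t[)
                (abs2 (expi phi * f (x + 2 * pi - t) - f x))%:E) < +oo)%E] &
      forall s : R, 1 / 2 < s < 1 ->
        op_dom (op_pow I2pi (opA phi) (s / 2)) =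
          op_dom (op_abs_pow I2pi (opP phi) s) /\
        op_dom (op_abs_pow I2pi (opP phi) s) =
          [set f | Hs I2pi s f /\ quasi_periodic phi f]].
Proof.
split.
- move=> s hs; split; first exact: (op_pow_abs_pow hphi s).
  exact: (op_abs_pow_subcritical hphi hs).
- split; last exact: (op_abs_pow_critical hphi).
  have e : 1 / 4 = 1 / 2 / 2 :> R by field.
  have E a : a = 1 / 2 / 2 -> op_dom (op_pow I2pi (opA phi) a) =
      op_dom (op_abs_pow I2pi (opP phi) (1 / 2)).
    by move=> ->; exact: (op_pow_abs_pow hphi (1 / 2)).
  exact: (E _ e).
- move=> s hs; split; first exact: (op_pow_abs_pow hphi s).
  exact: (op_abs_pow_supercritical hphi hs).
Qed.
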